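(* Let $1<p,q<\infty$, $0<\delta<1$, and $m>-\left|\frac1q-\frac12\right|\delta n$. Let $\sigma_\delta$ be the symbol defined below and $\sigma_\delta^*$ its adjoint symbol. Then $\sigma_\delta$ and $\sigma_\delta^*$ belong to $S^m_{1,\delta}$. Moreover, if $q\ge2$ then $\sigma_\delta(X,D)$ is not bounded on $M^{p,q}(\mathbb{R}^n)$, and if $q\le 2$ then $\sigma_\delta^*(X,D)$ is not bounded on $M^{p,q}(\mathbb{R}^n)$.
   Context: Fourier transform: $\widehat f(\xi)=\mathcal{F}f(\xi)=\int_{\mathbb{R}^n}e^{-i\xi\cdot x}f(x)\,dx$, $\mathcal{F}^{-1}f(x)=(2\pi)^{-n}\int e^{ix\cdot\xi}f(\xi)\,d\xi$. For $m\in\mathbb{R}$, $0\le\delta\le\rho\le1$, $S^m_{\rho,\delta}$ consists of all $\sigma\in C^\infty(\mathbb{R}^n\times\mathbb{R}^n)$ with $|\partial_\xi^\alpha\partial_x^\beta\sigma(x,\xi)|\le C_{\alpha,\beta}(1+|\xi|)^{m-\rho|\alpha|+\delta|\beta|}$ for all multi-indices $\alpha,\beta$; $\sigma(X,D)f(x)=(2\pi)^{-n}\int e^{ix\cdot\xi}\sigma(x,\xi)\widehat f(\xi)\,d\xi$ for $f\in\mathcal{S}(\mathbb{R}^n)$. For $\sigma\in S^m_{\rho,\delta}$ with $\delta<1$, the adjoint symbol is the oscillatory integral $\sigma^*(x,\xi)=\lim_{\epsilon\to0}(2\pi)^{-n}\iint e^{-iy\cdot\zeta}\chi(\epsilon y,\epsilon\zeta)\overline{\sigma(x+y,\xi+\zeta)}\,dy\,d\zeta$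 (any $\chi\in\mathcal{S}(\mathbb{R}^{2n})$ with $\chi(0,0)=1$); it satisfies $(\sigma(X,D)f,g)=(f,\sigma^*(X,D)g)$ for $f,g\in\mathcal{S}$, where $(f,g)=\int f\bar g$. Modulation spaces: fix $\gamma\in\mathcal{S}(\mathbb{R}^n)\setminus\{0\}$; $V_\gamma f(x,\xi)=(f,M_\xi T_x\gamma)$ with $M_\xi\gamma(t)=e^{i\xi\cdot t}\gamma(t)$, $T_x\gamma(t)=\gamma(t-x)$; $M^{p,q}(\mathbb{R}^n)=\{f\in\mathcal{S}':\|f\|_{M^{p,q}}=(\int(\int|V_\gamma f(x,\xi)|^pdx)^{q/p}d\xi)^{1/q}<\infty\}$; ''bounded on $M^{p,q}$'' means $\|\sigma(X,D)f\|_{M^{p,q}}\le C\|f\|_{M^{p,q}}$ for all $f\in\mathcal{S}$. The symbol $\sigma_\delta$: let $\varphi,\eta\in\mathcal{S}(\mathbb{R}^n)$ be real-valued, $\varphi$ radial, $\operatorname{supp}\varphi\subset\{|\xi|\le1/8\}$, $\int\varphi=1$, $\operatorname{supp}\eta\subset\{2^{-1/2}\le|\xi|\le2^{1/2}\}$, $\eta=1$ on $\{2^{-1/4}\le|\xi|\le2^{1/4}\}$; $\Phi=\mathcal{F}^{-1}\varphi$. Choose $j_0\in\{0,1,2,\dots\}$ with $1+2^{j_0(\delta-1)+1}\le2^{1/4}$, $1-2^{j_0(\delta-1)+1}\ge2^{-1/4}$, $2^{-j_0\delta/2}\sqrt n\le2^{-3}$. Then $\sigma_\delta(x,\xi)=\sum_{j=j_0}^\infty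 2^{jm}\Big(\sum_{k\in\mathbb{Z}^n,\,0<|k|\le2^{j\delta/2}}e^{-ik\cdot(2^{j\delta/2}x-k)}\Phi(2^{j\delta/2}x-k)\Big)\eta(2^{-j}\xi)$, and $\sigma_\delta^*$ is its adjoint symbol. *)

(* Defs.v *)
From HB Require Import structures.
From mathcomp Require Import all_boot all_order all_algebra.
From mathcomp Require Import all_classical all_reals all_analysis.
From mathcomp Require Import complex.
Set Implicit Arguments. Unset Strict Implicit. Unset Printing Implicit Defensive.
Import Order.TTheory GRing.Theory Num.Theory.
Import numFieldNormedType.Exports.
Local Open Scope classical_set_scope.
Local Open Scope ring_scope.
Local Open Scope complex_scope.

Section Defs.
Context {R : realType} {n : nat}.
Definition reC (z : R[i]) : R := complex.Re z.
Definition imC (z : R[i]) : R := complex.Im z.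
Notation V := 'rV[R]_n.

Definition dotR (x y : V) : R := \sum_(i < n) x ord0 i * y ord0 i.
Definition enorm (x : V) : R := Num.sqrt (dotR x x).
Definition cabs (z : R[i]) : R := Num.sqrt (reC z ^+ 2 + imC z ^+ 2).
Definition expi (t : R) : R[i] := cos t +i* sin t.
Definition evec (i : 'I_n) : V := \row_j (i == j)%:R.
Definition mono (g : seq 'I_n) (x : V) : R := \prod_(i <- g) x ord0 i.

Definition iterD {W : normedModType R} {I : Type} (dir : I -> W)
  (s : seq I) (f : W -> R) : W -> R :=
  foldr (fun i g => fun a => derive g a (dir i)) f s.

Definition smooth {W : normedModType R} {I : Type} (dir : I -> W)
  (f : W -> R) : Prop :=
  forall s : seq I, continuous (iterD dir s f) /\
    forall (i : I) (a : W), derivable (iterD dir s f) a (dir i).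

Definition csmooth {W : normedModType R} {I : Type} (dir : I -> W)
  (f : W -> R[i]) : Prop :=
  smooth dir (fun a => reC (f a)) /\ smooth dir (fun a => imC (f a)).

Definition citerD {W : normedModType R} {I : Type} (dir : I -> W)
  (s : seq I) (f : W -> R[i]) : W -> R[i] :=
  fun a => iterD dir s (fun b => reC (f b)) a +i* iterD dir s (fun b => imC (f b)) a.

(* directions in R^n x R^n: (true, i) = d/dx_i, (false, i) = d/dxi_i *)
Definition dir2 (bi : bool * 'I_n) : V * V :=
  if bi.1 then (evec bi.2, 0) else (0, evec bi.2).

Definition symbol_class (rho delta m : R) (sigma : V -> V -> R[i]) : Prop :=
  let f := fun z : V * V => sigma z.1 z.2 in
  csmooth dir2 f /\
  forall s : seq (bool * 'I_n), exists C : R, forall x xi : V,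
    cabs (citerD dir2 s f (x, xi)) <=
    C * (1 + enorm xi) `^ (m - rho * (count (fun b => ~~ b.1) s)%:R
                             + delta * (count (fun b => b.1) s)%:R).

Definition schwartzR (f : V -> R) : Prop :=
  smooth evec f /\
  forall s g : seq 'I_n, exists C : R, forall x : V,
    `|mono g x * iterD evec s f x| <= C.
Definition schwartz (f : V -> R[i]) : Prop :=
  schwartzR (fun x => reC (f x)) /\ schwartzR (fun x => imC (f x)).

Definition upd (a : nat -> R) (k : nat) (t : R) : nat -> R :=
  fun i => if i == k then t else a i.
Fixpoint iint (k : nat) (F : (nat -> R) -> R) (a : nat -> R) : R :=
  match k with
  | 0 => F a
  | k'.+1 => Rintegral (@lebesgue_measure R) setT
               (fun t => iint k' F (upd a k' t))
  end.
Fixpoint iintE (k : nat) (F : (nat -> R) -> \bar R) (a : nat -> R) : \bar R :=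
  match k with
  | 0 => F a
  | k'.+1 => (\int[@lebesgue_measure R]_(t in setT) iintE k' F (upd a k' t))%E
  end.
Definition intRn (f : V -> R) : R :=
  iint n (fun a => f (\row_i a (nat_of_ord i))) (fun _ => 0).
Definition intRnE (f : V -> \bar R) : \bar R :=
  iintE n (fun a => f (\row_i a (nat_of_ord i))) (fun _ => 0).
Definition cint (f : V -> R[i]) : R[i] :=
  intRn (fun x => reC (f x)) +i* intRn (fun x => imC (f x)).

Definition twopin : R := ((2 * pi) ^+ n)^-1.
Definition fourier (f : V -> R[i]) (xi : V) : R[i] :=
  cint (fun x => expi (- dotR xi x) * f x).
Definition ifourier (f : V -> R[i]) (x : V) : R[i] :=
  twopin%:C * cint (fun xi => expi (dotR x xi) * f xi).
Definition psido (sigma : V -> V -> R[i]) (f : V -> R[i]) (x : V) : R[i] :=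
  twopin%:C * cint (fun xi => expi (dotR x xi) * sigma x xi * fourier f xi).

(* adjoint symbol (oscillatory integral), with the cut-off
   chi(y,zeta) = exp(-(|y|^2+|zeta|^2)), a Schwartz function with chi(0,0)=1 *)
Definition chi0 (y zeta : V) : R := expR (- (dotR y y + dotR zeta zeta)).
Definition adj_eps (sigma : V -> V -> R[i]) (x xi : V) (eps : R) : R[i] :=
  twopin%:C * cint (fun zeta => cint (fun y =>
     expi (- dotR y zeta) * (chi0 (eps *: y) (eps *: zeta))%:C
       * conjc (sigma (x + y) (xi + zeta)))).
Definition adjoint_symbol (sigma : V -> V -> R[i]) (x xi : V) : R[i] :=
  lim (reC (adj_eps sigma x xi eps) @[eps --> 0^'+])
  +i* lim (imC (adj_eps sigma x xi eps) @[eps --> 0^'+]).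

Definition stft (gamma f : V -> R[i]) (x xi : V) : R[i] :=
  cint (fun t => f t * conjc (expi (dotR xi t) * gamma (t - x))).
Definition Mnorm (p q : R) (gamma f : V -> R[i]) : \bar R :=
  poweR (intRnE (fun xi =>
     poweR (intRnE (fun x => ((cabs (stft gamma f x xi)) `^ p)%:E)) (q / p)))
  q^-1.
Definition bounded_Mpq (p q : R) (gamma : V -> R[i])
  (T : (V -> R[i]) -> (V -> R[i])) : Prop :=
  exists C : R, forall f, schwartz f ->
    (Mnorm p q gamma (T f) <= C%:E * Mnorm p q gamma f)%E.

Definition kset (s : R) : set 'rV[int]_n :=
  [set k | 0 < enorm (map_mx (fun z : int => z%:~R) k) <= s].
Definition sigma_term (delta m : R) (phi eta : V -> R) (j : nat)
  (x xi : V) : R[i] :=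
  let s := 2 `^ (j%:R * delta / 2) in
  let Phi := ifourier (fun z => (phi z)%:C) in
  (2 `^ (j%:R * m))%:C *
  (\sum_(k \in kset s)
     let kR := map_mx (fun z : int => z%:~R) k in
     expi (- dotR kR (s *: x - kR)) * Phi (s *: x - kR))
  * (eta (2 `^ (- j%:R) *: xi))%:C.
Definition sigma_delta (delta m : R) (phi eta : V -> R) (j0 : nat)
  (x xi : V) : R[i] :=
  let u := fun N : nat => \sum_(j0 <= j < N) sigma_term delta m phi eta j x xi in
  lim (reC (u N) @[N --> \oo]) +i* lim (imC (u N) @[N --> \oo]).

End Defs.

(* Main.v *)
(* Write s = 2^(j delta / 2) and P_k(u) = e^(-i k.(u - k)) Phi(u - k). The j-th dyadic block of
   sigma (tau = 0) and of its adjoint symbol (tau = 1) is 2^(j m) times a sum over k of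
     int cos((s x - k).(w - k) + c) phi(w) eta(2^(-j) (xi - tau s (w - k))) dw,
   the phase c selecting real and imaginary parts; for the adjoint this follows by integrating the
   Gaussian cut-off exactly. As s |w - k| is a small multiple of 2^j, the blocks live in dyadic
   annuli, boundedly many of which meet at a point, and an x-derivative costs a factor
   s^2 = 2^(j delta): both symbols belong to S^m_(1,delta).

   Near the frequency xi0 = 2^j e_1 the operators are multiplication by 2^(j m) a_j and by its
   conjugate, where a_j(x) = sum_k P_k(s x) ([amp] below). If q >= 2, test sigma on
     h(t) = e^(i xi0.t) sum_l e^(i l.(s t - l)) Phi(s t - l),   l in {1, ..., theta s}^n:
   the phases of P_l cancel, so a_j h has a short-time Fourier transform bounded below on a fixed
   box, whereas |V h| <= C s^(-n) w(x) w((xi - xi0) / (2 s^2)), w(x) = prod_i 1 / (1 + x_i^2).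
   If q <= 2, test the adjoint on e^(i xi0.t) Phi(t), of bounded norm: the conjugate of a_j spreads
   it over (theta s)^n frequency boxes of side of order s, with amplitude of order s^(-n). In both
   cases the norm is multiplied by at least c 2^(j m) 2^(j delta n |1/q - 1/2|), which is
   unbounded in j. *)
Require Import Defs.
From mathcomp Require Import all_boot all_order all_algebra.
From mathcomp Require Import all_classical all_reals all_analysis.
From mathcomp Require Import complex.
From mathcomp Require Import measurable_realfun gauss_integral ring lra zify.
Import Order.TTheory GRing.Theory Num.Theory.
Import Defs.
Import numFieldNormedType.Exports.
Set Implicit Arguments. Unset Strict Implicit. Unset Printing Implicit Defensive.
Local Open Scope classical_set_scope.
Local Open Scope ring_scope.

(** * Iterated integrals *)

Section OneVariable.
Context {R : realType}.
Notation mu := (@lebesgue_measure R).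

(** Integrals over R^n are given as n nested one-variable Lebesgue integrals. Absolute convergence
    is therefore expressed as domination by a multiple of the product weight w, whose integral is
    pi^n, and Fubini, dominated convergence and affine substitution are rebuilt one coordinate at a
    time for continuous dominated functions. A complex quantity is carried as a real function of a
    phase c, so that differentiating a wave or multiplying by a unimodular factor is a shift of c.
    Count of the powers of s. If q >= 2, each diagonal product k = l contributes s^(-n) times the
    integral of Phi^2, positive because phi is even; pairs k <> l lie at frequency distance about s
    and are negligible. The input has norm at most of order s^(-n) s^(2 n / q), its spectrum filling
    a box of side s^2, while the output stays of order 2^(j m). If q <= 2, in each coordinate the
    output occupies about theta s intervals of length comparable to s, a set of measure about s^2,
    which gives s^(-n) s^(2 n / q) after the L^q norm. The errors made by the Gaussian cut-off are
    kept linear in eps, because the limit defining the adjoint symbol has to be exchanged with the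
    sum over blocks. *)

Definition w1 (t : R) : R := (1 + t ^+ 2)^-1.

Lemma w1_gt0 t : 0 < w1 t.
Proof. by rewrite invr_gt0 ltr_pwDl// sqr_ge0. Qed.

Lemma w1_ge0 t : 0 <= w1 t. Proof. exact/ltW/w1_gt0. Qed.

Lemma w1_le1 t : w1 t <= 1.
Proof. by rewrite invf_le1 ?lerDl ?sqr_ge0// ltr_pwDl// sqr_ge0. Qed.

Lemma w1N t : w1 (- t) = w1 t. Proof. by rewrite /w1 sqrrN. Qed.

Lemma continuous_w1 : continuous w1.
Proof. exact: continuous_oneDsqrV. Qed.

Lemma integral_w1 : (\int[mu]_x (w1 x)%:E = pi%:E)%E.
Proof.
rewrite ge0_symfun_integralT; last 3 first.
- exact: w1_ge0.
- exact: continuous_w1.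
- by move=> x /=; rewrite w1N.
rewrite -set_itvcy (_ : (fun x => _) = fun x : R => (oneDsqr x)^-1%:E)//.
rewrite integral0y_oneDsqr -EFinM; congr EFin; lra.
Qed.

Lemma integrable_w1 : mu.-integrable setT (EFin \o w1).
Proof.
apply/integrableP; split.
  by apply/measurable_EFinP; apply: continuous_measurable_fun; exact: continuous_w1.
under eq_integral do rewrite /= ger0_norm ?w1_ge0//.
by rewrite integral_w1 ltry.
Qed.

(** One fixed integrable majorant stands in for integrability: bounds are compared through a single
    constant, and the mass of [w1] is exactly [pi]. *)
Definition dom1 (C : R) (f : R -> R) := forall t, `|f t| <= C * w1 t.

Lemma dom1_ge0 C f : dom1 C f -> 0 <= C.
Proof.
move=> /(_ 0) h; rewrite -(pmulr_lge0 _ (w1_gt0 0)).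
exact: le_trans h.
Qed.

Lemma integrable_dom1 C f : continuous f -> dom1 C f ->
  mu.-integrable setT (EFin \o f).
Proof.
move=> cf df; apply: (@le_integrable _ _ _ mu setT measurableT _ (EFin \o (fun t => C * w1 t))).
- by apply/measurable_EFinP; exact: continuous_measurable_fun.
- move=> x _ /=; rewrite lee_fin (le_trans (df x))// ler_norm//.
- rewrite (_ : EFin \o _ = (fun t => C%:E * (EFin \o w1) t)%E)//.
  by apply: integrableZl => //; exact: integrable_w1.
Qed.

Lemma Rintegral_dom1 C f : continuous f -> dom1 C f ->
  `|\int[mu]_t f t| <= C * pi.
Proof.
move=> cf df; apply: (le_trans (le_normr_Rintegral _ _)) => //.
  exact: integrable_dom1 df.
have -> : C * pi = \int[mu]_t (C * w1 t).
  rewrite RintegralZl//; last exact: integrable_w1.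
  by rewrite /Rintegral integral_w1.
apply: le_Rintegral => //.
- apply: (@integrable_dom1 C) => [t|t]; last by rewrite normr_id.
  exact: cvg_norm (cf t).
- apply: (@integrable_dom1 C) => [t|t]; last first.
    by rewrite ger0_norm// mulr_ge0 ?w1_ge0// (dom1_ge0 df).
  by apply: cvgM; [exact: cvg_cst|exact: continuous_w1].
Qed.

Lemma dct1 C (f_ : nat -> R -> R) (f : R -> R) :
  (forall m, continuous (f_ m)) -> (forall m, dom1 C (f_ m)) ->
  continuous f -> dom1 C f ->
  (forall t, f_ m t @[m --> \oo] --> f t) ->
  \int[mu]_t f_ m t @[m --> \oo] --> \int[mu]_t f t.
Proof.
move=> cf_ df_ cf df ff.
have [] := @dominated_convergence _ _ _ mu setT measurableT
  (fun m => EFin \o f_ m) (EFin \o f) (EFin \o (fun t => C * w1 t)).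
- by move=> m; apply/measurable_EFinP; exact: continuous_measurable_fun.
- by apply/measurable_EFinP; exact: continuous_measurable_fun.
- by apply: aeW => t _ /=; apply: cvg_EFin; [exact: nearW|exact: ff].
- rewrite (_ : EFin \o _ = (fun t => C%:E * (EFin \o w1) t)%E)//.
  by apply: integrableZl => //; exact: integrable_w1.
- by apply: aeW => t m _ /=; rewrite lee_fin; exact: df_.
move=> _ _ h.
have fin g : continuous g -> dom1 C g -> (\int[mu]_x (g x)%:E)%E \is a fin_num.
  by move=> cg dg; apply: integrable_fin_num => //; exact: integrable_dom1 dg.
apply: fine_cvg; rewrite fineK; last exact: fin.
exact: h.
Qed.

(** Converts dominated convergence, which is sequential, into continuity of integrals in a
    parameter: a failure of continuity provides points within [1 / (m + 1)] of [a] that form a bad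
    sequence. *)
Lemma seq_continuous (W : normedModType R) (f : W -> R) (a : W) :
  (forall u : nat -> W, u @ \oo --> a -> f (u m) @[m --> \oo] --> f a) ->
  {for a, continuous f}.
Proof.
move=> H; apply/cvgrPdist_lt => e e0; apply: contrapT => nH.
have {}nH : forall m : nat, exists x : W, `|a - x| < m.+1%:R^-1 /\ e <= `|f a - f x|.
  move=> m; apply: contrapT => hx; apply: nH.
  have : \forall x \near a, `|a - x| < m.+1%:R^-1 by apply: cvgr_dist_lt => //; exact: cvg_id.
  apply: filterS => x ax; rewrite ltNge; apply/negP => le.
  by apply: hx; exists x.
have [u hu] := choice nH.
have : f (u m) @[m --> \oo] --> f a.
  apply: H; apply/cvgrPdist_lt => d d0; near=> m.
  apply: (lt_trans (hu m).1).
  near: m; exact: near_infty_natSinv_lt (PosNum d0).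
move=> /cvgrPdist_lt /(_ _ e0) [N _ /(_ N (leqnn N)) /=].
by rewrite ltNge (hu N).2.
Unshelve. all: by end_near. Qed.

(* Caratheodory functions are jointly measurable: discretise the continuous variable. *)
Lemma measurable_separately_continuous (g : R -> R -> R) :
  (forall u, continuous (g^~ u)) -> (forall t, continuous (g t)) ->
  measurable_fun [set: measurableTypeR R * measurableTypeR R] (fun z => g z.1 z.2).
Proof.
move=> c1 c2.
pose fl (m : nat) (t : R) : int := Num.floor (m.+1%:R * t).
pose h (m : nat) (z : measurableTypeR R * measurableTypeR R) : R :=
  g ((fl m z.1)%:~R / m.+1%:R) z.2.
have flP m t (z : int) : fl m t = z <-> (z%:~R / m.+1%:R <= t < (z + 1)%:~R / m.+1%:R).
  have := @Num.Theory.floor_itv _ (m.+1%:R * t); rewrite -/(fl m t).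
  split=> [<-|].
    by rewrite ler_pdivrMr// ltr_pdivlMr// mulrC.
  by rewrite ler_pdivrMr// ltr_pdivlMr// mulrC => /Num.Theory.floor_def.
apply: (@measurable_fun_cvg _ _ _ _ h).
  move=> m _ Y mY; rewrite setTI.
  have -> : h m @^-1` Y = \bigcup_(z : int)
      ([set` `[z%:~R / m.+1%:R, (z + 1)%:~R / m.+1%:R[] `*` (g (z%:~R / m.+1%:R) @^-1` Y)).
    apply/seteqP; split => [[t u] /= hY|[t u] /= [z _ [/=]]].
      exists (fl m t) => //; split => //=; rewrite in_itv /=.
      exact: (flP m t (fl m t)).1.
    by rewrite in_itv /= => /(flP m t z) /= <-.
  apply: countable_bigcupT_measurable => // z.
  apply: measurableX; first exact: measurable_itv.
  rewrite -[X in measurable X]setTI.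
  exact: (continuous_measurable_fun (c2 _)).
move=> [t u] _; rewrite /h /=.
apply: (@cvg_comp _ _ _ (fun m => (fl m t)%:~R / m.+1%:R) (g^~ u) _ (nbhs t)); last exact: c1.
apply/cvgrPdist_lt => d d0; near=> m.
have /(_ erefl) /andP[l1 l2] := (flP m t (fl m t)).1.
rewrite ger0_norm ?subr_ge0//.
apply: (@lt_trans _ _ (m.+1%:R^-1)).
  by rewrite ltrBlDr (lt_le_trans l2)// intrD mulrDl mul1r addrC.
near: m; exact: near_infty_natSinv_lt (PosNum d0).
Unshelve. all: by end_near. Qed.

(** Separate continuity gives joint measurability, and the majorant has mass [C * pi ^+ 2] on the
    plane, so that Fubini's theorem applies. *)
Lemma fubini_dom1 (C : R) (g : R -> R -> R) :
  (forall u, continuous (g^~ u)) -> (forall t, continuous (g t)) ->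
  (forall t u, `|g t u| <= C * w1 t * w1 u) ->
  \int[mu]_t \int[mu]_u g t u = \int[mu]_u \int[mu]_t g t u.
Proof.
move=> c1 c2 dg.
have d2 t : dom1 (C * w1 t) (g t) by move=> u; exact: dg.
have d1 u : dom1 (C * w1 u) (g^~ u) by move=> t; rewrite mulrAC; exact: dg.
have C0 : 0 <= C.
  have := le_trans (normr_ge0 _) (dg 0 0); rewrite -mulrA.
  by rewrite pmulr_lge0// mulr_gt0 ?w1_gt0.
have mg := measurable_separately_continuous c1 c2.
have ig : (mu \x mu)%E.-integrable setT (fun z => (g z.1 z.2)%:E).
  apply/integrable12ltyP; first exact/measurable_EFinP.
  apply: (@le_lt_trans _ _ (\int[mu]_x (C * pi * w1 x)%:E)%E).
    apply: ge0_le_integral => //.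
    - move=> t _; exact: integral_ge0.
    - apply: (@measurable_fun_fubini_tonelli_F _ _ _ _ _ mu (fun z => `|(g z.1 z.2)%:E|%E)) => //.
      by apply/measurable_EFinP; exact: measurableT_comp.
    - apply/measurable_EFinP; apply: measurable_funM => //.
      by apply: continuous_measurable_fun; exact: continuous_w1.
    move=> t _ /=.
    apply: (@le_trans _ _ (\int[mu]_u (C * w1 t * w1 u)%:E)%E).
      apply: ge0_le_integral => //.
      - by apply/measurable_EFinP; apply: continuous_measurable_fun => u; exact: cvg_norm (c2 t u).
      - apply/measurable_EFinP; apply: measurable_funM => //.
        by apply: continuous_measurable_fun; exact: continuous_w1.
      - by move=> u _; rewrite lee_fin.
    under eq_integral do rewrite EFinM.
    rewrite ge0_integralZl//; last 3 first.
    - by apply/measurable_EFinP; apply: continuous_measurable_fun; exact: continuous_w1.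
    - by move=> u _; rewrite lee_fin w1_ge0.
    - by rewrite lee_fin mulr_ge0 ?w1_ge0.
    by rewrite integral_w1 -EFinM lee_fin mulrAC.
  under eq_integral do rewrite EFinM.
  rewrite ge0_integralZl//; last 3 first.
  - by apply/measurable_EFinP; apply: continuous_measurable_fun; exact: continuous_w1.
  - by move=> u _; rewrite lee_fin w1_ge0.
  - by rewrite lee_fin mulr_ge0 ?pi_ge0.
  by rewrite integral_w1 -EFinM ltry.
have fin2 t : (\int[mu]_u (g t u)%:E)%E \is a fin_num.
  by apply: integrable_fin_num => //; exact: integrable_dom1 (d2 t).
have fin1 u : (\int[mu]_t (g t u)%:E)%E \is a fin_num.
  by apply: integrable_fin_num => //; exact: integrable_dom1 (d1 u).
rewrite [LHS]/Rintegral [RHS]/Rintegral; congr fine.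
transitivity (\int[mu]_t \int[mu]_u (g t u)%:E)%E.
  by apply: eq_integral => t _; rewrite /Rintegral fineK.
rewrite (Fubini ig) /=.
by apply: eq_integral => u _; rewrite /Rintegral fineK.
Qed.

Lemma ge0_integral_affine (G : R -> R) (al be : R) : 0 < al -> continuous G ->
  (forall t, 0 <= G t) ->
  (\int[mu]_t (G t)%:E = \int[mu]_t (al * G (al * t + be))%:E)%E.
Proof.
move=> al0 cG G0.
have dF (x : R) : is_derive x (1 : R) (fun t : R => al * t + be) al.
  by apply: is_derive_eq; rewrite addr0 /GRing.scale /= mulr1.
have dFE : derive1 (fun t : R => al * t + be) = cst al.
  by apply/funext => x; rewrite derive1E; exact: derive_val.
rewrite (@increasing_ge0_integration_by_substitutionT _ (fun t : R => al * t + be))//.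
- by apply: eq_integral => x _ /=; rewrite dFE /= mulrC.
- by move=> x y xy; rewrite ltrD2r ltr_pM2l.
- by rewrite dFE; exact: cst_continuous.
- by rewrite dFE; exact: is_cvg_cst.
- by rewrite dFE; exact: is_cvg_cst.
- apply/cvgrNyPle => M /=; exists ((M - be) / al); split; first exact: num_real.
  by move=> x; rewrite ltr_pdivlMr//= mulrC; lra.
- apply/cvgryPge => M /=; exists ((M - be) / al); split; first exact: num_real.
  by move=> x; rewrite ltr_pdivrMr//= mulrC; lra.
Qed.

Lemma RintegralD_dom1 C D (f g : R -> R) : continuous f -> dom1 C f ->
  continuous g -> dom1 D g ->
  \int[mu]_t (f t + g t) = \int[mu]_t f t + \int[mu]_t g t.
Proof.
by move=> cf df cg dg; rewrite RintegralD//; [exact: integrable_dom1 df|exact: integrable_dom1 dg].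
Qed.

Lemma RintegralZ_dom1 C r (f : R -> R) : continuous f -> dom1 C f ->
  \int[mu]_t (r * f t) = r * \int[mu]_t f t.
Proof. by move=> cf df; rewrite RintegralZl//; exact: integrable_dom1 df. Qed.

Lemma le_Rintegral_dom1 C D (f g : R -> R) : continuous f -> dom1 C f ->
  continuous g -> dom1 D g -> (forall t, f t <= g t) ->
  \int[mu]_t f t <= \int[mu]_t g t.
Proof.
by move=> cf df cg dg fg; apply: le_Rintegral => //;
  [exact: integrable_dom1 df|exact: integrable_dom1 dg].
Qed.

Lemma w1_affine (al be : R) : 0 < al -> exists2 D : R, 0 <= D &
  forall t, w1 (al * t + be) <= D * w1 t.
Proof.
move=> al0; exists (2 * (al ^+ 2)^-1 * (1 + be ^+ 2) + 2 * (1 + be ^+ 2)).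
  by rewrite addr_ge0// !mulr_ge0 ?invr_ge0 ?sqr_ge0// addr_ge0 ?sqr_ge0.
move=> t; rewrite /w1.
have h1 : 0 < 1 + t ^+ 2 by rewrite ltr_pwDl// sqr_ge0.
have h2 : 0 < 1 + (al * t + be) ^+ 2 by rewrite ltr_pwDl// sqr_ge0.
rewrite -div1r ler_pdivrMr// mulrAC ler_pdivlMr// mul1r.
have a20 : 0 < al ^+ 2 by rewrite exprn_gt0.
set v := al * t + be.
have -> : t = (v - be) / al by rewrite /v addrK mulrAC mulfV ?mul1r// gt_eqF.
rewrite expr_div_n.
have : 0 <= (al ^+ 2)^-1 by rewrite invr_ge0 ltW.
set A := (al ^+ 2)^-1 => A0.
have e1 : (v - be) ^+ 2 <= 2 * (1 + be ^+ 2) * (1 + v ^+ 2) by nra.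
have e2 : 1 <= 2 * (1 + be ^+ 2) * (1 + v ^+ 2) by nra.
have := ler_wpM2r A0 e1; rewrite -/A; nra.
Qed.

Lemma dom1_affine C (f : R -> R) (al be : R) : 0 < al -> dom1 C f ->
  exists C', dom1 C' (fun t => f (al * t + be)).
Proof.
move=> al0 df; have [D D0 hD] := w1_affine be al0; exists (C * D) => t.
rewrite (le_trans (df _))// -mulrA ler_wpM2l//; exact: dom1_ge0 df.
Qed.

Lemma continuous_affine (f : R -> R) (al be : R) : continuous f ->
  continuous (fun t => f (al * t + be)).
Proof.
move=> cf t; apply: (@continuous_comp _ _ _ (fun t => al * t + be) f); last exact: cf.
by apply: cvgD; [apply: cvgM; [exact: cvg_cst|exact: cvg_id]|exact: cvg_cst].
Qed.

Lemma Rintegral_affine C (f : R -> R) (al be : R) : 0 < al -> continuous f ->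
  dom1 C f -> \int[mu]_t f (al * t + be) = al^-1 * \int[mu]_t f t.
Proof.
move=> al0 cf df.
have C0 := dom1_ge0 df.
have cCw : continuous (fun t : R => C * w1 t).
  by move=> t; apply: cvgM; [exact: cvg_cst|exact: continuous_w1].
have dCw : dom1 C (fun t : R => C * w1 t).
  by move=> t; rewrite ger0_norm// mulr_ge0 ?w1_ge0.
have pos g D : continuous g -> dom1 D g -> (forall t, 0 <= g t) ->
    \int[mu]_t g (al * t + be) = al^-1 * \int[mu]_t g t.
  move=> cg dg g0; rewrite [in RHS]/Rintegral (ge0_integral_affine be al0 cg g0).
  rewrite -/(Rintegral mu setT (fun t => al * g (al * t + be))).
  have [D' dg'] := dom1_affine be al0 dg.
  rewrite (@RintegralZ_dom1 D')//; last exact: continuous_affine.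
  by rewrite mulrA mulVf ?mul1r// gt_eqF.
(* The substitution rule is at hand for nonnegative integrands; [f + C * w1] is nonnegative, and the
   contribution of [C * w1] is subtracted at the end. *)
have cg : continuous (fun t => f t + C * w1 t) by move=> t; apply: cvgD; [exact: cf|exact: cCw].
have dg : dom1 (C + C) (fun t => f t + C * w1 t).
  by move=> t; rewrite mulrDl (le_trans (ler_normD _ _))// lerD// dCw.
have := pos _ _ cg dg; rewrite (RintegralD_dom1 cf df cCw dCw).
have [D1 df'] := dom1_affine be al0 df.
have [D2 dCw'] := dom1_affine be al0 dCw.
rewrite (RintegralD_dom1 (continuous_affine (be:=be) cf) df' (continuous_affine (be:=be) cCw) dCw').
rewrite (pos _ _ cCw dCw) => [h|t]; last by rewrite mulr_ge0 ?w1_ge0.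
move: h; rewrite mulrDr => h.
apply: (@addIr _ (al^-1 * \int[mu]_t (C * w1 t))); apply: h => t.
have := df t; rewrite ler_norml => /andP[]; lra.
Qed.

End OneVariable.

(** * Iterated integrals in k variables *)

Section Iterated.
Context {R : realType}.
Notation mu := (@lebesgue_measure R).
Implicit Types (F G : (nat -> R) -> R) (a b : nat -> R) (k i : nat).

Lemma updE a k t i : upd a k t i = if i == k then t else a i.
Proof. by []. Qed.

Lemma upd_upd a k t u : upd (upd a k t) k u = upd a k u.
Proof. by apply/funext => i; rewrite !updE; case: eqP. Qed.

Lemma updC a k i t u : k != i -> upd (upd a k t) i u = upd (upd a i u) k t.
Proof.
move=> ki; apply/funext => l; rewrite !updE.
by case: eqP => [->|//]; rewrite eq_sym (negbTE ki).
Qed.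

Definition wprod k a : R := \prod_(i < k) w1 (a i).

Lemma wprod_ge0 k a : 0 <= wprod k a.
Proof. by apply: prodr_ge0 => i _; exact: w1_ge0. Qed.

Lemma wprodS k a : wprod k.+1 a = wprod k a * w1 (a k).
Proof. by rewrite /wprod big_ord_recr. Qed.

Lemma wprod_upd k i a t : (k <= i)%N -> wprod k (upd a i t) = wprod k a.
Proof.
move=> ki; apply: eq_bigr => l _; rewrite updE ltn_eqF//.
exact: leq_trans (ltn_ord l) ki.
Qed.

Lemma wprod_updS k a t : wprod k.+1 (upd a k t) = wprod k a * w1 t.
Proof. by rewrite wprodS wprod_upd// updE eqxx. Qed.

(* Separate continuity suffices below: one variable is integrated at a time. *)
Definition sepc F := forall i a, continuous (fun t => F (upd a i t)).
Definition domk k C F := forall a, `|F a| <= C * wprod k a.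

Lemma sepc_upd F i t : sepc F -> sepc (fun a => F (upd a i t)).
Proof.
move=> sF l a; have [->|il] := eqVneq l i.
  by under eq_fun do rewrite upd_upd; exact: cst_continuous.
by under eq_fun do rewrite updC//; exact: sF.
Qed.

Lemma domk_upd k i C F t : (k <= i)%N -> domk k C F -> domk k C (fun a => F (upd a i t)).
Proof. by move=> ki dF a; rewrite (le_trans (dF _))// wprod_upd. Qed.

Lemma domkS_upd k C F t : domk k.+1 C F -> domk k (C * w1 t) (fun a => F (upd a k t)).
Proof. by move=> dF a; rewrite (le_trans (dF _))// wprod_updS -mulrA [w1 t * _]mulrC. Qed.

Lemma iint_upd k i F a t : (k <= i)%N ->
  iint k F (upd a i t) = iint k (fun b => F (upd b i t)) a.
Proof.
elim: k F a => [//|k IH] F a ki /=; apply: eq_Rintegral => u _.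
by rewrite updC ?gtn_eqF// IH// ltnW.
Qed.

Lemma iint_eq k F G a : (forall b, F b = G b) -> iint k F a = iint k G a.
Proof. by move=> FG; congr iint; exact/funext. Qed.

(** Bound and dominated convergence go through a single induction: the outer integral at step
    [k + 1] needs its integrand, an integral in [k] variables, to be continuous and dominated, and
    these two facts come from dominated convergence and the bound at step [k]. *)
Record iint_props k : Prop := IintProps {
  ip_bound : forall C F a, sepc F -> domk k C F -> `|iint k F a| <= C * pi ^+ k ;
  ip_dct : forall C (F_ : nat -> (nat -> R) -> R) F a,
    (forall m, sepc (F_ m)) -> (forall m, domk k C (F_ m)) -> sepc F -> domk k C F ->
    (forall b, F_ m b @[m --> \oo] --> F b) ->
    iint k (F_ m) a @[m --> \oo] --> iint k F a }.

Lemma iint_props_cont k : iint_props k -> forall C F a i, sepc F -> domk k C F ->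
  (k <= i)%N -> continuous (fun t => iint k F (upd a i t)).
Proof.
move=> [_ H] C F a i sF dF ki t; apply: seq_continuous => u ut.
rewrite iint_upd//; under eq_fun do rewrite iint_upd//.
apply: (H C).
- by move=> m; exact: sepc_upd.
- by move=> m; exact: domk_upd.
- exact: sepc_upd.
- exact: domk_upd.
move=> b; apply: (@cvg_comp _ _ _ u (fun t => F (upd b i t)) _ (nbhs t)) => //.
exact: sF.
Qed.

Lemma iint_propsS_cont k : iint_props k -> forall C F a, sepc F -> domk k.+1 C F ->
  continuous (fun t => iint k F (upd a k t)).
Proof.
move=> H C F a sF dF; apply: (iint_props_cont H (C := `|C|)) => // b.
rewrite (le_trans (dF b))// wprodS mulrA.
apply: (@le_trans _ _ (`|C| * wprod k b * w1 (b k))).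
  by rewrite ler_wpM2r ?w1_ge0// ler_wpM2r ?wprod_ge0// ler_norm.
by rewrite ler_piMr ?w1_le1// mulr_ge0 ?wprod_ge0.
Qed.

Lemma iint_propsS_dom k : iint_props k -> forall C F a, sepc F -> domk k.+1 C F ->
  dom1 (C * pi ^+ k) (fun t => iint k F (upd a k t)).
Proof.
move=> [H _] C F a sF dF t; rewrite iint_upd// mulrAC.
by apply: H; [exact: sepc_upd|exact: domkS_upd].
Qed.

Arguments iint_propsS_cont {k} _ {C F} a _ _.
Arguments iint_propsS_dom {k} _ {C F} a _ _.

Lemma wprod_le1 k a : wprod k a <= 1.
Proof. by apply: prodr_ile1 => j _; rewrite w1_ge0 w1_le1. Qed.

Lemma iint_propsP k : iint_props k.
Proof.
elim: k => [|k IH].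
  split=> [C F a _ /(_ a)|C F_ F a _ _ _ _ h]; last exact: h.
  by rewrite /wprod big_ord0 expr0.
split=> [C F a sF dF|C F_ F a sF_ dF_ sF dF FF] /=.
  rewrite exprSr mulrA; apply: Rintegral_dom1.
    exact: iint_propsS_cont dF.
  exact: iint_propsS_dom dF.
apply: (@dct1 _ (C * pi ^+ k)).
- by move=> m; exact: (iint_propsS_cont IH a (sF_ m) (dF_ m)).
- by move=> m; exact: iint_propsS_dom.
- exact: iint_propsS_cont dF.
- exact: iint_propsS_dom.
move=> t; rewrite iint_upd//; under eq_fun do rewrite iint_upd//.
apply: (ip_dct IH (C := C * w1 t)).
- by move=> m; exact: sepc_upd.
- by move=> m; exact: domkS_upd.
- exact: sepc_upd.
- exact: domkS_upd.
- by move=> b; exact: FF.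
Qed.

Definition iintS_cont k C F a := @iint_propsS_cont k (iint_propsP k) C F a.
Definition iintS_dom k C F a := @iint_propsS_dom k (iint_propsP k) C F a.

Arguments iintS_cont {k C F} a _ _.
Arguments iintS_dom {k C F} a _ _.

Lemma iintD k C D F G a : sepc F -> domk k C F -> sepc G -> domk k D G ->
  iint k (fun b => F b + G b) a = iint k F a + iint k G a.
Proof.
elim: k C D F G a => [//|k IH] C D F G a sF dF sG dG /=.
rewrite -(RintegralD_dom1 (iintS_cont a sF dF) (iintS_dom a sF dF)
  (iintS_cont a sG dG) (iintS_dom a sG dG)).
apply: eq_Rintegral => t _; rewrite !iint_upd//.
by apply: (IH (C * w1 t) (D * w1 t) (fun b => F (upd b k t)) (fun b => G (upd b k t)));
  [exact: sepc_upd|exact: domkS_upd|exact: sepc_upd|exact: domkS_upd].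
Qed.

Lemma iintZ k C r F a : sepc F -> domk k C F ->
  iint k (fun b => r * F b) a = r * iint k F a.
Proof.
elim: k C F a => [//|k IH] C F a sF dF /=.
rewrite -(RintegralZ_dom1 r (iintS_cont a sF dF) (iintS_dom a sF dF)).
apply: eq_Rintegral => t _; rewrite !iint_upd//.
by apply: (IH (C * w1 t) (fun b => F (upd b k t))); [exact: sepc_upd|exact: domkS_upd].
Qed.

Lemma le_iint k C D F G a : sepc F -> domk k C F -> sepc G -> domk k D G ->
  (forall b, F b <= G b) -> iint k F a <= iint k G a.
Proof.
elim: k C D F G a => [//|k IH] C D F G a sF dF sG dG FG /=.
apply: (le_Rintegral_dom1 (iintS_cont a sF dF) (iintS_dom a sF dF)
  (iintS_cont a sG dG) (iintS_dom a sG dG)) => t; rewrite !iint_upd//.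
by apply: (IH (C * w1 t) (D * w1 t) (fun b => F (upd b k t)) (fun b => G (upd b k t)));
  [exact: sepc_upd|exact: domkS_upd|exact: sepc_upd|exact: domkS_upd|].
Qed.

(** The base point on the right is transformed as well: the coordinates from [k] on are not
    integrated but still enter [F], and each step of the induction integrates one of them. *)
Lemma iint_affine k C F (al : R) (be : nat -> R) a : 0 < al -> sepc F -> domk k C F ->
  iint k (fun b => F (fun i => al * b i + be i)) a =
  al ^- k * iint k F (fun i => al * a i + be i).
Proof.
move=> al0; elim: k C F a => [|k IH] C F a sF dF /=; first by rewrite expr0 invr1 mul1r.
have E t : iint k (fun b => F (fun i => al * b i + be i)) (upd a k t) =
   al ^- k * iint k F (upd (fun i => al * a i + be i) k (al * t + be k)).
  rewrite iint_upd// [in RHS]iint_upd//.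
  rewrite -(IH (C * w1 (al * t + be k)))//; last 2 first.
  - exact: sepc_upd.
  - exact: domkS_upd.
  apply: iint_eq => b; congr F; apply/funext => i; rewrite !updE.
  by case: eqP => // ->.
under eq_Rintegral do rewrite E.
have [sc dc] := (iintS_cont (fun i => al * a i + be i) sF dF, iintS_dom (fun i => al * a i + be i) sF dF).
have [D dD] := dom1_affine (be k) al0 dc.
rewrite (RintegralZ_dom1 _ (continuous_affine (be:=be k) sc) dD).
by rewrite (Rintegral_affine (be k) al0 sc dc) exprSr invfM mulrA.
Qed.

Definition domt k C (F : R -> (nat -> R) -> R) :=
  forall t a, `|F t a| <= C * w1 t * wprod k a.

Lemma Rint_iint k C (F : R -> (nat -> R) -> R) a :
  (forall t, sepc (F t)) -> (forall a, continuous (F^~ a)) -> domt k C F ->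
  \int[mu]_t iint k (F t) a = iint k (fun b => \int[mu]_t F t b) a.
Proof.
elim: k C F a => [//|k IH] C F a sF cF dF /=.
have cI u : continuous (fun t => iint k (F t) (upd a k u)).
  move=> t; apply: seq_continuous => v vt; rewrite iint_upd//.
  under eq_fun do rewrite iint_upd//.
  (* The decay in the outer variable is given up for a majorant that serves all values of the
     parameter at once. *)
  have C0 s : domk k (C * w1 u) (fun a => F s (upd a k u)).
    move=> c; rewrite (le_trans (dF s _))// wprod_updS.
    have C0 : 0 <= C.
      have := le_trans (normr_ge0 _) (dF 0 (fun=> 0)).
      by rewrite -mulrA pmulr_lge0// mulr_gt0 ?w1_gt0// prodr_gt0// => i _; exact: w1_gt0.
    rewrite -[leRHS]mul1r [leLHS](_ : _ = w1 s * (C * w1 u * wprod k c)); last by ring.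
    by rewrite ler_wpM2r ?w1_le1// !mulr_ge0 ?w1_ge0 ?wprod_ge0.
  apply: (ip_dct (iint_propsP k) (C := C * w1 u)) => //.
  - by move=> m; apply: sepc_upd; exact: sF.
  - by apply: sepc_upd; exact: sF.
  - move=> b; apply: (@cvg_comp _ _ _ v (F^~ (upd b k u)) _ (nbhs t)) => //; exact: cF.
have dFk t : domk k.+1 (C * w1 t) (F t) by move=> b; exact: dF.
rewrite (@fubini_dom1 _ (C * pi ^+ k) (fun t u => iint k (F t) (upd a k u))); last 3 first.
- exact: cI.
- by move=> t; exact: (iintS_cont a (sF t) (dFk t)).
- by move=> t u; rewrite (le_trans (iintS_dom a (sF t) (dFk t) u))// [C * w1 t * _]mulrAC.
apply: eq_Rintegral => u _.
under eq_Rintegral do rewrite iint_upd//.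
rewrite (IH (C * w1 u))//.
- by rewrite iint_upd.
- by move=> t; apply: sepc_upd; exact: sF.
- move=> t b; rewrite (le_trans (dF t _))// wprod_updS.
  by rewrite [leRHS](_ : _ = C * w1 t * (wprod k b * w1 u))//; ring.
Qed.

(** The variables of the outer integral are moved past the inner one singly, each by [Rint_iint]. *)
Lemma iint_iint k l C (F : (nat -> R) -> (nat -> R) -> R) a b :
  (forall a, sepc (F a)) -> (forall b, sepc (F^~ b)) ->
  (forall a b, `|F a b| <= C * wprod k a * wprod l b) ->
  iint k (fun a => iint l (F a) b) a = iint l (fun b => iint k (F^~ b) a) b.
Proof.
elim: k C F a b => [//|k IH] C F a b s1 s2 dF /=.
have dF' t c d : `|F (upd c k t) d| <= C * w1 t * wprod k c * wprod l d.
  rewrite (le_trans (dF _ _))// wprod_updS.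
  by rewrite [leRHS](_ : _ = C * (wprod k c * w1 t) * wprod l d)//; ring.
transitivity (\int[mu]_t iint l (fun b => iint k (F^~ b) (upd a k t)) b).
  apply: eq_Rintegral => t _; rewrite iint_upd//.
  rewrite (IH (C * w1 t) (fun a => F (upd a k t)))//; last first.
    by move=> c; apply: (@sepc_upd (F^~ c)); exact: s2.
  by apply: iint_eq => c; rewrite iint_upd.
have dk c : domk k.+1 (C * wprod l c) (F^~ c).
  by move=> d; rewrite (le_trans (dF _ _))// mulrAC.
apply: (@Rint_iint l (C * pi ^+ k) (fun t b => iint k (F^~ b) (upd a k t))).
- move=> t i c u; apply: seq_continuous => v vu.
  rewrite iint_upd//; under eq_fun do rewrite iint_upd//.
  have C0 : 0 <= C.
    have := le_trans (normr_ge0 _) (dF (fun=> 0) (fun=> 0)).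
    by rewrite -mulrA pmulr_lge0// mulr_gt0// prodr_gt0// => j _; exact: w1_gt0.
  have dd d : domk k C (fun c => F (upd c k t) d).
    move=> e; rewrite (le_trans (dF' _ _ _))//.
    rewrite [leLHS](_ : _ = w1 t * wprod l d * (C * wprod k e)); last by ring.
    rewrite -[leRHS]mul1r ler_wpM2r ?mulr_ge0 ?wprod_ge0//.
    rewrite mulr_ile1 ?w1_ge0 ?w1_le1 ?wprod_ge0//.
    exact: wprod_le1.
  apply: (ip_dct (iint_propsP k) (C := C)) => //.
  + by move=> m; apply: (@sepc_upd (F^~ (upd c i (v m)))); exact: s2.
  + by apply: (@sepc_upd (F^~ (upd c i u))); exact: s2.
  + move=> d; apply: (@cvg_comp _ _ _ v (fun u => F (upd d k t) (upd c i u)) _ (nbhs u)) => //.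
    exact: s1.
- by move=> c; exact: (iintS_cont a (s2 c) (dk c)).
- move=> t c; rewrite (le_trans (iintS_dom a (s2 c) (dk c) t))//.
  by rewrite [leRHS](_ : _ = C * wprod l c * pi ^+ k * w1 t)//; ring.
Qed.

End Iterated.

Section Continuity.
Context {R : realType} {T : topologicalType}.
Implicit Types f g : T -> R.

Lemma contC (c : R) : continuous (fun _ : T => c).
Proof. exact: cst_continuous. Qed.

Lemma contD f g : continuous f -> continuous g -> continuous (fun x => f x + g x).
Proof. by move=> cf cg x; apply: cvgD; [exact: cf|exact: cg]. Qed.

Lemma contM f g : continuous f -> continuous g -> continuous (fun x => f x * g x).
Proof. by move=> cf cg x; apply: cvgM; [exact: cf|exact: cg]. Qed.

Lemma contN f : continuous f -> continuous (fun x => - f x).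
Proof. by move=> cf x; exact: cvgN (cf x). Qed.

Lemma contB f g : continuous f -> continuous g -> continuous (fun x => f x - g x).
Proof. by move=> cf cg; apply: contD => //; exact: contN. Qed.

Lemma cont_norm f : continuous f -> continuous (fun x => `|f x|).
Proof. by move=> cf x; exact: cvg_norm (cf x). Qed.

Lemma cont_sum (I : Type) (r : seq I) (P : pred I) (f : I -> T -> R) :
  (forall i, continuous (f i)) -> continuous (fun x => \sum_(i <- r | P i) f i x).
Proof.
move=> cf; elim: r => [|i r IH].
  by under eq_fun do rewrite big_nil; exact: contC.
under eq_fun do rewrite big_cons.
by case: (P i) => //; exact: contD.
Qed.

Lemma cont_prod (I : Type) (r : seq I) (P : pred I) (f : I -> T -> R) :
  (forall i, continuous (f i)) -> continuous (fun x => \prod_(i <- r | P i) f i x).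
Proof.
move=> cf; elim: r => [|i r IH].
  by under eq_fun do rewrite big_nil; exact: contC.
under eq_fun do rewrite big_cons.
by case: (P i) => //; exact: contM.
Qed.

Lemma cont_comp (U S : topologicalType) (h : S -> U) (f : T -> S) :
  continuous h -> continuous f -> continuous (fun x => h (f x)).
Proof. by move=> ch cf x; apply: (@continuous_comp _ _ _ f h); [exact: cf|exact: ch]. Qed.

End Continuity.

(** * Integrals over R^n *)

Section IntegralRn.
Context {R : realType} {n : nat}.
Notation mu := (@lebesgue_measure R).
Notation V := 'rV[R]_n.

Lemma iint_base k (F : (nat -> R) -> R) a b : (forall i, (k <= i)%N -> a i = b i) ->
  iint k F a = iint k F b.
Proof.
elim: k a b => [|k IH] a b ab /=; first by congr F; apply/funext => i; exact: ab.
apply: eq_Rintegral => t _; apply: IH => i ki; rewrite !updE.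
by case: eqP => // /eqP ik; apply: ab; rewrite ltn_neqAle eq_sym ik.
Qed.

Definition rowof (a : nat -> R) : V := \row_i a i.

Lemma rowof_upd a k t : rowof (upd a k t) = rowof (upd a k 0) + t *: \row_i ((i : nat) == k)%:R.
Proof.
apply/rowP => i; rewrite !mxE !updE; case: eqP => _; first by rewrite add0r mulr1.
by rewrite mulr0 addr0.
Qed.

Lemma continuous_rowof a k : continuous (fun t => rowof (upd a k t)).
Proof.
under eq_fun do rewrite rowof_upd.
by move=> t; apply: cvgD; [exact: cvg_cst|exact: scalel_continuous].
Qed.

Definition w (x : V) : R := \prod_i w1 (x ord0 i).

Lemma w_ge0 x : 0 <= w x. Proof. by apply: prodr_ge0 => i _; exact: w1_ge0. Qed.
Lemma w_gt0 x : 0 < w x. Proof. by apply: prodr_gt0 => i _; exact: w1_gt0. Qed.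
Lemma w_le1 x : w x <= 1.
Proof. by apply: prodr_ile1 => i _; rewrite w1_ge0 w1_le1. Qed.
Lemma wN x : w (- x) = w x.
Proof. by apply: eq_bigr => i _; rewrite mxE w1N. Qed.

Lemma continuous_coord i : continuous (fun x : V => x ord0 i).
Proof. by move=> x; exact: coord_continuous. Qed.

Lemma continuous_w : continuous w.
Proof.
apply: cont_prod => i; apply: cont_comp; first exact: continuous_w1.
exact: continuous_coord.
Qed.

Definition dom (C : R) (f : V -> R) := forall x, `|f x| <= C * w x.

Lemma dom_ge0 C f : dom C f -> 0 <= C.
Proof.
move=> /(_ 0) h; rewrite -(pmulr_lge0 _ (w_gt0 0)); exact: le_trans h.
Qed.

Lemma wprod_rowof a : wprod n a = w (rowof a).
Proof. by apply: eq_bigr => i _; rewrite mxE. Qed.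

Lemma sepc_rowof (f : V -> R) : continuous f -> sepc (fun a => f (rowof a)).
Proof.
move=> cf i a t; apply: (@continuous_comp _ _ _ (fun t => rowof (upd a i t)) f).
  exact: continuous_rowof.
exact: cf.
Qed.

Lemma domk_rowof C f : dom C f -> domk n C (fun a => f (rowof a)).
Proof. by move=> df a; rewrite wprod_rowof. Qed.

Lemma eq_intRn (f g : V -> R) : (forall x, f x = g x) -> intRn f = intRn g.
Proof. by move=> fg; congr intRn; exact/funext. Qed.

Lemma intRn_bound C f : continuous f -> dom C f -> `|intRn f| <= C * pi ^+ n.
Proof.
by move=> cf df; apply: (ip_bound (iint_propsP n)); [exact: sepc_rowof|exact: domk_rowof].
Qed.

Lemma intRnD C D f g : continuous f -> dom C f -> continuous g -> dom D g ->
  intRn (fun x => f x + g x) = intRn f + intRn g.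
Proof.
move=> cf df cg dg.
exact: (iintD _ (sepc_rowof cf) (domk_rowof df) (sepc_rowof cg) (domk_rowof dg)).
Qed.

Lemma intRnZ C r f : continuous f -> dom C f -> intRn (fun x => r * f x) = r * intRn f.
Proof. move=> cf df; exact: (iintZ r _ (sepc_rowof cf) (domk_rowof df)). Qed.

Lemma intRnN C f : continuous f -> dom C f -> intRn (fun x => - f x) = - intRn f.
Proof.
move=> cf df; rewrite -mulN1r -(intRnZ _ cf df); apply: eq_intRn => x; rewrite mulN1r//.
Qed.

Lemma intRnB C D f g : continuous f -> dom C f -> continuous g -> dom D g ->
  intRn (fun x => f x - g x) = intRn f - intRn g.
Proof.
move=> cf df cg dg; rewrite -(intRnN cg dg) -(intRnD cf df (g := fun x => - g x) (D := D))//.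
- exact: contN.
- by move=> x; rewrite normrN.
Qed.

Lemma intRn0 : intRn (fun _ : V => 0 : R) = 0.
Proof.
have c0 : continuous (fun _ : V => 0 : R) by exact: cst_continuous.
have d0 : dom 0 (fun _ : V => 0 : R) by move=> x; rewrite normr0 mul0r.
by apply/eqP; rewrite -normr_le0 (le_trans (intRn_bound c0 d0))// mul0r.
Qed.

Lemma le_intRn C D f g : continuous f -> dom C f -> continuous g -> dom D g ->
  (forall x, f x <= g x) -> intRn f <= intRn g.
Proof.
move=> cf df cg dg fg.
apply: (le_iint _ (sepc_rowof cf) (domk_rowof df) (sepc_rowof cg) (domk_rowof dg)) => b.
exact: fg.
Qed.

Lemma dom_norm C f : dom C f -> dom C (fun x => `|f x|).
Proof. by move=> df x; rewrite normr_id. Qed.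

Lemma le_norm_intRn C f : continuous f -> dom C f -> `|intRn f| <= intRn (fun x => `|f x|).
Proof.
move=> cf df.
have cn := cont_norm cf; have dn := dom_norm df.
rewrite ler_norml; apply/andP; split.
  rewrite -(intRnN cn dn); apply: (le_intRn (C := C) (D := C)) => //.
  - exact: contN.
  - by move=> x; rewrite normrN normr_id.
  - by move=> x; rewrite lerNl ler_normr lexx orbT.
by apply: (le_intRn (C := C) (D := C)) => // x; rewrite ler_norm.
Qed.

Lemma le_norm_intRn_dom C D f g : continuous f -> dom C f -> continuous g -> dom D g ->
  (forall x, `|f x| <= g x) -> `|intRn f| <= intRn g.
Proof.
move=> cf df cg dg fg; apply: (le_trans (le_norm_intRn cf df)).
exact: (le_intRn (cont_norm cf) (dom_norm df) cg dg).
Qed.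

Lemma intRn_swap C (f : V -> V -> R) :
  (forall x, continuous (f x)) -> (forall y, continuous (f^~ y)) ->
  (forall x y, `|f x y| <= C * w x * w y) ->
  intRn (fun x => intRn (fun y => f x y)) = intRn (fun y => intRn (fun x => f x y)).
Proof.
move=> c1 c2 df.
apply: (@iint_iint _ n n C (fun a b => f (rowof a) (rowof b))).
- by move=> a; exact: sepc_rowof (c1 _).
- by move=> b; exact: (sepc_rowof (c2 (rowof b))).
- by move=> a b; rewrite !wprod_rowof.
Qed.

Lemma intRn_dct C (f_ : nat -> V -> R) (f : V -> R) :
  (forall m, continuous (f_ m)) -> (forall m, dom C (f_ m)) ->
  continuous f -> dom C f -> (forall x, f_ m x @[m --> \oo] --> f x) ->
  intRn (f_ m) @[m --> \oo] --> intRn f.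
Proof.
move=> cf_ df_ cf df ff; apply: (ip_dct (iint_propsP n) (C := C)).
- by move=> m; exact: sepc_rowof.
- by move=> m; exact: domk_rowof.
- exact: sepc_rowof.
- exact: domk_rowof.
- by move=> b; exact: ff.
Qed.

Lemma continuous_intRn C (W : normedModType R) (f : W -> V -> R) (a : W) :
  (forall u, continuous (f u)) -> (forall x, {for a, continuous (f^~ x)}) ->
  (forall u, dom C (f u)) -> {for a, continuous (fun u => intRn (f u))}.
Proof.
move=> c1 c2 df; apply: seq_continuous => u ua; apply: (intRn_dct (C := C)) => //.
by move=> x; apply: (@cvg_comp _ _ _ u (f^~ x) _ (nbhs a)) => //; exact: c2.
Qed.

Lemma intRn_affine C f (al : R) (b : V) : 0 < al -> continuous f -> dom C f ->
  intRn (fun x => f (al *: x + b)) = al ^- n * intRn f.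
Proof.
move=> al0 cf df.
(* The shift is extended by 0 beyond [n], so that the zero base point is preserved there. *)
pose be (i : nat) : R := if insub i is Some j then b ord0 j else 0.
have E a : f (al *: rowof a + b) = f (rowof (fun i => al * a i + be i)).
  congr f; apply/rowP => i; rewrite !mxE /be; congr (_ + _).
  by case: insubP => [j _ /val_inj ->//|]; rewrite ltn_ord.
rewrite /intRn (iint_eq _ (G := fun a => f (rowof (fun i => al * a i + be i)))); last exact: E.
rewrite (iint_affine be _ al0 (sepc_rowof cf) (domk_rowof df)); congr (_ * _).
apply: iint_base => i ni; rewrite mulr0 add0r /be; case: insubP => //= j.
by rewrite ltnNge ni.
Qed.

Lemma intRn_sum (I : Type) (r : seq I) (P : pred I) (C : I -> R) (f : I -> V -> R) :
  (forall i, continuous (f i)) -> (forall i, dom (C i) (f i)) ->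
  intRn (fun x => \sum_(i <- r | P i) f i x) = \sum_(i <- r | P i) intRn (f i).
Proof.
move=> cf df; elim: r => [|i r IH].
  by rewrite big_nil -[RHS]intRn0; apply: eq_intRn => x; rewrite big_nil.
rewrite big_cons -IH; case: (boolP (P i)) => Pi; last first.
  by apply: eq_intRn => x; rewrite big_cons (negbTE Pi).
rewrite -(@intRnD (C i) (\sum_(i <- r | P i) C i))//.
- by apply: eq_intRn => x; rewrite big_cons Pi.
- exact: cont_sum.
move=> x; elim: r {IH} => [|j r IH]; first by rewrite !big_nil normr0 mul0r.
rewrite !big_cons; case: (P j) => //.
by rewrite mulrDl (le_trans (ler_normD _ _))// lerD// df.
Qed.

Lemma cont_shift (f : V -> R) (al : R) (b : V) : continuous f ->
  continuous (fun x : V => f (al *: x + b)).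
Proof.
move=> cf x; apply: (@continuous_comp _ _ _ (fun x : V => al *: x + b) f); last exact: cf.
apply: (@continuousD R V V (fun x1 : V => al *: x1) (fun=> b) x); last exact: cst_continuous.
exact: (@scaler_continuous R V al x).
Qed.

Lemma w_affine (al : R) (b : V) : 0 < al -> exists2 D : R, 0 <= D &
  forall x, w (al *: x + b) <= D * w x.
Proof.
move=> al0.
have H i : exists D : R, 0 <= D /\ forall t, w1 (al * t + b ord0 i) <= D * w1 t.
  by have [D D0 h] := w1_affine (b ord0 i) al0; exists D.
have [D hD] := choice H.
exists (\prod_i D i); first by apply: prodr_ge0 => i _; exact: (hD i).1.
move=> x; rewrite /w -big_split /=; apply: ler_prod => i _.
by rewrite w1_ge0 !mxE; exact: (hD i).2.
Qed.

Lemma dom_affine C f (al : R) (b : V) : 0 < al -> dom C f ->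
  exists C', dom C' (fun x => f (al *: x + b)).
Proof.
move=> al0 df; have [D D0 hD] := w_affine b al0; exists (C * D) => x.
by rewrite (le_trans (df _))// -mulrA ler_wpM2l// (dom_ge0 df).
Qed.

Lemma intRn_shift C f (b : V) : continuous f -> dom C f ->
  intRn (fun x => f (x + b)) = intRn f.
Proof.
move=> cf df.
have := intRn_affine b ltr01 cf df; rewrite expr1n invr1 mul1r => <-.
by apply: eq_intRn => x; rewrite scale1r.
Qed.

End IntegralRn.

(** * Families of rapidly decreasing functions *)

Section Directional.
Context {R : realType} {W : normedModType R}.
Implicit Types (f g : W -> R) (a v : W).

Lemma is_derive_line f a v t d : is_derive (a + t *: v) v f d ->
  is_derive t (1 : R) (fun t : R => f (a + t *: v)) d.
Proof.
move=> [df <-].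
have E : (fun h : R => h^-1 *: ((fun t : R => f (a + t *: v)) (h *: (1 : R) + t) - f (a + t *: v))) =
         (fun h : R => h^-1 *: (f (h *: v + (a + t *: v)) - f (a + t *: v))).
  apply/funext => h; congr (_ *: (f _ - _)).
  by rewrite [h *: 1]mulr1 scalerDl addrCA.
split; first by rewrite /derivable /= E.
by rewrite /derive /= E.
Qed.

Lemma mvt_dir f a v (f' : R -> R) (C h : R) :
  (forall t, is_derive (a + t *: v) v f (f' t)) ->
  (forall t, `|t| <= `|h| -> `|f' t| <= C) ->
  `|f (a + h *: v) - f a| <= C * `|h|.
Proof.
move=> df bf.
pose F (t : R) := f (a + t *: v).
have dF t : is_derive t (1 : R) F (f' t) by exact: is_derive_line.
have cF : continuous F by move=> t; apply: differentiable_continuous; apply/derivable1_diffP; exact: ex_derive.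
have [h0|h0|->] := ltgtP h 0.
- have [] := @MVT _ F f' h 0 h0 (fun x _ => dF x).
    exact: continuous_subspaceT.
  move=> c /[!in_itv]/= /andP[hc c0].
  rewrite /F scale0r addr0 sub0r => e; rewrite distrC e normrM normrN.
  rewrite ler_wpM2r// bf// !ltr0_norm//; lra.
- have [] := @MVT _ F f' 0 h h0 (fun x _ => dF x).
    exact: continuous_subspaceT.
  move=> c /[!in_itv]/= /andP[hc c0].
  rewrite /F scale0r addr0 subr0 => ->; rewrite normrM.
  rewrite ler_wpM2r// bf// !gtr0_norm//; lra.
by rewrite scale0r addr0 subrr !normr0 mulr0.
Qed.

Lemma derivable_sumseq (I : Type) (r : seq I) (f : I -> W -> R) a v :
  (forall i, derivable (f i) a v) -> derivable (fun x => \sum_(i <- r) f i x) a v.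
Proof.
move=> df; elim: r => [|i r IH].
  by under eq_fun do rewrite big_nil; exact: derivable_cst.
under eq_fun do rewrite big_cons.
exact: (@derivableD _ _ _ (f i) (fun x => \sum_(j <- r) f j x)).

Qed.

Lemma derive_sumseq (I : Type) (r : seq I) (f : I -> W -> R) a v :
  (forall i, derivable (f i) a v) ->
  derive (fun x => \sum_(i <- r) f i x) a v = \sum_(i <- r) derive (f i) a v.
Proof.
move=> df; elim: r => [|i r IH].
  by under eq_fun do rewrite big_nil; rewrite big_nil derive_cst.
under eq_fun do rewrite big_cons.
by rewrite big_cons -IH deriveD//; exact: derivable_sumseq.
Qed.

Lemma is_derive_comp1 (h : R -> R) f a v (d d' : R) :
  is_derive (f a) (1 : R) h d -> is_derive a v f d' ->
  is_derive a v (fun x => h (f x)) (d * d').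
Proof.
move=> dh df.
have dline : is_derive (0 : R) (1 : R) (fun t : R => f (a + t *: v)) d'.
  by apply: is_derive_line; rewrite scale0r addr0.
have dl2 : is_derive (0 : R) (1 : R) (h \o (fun t : R => f (a + t *: v))) (d * d').
  have e0 : f (a + 0 *: v) = f a by rewrite scale0r addr0.
  have dh' : is_derive (f (a + 0 *: v)) (1 : R) h d by rewrite e0.
  exact: (@is_derive1_comp _ h (fun t : R => f (a + t *: v)) 0).
have [dv <-] := dl2.
have E : (fun t : R => t^-1 *: (((h \o (fun t : R => f (a + t *: v))) (t *: (1 : R) + 0)) - (h \o (fun t : R => f (a + t *: v))) 0))
      = (fun t : R => t^-1 *: (h (f (t *: v + a)) - h (f a))).
  apply/funext => t; rewrite /= scale0r !addr0; congr (_ *: (h (f _) - _)).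
  by rewrite /GRing.scale /= mulr1 addrC.
move: dv; rewrite /derivable /= E => dv.
split; first by rewrite /derivable.
by rewrite /derive /= E.
Qed.

End Directional.

Section Families.
Context {R : realType} {W : normedModType R} {I : Type} (dir : I -> W).

(** The constants are uniform in [p], which later carries scale, lattice point and centre; they may
    depend on the derivative. Recursion on the order, instead of quantification over words of
    derivatives, makes the derivative of a family again a family, so that sums, products and affine
    changes of variable are handled by induction. *)
Fixpoint wf (N : nat) (P : Type) (f B : P -> W -> R) : Prop :=
  ((forall p, continuous (f p)) /\ exists C : R, forall p x, `|f p x| <= C * B p x) /\
  match N with
  | 0 => True
  | N'.+1 => forall i, (forall p a, derivable (f p) a (dir i)) /\
                       wf N' (fun p a => derive (f p) a (dir i)) B
  end.

Definition wfam P f B := forall N, @wf N P f B.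

Lemma wf_cont N P (f B : P -> W -> R) : wf N f B -> forall p, continuous (f p).
Proof. by case: N => [|N] [[]]. Qed.

Lemma wf_bound N P (f B : P -> W -> R) : wf N f B ->
  exists C : R, forall p x, `|f p x| <= C * B p x.
Proof. by case: N => [|N] [[]]. Qed.

Lemma wfW N P (f B : P -> W -> R) : wf N.+1 f B -> wf N f B.
Proof.
elim: N f => [|N IH] f [hf h]; split=> // i; have [h1 h2] := h i; split=> //.
exact: IH.
Qed.

Lemma wf_le N P (f B B' : P -> W -> R) :
  (exists D : R, forall p x, 0 <= B p x <= D * B' p x) -> wf N f B -> wf N f B'.
Proof.
move=> [D hD]; elim: N f => [|N IH] f [[cf [C hC]] h].
  split=> //; split=> //; exists (`|C| * D) => p x.
  have /andP[h1 h2] := hD p x; rewrite (le_trans (hC p x))// -mulrA.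
  by rewrite (@le_trans _ _ (`|C| * B p x))// ?ler_wpM2r ?ler_norm// ler_wpM2l.
split; last by move=> i; have [h1 h2] := h i; split=> //; exact: IH.
split=> //; exists (`|C| * D) => p x.
have /andP[h1 h2] := hD p x; rewrite (le_trans (hC p x))// -mulrA.
by rewrite (@le_trans _ _ (`|C| * B p x))// ?ler_wpM2r ?ler_norm// ler_wpM2l.
Qed.

Lemma wf_reindex N P Q (s : Q -> P) (f B : P -> W -> R) :
  wf N f B -> wf N (fun q => f (s q)) (fun q => B (s q)).
Proof.
elim: N f => [|N IH] f [[cf [C hC]] h]; split=> //.
- by split; [move=> q; exact: cf|exists C => q x; exact: hC].
- by split; [move=> q; exact: cf|exists C => q x; exact: hC].
by move=> i; have [h1 h2] := h i; split=> [q a|]; [exact: h1|exact: (IH _ h2)].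
Qed.

Lemma wfD N P (f g B : P -> W -> R) :
  wf N f B -> wf N g B -> wf N (fun p x => f p x + g p x) B.
Proof.
have base (u v : P -> W -> R) : ((forall p, continuous (u p)) /\ exists C : R, forall p x, `|u p x| <= C * B p x) ->
   ((forall p, continuous (v p)) /\ exists C : R, forall p x, `|v p x| <= C * B p x) ->
   ((forall p, continuous (fun x => u p x + v p x)) /\ exists C : R, forall p x, `|u p x + v p x| <= C * B p x).
  move=> [cu [C hC]] [cv [D hD]]; split=> [p|]; first exact: contD.
  by exists (C + D) => p x; rewrite mulrDl (le_trans (ler_normD _ _))// lerD.
elim: N f g => [|N IH] f g [hf df] [hg dg]; split=> //.
- exact: base.
- exact: base.
move=> i; have [f1 f2] := df i; have [g1 g2] := dg i; split=> [p a|].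
  exact: derivableD.
have -> : (fun p a => derive (fun x => f p x + g p x) a (dir i)) =
          (fun p a => derive (f p) a (dir i) + derive (g p) a (dir i)).
  by apply/funext => p; apply/funext => a; rewrite deriveD.
exact: (IH _ _ f2 g2).
Qed.

Lemma wfM N P (f g B B' : P -> W -> R) :
  wf N f B -> wf N g B' -> wf N (fun p x => f p x * g p x) (fun p x => B p x * B' p x).
Proof.
have base (u v : P -> W -> R) : ((forall p, continuous (u p)) /\ exists C : R, forall p x, `|u p x| <= C * B p x) ->
   ((forall p, continuous (v p)) /\ exists C : R, forall p x, `|v p x| <= C * B' p x) ->
   ((forall p, continuous (fun x => u p x * v p x)) /\ exists C : R, forall p x, `|u p x * v p x| <= C * (B p x * B' p x)).
  move=> [cu [C hC]] [cv [D hD]]; split=> [p|]; first exact: contM.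
  by exists (C * D) => p x; rewrite normrM mulrACA ler_pM.
elim: N f g => [|N IH] f g; first by move=> [hf _] [hg _]; split=> //; exact: base.
move=> wff wfg; have wff' := wfW wff; have wfg' := wfW wfg.
case: wff wfg => [hf df] [hg dg]; split; first exact: base.
move=> i; have [f1 f2] := df i; have [g1 g2] := dg i; split=> [p a|].
  exact: derivableM.
have -> : (fun p a => derive (fun x => f p x * g p x) a (dir i)) =
          (fun p a => derive (f p) a (dir i) * g p a + f p a * derive (g p) a (dir i)).
  apply/funext => p; apply/funext => a.
  have := @deriveM _ _ (f p) (g p) a (dir i) (f1 p a) (g1 p a).
  by move=> ->; rewrite addrC /GRing.scale /= [X in _ + X]mulrC mulrC [X in X + _]mulrC; congr (_ + _); rewrite mulrC.
by apply: wfD; exact: IH.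
Qed.

Lemma wf_cst N P (c : P -> R) : (exists C : R, forall p, `|c p| <= C) ->
  wf N (fun p (_ : W) => c p) (fun _ _ => 1).
Proof.
move=> [C hC].
have base (d : P -> R) D : (forall p, `|d p| <= D) ->
   ((forall p, continuous (fun _ : W => d p)) /\ exists C : R, forall p (x : W), `|d p| <= C * 1).
  by move=> hD; split=> [p|]; [exact: contC|exists D => p _; rewrite mulr1].
case: N => [|N]; split=> //; try exact: base hC.
move=> i; split=> [p a|]; first exact: derivable_cst.
have -> : (fun p a => derive (fun _ : W => c p) a (dir i)) = (fun p a => 0 : R).
  by apply/funext => p; apply/funext => a; rewrite derive_cst.
elim: N => [|N IH]; split=> //; try by apply: (base _ 0) => p; rewrite normr0.
move=> j; split=> [p a|]; first exact: derivable_cst.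
have -> // : (fun (p : P) a => derive (fun _ : W => 0 : R) a (dir j)) = (fun p a => 0 : R).
by apply/funext => p; apply/funext => a; rewrite derive_cst.
Qed.

Lemma wfZ N P (c : P -> R) (f B : P -> W -> R) : (exists C : R, forall p, `|c p| <= C) ->
  wf N f B -> wf N (fun p x => c p * f p x) B.
Proof.
move=> hc wff; have := wfM (wf_cst N hc) wff.
by congr wf; apply/funext => p; apply/funext => x; rewrite mul1r.
Qed.

Lemma wfN N P (f B : P -> W -> R) : wf N f B -> wf N (fun p x => - f p x) B.
Proof.
move=> wff; have := @wfZ N P (fun=> -1) f B _ wff.
rewrite (_ : (fun p x => -1 * f p x) = (fun p x => - f p x)); last first.
  by apply/funext => p; apply/funext => x; rewrite mulN1r.
by apply; exists 1 => p; rewrite normrN1.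
Qed.

Lemma wf_sum N P L (A : P -> seq L) (f B : P * L -> W -> R) :
  wf N f B -> wf N (fun p x => \sum_(l <- A p) f (p, l) x) (fun p x => \sum_(l <- A p) B (p, l) x).
Proof.
have base (u : P * L -> W -> R) : ((forall p, continuous (u p)) /\ exists C : R, forall p x, `|u p x| <= C * B p x) ->
   ((forall p, continuous (fun x => \sum_(l <- A p) u (p, l) x)) /\
     exists C : R, forall p x, `|\sum_(l <- A p) u (p, l) x| <= C * \sum_(l <- A p) B (p, l) x).
  move=> [cu [C hC]]; split=> [p|]; first by apply: cont_sum => l; exact: cu.
  exists C => p x; rewrite mulr_sumr (le_trans (ler_norm_sum _ _ _))//.
  by apply: ler_sum => l _; exact: hC.
elim: N f => [|N IH] f [hf df]; split=> //; try exact: base.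
move=> i; have [f1 f2] := df i; split=> [p a|].
  by apply: derivable_sumseq => l; exact: f1.
have -> : (fun p a => derive (fun x => \sum_(l <- A p) f (p, l) x) a (dir i)) =
          (fun p a => \sum_(l <- A p) derive (f (p, l)) a (dir i)).
  by apply/funext => p; apply/funext => a; rewrite derive_sumseq.
exact: (IH _ f2).
Qed.

Lemma wf_derive N P (f B : P -> W -> R) i : wf N.+1 f B ->
  wf N (fun p a => derive (f p) a (dir i)) B.
Proof. by move=> [_ /(_ i) []]. Qed.

Lemma wf_derivable N P (f B : P -> W -> R) i : wf N.+1 f B ->
  forall p a, derivable (f p) a (dir i).
Proof. by move=> [_ /(_ i) []]. Qed.

Lemma iterD_rcons s i (f : W -> R) :
  iterD dir (rcons s i) f = iterD dir s (fun a => derive f a (dir i)).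
Proof. by elim: s => [//|j s IH] /=; rewrite IH. Qed.

Lemma wf_iterD P (f B : P -> W -> R) s : wfam f B ->
  wfam (fun p => iterD dir s (f p)) B.
Proof.
move=> wff; elim: s => [//|i s IH] /= N; exact: (wf_derive i (IH N.+1)).
Qed.

Lemma wfam_smooth P (f B : P -> W -> R) : wfam f B -> forall p, smooth dir (f p).
Proof.
move=> wff p s; have h := wf_iterD s wff; split; first exact: wf_cont (h 0%N) p.
by move=> i a; have [_ /(_ i) [h1 _]] := h 1%N; exact: (h1 p a).
Qed.

Lemma wfam_intro P (f B : P -> W -> R) : (forall p, smooth dir (f p)) ->
  (forall s, exists C : R, forall p x, `|iterD dir s (f p) x| <= C * B p x) ->
  wfam f B.
Proof.
move=> sf bf N; elim: N f sf bf => [|N IH] f sf bf.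
  by split=> //; split=> [p|]; [exact: (sf p [::]).1|exact: (bf [::])].
split; first by split=> [p|]; [exact: (sf p [::]).1|exact: (bf [::])].
move=> i; split=> [p a|]; first exact: (sf p [::]).2.
apply: IH => [p s|s]; first by rewrite -iterD_rcons; exact: sf.
by have [C hC] := bf (rcons s i); exists C => p x; rewrite -iterD_rcons.
Qed.

End Families.

Section FamiliesRn.
Context {R : realType} {n : nat}.
Notation V := 'rV[R]_n.
Implicit Types (P : Type).

Lemma evecE (i j : 'I_n) : (evec i : V) ord0 j = (i == j)%:R.
Proof. by rewrite mxE. Qed.

Lemma dotRDr (u x y : V) : dotR u (x + y) = dotR u x + dotR u y.
Proof. by rewrite -big_split; apply: eq_bigr => i _; rewrite mxE mulrDr. Qed.

Lemma dotRZr (u x : V) a : dotR u (a *: x) = a * dotR u x.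
Proof. by rewrite mulr_sumr; apply: eq_bigr => i _; rewrite mxE mulrCA. Qed.

Lemma dotRC (u x : V) : dotR u x = dotR x u.
Proof. by apply: eq_bigr => i _; rewrite mulrC. Qed.

Lemma dotRNr (u x : V) : dotR u (- x) = - dotR u x.
Proof. by rewrite -scaleN1r dotRZr mulN1r. Qed.

Lemma dotRBr (u x y : V) : dotR u (x - y) = dotR u x - dotR u y.
Proof. by rewrite dotRDr dotRNr. Qed.

Lemma dotRDl (u x y : V) : dotR (x + y) u = dotR x u + dotR y u.
Proof. by rewrite !(dotRC _ u) dotRDr. Qed.

Lemma dotRZl (u x : V) a : dotR (a *: x) u = a * dotR x u.
Proof. by rewrite !(dotRC _ u) dotRZr. Qed.

Lemma dotRNl (u x : V) : dotR (- x) u = - dotR x u.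
Proof. by rewrite !(dotRC _ u) dotRNr. Qed.

Lemma dotRBl (u x y : V) : dotR (x - y) u = dotR x u - dotR y u.
Proof. by rewrite !(dotRC _ u) dotRBr. Qed.

Lemma dotR_evec (u : V) i : dotR u (evec i) = u ord0 i.
Proof.
rewrite /dotR (bigD1 i)//= evecE eqxx mulr1 big1 ?addr0// => j ji.
by rewrite evecE eq_sym (negbTE ji) mulr0.
Qed.

Lemma dotR_evecl (u : V) i : dotR (evec i) u = u ord0 i.
Proof. by rewrite dotRC dotR_evec. Qed.

Lemma continuous_dotR (u : V) : continuous (fun x : V => dotR u x).
Proof. by apply: cont_sum => i; apply: contM; [exact: contC|exact: continuous_coord]. Qed.

Lemma is_derive_linear (W : normedModType R) (f : W -> R) (a v : W) (d : R) :
  (forall h, f (h *: v + a) = h * d + f a) -> is_derive a v f d.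
Proof.
move=> hf.
have E : (fun h : R => h^-1 *: (f (h *: v + a) - f a)) @ 0^' --> d.
  apply: cvg_near_cst; near=> h.
  rewrite hf addrK /GRing.scale /= mulrA mulVf ?mul1r//.
  by near: h; exact: nbhs_dnbhs_neq.
split; first by apply/cvg_ex; exists d.
exact: (cvg_lim (@norm_hausdorff _ _) E).
Unshelve. all: by end_near. Qed.

Lemma is_derive_coord (a v : V) j : is_derive a v (fun x : V => x ord0 j) (v ord0 j).
Proof. by apply: is_derive_linear => h; rewrite !mxE. Qed.

Lemma is_derive_dotR (u a v : V) : is_derive a v (fun x : V => dotR u x) (dotR u v).
Proof. by apply: is_derive_linear => h; rewrite dotRDr dotRZr. Qed.

Lemma cosDpihalf' (t : R) : cos (t + pi / 2) = - sin t.
Proof. exact: cosDpihalf. Qed.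

(** Differentiation advances the phase by [pi / 2]: cosines with a free phase are closed under
    differentiation, and sines need no separate treatment. *)
Lemma is_derive_cos_phase (W : normedModType R) (f : W -> R) (a v : W) (d c : R) :
  is_derive a v f d -> is_derive a v (fun x => cos (f x + c)) (d * cos (f a + (c + pi / 2))).
Proof.
move=> df; rewrite addrA cosDpihalf mulrC.
apply: (is_derive_comp1 (h := fun t => cos (t + c)) (f := f)) => //.
have hs : is_derive (f a) (1 : R) (fun t : R => t + c) 1.
  by apply: is_derive_linear => h; rewrite /GRing.scale /= mulr1 addrA.
have := @is_derive1_comp _ cos (fun t => t + c) (f a) (- sin (f a + c)) 1.
by rewrite mulr1; apply => //; exact: is_derive_cos.
Qed.

Lemma is_derive_affine (f : V -> R) (al : R) (b a v : V) (d : R) :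
  is_derive (al *: a + b) v f d -> is_derive a v (fun x => f (al *: x + b)) (al * d).
Proof.
move=> df.
have dl : is_derive (0 : R) (1 : R) (fun t : R => f ((al *: a + b) + t *: v)) d.
  by apply: is_derive_line; rewrite scale0r addr0.
have dal : is_derive (0 : R) (1 : R) (fun t : R => al * t) al.
  by apply: is_derive_linear => h; rewrite /GRing.scale /= mulr1 !mulr0 !addr0 mulrC.
have := @is_derive1_comp _ (fun t : R => f ((al *: a + b) + t *: v)) (fun t => al * t) 0 d al.
rewrite mulr0 mulrC => /(_ dl dal) [dv <-].
have E : (fun t : R => t^-1 *: (((fun t : R => f ((al *: a + b) + t *: v)) \o (fun t => al * t)) (t *: (1 : R) + 0)
     - ((fun t : R => f ((al *: a + b) + t *: v)) \o (fun t => al * t)) 0)) =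
  (fun t : R => t^-1 *: (f (al *: (t *: v + a) + b) - f (al *: a + b))).
  apply/funext => t /=; rewrite mulr0 scale0r !addr0; congr (_ *: (f _ - _)).
  by rewrite [t *: 1]mulr1 scalerDr scalerA addrC addrA.
move: dv; rewrite /derivable E => dv; split; first by rewrite /derivable.
by rewrite /derive E.
Qed.

Lemma wf_affine N P (f B : P -> V -> R) (al : P -> R) (b : P -> V) :
  (exists C : R, forall p, `|al p| <= C) -> wf evec N f B ->
  wf evec N (fun p x => f p (al p *: x + b p)) (fun p x => B p (al p *: x + b p)).
Proof.
move=> hal.
have base (u : P -> V -> R) : ((forall p, continuous (u p)) /\ exists C : R, forall p x, `|u p x| <= C * B p x) ->
   ((forall p, continuous (fun x : V => u p (al p *: x + b p))) /\ exists C : R, forall p (x : V), `|u p (al p *: x + b p)| <= C * B p (al p *: x + b p)).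
  move=> [cu [C hC]]; split=> [p|]; first exact: cont_shift.
  by exists C => p x.
elim: N f => [|N IH] f [hf df]; split=> //; try exact: base.
move=> i; have [f1 f2] := df i.
have D p a : is_derive a (evec i) (fun x => f p (al p *: x + b p)) (al p * derive (f p) (al p *: a + b p) (evec i)).
  by apply: is_derive_affine; exact: derivableP.
split=> [p a|]; first exact: ex_derive.
have -> : (fun p a => derive (fun x => f p (al p *: x + b p)) a (evec i)) =
          (fun p a => al p * derive (f p) (al p *: a + b p) (evec i)).
  by apply/funext => p; apply/funext => a; rewrite derive_val.
by apply: wfZ => //; exact: (IH (fun p x => derive (f p) x (evec i))).
Qed.

Lemma wf_cos N P (v : P -> V) (c : P -> R) :
  (exists C : R, forall p i, `|v p ord0 i| <= C) ->
  wf evec N (fun p x => cos (dotR (v p) x + c p)) (fun _ _ => 1).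
Proof.
move=> hv.
have base (d : P -> R) : ((forall p, continuous (fun x => cos (dotR (v p) x + d p))) /\ exists C : R, forall p (x : V), `|cos (dotR (v p) x + d p)| <= C * 1).
  split=> [p|]; last by exists 1 => p x; rewrite mulr1 ler_norml cos_geN1 cos_le1.
  by apply: cont_comp; [exact: continuous_cos|apply: contD; [exact: continuous_dotR|exact: contC]].
elim: N c => [|N IH] c; split=> //; try exact: base.
move=> i.
have D p a := is_derive_cos_phase (c p) (is_derive_dotR (v p) a (evec i)).
split=> [p a|]; first exact: ex_derive.
have -> : (fun p a => derive (fun x => cos (dotR (v p) x + c p)) a (evec i)) =
          (fun p a => v p ord0 i * cos (dotR (v p) a + (c p + pi / 2))).
  by apply/funext => p; apply/funext => a; rewrite derive_val dotR_evec.
apply: wfZ => //; have [C hC] := hv; by exists C => p.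
Qed.

Lemma wf_coord N P j : wf evec N (fun (_ : P) (x : V) => x ord0 j) (fun _ x => 1 + `|x ord0 j|).
Proof.
have cc : (forall p : P, continuous (fun x : V => x ord0 j)) /\
    exists C : R, forall (p : P) (x : V), `|x ord0 j| <= C * (1 + `|x ord0 j|).
  by split=> [p|]; [exact: continuous_coord|exists 1 => p x; rewrite mul1r lerDr].
case: N => [|N]; split=> // i.
split=> [p a|]; first by have [] := is_derive_coord a (evec i) j.
have -> : (fun (p : P) a => derive (fun x : V => x ord0 j) a (evec i)) =
          (fun (p : P) (a : V) => (evec i : V) ord0 j).
  apply/funext => p; apply/funext => a.
  by have [] := is_derive_coord a (evec i) j.
apply: (@wf_le _ _ _ evec N P _ (fun _ _ => 1)).
  by exists 1 => p x; rewrite mul1r ler01 lerDl/=.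
by apply: wf_cst; exists `|(evec i : V) ord0 j|.
Qed.

Lemma w1_mul1 (t : R) : w1 t * (1 + t ^+ 2) = 1.
Proof. by rewrite /w1 mulVf// gt_eqF// ltr_pwDl// sqr_ge0. Qed.

Lemma w_coord (x : V) j : (1 + `|x ord0 j|) * w x <= 2.
Proof.
rewrite /w (bigD1 j)//= mulrA.
set q := \prod_(i < n | i != j) _.
have q0 : 0 <= q by apply: prodr_ge0 => i _; exact: w1_ge0.
have q1 : q <= 1 by apply: prodr_ile1 => i _; rewrite w1_ge0 w1_le1.
have h : (1 + `|x ord0 j|) * w1 (x ord0 j) <= 2.
  set t := x ord0 j; have := w1_mul1 t; have v0 := w1_ge0 t.
  rewrite -(real_normK (num_real t)); have := mulr_ge0 v0 (sqr_ge0 (1 - `|t|)).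
  have := mulr_ge0 v0 (sqr_ge0 `|t|); set u := `|t|; set v := w1 t; lra.
have h0 : 0 <= (1 + `|x ord0 j|) * w1 (x ord0 j) by rewrite mulr_ge0 ?w1_ge0// addr_ge0.
nra.
Qed.

(** Powers of [w] measure the same decay as monomials, but are positive, bounded by 1 and stable
    under products and affine maps. The factor [B p] records the size of the member [p]. *)
Definition rapid P (f : P -> V -> R) (B : P -> R) :=
  forall K : nat, wfam evec f (fun p x => B p * w x ^+ K).

Lemma wf_coord_mul N P (f : P -> V -> R) (B : P -> R) j : (forall p, 0 <= B p) ->
  (forall K, wf evec N f (fun p x => B p * w x ^+ K)) ->
  forall K, wf evec N (fun p x => x ord0 j * f p x) (fun p x => B p * w x ^+ K).
Proof.
move=> B0 rf K; have := wfM (wf_coord N P j) (rf K.+1).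
apply: wf_le; exists 2 => p x.
rewrite exprS mulrCA !mulr_ge0 ?exprn_ge0 ?w_ge0// ?addr_ge0//=.
rewrite [leLHS](_ : _ = (1 + `|x ord0 j|) * w x * (B p * w x ^+ K)); last by ring.
by rewrite ler_wpM2r ?w_coord// mulr_ge0 ?exprn_ge0 ?w_ge0.
Qed.

Lemma rapid_coord P (f : P -> V -> R) B j : (forall p, 0 <= B p) -> rapid f B ->
  rapid (fun p x => x ord0 j * f p x) B.
Proof. by move=> B0 rf K N; apply: wf_coord_mul => // K'; exact: rf. Qed.

Lemma rapidD P (f g : P -> V -> R) B : rapid f B -> rapid g B -> rapid (fun p x => f p x + g p x) B.
Proof. by move=> rf rg K N; exact: wfD (rf K N) (rg K N). Qed.

Lemma rapidM P (f g : P -> V -> R) B : rapid f B -> wfam evec g (fun _ _ => 1) ->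
  rapid (fun p x => f p x * g p x) B.
Proof.
move=> rf wg K N; have := wfM (rf K N) (wg N).
by congr wf; apply/funext => p; apply/funext => x; rewrite mulr1.
Qed.

Lemma monoE (s : seq 'I_n) (x : V) : `|mono s x| * w x ^+ size s <= 1.
Proof.
elim: s => [|i s IH]; first by rewrite /mono big_nil normr1 mul1r.
rewrite /mono big_cons normrM /= exprS mulrACA.
have h : `|x ord0 i| * w x <= 1.
  rewrite /w (bigD1 i)//= mulrA.
  set q := \prod_(j < n | j != i) _.
  have q0 : 0 <= q by apply: prodr_ge0 => j _; exact: w1_ge0.
  have q1 : q <= 1 by apply: prodr_ile1 => j _; rewrite w1_ge0 w1_le1.
  have h : `|x ord0 i| * w1 (x ord0 i) <= 1.
    set t := x ord0 i; have := w1_mul1 t; have := w1_ge0 t.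
    rewrite -(real_normK (num_real t)); have := normr_ge0 t; set u := `|t|; set v := w1 t; nra.
  have h0 : 0 <= `|x ord0 i| * w1 (x ord0 i) by rewrite mulr_ge0 ?w1_ge0.
  nra.
by rewrite mulr_ile1// mulr_ge0 ?w_ge0 ?exprn_ge0 ?w_ge0.
Qed.

Lemma rapid_schwartzR (f : V -> R) : rapid (fun _ : unit => f) (fun=> 1) -> schwartzR f.
Proof.
move=> rf; split; first exact: (wfam_smooth (rf 0%N) tt).
move=> s g; have [C hC] := wf_bound (wf_iterD s (rf (size g)) 0%N).
exists `|C| => x; rewrite normrM (le_trans (ler_wpM2l _ (hC tt x)))//.
rewrite mul1r mulrCA (le_trans (ler_norm _))// normrM normrM normr_id -[leRHS]mulr1 ler_wpM2l//.
by rewrite [X in _ * X]ger0_norm ?exprn_ge0 ?w_ge0// monoE.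
Qed.

(** The inverse of [w ^+ K] is the product of the factors 1 + x_i^2 with every coordinate listed [K]
    times; each factor splits a weighted bound into two, one of them with a longer monomial. *)
Lemma schwartzR_rapid (f : V -> R) : schwartzR f -> rapid (fun _ : unit => f) (fun=> 1).
Proof.
move=> [sf df] K; apply: wfam_intro => [_//|s].
have P1 (r : seq 'I_n) : forall g : seq 'I_n, exists C : R, forall x : V,
    `|mono g x * (\prod_(i <- r) (1 + x ord0 i ^+ 2) * iterD evec s f x)| <= C.
  elim: r => [|i r IH] g; first by have [C hC] := df s g; exists C => x; rewrite big_nil mul1r.
  have [C hC] := IH g; have [D hD] := IH (i :: i :: g); exists (C + D) => x.
  rewrite big_cons.
  have -> : mono g x * ((1 + x ord0 i ^+ 2) * \prod_(j <- r) (1 + x ord0 j ^+ 2) * iterD evec s f x)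
     = mono g x * (\prod_(j <- r) (1 + x ord0 j ^+ 2) * iterD evec s f x) +
       mono (i :: i :: g) x * (\prod_(j <- r) (1 + x ord0 j ^+ 2) * iterD evec s f x).
    by rewrite /mono !big_cons; ring.
  by rewrite (le_trans (ler_normD _ _))// lerD.
have [C hC] := P1 (flatten (nseq K (index_enum 'I_n))) [::].
exists C => _ x; rewrite mul1r -[leLHS]mulr1.
have E : w x ^+ K * \prod_(i <- flatten (nseq K (index_enum 'I_n))) (1 + x ord0 i ^+ 2) = 1.
  elim: K {hC} => [|K IH]; first by rewrite big_nil mulr1.
  rewrite /= big_cat /= exprS mulrACA IH mulr1 /w -big_split /=.
  by apply: big1 => i _; rewrite w1_mul1.
rewrite -E mulrA mulrC mulrA mulrAC mulrC.
rewrite mulrA ler_wpM2r ?exprn_ge0 ?w_ge0//; apply: le_trans (hC x).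
rewrite /mono big_nil mul1r normrM mulrC ler_wpM2r//.
exact: ler_norm.
Qed.

End FamiliesRn.

(** * Fourier transform *)

Section DiffIntegral.
Context {R : realType} {n : nat}.
Notation V := 'rV[R]_n.

Lemma domD C D (f g : V -> R) : dom C f -> dom D g -> dom (C + D) (fun x => f x + g x).
Proof. by move=> df dg x; rewrite mulrDl (le_trans (ler_normD _ _))// lerD. Qed.

Lemma domZ C r (f : V -> R) : dom C f -> dom (`|r| * C) (fun x => r * f x).
Proof. by move=> df x; rewrite normrM -mulrA ler_wpM2l. Qed.

Lemma domN C (f : V -> R) : dom C f -> dom C (fun x => - f x).
Proof. by move=> df x; rewrite normrN. Qed.

Lemma domB C D (f g : V -> R) : dom C f -> dom D g -> dom (C + D) (fun x => f x - g x).
Proof. by move=> df dg; apply: domD => //; exact: domN. Qed.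

(** The mean value theorem dominates the difference quotients by the majorant of the derivative.
    Majorants are asked for only on the segment [|t| <= 1] through [a], so they may depend on
    [a]. *)
Lemma is_derive_intRn C D (W : normedModType R) (f f' : W -> V -> R) (a v : W) :
  (forall b x, is_derive b v (f^~ x) (f' b x)) ->
  (forall b, continuous (f b)) -> (forall t, `|t| <= 1 -> dom C (f (a + t *: v))) ->
  (forall b, continuous (f' b)) -> (forall t, `|t| <= 1 -> dom D (f' (a + t *: v))) ->
  is_derive a v (fun b => intRn (f b)) (intRn (f' a)).
Proof.
move=> df cf bf cf' bf'.
have a0 : a + 0 *: v = a by rewrite scale0r addr0.
have n01 : `|0 : R| <= 1 by rewrite normr0.
have bf0 := bf 0 n01; have bf'0 := bf' 0 n01; rewrite a0 in bf0 bf'0.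
pose q (h : R) (x : V) := h^-1 * (f (h *: v + a) x - f a x).
have cq h : continuous (q h) by apply: contM; [exact: contC|apply: contB; exact: cf].
have dq (h : R) : `|h| <= 1 -> dom D (q h).
  move=> h1 x.
  have B : `|f (a + h *: v) x - f a x| <= D * w x * `|h|.
    apply: (@mvt_dir _ _ (f^~ x) a v (fun t => f' (a + t *: v) x)) => // t th.
    by apply: bf'; exact: le_trans h1.
  rewrite /q normrM normfV addrC.
  (* At [h = 0] the convention [0^-1 = 0] makes the quotient vanish. *)
  have [->|h0] := eqVneq h 0.
    by rewrite normr0 invr0 mul0r mulr_ge0 ?w_ge0// (dom_ge0 bf'0).
  rewrite addrC [h *: v + a]addrC.
  by rewrite mulrC ler_pdivrMr ?normr_gt0.
have H : intRn (q h) @[h --> 0^'] --> intRn (f' a).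
  apply/cvgr_dnbhsP => u [u0 ucv].
  have [N _ hN] : \forall m \near \oo, `|u m| <= 1.
    have /cvgrPdist_le /(_ _ ltr01) := ucv.
    by apply: filterS => m; rewrite sub0r normrN.
  rewrite -(cvg_shiftn N).
  apply: (intRn_dct (C := D)) => //.
  - by move=> m; apply: dq; apply: hN => /=; rewrite leq_addl.
  move=> x.
  have [dx <-] := df a x.
  have : (fun h : R => h^-1 *: (f (h *: v + a) x - f a x)) @ 0^' --> derive (f^~ x) a v by exact: dx.
  move=> /cvgr_dnbhsP /(_ (fun m => u (m + N)%N)); apply => //.
  by rewrite (cvg_shiftn N).
have H' : (fun h : R => h^-1 *: (intRn (f (h *: v + a)) - intRn (f a))) @ 0^' --> intRn (f' a).
  apply: cvg_trans H; apply: near_eq_cvg; near=> h.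
  have h1 : `|h| <= 1 by near: h; exact: dnbhs0_le.
  have bfh := bf h h1; rewrite addrC in bfh.
  rewrite -(intRnB (cf _) bfh (cf a) bf0) /GRing.scale /=.
  rewrite -(intRnZ (C := C + C))//; first by apply: contB; exact: cf.
  by move=> x; rewrite mulrDl (le_trans (ler_normB _ _))// lerD.
split; first by apply/cvg_ex; exists (intRn (f' a)).
exact: (cvg_lim (@norm_hausdorff _ _) H').
Unshelve. all: by end_near. Qed.

Lemma w1_shift (s b t : R) : `|t| <= 1 -> w1 (s + t * b) <= 2 * (1 + b ^+ 2) * w1 s.
Proof.
move=> t1; rewrite /w1.
have h1 : 0 < 1 + s ^+ 2 by rewrite ltr_pwDl// sqr_ge0.
have h2 : 0 < 1 + (s + t * b) ^+ 2 by rewrite ltr_pwDl// sqr_ge0.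
rewrite -div1r ler_pdivrMr// mulrAC ler_pdivlMr// mul1r.
have t2 : t ^+ 2 <= 1 by rewrite -(real_normK (num_real t)) expr_le1.
have b2 := sqr_ge0 b.
have tb : t ^+ 2 * b ^+ 2 <= b ^+ 2 by nra.
set v := s + t * b; have -> : s = v - t * b by rewrite /v addrK.
have : (v - t * b) ^+ 2 <= 2 * v ^+ 2 + 2 * b ^+ 2.
  have := sqr_ge0 (v + t * b); have := sqr_ge0 v; nra.
by have := sqr_ge0 v; nra.
Qed.

Lemma w_shift (v : V) : exists2 D : R, 0 <= D &
  forall t x, `|t| <= 1 -> w (x + t *: v) <= D * w x.
Proof.
exists (\prod_i (2 * (1 + v ord0 i ^+ 2))).
  by apply: prodr_ge0 => i _; rewrite mulr_ge0// addr_ge0// sqr_ge0.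
move=> t x t1; rewrite /w -big_split /=; apply: ler_prod => i _.
by rewrite w1_ge0 !mxE w1_shift.
Qed.

(** By translation invariance the integral of f(x + t v) does not depend on t; differentiation under
    the integral sign at t = 0 gives the claim. This is integration by parts without boundary
    terms. *)
Lemma intRn_derive0 C D (f f' : V -> R) (v : V) :
  (forall x, is_derive x v f (f' x)) -> continuous f -> dom C f ->
  continuous f' -> dom D f' -> intRn f' = 0.
Proof.
move=> df cf bf cf' bf'.
have [E E0 hE] := w_shift v.
have sh (g : V -> R) : continuous g -> forall t : R, continuous (fun x : V => g (x + t *: v)).
  move=> cg t; have := cont_shift (al := 1) (b := t *: v) cg.
  by under eq_fun do rewrite scale1r.
have shd (g : V -> R) B : dom B g -> forall t : R, `|t| <= 1 ->
    dom (B * E) (fun x : V => g (x + (0 + t *: (1 : R)) *: v)).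
  move=> dg t t1 x; rewrite add0r [t *: 1]mulr1 (le_trans (dg _))//.
  by rewrite -mulrA ler_wpM2l ?(dom_ge0 dg)// hE.
have := @is_derive_intRn (C * E) (D * E) R (fun t x => f (x + t *: v))
  (fun t x => f' (x + t *: v)) 0 (1 : R) _ (sh _ cf) (shd _ _ bf) (sh _ cf') (shd _ _ bf').
have -> : (fun t : R => intRn (fun x : V => f (x + t *: v))) = cst (intRn f).
  by apply/funext => t; rewrite (intRn_shift _ cf bf).
case=> [t x|_]; first exact: is_derive_line.
rewrite derive_cst => ->.
by apply: eq_intRn => x; rewrite scale0r addr0.
Qed.

End DiffIntegral.

Section Phase.
Context {R : realType} {n : nat}.
Notation V := 'rV[R]_n.
Implicit Types (u x : V) (c : R).

(* The phase [c] encodes real and imaginary parts at once: [c = 0] gives the real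
   and [c = - pi / 2] the imaginary part of the Fourier integral. *)
Definition FT (f : V -> R) (u : V) (c : R) : R :=
  intRn (fun x => cos (dotR u x + c) * f x).

Lemma continuous_phase u c : continuous (fun x : V => cos (dotR u x + c)).
Proof.
by apply: cont_comp; [exact: continuous_cos|apply: contD; [exact: continuous_dotR|exact: contC]].
Qed.

Lemma cos_abs_le1 (t : R) : `|cos t| <= 1.
Proof. by rewrite ler_norml cos_geN1 cos_le1. Qed.

Lemma dom_phase C (f : V -> R) u c : dom C f -> dom C (fun x => cos (dotR u x + c) * f x).
Proof.
by move=> df x; rewrite normrM (le_trans (ler_wpM2r _ (cos_abs_le1 _)))// mul1r.
Qed.

Lemma FT_bound C f u c : continuous f -> dom C f -> `|FT f u c| <= C * pi ^+ n.
Proof.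
move=> cf df; apply: intRn_bound; last exact: dom_phase.
by apply: contM => //; exact: continuous_phase.
Qed.

Lemma FT_ibp2 C D E f f' f'' u c i :
  (forall x, is_derive x (evec i) f (f' x)) -> (forall x, is_derive x (evec i) f' (f'' x)) ->
  continuous f -> dom C f -> continuous f' -> dom D f' -> continuous f'' -> dom E f'' ->
  (1 + u ord0 i ^+ 2) * FT f u c = FT (fun x => f x - f'' x) u c.
Proof.
move=> df df' cf bf cf' bf' cf'' bf''.
(* Primitive for both integrations by parts at once: the two terms containing [f'] and the phase
   [c + pi / 2] cancel in [h']. *)
pose h x := - u ord0 i * (cos (dotR u x + (c + pi / 2)) * f x) + cos (dotR u x + c) * f' x.
pose h' x := u ord0 i ^+ 2 * (cos (dotR u x + c) * f x) + cos (dotR u x + c) * f'' x.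
have cp d := @continuous_phase u d.
have cpf d g : continuous g -> continuous (fun x => cos (dotR u x + d) * g x) by apply: contM.
have dh x : is_derive x (evec i) h (h' x).
  have D1 d := is_derive_cos_phase d (is_derive_dotR u x (evec i)).
  apply: is_derive_eq.
  have e2 : cos (dotR u x + (c + pi / 2 + pi / 2)) = - cos (dotR u x + c).
    by rewrite !addrA cosDpihalf sinDpihalf.
  rewrite e2 dotR_evec /GRing.scale /= /h'; ring.
have h0 : intRn h' = 0.
  apply: (intRn_derive0 (C := `|u ord0 i| * C + D) (D := u ord0 i ^+ 2 * C + E) dh).
  - by apply: contD; [apply: contM; [exact: contC|exact: cpf]|exact: cpf].
  - move=> x; rewrite mulrDl (le_trans (ler_normD _ _))// lerD//; last exact: dom_phase.
    by rewrite normrM normrN -mulrA ler_wpM2l//; exact: dom_phase.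
  - by apply: contD; [apply: contM; [exact: contC|exact: cpf]|exact: cpf].
  - move=> x; rewrite mulrDl (le_trans (ler_normD _ _))// lerD//; last exact: dom_phase.
    by rewrite normrM ger0_norm ?sqr_ge0// -mulrA ler_wpM2l ?sqr_ge0//; exact: dom_phase.
move: h0; rewrite /h' (intRnD (C := u ord0 i ^+ 2 * C) (D := E)); last 4 first.
- by apply: contM; [exact: contC|exact: cpf].
- move=> x; rewrite normrM ger0_norm ?sqr_ge0// -mulrA ler_wpM2l ?sqr_ge0//; exact: dom_phase.
- exact: cpf.
- exact: dom_phase.
rewrite (intRnZ _ (cpf _ _ cf) (dom_phase _ _ bf)) -!/(FT _ _ _).
have -> : FT (fun x => f x - f'' x) u c = FT f u c - FT f'' u c.
  rewrite /FT -(intRnB (cpf _ _ cf) (dom_phase _ _ bf) (cpf _ _ cf'') (dom_phase _ _ bf'')).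
  by apply: eq_intRn => x; rewrite mulrBr.
lra.
Qed.

(** On the Fourier side 1 - d_i^2 becomes 1 + u_i^2. Applying it [K] times in each coordinate
    produces the inverse of [w u ^+ K], with constants that remain uniform over the family. *)
Lemma FT_decay P (f : P -> V -> R) (B : P -> R) (K : nat) :
  wfam evec f (fun p x => B p * w x) ->
  exists C : R, forall p u c, `|FT (f p) u c| <= C * B p * w u ^+ K.
Proof.
move=> wff.
have P1 (r : seq 'I_n) : forall f : P -> V -> R, wfam evec f (fun p x => B p * w x) ->
   exists C : R, forall p u c, \prod_(i <- r) (1 + u ord0 i ^+ 2) * `|FT (f p) u c| <= C * B p.
  elim: r => [|i r IH] {wff}f wff.
    have [C hC] := wf_bound (wff 0%N).
    exists (C * pi ^+ n) => p u c; rewrite big_nil mul1r mulrAC; apply: FT_bound.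
      exact: (wf_cont (wff 0%N)).
    by move=> x; rewrite -mulrA.
  pose f1 p x := derive (f p) x (evec i); pose f2 p x := derive (f1 p) x (evec i).
  have w1f : wfam evec f1 (fun p x => B p * w x) by move=> N; exact: wf_derive (wff N.+1).
  have w2f : wfam evec f2 (fun p x => B p * w x) by move=> N; exact: wf_derive (w1f N.+1).
  have [C hC] := IH (fun p x => f p x - f2 p x) (fun N => wfD (wff N) (wfN (w2f N))).
  exists C => p u c; apply: le_trans (hC p u c).
  have [C0 h0] := wf_bound (wff 0%N); have [C1 h1] := wf_bound (w1f 0%N).
  have [C2 h2] := wf_bound (w2f 0%N).
  have -> : FT (fun x => f p x - f2 p x) u c = (1 + u ord0 i ^+ 2) * FT (f p) u c.
    apply/esym; apply: (@FT_ibp2 (C0 * B p) (C1 * B p) (C2 * B p) _ (f1 p)).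
    - by move=> x; apply: derivableP; exact: wf_derivable (wff 1%N) p x.
    - by move=> x; apply: derivableP; exact: wf_derivable (w1f 1%N) p x.
    - exact: wf_cont (wff 0%N) p.
    - by move=> x; rewrite -mulrA.
    - exact: wf_cont (w1f 0%N) p.
    - by move=> x; rewrite -mulrA.
    - exact: wf_cont (w2f 0%N) p.
    - by move=> x; rewrite -mulrA.
  rewrite big_cons normrM [`|1 + _|]ger0_norm ?addr_ge0 ?sqr_ge0//.
  by rewrite mulrA [X in X * _]mulrC.
have [C hC] := P1 (flatten (nseq K (index_enum 'I_n))) f wff.
exists C => p u c.
have E : w u ^+ K * \prod_(i <- flatten (nseq K (index_enum 'I_n))) (1 + u ord0 i ^+ 2) = 1.
  elim: K {hC} => [|K IH]; first by rewrite big_nil mulr1.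
  rewrite /= big_cat /= exprS mulrACA IH mulr1 /w -big_split /=.
  by apply: big1 => i _; rewrite w1_mul1.
have := ler_wpM2l (exprn_ge0 K (w_ge0 u)) (hC p u c).
by rewrite mulrA E mul1r [X in _ <= X -> _]mulrC.
Qed.

Lemma cont_FT C (W : normedModType R) (f : V -> R) (h : W -> V) (k : W -> R) :
  continuous f -> dom C f -> (forall x, continuous (fun a => dotR (h a) x)) -> continuous k ->
  continuous (fun a => FT f (h a) (k a)).
Proof.
move=> cf df ch ck a; apply: (@continuous_intRn _ _ C).
- by move=> b; apply: contM => //; exact: continuous_phase.
- move=> x; apply: contM; last exact: contC.
  by apply: cont_comp; [exact: continuous_cos|apply: contD].
- by move=> b; exact: dom_phase.
Qed.

Lemma is_derive_FT C D (W : normedModType R) (f : V -> R) (h : W -> V) (c : R) (a v : W) (e : V) :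
  (forall b x, is_derive b v (fun b => dotR (h b) x) (dotR e x)) ->
  continuous f -> dom C f -> dom D (fun x => dotR e x * f x) ->
  is_derive a v (fun b => FT f (h b) c) (FT (fun x => dotR e x * f x) (h a) (c + pi / 2)).
Proof.
move=> dh cf df def.
apply: (@is_derive_intRn _ _ C D _ (fun b x => cos (dotR (h b) x + c) * f x)
   (fun b x => cos (dotR (h b) x + (c + pi / 2)) * (dotR e x * f x))).
- move=> b x; have dc := is_derive_cos_phase c (dh b x).
  apply: is_derive_eq.
  by rewrite scaler0 add0r /GRing.scale /=; ring.
- by move=> b; apply: contM => //; exact: continuous_phase.
- by move=> t _; exact: dom_phase.
- move=> b; apply: contM; first exact: continuous_phase.
  by apply: contM => //; exact: continuous_dotR.
- by move=> t _; exact: dom_phase.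
Qed.

Lemma rapid_dom P (f : P -> V -> R) B : rapid f B ->
  exists C : R, forall p, dom (C * B p) (f p).
Proof.
move=> /(_ 1%N 0%N) /wf_bound [C hC]; exists C => p x; rewrite -mulrA.
exact: hC.
Qed.

Lemma rapid_cont P (f : P -> V -> R) B : rapid f B -> forall p, continuous (f p).
Proof. by move=> /(_ 0%N 0%N); exact: wf_cont. Qed.

Arguments rapid_cont {P f B} _ p.

Lemma rapid1 P (f : P -> V -> R) B : rapid f B -> wfam evec f (fun p x => B p * w x).
Proof. by move=> rf N; exact: (rf 1%N N). Qed.

(** A derivative in u_i multiplies the function by x_i and advances the phase, so the induction on
    the order has to let both the family and its phases vary. *)
Lemma rapid_FT P (f : P -> V -> R) (B : P -> R) (c : P -> R) : (forall p, 0 <= B p) ->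
  rapid f B -> rapid (fun p u => FT (f p) u (c p)) B.
Proof.
move=> B0 rf K N; elim: N f c rf => [|N IH] f c rf.
  split=> //; split=> [p|]; last first.
    have [C hC] := FT_decay K (rapid1 rf).
    by exists C => p x; rewrite mulrA.
  have [C hC] := rapid_dom rf.
  apply: (@cont_FT (C * B p) V (f p) id (fun=> c p) (rapid_cont rf p) (hC p)) => [x|]; last exact: contC.
  by under eq_fun do rewrite dotRC; exact: continuous_dotR.
split; first by split; [exact: (wf_cont (IH f c rf))|exact: (wf_bound (IH f c rf))].
move=> i.
have rg := rapid_coord i B0 rf.
have [C hC] := rapid_dom rf; have [D hD] := rapid_dom rg.
have D1 p a : is_derive a (evec i) (fun u => FT (f p) u (c p))
   (FT (fun x => x ord0 i * f p x) a (c p + pi / 2)).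
  have -> : (fun x => x ord0 i * f p x) = (fun x : V => dotR (evec i) x * f p x).
    by apply/funext => x; rewrite dotR_evecl.
  apply: (is_derive_FT (C := C * B p) (D := D * B p)) => //.
  - by move=> b x; under eq_fun do rewrite dotRC; rewrite dotRC; exact: is_derive_dotR.
  - exact: rapid_cont rf p.
  - by under eq_fun do rewrite dotR_evecl; exact: hD.
split=> [p a|]; first by have [] := D1 p a.
have -> : (fun p a => derive (fun u => FT (f p) u (c p)) a (evec i)) =
          (fun p a => FT (fun x => x ord0 i * f p x) a (c p + pi / 2)).
  by apply/funext => p; apply/funext => a; have [] := D1 p a.
exact: (IH (fun p x => x ord0 i * f p x) (fun p => c p + pi / 2)).
Qed.

End Phase.
Arguments rapid_cont {R n P f B} _ p.

(** * Gaussian integrals and Fourier inversion *)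

Section Gaussian.
Context {R : realType} {n : nat}.
Notation V := 'rV[R]_n.
Notation mu := (@lebesgue_measure R).

Definition gau (x : V) : R := expR (- dotR x x).

Lemma gauE x : gau x = \prod_i expR (- x ord0 i ^+ 2).
Proof. by rewrite /gau /dotR -sumrN expR_sum; apply: eq_bigr => i _; rewrite expr2. Qed.

Lemma continuous_dotRR : continuous (fun x : V => dotR x x).
Proof. by apply: cont_sum => i; apply: contM; exact: continuous_coord. Qed.

Lemma continuous_gau : continuous gau.
Proof. by apply: cont_comp; [exact: continuous_expR|apply: contN; exact: continuous_dotRR]. Qed.

(** In one variable exp(-t^2) is the power [K + 1] of exp(-t^2 / (K + 1)), and each factor is at
    most (K + 1) [w1 t] by exp(u) >= 1 + u. *)
Lemma gau_w (K : nat) (x : V) : gau x <= (K.+1%:R ^+ K.+1) ^+ n * w x ^+ K.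
Proof.
have h1 (t : R) : expR (- t ^+ 2) <= K.+1%:R ^+ K.+1 * w1 t ^+ K.
  have -> : expR (- t ^+ 2) = (expR (- t ^+ 2 / K.+1%:R)) ^+ K.+1.
    by rewrite -expRM_natl mulrCA divff ?mulr1.
  have h2 : expR (- t ^+ 2 / K.+1%:R) <= K.+1%:R * w1 t.
    rewrite mulNr expRN /w1.
    have q0 : 0 < 1 + t ^+ 2 by rewrite ltr_pwDl// sqr_ge0.
    have -> : K.+1%:R * (1 + t ^+ 2)^-1 = (K.+1%:R^-1 * (1 + t ^+ 2))^-1.
      by rewrite invfM invrK.
    rewrite lef_pV2 ?posrE ?expR_gt0 ?mulr_gt0 ?invr_gt0//.
    apply: le_trans (expR_ge1Dx _).
    rewrite mulrDr mulr1 [X in _ + X]mulrC lerD2r invf_le1//.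
    by rewrite ler1n.
  have e0 := expR_ge0 (- t ^+ 2 / K.+1%:R).
  apply: (@le_trans _ _ ((K.+1%:R * w1 t) ^+ K.+1)); first by rewrite lerXn2r ?nnegrE ?mulr_ge0 ?w1_ge0.
  rewrite exprMn ler_wpM2l ?exprn_ge0// exprS ler_piMl ?exprn_ge0 ?w1_ge0//; exact: w1_le1.
rewrite gauE /w -prodrXl -[X in _ ^+ X]card_ord -prodr_const -big_split /=.
by apply: ler_prod => i _; rewrite expR_ge0 h1.
Qed.

Lemma is_derive_gau (x v : V) : is_derive x v gau (- 2 * dotR v x * gau x).
Proof.
have D1 : is_derive x v (fun y : V => - dotR y y) (- 2 * dotR v x).
  have Di i : is_derive x v (fun y : V => y ord0 i) (v ord0 i) by exact: is_derive_coord.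
  have Dii i : derivable (fun y : V => y ord0 i * y ord0 i) x v /\
     derive (fun y : V => y ord0 i * y ord0 i) x v = 2 * (v ord0 i * x ord0 i).
    have D2 : is_derive x v (fun y : V => y ord0 i * y ord0 i) (2 * (v ord0 i * x ord0 i)).
      by apply: is_derive_eq; rewrite /GRing.scale /=; ring.
    by split; [exact: ex_derive|exact: derive_val].
  have D3 : is_derive x v (fun y : V => dotR y y) (2 * dotR v x).
    split; first by apply: derivable_sumseq => i; have [] := Dii i.
    rewrite derive_sumseq => [|i]; last by have [] := Dii i.
    by rewrite mulr_sumr; apply: eq_bigr => i _; have [] := Dii i.
  by apply: is_derive_eq; rewrite mulNr.
rewrite mulrC; apply: (is_derive_comp1 (h := expR) (f := fun y : V => - dotR y y)) => //.
Qed.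

Lemma rapid_gau : rapid (fun _ : unit => gau) (fun=> 1).
Proof.
suff H N : forall K, wf evec N (fun _ : unit => gau) (fun _ x => 1 * w x ^+ K).
  by move=> K N; exact: H.
elim: N => [|N IH] K.
  split=> //; split=> [_|]; first exact: continuous_gau.
  exists ((K.+1%:R ^+ K.+1) ^+ n) => _ x; rewrite mul1r ger0_norm ?expR_ge0//.
  exact: gau_w.
split; first by have := IH K; case: (N) => [|?] [].
move=> i; split=> [_ a|]; first exact: (@ex_derive _ _ _ _ _ _ _ (is_derive_gau a (evec i))).
have -> : (fun (_ : unit) a => derive gau a (evec i)) = (fun (_ : unit) (a : V) => - 2 * (a ord0 i * gau a)).
  apply/funext => _; apply/funext => a.
  by rewrite (@derive_val _ _ _ _ _ _ _ (is_derive_gau a (evec i))) dotR_evecl mulrA.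
apply: (@wfZ _ _ _ _ N _ (fun=> - 2)); first by exists `|-2|.
exact: (wf_coord_mul (B := fun=> 1)).
Qed.

Lemma gauss_le_w1 (t : R) : expR (- t ^+ 2) <= w1 t.
Proof.
by rewrite expRN /w1 lef_pV2 ?posrE ?expR_gt0 ?expR_ge1Dx// ltr_pwDl// sqr_ge0.
Qed.

Lemma intRn_gau : intRn gau = Num.sqrt pi ^+ n.
Proof.
pose G k (a : nat -> R) : R := \prod_(i < k) expR (- a i ^+ 2).
have sG k : sepc (G k).
  move=> i a; apply: cont_prod => j; apply: cont_comp; first exact: continuous_expR.
  apply: contN; rewrite /upd; case: eqP => _; last exact: contC.
  by move=> t; exact: exprn_continuous.
have dG k : domk k 1 (G k).
  move=> a; rewrite mul1r ger0_norm; last by apply: prodr_ge0 => i _; exact: expR_ge0.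
  by apply: ler_prod => i _; rewrite expR_ge0 gauss_le_w1.
have H k a : iint k (G k) a = Num.sqrt pi ^+ k.
  elim: k a => [|k IH] a; first by rewrite /= /G big_ord0 expr0.
  rewrite /=.
  have E t : iint k (G k.+1) (upd a k t) = Num.sqrt pi ^+ k * gauss_fun t.
    rewrite iint_upd// -(IH a) mulrC -(iintZ _ _ (sG k) (dG k)).
    apply: iint_eq => b; rewrite /G big_ord_recr /= updE eqxx mulrC; congr (_ * _).
    by apply: eq_bigr => i _; rewrite updE ltn_eqF.
  under eq_Rintegral do rewrite E.
  rewrite RintegralZl//; last exact: integrableT_gauss.
  by rewrite /Rintegral integralT_gauss exprSr.
rewrite /intRn -(H n (fun=> 0)); apply: iint_eq => a.
by rewrite gauE; apply: eq_bigr => i _; rewrite mxE.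
Qed.

(** Along the ray t u the transform h satisfies h' = - (t |u|^2 / 2) h, by integration by parts in
    the direction u; its value at t = 0 is a Gaussian integral. *)
Lemma FT_gau u c : FT gau u c = cos c * (Num.sqrt pi ^+ n * expR (- dotR u u / 4)).
Proof.
pose h (t : R) := FT gau (t *: u) c.
have [C hC] := rapid_dom rapid_gau; have {}hC := hC tt; rewrite mulr1 in hC.
pose gu x : R := dotR u x * gau x.
have rgu : rapid (fun _ : unit => gu) (fun=> 1).
  suff : rapid (fun _ : unit => fun x : V => \sum_(i <- index_enum 'I_n) u ord0 i * (x ord0 i * gau x)) (fun=> 1).
    congr rapid; apply/funext => _; apply/funext => x.
    by rewrite /gu /dotR mulr_suml; apply: eq_bigr => i _; rewrite mulrA.
  elim: (index_enum _) => [|i r IH].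
    move=> K N; under eq_fun do under eq_fun do rewrite big_nil.
    have -> : (fun _ : unit => fun x : V => 0 : R) = (fun _ => fun x => 0 * gau x).
      by apply/funext => _; apply/funext => x; rewrite mul0r.
    apply: (@wfZ _ _ _ _ N _ (fun=> 0)); last exact: rapid_gau.
    by exists 0 => p; rewrite normr0.
  under eq_fun do under eq_fun do rewrite big_cons.
  apply: rapidD => //; move=> K N.
  apply: (@wfZ _ _ _ _ N _ (fun=> u ord0 i)); first by exists `|u ord0 i|.
  exact: (rapid_coord i _ rapid_gau).
have [D hD] := rapid_dom rgu; have {}hD := hD tt; rewrite mulr1 in hD.
have cgu := rapid_cont rgu tt.
have dh (t : R) : is_derive t (1 : R) h (- (t * dotR u u / 2) * h t).
  have D1 : is_derive t (1 : R) h (FT gu (t *: u) (c + pi / 2)).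
    apply: (is_derive_FT (C := C) (D := D) (h := fun t : R => t *: u)) => //.
    - move=> b x; apply: is_derive_linear => k.
      by rewrite !dotRZl [k *: 1]mulr1 mulrDl.
    - exact: continuous_gau.
  (* The integral of the derivative along [u] of the Gaussian times the wave of phase [c + pi / 2];
     one more quarter turn of the phase gives [- h t]. *)
  have : intRn (fun x => (t * dotR u u) * (cos (dotR (t *: u) x + (c + pi / 2 + pi / 2)) * gau x)
     + (- 2) * (cos (dotR (t *: u) x + (c + pi / 2)) * gu x)) = 0.
    apply: (@intRn_derive0 _ _ C (`|t * dotR u u| * C + `|-2| * D) (fun x => cos (dotR (t *: u) x + (c + pi / 2)) * gau x) _ u).
    - move=> x; have e1 := is_derive_cos_phase (c + pi / 2) (is_derive_dotR (t *: u) x u).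
      have e2 := is_derive_gau x u.
      by apply: is_derive_eq; rewrite !dotRZl /GRing.scale /= /gu; ring.
    - by apply: contM; [exact: continuous_phase|exact: continuous_gau].
    - exact: dom_phase.
    - apply: contD; apply: contM; try exact: contC; apply: contM => //; try exact: continuous_phase.
      exact: continuous_gau.
    - by apply: domD; apply: domZ; exact: dom_phase.
  rewrite (intRnD (C := `|t * dotR u u| * C) (D := `|-2| * D)); last 4 first.
  - by apply: contM; [exact: contC|apply: contM; [exact: continuous_phase|exact: continuous_gau]].
  - by apply: domZ; exact: dom_phase.
  - by apply: contM; [exact: contC|apply: contM; [exact: continuous_phase|exact: cgu]].
  - by apply: domZ; exact: dom_phase.
  rewrite (intRnZ (C := C)); last 2 first.
  - by apply: contM; [exact: continuous_phase|exact: continuous_gau].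
  - exact: dom_phase.
  rewrite (intRnZ (C := D)); last 2 first.
  - by apply: contM; [exact: continuous_phase|exact: cgu].
  - exact: dom_phase.
  rewrite -!/(FT _ _ _).
  have -> : FT gau (t *: u) (c + pi / 2 + pi / 2) = - h t.
    rewrite /h /FT -(intRnN (C := C)); last 2 first.
    - by apply: contM; [exact: continuous_phase|exact: continuous_gau].
    - exact: dom_phase.
    by apply: eq_intRn => x; rewrite !addrA cosDpihalf sinDpihalf mulNr.
  move=> e; apply: is_derive_eq; lra.
(* Integrating factor: [k] is constant. *)
pose k (t : R) := h t * expR (dotR u u * t ^+ 2 / 4).
have dk (t : R) : is_derive t (1 : R) k 0.
  have d2 : is_derive t (1 : R) (fun t : R => dotR u u * t ^+ 2 / 4) (dotR u u * t / 2).
    apply: is_derive_eq; rewrite /GRing.scale /=; lra.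
  have d3 : is_derive t (1 : R) (fun t : R => expR (dotR u u * t ^+ 2 / 4)) (expR (dotR u u * t ^+ 2 / 4) * (dotR u u * t / 2)).
    by apply: (is_derive_comp1 (h := expR)); exact: is_derive_expR.
  apply: is_derive_eq; rewrite /GRing.scale /=; lra.
have k01 : k 1 = k 0.
  by apply: is_derive_0_is_cst; exact: dk.
move: k01; rewrite /k /h expr1n mulr1 expr0n /= mulr0 mul0r expR0 mulr1 scale1r scale0r => e.
have -> : FT gau u c = FT gau 0 c * expR (- dotR u u / 4).
  rewrite -e -mulrA -expRD mulNr addrN expR0 mulr1//.
have -> : FT gau 0 c = cos c * Num.sqrt pi ^+ n.
  rewrite -intRn_gau -(intRnZ _ continuous_gau hC); apply: eq_intRn => x.
  by rewrite -(scale0r x) dotRZl mul0r add0r.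
by rewrite mulrA.
Qed.

Definition n1 (x : V) : R := \sum_i `|x ord0 i|.

Lemma n1_ge0 x : 0 <= n1 x. Proof. by apply: sumr_ge0 => i _. Qed.

Lemma continuous_n1 : continuous n1.
Proof. by apply: cont_sum => i; apply: cont_norm; exact: continuous_coord. Qed.

Lemma n1Z a x : n1 (a *: x) = `|a| * n1 x.
Proof. by rewrite /n1 mulr_sumr; apply: eq_bigr => i _; rewrite mxE normrM. Qed.

Lemma n1_w (x : V) : n1 x * w x <= n%:R.
Proof.
rewrite /n1 mulr_suml -[X in _ <= X%:R]card_ord -sum1_card natr_sum.
by apply: ler_sum => i _; have := monoE [:: i] x; rewrite /mono big_seq1 expr1.
Qed.

Lemma dotRR_w (x : V) : dotR x x * w x ^+ 2 <= n%:R * w x.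
Proof.
rewrite /dotR mulr_suml -[X in _ <= X%:R * _]card_ord -sum1_card natr_sum mulr_suml.
apply: ler_sum => i _; rewrite mul1r -[leRHS]mul1r expr2 mulrA ler_wpM2r ?w_ge0//.
rewrite /w (bigD1 i)//= mulrA mulr_ile1//.
- by rewrite mulr_ge0 ?w1_ge0// -expr2 sqr_ge0.
- by apply: prodr_ge0 => j _; exact: w1_ge0.
- have := w1_mul1 (x ord0 i); have := w1_ge0 (x ord0 i); rewrite expr2; nra.
- by apply: prodr_ile1 => j _; rewrite w1_ge0 w1_le1.
Qed.

Lemma dotRR_ge0 (x : V) : 0 <= dotR x x.
Proof. by apply: sumr_ge0 => i _; rewrite -expr2 sqr_ge0. Qed.

Lemma lipschitz_n1 (f : V -> R) (L : R) :
  (forall x i, derivable f x (evec i) /\ `|derive f x (evec i)| <= L) ->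
  forall x y, `|f (x + y) - f x| <= L * n1 y.
Proof.
move=> df x y.
have ey : y = \sum_(i <- index_enum 'I_n) y ord0 i *: evec i.
  apply/rowP => j; rewrite summxE (bigD1 j)//= mxE evecE eqxx mulr1 big1 ?addr0// => i ij.
  by rewrite mxE evecE (negbTE ij) mulr0.
have H r : `|f (x + \sum_(i <- r) y ord0 i *: evec i) - f x| <= L * \sum_(i <- r) `|y ord0 i|.
  elim: r => [|i r IH]; first by rewrite !big_nil addr0 subrr normr0 mulr0.
  rewrite !big_cons addrCA addrC.
  set z := x + _.
  have -> : f (z + y ord0 i *: evec i) - f x = (f (z + y ord0 i *: evec i) - f z) + (f z - f x) by rewrite addrA subrK.
  rewrite (le_trans (ler_normD _ _))// mulrDr lerD//.
  apply: (@mvt_dir _ _ f z (evec i) (fun t => derive f (z + t *: evec i) (evec i))).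
    by move=> t; apply: derivableP; exact: (df _ i).1.
  by move=> t _; exact: (df _ i).2.
by rewrite {1}ey; exact: H.
Qed.

Lemma wfam_derivable P (f B : P -> V -> R) : wfam evec f B ->
  forall p a i, derivable (f p) a (evec i).
Proof. by move=> wff p a i; have [_ /(_ i) [h _]] := wff 1%N; exact: h. Qed.

Lemma wfam_lip P (f B : P -> V -> R) : wfam evec f B -> (forall p x, 0 <= B p x <= 1) ->
  exists L : R, forall p x y, `|f p (x + y) - f p x| <= L * n1 y.
Proof.
move=> wff B1.
have L1 i : exists L : R, forall p x, `|derive (f p) x (evec i)| <= L.
  have [L hL] := wf_bound (wf_derive i (wff 1%N)); exists `|L| => p x.
  have /andP[b0 b1] := B1 p x.
  rewrite (le_trans (hL p x))// (le_trans (ler_norm _))// normrM ler_piMr//.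
  by rewrite ger0_norm.
have [L hL] := choice L1; exists (\sum_i `|L i|) => p; apply: lipschitz_n1 => x i.
split; first exact: (wfam_derivable wff).
rewrite (le_trans (hL i p x))// (le_trans (ler_norm _))//.
by rewrite (bigD1 i)//= lerDl sumr_ge0.
Qed.

Lemma dom_gau (K : nat) : exists C : R, forall x : V, gau x <= C * w x ^+ K.
Proof. by exists ((K.+1%:R ^+ K.+1) ^+ n) => x; exact: gau_w. Qed.

Lemma gau_ge0 x : 0 <= gau x. Proof. exact: expR_ge0. Qed.

Lemma gau_le1 x : gau x <= 1.
Proof. by rewrite /gau -expR0 ler_expR oppr_le0 dotRR_ge0. Qed.

Lemma gauss_kernel (eps : R) v c : 0 < eps ->
  intRn (fun x => cos (dotR v x + c) * gau (eps *: x)) =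
  (Num.sqrt pi / eps) ^+ n * cos c * gau ((2 * eps)^-1 *: v).
Proof.
move=> e0.
have [C hC] := rapid_dom rapid_gau; have {}hC := hC tt; rewrite mulr1 in hC.
have cf : continuous (fun x => cos (dotR (eps^-1 *: v) x + c) * gau x).
  by apply: contM; [exact: continuous_phase|exact: continuous_gau].
have := intRn_affine 0 e0 cf (dom_phase _ _ hC).
rewrite -/(FT gau (eps^-1 *: v) c) FT_gau => h.
transitivity (intRn (fun x => cos (dotR (eps^-1 *: v) (eps *: x + 0) + c) * gau (eps *: x + 0))).
  by apply: eq_intRn => x; rewrite addr0 dotRZl dotRZr mulrA mulVf ?mul1r// gt_eqF.
rewrite h /gau !dotRZl !dotRZr expr_div_n.
rewrite [in RHS](_ : - ((2 * eps)^-1 * ((2 * eps)^-1 * dotR v v)) = - (eps^-1 * (eps^-1 * dotR v v)) / 4); last first.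
  by field; rewrite gt_eqF.
by ring.
Qed.

Lemma gauss_recenter C (H : V -> R) (eps : R) (z : V) : 0 < eps -> continuous H ->
  (forall x, `|H x| <= C) ->
  intRn (fun x => H x * gau ((2 * eps)^-1 *: (x - z))) =
  (2 * eps) ^+ n * intRn (fun y => H (2 * eps *: y + z) * gau y).
Proof.
move=> e0 cH bH.
have e2 : 0 < 2 * eps by rewrite mulr_gt0.
have [D hD] := rapid_dom rapid_gau; have {}hD := hD tt; rewrite mulr1 in hD.
have C0 : 0 <= C by apply: le_trans (bH 0).
have cf : continuous (fun y : V => H (2 * eps *: y + z) * gau y).
  by apply: contM; [exact: cont_shift|exact: continuous_gau].
have df : dom (C * D) (fun y => H (2 * eps *: y + z) * gau y).
  by move=> y; rewrite normrM -mulrA ler_pM.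
have e2' : 0 < (2 * eps)^-1 by rewrite invr_gt0.
have := intRn_affine (- ((2 * eps)^-1 *: z)) e2' cf df.
rewrite exprVn invrK => <-; apply: eq_intRn => x.
by rewrite -scalerBr scalerA divff ?gt_eqF// scale1r subrK.
Qed.

(** The Gaussian is an approximate identity of width [2 * eps], and a Lipschitz bound at the centre
    makes the error linear in [eps]. *)
Lemma gauss_approx C L (H : V -> R) (eps : R) (z : V) : 0 < eps -> continuous H ->
  (forall x, `|H x| <= C) -> (forall y, `|H (z + y) - H z| <= L * n1 y) ->
  `|intRn (fun y => H (2 * eps *: y + z) * gau y) - H z * Num.sqrt pi ^+ n| <=
  2 * eps * L * intRn (fun y => n1 y * gau y).
Proof.
move=> e0 cH bH lH.
have [D hD] := rapid_dom rapid_gau; have {}hD := hD tt; rewrite mulr1 in hD.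
have C0 : 0 <= C by apply: le_trans (bH 0).
have cf : continuous (fun y : V => H (2 * eps *: y + z) * gau y).
  by apply: contM; [exact: cont_shift|exact: continuous_gau].
have df : dom (C * D) (fun y => H (2 * eps *: y + z) * gau y).
  by move=> y; rewrite normrM -mulrA ler_pM.
have cz : continuous (fun y => H z * gau y) by apply: contM; [exact: contC|exact: continuous_gau].
rewrite -intRn_gau -(intRnZ _ continuous_gau hD) -(intRnB cf df cz (domZ _ hD)).
have [D2 hD2] := dom_gau 2.
have cn : continuous (fun y => n1 y * gau y) by apply: contM; [exact: continuous_n1|exact: continuous_gau].
have dn : dom (D2 * n%:R) (fun y => n1 y * gau y).
  have D20 : 0 <= D2.
    have := le_trans (gau_ge0 0) (hD2 0).
    by rewrite pmulr_lge0// exprn_gt0// w_gt0.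
  move=> y; rewrite ger0_norm ?mulr_ge0 ?n1_ge0 ?gau_ge0//.
  rewrite (le_trans (ler_wpM2l (n1_ge0 _) (hD2 y)))//.
  rewrite expr2 mulrCA -!mulrA ler_wpM2l// mulrA ler_wpM2r ?w_ge0//; exact: n1_w.
rewrite -(intRnZ _ cn dn).
apply: (le_norm_intRn_dom (C := C * D + `|H z| * D) (D := `|2 * eps * L| * (D2 * n%:R))).
- exact: contB.
- by apply: domB => //; exact: domZ.
- by apply: contM => //; exact: contC.
- exact: domZ.
move=> y; rewrite -mulrBl normrM (ger0_norm (gau_ge0 _)) mulrA ler_wpM2r ?gau_ge0//.
rewrite [X in H X - _]addrC (le_trans (lH _))// n1Z ger0_norm ?mulr_ge0 ?(ltW e0)//.
by rewrite mulrCA mulrA.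
Qed.

Lemma eq0_small (x A : R) : (forall eps, 0 < eps -> eps <= 1 -> `|x| <= eps * A) -> x = 0.
Proof.
move=> key; apply/eqP; rewrite -normr_le0.
apply/ler_addgt0Pl => e e0; rewrite addr0.
have [A0|A0] := leP A 0.
  by have := key 1 ltr01 (lexx _); rewrite mul1r; lra.
pose ep := Num.min 1 (e / A).
have ep0 : 0 < ep by rewrite lt_min ltr01 divr_gt0.
apply: (le_trans (key ep ep0 _)); first by rewrite ge_min lexx.
by rewrite -ler_pdivlMr// ge_min lexx orbT.
Qed.

(* The integrals over the two variables may only be exchanged after inserting a
   Gaussian factor. *)
Lemma FT_inversion (f : V -> R) (xi : V) (c : R) : rapid (fun _ : unit => f) (fun=> 1) ->
  intRn (fun x => FT f x (c - dotR x xi)) = (2 * pi) ^+ n * cos c * f xi.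
Proof.
move=> rf.
have [Cf hf] := rapid_dom rf; have {}hf := hf tt; rewrite mulr1 in hf.
have cf := rapid_cont rf tt.
have [K hK] := FT_decay 2 (rapid1 rf).
have {}hK u d : `|FT f u d| <= K * w u ^+ 2 by have := hK tt u d; rewrite mulr1.
have K0 : 0 <= K.
  by have := le_trans (normr_ge0 _) (hK 0 0); rewrite pmulr_lge0// exprn_gt0// w_gt0.
have cF : continuous (fun x => FT f x (c - dotR x xi)).
  apply: (@cont_FT _ _ Cf V f id (fun x => c - dotR x xi) cf hf) => [x|].
    by under eq_fun do rewrite dotRC; exact: continuous_dotR.
  apply: contB; first exact: contC.
  by under eq_fun do rewrite dotRC; exact: continuous_dotR.
have dF : dom K (fun x => FT f x (c - dotR x xi)).
  move=> x; rewrite (le_trans (hK _ _))// ler_wpM2l// expr2 ler_piMr ?w_ge0//; exact: w_le1.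
have [L lip] : exists L : R, forall x y, `|f (x + y) - f x| <= L * n1 y.
  have := @wfam_lip unit (fun=> f) (fun _ x => 1 * w x) (rapid1 rf).
  by case=> [_ x|L hL]; [rewrite mul1r w_ge0 w_le1|exists L => x y; exact: hL tt x y].
set J := intRn _; set M := intRn (fun y => n1 y * gau y).
have key (eps : R) : 0 < eps -> eps <= 1 ->
    `|J - (2 * pi) ^+ n * cos c * f xi| <=
    eps * (K * n%:R * pi ^+ n + (2 * Num.sqrt pi) ^+ n * (2 * L * M)).
  move=> e0 e1.
  have cg : continuous (fun x : V => gau (eps *: x)).
    have := cont_shift (al := eps) (b := 0) continuous_gau.
    by under eq_fun do rewrite addr0.
  have [Cg hg] : exists C : R, dom C (fun x : V => gau (eps *: x)).
    have [D hD] := rapid_dom rapid_gau; have {}hD := hD tt; rewrite mulr1 in hD.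
    have [D' hD'] := dom_affine 0 e0 hD; exists D' => x; have := hD' x; rewrite addr0//.
  have gle x : `|gau (eps *: x)| <= 1 by rewrite ger0_norm ?gau_ge0 ?gau_le1.
  pose Je := intRn (fun x => FT f x (c - dotR x xi) * gau (eps *: x)).
  have cJe : continuous (fun x => FT f x (c - dotR x xi) * gau (eps *: x)) by apply: contM.
  have dJe : dom K (fun x => FT f x (c - dotR x xi) * gau (eps *: x)).
    by move=> x; rewrite normrM (le_trans _ (dF x))// ler_piMr.
  (* For [eps <= 1] removing the Gaussian costs at most eps |x|^2, and one of the two powers of [w]
     in the decay of the transform pays for |x|^2. *)
  have h1 : `|J - Je| <= eps * (K * n%:R * pi ^+ n).
    rewrite -(intRnB cF dF cJe dJe) mulrA; apply: intRn_bound; first exact: contB.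
    move=> x; rewrite -[X in X - _]mulr1 -mulrBr normrM.
    have -> : `|1 - gau (eps *: x)| = 1 - gau (eps *: x) by rewrite ger0_norm ?subr_ge0 ?gau_le1.
    have hg1 : 1 - gau (eps *: x) <= eps * dotR x x.
      have := expR_ge1Dx (- dotR (eps *: x) (eps *: x)).
      rewrite -/(gau _) dotRZl dotRZr mulrA => h.
      have : eps * eps * dotR x x <= eps * dotR x x.
        by rewrite ler_wpM2r ?dotRR_ge0// ler_piMr// ltW.
      by move: h; lra.
    apply: (le_trans (ler_pM _ _ (hK _ _) hg1)) => //; first by rewrite subr_ge0 gau_le1.
    rewrite [leLHS](_ : _ = eps * K * (dotR x x * w x ^+ 2)); last by ring.
    rewrite [leRHS](_ : _ = eps * K * (n%:R * w x)); last by ring.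
    by rewrite ler_wpM2l ?dotRR_w// mulr_ge0// ltW.
  have h2 : Je = (2 * Num.sqrt pi) ^+ n * cos c * intRn (fun y => f (2 * eps *: y + xi) * gau y).
    have -> : Je = intRn (fun x => intRn (fun y => gau (eps *: x) * (cos (dotR x y + (c - dotR x xi)) * f y))).
      apply: eq_intRn => x; rewrite /FT mulrC -(intRnZ (C := Cf))//; last exact: dom_phase.
      by apply: contM => //; exact: continuous_phase.
    rewrite (@intRn_swap _ _ (Cg * Cf)); last 3 first.
    - move=> x; apply: contM; first exact: contC.
      by apply: contM => //; exact: continuous_phase.
    - move=> y; apply: contM => //; apply: contM; last exact: contC.
      apply: cont_comp; first exact: continuous_cos.
      apply: contD; last apply: contB; try exact: contC;
        by under eq_fun do rewrite dotRC; exact: continuous_dotR.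
    - move=> x y; rewrite normrM [leRHS](_ : _ = (Cg * w x) * (Cf * w y)); last by ring.
      by rewrite ler_pM//; exact: dom_phase.
    have E y : intRn (fun x => gau (eps *: x) * (cos (dotR x y + (c - dotR x xi)) * f y)) =
        (Num.sqrt pi / eps) ^+ n * cos c * (f y * gau ((2 * eps)^-1 *: (y - xi))).
      rewrite [RHS]mulrCA -gauss_kernel// -(intRnZ (C := Cg)); last 2 first.
      - by apply: contM => //; exact: continuous_phase.
      - exact: dom_phase.
      apply: eq_intRn => x; rewrite dotRBl [dotR x y]dotRC [dotR x xi]dotRC.
      by rewrite addrAC -addrA; ring.
    under eq_fun do rewrite E.
    have cfy : continuous (fun y => f y * gau ((2 * eps)^-1 *: (y - xi))).
      apply: contM => //; have := cont_shift (al := (2 * eps)^-1) (b := - ((2 * eps)^-1 *: xi)) continuous_gau.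
      by under eq_fun do rewrite -scalerBr.
    rewrite (intRnZ (C := Cf)) ; last 2 first.
    - exact: cfy.
    - by move=> y; rewrite normrM (le_trans _ (hf y))// ler_piMr// ger0_norm ?gau_ge0 ?gau_le1.
    rewrite (@gauss_recenter Cf)//; last first.
      by move=> x; rewrite (le_trans (hf x))// ler_piMr ?w_le1// (dom_ge0 hf).
    rewrite mulrA; congr (_ * _).
    rewrite mulrAC -exprMn; congr (_ ^+ n * _); field; by rewrite gt_eqF.
  have h3 := @gauss_approx Cf L f eps xi e0 cf _ (lip xi).
  have {}h3 : `|intRn (fun y => f (2 * eps *: y + xi) * gau y) - f xi * Num.sqrt pi ^+ n| <= 2 * eps * L * M.
    by apply: h3 => x; rewrite (le_trans (hf x))// ler_piMr ?w_le1// (dom_ge0 hf).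
  have e : (2 * pi) ^+ n * cos c * f xi = (2 * Num.sqrt pi) ^+ n * cos c * (f xi * Num.sqrt pi ^+ n).
    rewrite -[in LHS](sqr_sqrtr (pi_ge0 R)) [in LHS]expr2 mulrA exprMn; ring.
  have -> : J - (2 * pi) ^+ n * cos c * f xi = (J - Je) + (Je - (2 * pi) ^+ n * cos c * f xi).
    by rewrite addrA subrK.
  rewrite [leRHS]mulrDr (le_trans (ler_normD _ _))// lerD// h2 e -mulrBr normrM [`|_ * cos c|]normrM.
  apply: (@le_trans _ _ ((2 * Num.sqrt pi) ^+ n * (2 * eps * L * M))); last first.
    by rewrite le_eqVlt; apply/orP; left; apply/eqP; ring.
  rewrite ler_pM// ger0_norm ?exprn_ge0 ?mulr_ge0 ?sqrtr_ge0//.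
  by rewrite ler_piMr ?exprn_ge0 ?mulr_ge0 ?sqrtr_ge0// cos_abs_le1.
by apply/eqP; rewrite -subr_eq0; apply/eqP; exact: eq0_small key.
Qed.

End Gaussian.

(** * Atoms of the symbols *)

Section Locality.
Context {R : realType} {W : normedModType R} {I : Type} (dir : I -> W).

Lemma iterD_open (U : set W) (f g : W -> R) s : open U -> (forall a, U a -> f a = g a) ->
  forall a, U a -> iterD dir s f a = iterD dir s g a.
Proof.
move=> oU fg; elim: s => [|i s IH] a Ua /=; first exact: fg.
apply: near_eq_derive; near=> b; apply: IH.
by near: b; exact: open_nbhs_nbhs.
Unshelve. all: by end_near. Qed.

Lemma iterD0 s : iterD dir s (fun _ : W => 0 : R) = (fun=> 0).
Proof.
elim: s => [//|i s IH] /=; rewrite IH; apply/funext => a; exact: derive_cst.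
Qed.

Lemma iterD_sum (J : Type) (r : seq J) (f : J -> W -> R) s :
  (forall j, smooth dir (f j)) ->
  iterD dir s (fun a => \sum_(j <- r) f j a) = (fun a => \sum_(j <- r) iterD dir s (f j) a).
Proof.
move=> sf; elim: s => [//|i s IH] /=; rewrite IH; apply/funext => a.
by rewrite derive_sumseq// => j; exact: (sf j s).2.
Qed.

Lemma smooth_sum (J : Type) (r : seq J) (f : J -> W -> R) :
  (forall j, smooth dir (f j)) -> smooth dir (fun a => \sum_(j <- r) f j a).
Proof.
move=> sf s; rewrite iterD_sum//; split=> [|i a].
  by apply: cont_sum => j; exact: (sf j s).1.
by apply: derivable_sumseq => j; exact: (sf j s).2.
Qed.

Lemma iterD_scale (c : R) (f : W -> R) s : smooth dir f ->
  iterD dir s (fun a => c * f a) = (fun a => c * iterD dir s f a).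
Proof.
move=> sf; elim: s => [//|i s IH] /=; rewrite IH; apply/funext => a.
by have := @deriveZ _ _ _ (iterD dir s f) c a (dir i) ((sf s).2 i a).
Qed.

Lemma smooth_scale (c : R) (f : W -> R) : smooth dir f -> smooth dir (fun a => c * f a).
Proof.
move=> sf s; rewrite iterD_scale//; split=> [|i a].
  by apply: contM; [exact: contC|exact: (sf s).1].
by apply: (@derivableZ _ _ _ (iterD dir s f)); exact: (sf s).2.
Qed.

(** The symbols are finite sums of blocks only locally, so smoothness has to be checked on open
    sets. *)
Lemma smooth_open (f : W -> R) :
  (forall a, exists U g, [/\ open U, U a, smooth dir g & forall b, U b -> f b = g b]) ->
  smooth dir f.
Proof.
move=> H s.
have E (a : W) : exists g, smooth dir g /\ \forall b \near a, iterD dir s g b = iterD dir s f b.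
  have [U [g [oU Ua sg fg]]] := H a; exists g; split=> //.
  near=> b; apply: (iterD_open s oU) => [c Uc|]; first by rewrite fg.
  by near: b; exact: open_nbhs_nbhs.
split=> [a|i a]; have [g [sg hg]] := E a.
  rewrite /continuous_at -(nbhs_singleton hg).
  apply: cvg_trans ((sg s).1 a); exact: near_eq_cvg.
by apply: near_eq_derivable hg _; exact: (sg s).2.
Unshelve. all: by end_near. Qed.

End Locality.

(** * Sums over lattice points *)

Section LatticeSums.
Context {R : realType} {n : nat}.
Notation V := 'rV[R]_n.

Definition intV (k : 'rV[int]_n) : V := map_mx (fun z : int => z%:~R) k.

(** The increment of atan equals 1 / (1 + c^2) for some c in (v, v + 1), and 1 + c^2 <= 3 (1 + v^2).
    The right side telescopes, which bounds sums of [w1] over integer translates by [3 * pi],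
    whatever the offset and the number of terms. *)
Lemma w1_atan (v : R) : w1 v <= 3 * (atan (v + 1) - atan v).
Proof.
have v1 : v < v + 1 by rewrite ltrDl.
have [] := @MVT _ (@atan R) (fun x => (1 + x ^+ 2)^-1) v (v + 1) v1 (fun x _ => is_derive1_atan x).
  by apply: continuous_subspaceT => x; exact: continuous_atan.
move=> c /[!in_itv]/= /andP[vc cv] ->.
rewrite addrAC subrr add0r mulr1 /w1.
have h1 : 0 < 1 + c ^+ 2 by rewrite ltr_pwDl// sqr_ge0.
have h2 : 0 < 1 + v ^+ 2 by rewrite ltr_pwDl// sqr_ge0.
rewrite -div1r ler_pdivrMr// mulrAC ler_pdivlMr// mul1r.
have e : c = v + (c - v) by rewrite addrC subrK.
have d0 : 0 < c - v by rewrite subr_gt0.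
have d1 : c - v < 1 by rewrite ltrBlDr addrC.
rewrite e; set d := c - v in d0 d1 *.
have := sqr_ge0 (v - d); nra.
Qed.

Lemma sum_w1 (t : R) L : \sum_(m < L) w1 (t - m%:R) <= 3 * pi.
Proof.
apply: (@le_trans _ _ (3 * (atan (L%:R - t) - atan (- t)))); last first.
  rewrite ler_wpM2l//.
  have := atan_ltpi2 (L%:R - t); have := atan_gtNpi2 (- t); lra.
elim: L => [|L IH]; first by rewrite big_ord0 sub0r subrr mulr0.
rewrite big_ord_recr /= -[L.+1%:R]natr1.
have := w1_atan (L%:R - t); rewrite -w1N opprB addrAC => h.
by move: h IH; lra.
Qed.

Context (M : nat).
Let enc (k : 'rV[int]_n) : {ffun 'I_n -> 'I_M.*2.+1} := [ffun i => inord `|(k ord0 i + M%:Z)%R|%N].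

(** Adding [M] to each entry embeds the list into the functions from coordinates to {0, ..., 2 M};
    the sum over all of these factorises over coordinates by distributivity. *)
Lemma sum_box (r : seq 'rV[int]_n) (F : V -> R) : uniq r ->
  (forall k, k \in r -> forall i, (`|k ord0 i| <= M)%N) -> (forall x, 0 <= F x) ->
  \sum_(k <- r) F (intV k) <=
  \sum_(f : {ffun 'I_n -> 'I_M.*2.+1}) F (\row_i ((f i)%:R - M%:R)).
Proof.
move=> ur rM F0.
have encE k : k \in r -> intV k = \row_i ((enc k i)%:R - M%:R).
  move=> kr; apply/rowP => i; rewrite !mxE ffunE.
  have := rM k kr i => kM.
  have hk : (`|(k ord0 i + M%:Z)%R| < M.*2.+1)%N by lia.
  rewrite (inordK hk).
  have -> : (`|(k ord0 i + M%:Z)%R|%N)%:R = (k ord0 i + M%:Z)%:~R :> R.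
    by rewrite pmulrn; congr (_ *~ _); lia.
  by rewrite intrD addrK.
have enc_inj : {in r &, injective enc}.
  move=> k l kr lr kl; apply/rowP => i; apply/eqP; rewrite -(eqr_int R); apply/eqP.
  have := encE k kr; have := encE l lr; rewrite kl => <- /rowP /(_ i).
  by rewrite !mxE.
have -> : \sum_(k <- r) F (intV k) = \sum_(f <- [seq enc k | k <- r]) F (\row_i ((f i)%:R - M%:R)).
  by rewrite big_map; apply: eq_big_seq => k kr; rewrite encE.
rewrite big_uniq ?map_inj_in_uniq//=.
by rewrite big_mkcond; apply: ler_sum => f _; case: ifP.
Qed.

Lemma sum_w_lattice (r : seq 'rV[int]_n) (u : V) : uniq r ->
  (forall k, k \in r -> forall i, (`|k ord0 i| <= M)%N) ->
  \sum_(k <- r) w (u - intV k) <= (3 * pi) ^+ n.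
Proof.
move=> ur rM.
apply: (le_trans (@sum_box r (fun y => w (u - y)) ur rM (fun y => w_ge0 _))).
rewrite /w.
have -> : \sum_(f : {ffun 'I_n -> 'I_M.*2.+1}) \prod_i w1 ((u - \row_j ((f j)%:R - M%:R)) ord0 i)
   = \prod_(i < n) \sum_(m < M.*2.+1) w1 (u ord0 i + M%:R - m%:R).
  rewrite bigA_distr_bigA /=; apply: eq_bigr => f _; apply: eq_bigr => i _.
  by rewrite !mxE opprB addrA.
rewrite -[X in _ <= _ ^+ X]card_ord -prodr_const.
apply: ler_prod => i _; rewrite sumr_ge0 ?sum_w1// => m _; exact: w1_ge0.
Qed.

Lemma size_lattice (r : seq 'rV[int]_n) : uniq r ->
  (forall k, k \in r -> forall i, (`|k ord0 i| <= M)%N) ->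
  (size r <= M.*2.+1 ^ n)%N.
Proof.
move=> ur rM; rewrite -(ler_nat R).
have := @sum_box r (fun=> 1) ur rM (fun=> ler01).
by rewrite sumr_const card_ffun !card_ord big_const_seq count_predT iter_addr_0.
Qed.

End LatticeSums.

(** * Derivatives and supports of single atoms *)

Section Atoms.
Context {R : realType} {n : nat}.
Notation V := 'rV[R]_n.
Implicit Types (phi eta : V -> R) (z : V * V).

Definition rap (f : V -> R) := rapid (fun _ : unit => f) (fun=> 1).
Definition bdd (f : V -> R) := wfam evec (fun _ : unit => f) (fun _ _ => 1).

Lemma rap_dom f : rap f -> exists C : R, dom C f.
Proof. by move=> /rapid_dom [C /(_ tt)]; rewrite mulr1 => hC; exists C. Qed.

Lemma rap_cont f : rap f -> continuous f.
Proof. by move=> rf; exact: (rapid_cont rf tt). Qed.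

Lemma bdd_bound f : bdd f -> exists C : R, forall x, `|f x| <= C.
Proof. by move=> bf; have [C hC] := wf_bound (bf 0%N); exists C => x; have := hC tt x; rewrite mulr1. Qed.

Lemma bdd_cont f : bdd f -> continuous f.
Proof. by move=> bf; have [[h _] _] := bf 0%N; exact: (h tt). Qed.

Lemma bdd_derive f i : bdd f -> bdd (fun a => derive f a (evec i)).
Proof. by move=> bf N; exact: (wf_derive i (bf N.+1)). Qed.

Lemma bdd_derivable f a i : bdd f -> derivable f a (evec i).
Proof. by move=> bf; have [_ /(_ i) [h _]] := bf 1%N; exact: (h tt a). Qed.

Lemma rap_bdd f : rap f -> bdd f.
Proof.
move=> rf N; apply: wf_le (rf 0%N N); exists 1 => _ x.
by rewrite expr0 !mul1r ler01 lexx.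
Qed.

(* The terms of the symbol ([tau = 0]) and of its adjoint ([tau = 1]). *)
Definition atom (s r tau : R) (k : V) phi eta (c : R) (z : V * V) : R :=
  intRn (fun om => cos (dotR (s *: z.1 - k) (om - k) + c) *
                   (phi om * eta (r *: (z.2 - (tau * s) *: (om - k))))).

Context (s r tau : R) (k : V).

Let arg_affine eta z (om : V) : eta (r *: (z.2 - (tau * s) *: (om - k))) =
  eta ((- (r * (tau * s))) *: om + r *: (z.2 + (tau * s) *: k)).
Proof.
congr eta; apply/rowP => i; rewrite !mxE; ring.
Qed.

Lemma atom_cont_om phi eta c z : continuous phi -> continuous eta ->
  continuous (fun om : V => cos (dotR (s *: z.1 - k) (om - k) + c) *
                   (phi om * eta (r *: (z.2 - (tau * s) *: (om - k))))).
Proof.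
move=> cphi ceta; apply: contM.
  under eq_fun do rewrite dotRBr -addrA.
  by apply: cont_comp; [exact: continuous_cos|apply: contD; [exact: continuous_dotR|exact: contC]].
apply: contM => //; under eq_fun do rewrite arg_affine.
exact: cont_shift.
Qed.

Lemma atom_dom C D phi eta c z : dom C phi -> (forall x, `|eta x| <= D) ->
  dom (C * D) (fun om => cos (dotR (s *: z.1 - k) (om - k) + c) *
                   (phi om * eta (r *: (z.2 - (tau * s) *: (om - k))))).
Proof.
move=> dphi beta om; rewrite normrM (le_trans (ler_wpM2r _ (cos_abs_le1 _)))// mul1r.
by rewrite normrM mulrAC ler_pM.
Qed.

Lemma continuous_atom phi eta c : rap phi -> bdd eta -> continuous (atom s r tau k phi eta c).
Proof.
move=> rphi beta z; have [C hC] := rap_dom rphi; have [D hD] := bdd_bound beta.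
apply: (@continuous_intRn _ _ (C * D)).
- by move=> u; apply: atom_cont_om; [exact: rap_cont|exact: bdd_cont].
- move=> om; apply: contM.
    apply: cont_comp; first exact: continuous_cos.
    apply: contD; last exact: contC.
    apply: cont_sum => i; apply: contM; last exact: contC.
    under eq_fun do rewrite !mxE.
    apply: contB; last exact: contC.
    apply: contM; first exact: contC.
    by move=> y; apply: (@continuous_comp _ _ _ fst (fun x : V => x ord0 i)); [exact: cvg_fst|exact: continuous_coord].
  apply: contM; first exact: contC.
  move=> y; apply: (@continuous_comp _ _ _ snd (fun x : V => eta (r *: (x - (tau * s) *: (om - k))))).
    exact: cvg_snd.
  have ce : continuous (fun x : V => eta (r *: (x - (tau * s) *: (om - k)))).
    under eq_fun do rewrite scalerBr.
    by apply: cont_shift; exact: bdd_cont.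
  exact: ce.
- by move=> u; exact: atom_dom.
Qed.

Lemma is_derive_pair2 (f : V -> R) z (v : V) d : is_derive z.2 v f d ->
  is_derive z (0, v) (fun z => f z.2) d.
Proof.
move=> [df <-].
have E : (fun h : R => h^-1 *: ((fun z : V * V => f z.2) (h *: (0, v) + z) - f z.2)) =
         (fun h : R => h^-1 *: (f (h *: v + z.2) - f z.2)) by [].
by split; rewrite /derivable /derive E.
Qed.

Lemma atom_derive1 phi eta c z i : rap phi -> bdd eta ->
  is_derive z (dir2 (true, i)) (atom s r tau k phi eta c)
    (atom s r tau k (fun om => s * (om ord0 i - k ord0 i) * phi om) eta (c + pi / 2) z).
Proof.
move=> rphi beta; have [C hC] := rap_dom rphi; have [D hD] := bdd_bound beta.
have r1 : rap (fun om => s * (om ord0 i - k ord0 i) * phi om).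
  have -> : (fun om : V => s * (om ord0 i - k ord0 i) * phi om) =
      (fun om => s * (om ord0 i * phi om) + (- (s * k ord0 i)) * phi om).
    by apply/funext => om; ring.
  apply: rapidD => K N.
    apply: (@wfZ _ _ _ _ N _ (fun=> s)); first by exists `|s|.
    exact: (rapid_coord i _ rphi).
  by apply: (@wfZ _ _ _ _ N _ (fun=> - (s * k ord0 i))); [exists (`|- (s * k ord0 i)|)|exact: rphi].
have [C' hC'] := rap_dom r1.
apply: (@is_derive_intRn _ _ (C * D) (C' * D) _ (fun z om => _) (fun z om => _)).
- move=> y om.
  have dl : is_derive y (dir2 (true, i)) (fun y : V * V => dotR (s *: y.1 - k) (om - k)) (s * (om ord0 i - k ord0 i)).
    apply: is_derive_linear => h; rewrite /dir2 /= scalerDr -addrA dotRDl !dotRZl dotR_evecl !mxE.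
    by rewrite mulrCA.
  have dc := is_derive_cos_phase c dl.
  have de : is_derive y (dir2 (true, i)) (fun y : V * V => eta (r *: (y.2 - (tau * s) *: (om - k)))) 0.
    have E : (fun h : R => h^-1 *: ((fun y : V * V => eta (r *: (y.2 - (tau * s) *: (om - k)))) (h *: dir2 (true, i) + y) - eta (r *: (y.2 - (tau * s) *: (om - k))))) = cst 0.
      by apply/funext => h /=; rewrite scaler0 add0r subrr scaler0.
    split; rewrite /derivable /derive E; first exact: is_cvg_cst.
    exact: lim_cst.
  have -> : (fun x : V * V => cos (dotR (s *: x.1 - k) (om - k) + c) * (phi om * eta (r *: (x.2 - (tau * s) *: (om - k))))) =
            (fun x : V * V => phi om * (cos (dotR (s *: x.1 - k) (om - k) + c) * eta (r *: (x.2 - (tau * s) *: (om - k))))).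
    by apply/funext => x; rewrite mulrCA.
  by apply: is_derive_eq; rewrite /GRing.scale /= mulr0 add0r; ring.
- by move=> y; apply: atom_cont_om; [exact: rap_cont|exact: bdd_cont].
- by move=> t _; exact: atom_dom.
- by move=> y; apply: atom_cont_om; [exact: rap_cont|exact: bdd_cont].
- by move=> t _; exact: atom_dom.
Qed.

Lemma atom_derive2 phi eta c z i : rap phi -> bdd eta ->
  is_derive z (dir2 (false, i)) (atom s r tau k phi eta c)
    (r * atom s r tau k phi (fun a => derive eta a (evec i)) c z).
Proof.
move=> rphi beta; have [C hC] := rap_dom rphi; have [D hD] := bdd_bound beta.
have b1 := bdd_derive i beta; have [D' hD'] := bdd_bound b1.
have cb1 y : _ := @atom_cont_om phi (fun a => derive eta a (evec i)) c y (rap_cont rphi) (bdd_cont b1).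
have cd1 y : _ := @atom_dom C D' phi (fun a => derive eta a (evec i)) c y hC hD'.
rewrite /atom -(intRnZ (C := C * D')); last 2 first.
- exact: cb1.
- exact: cd1.
apply: (@is_derive_intRn _ _ (C * D) (`|r| * (C * D')) _ (fun z om => _) (fun z om => r * _)).
- move=> y om.
  have dc : is_derive y (dir2 (false, i)) (fun y : V * V => cos (dotR (s *: y.1 - k) (om - k) + c)) 0.
    have E : (fun h : R => h^-1 *: ((fun y : V * V => cos (dotR (s *: y.1 - k) (om - k) + c)) (h *: dir2 (false, i) + y) - cos (dotR (s *: y.1 - k) (om - k) + c))) = cst 0.
      by apply/funext => h /=; rewrite scaler0 add0r subrr scaler0.
    split; rewrite /derivable /derive E; first exact: is_cvg_cst.
    exact: lim_cst.
  have de : is_derive y (dir2 (false, i)) (fun y : V * V => eta (r *: (y.2 - (tau * s) *: (om - k))))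
      (r * derive eta (r *: (y.2 - (tau * s) *: (om - k))) (evec i)).
    apply: (is_derive_pair2 (f := fun x : V => eta (r *: (x - (tau * s) *: (om - k))))).
    have -> : (fun x : V => eta (r *: (x - (tau * s) *: (om - k)))) =
       (fun x : V => eta (r *: x + - (r *: ((tau * s) *: (om - k))))).
      by apply/funext => x; rewrite scalerBr.
    have -> : derive eta (r *: (y.2 - (tau * s) *: (om - k))) (evec i) =
      derive eta (r *: y.2 + - (r *: ((tau * s) *: (om - k)))) (evec i) by rewrite scalerBr.
    apply: (@is_derive_affine _ _ eta r (- (r *: ((tau * s) *: (om - k)))) y.2 (evec i)).
    by apply: derivableP; exact: bdd_derivable.
  have -> : (fun x : V * V => cos (dotR (s *: x.1 - k) (om - k) + c) * (phi om * eta (r *: (x.2 - (tau * s) *: (om - k))))) =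
            (fun x : V * V => phi om * (cos (dotR (s *: x.1 - k) (om - k) + c) * eta (r *: (x.2 - (tau * s) *: (om - k))))).
    by apply/funext => x; rewrite mulrCA.
  by apply: is_derive_eq; rewrite /GRing.scale /= mulr0 addr0; ring.
- by move=> y; apply: atom_cont_om; [exact: rap_cont|exact: bdd_cont].
- by move=> t _; exact: atom_dom.
- by move=> y; apply: contM; [exact: contC|exact: cb1].
- by move=> t _; apply: domZ; exact: cd1.
Qed.

Fixpoint aphi (l : seq (bool * 'I_n)) phi : V -> R :=
  match l with
  | [::] => phi
  | (b, i) :: l' => if b then fun om : V => s * (om ord0 i - k ord0 i) * aphi l' phi om
                    else aphi l' phi
  end.

Definition aeta (l : seq (bool * 'I_n)) eta : V -> R :=
  iterD evec [seq b.2 | b <- l & ~~ b.1] eta.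

Lemma bdd_aeta l eta : bdd eta -> bdd (aeta l eta).
Proof. by move=> be; exact: (wf_iterD [seq b.2 | b <- l & ~~ b.1] be). Qed.

Lemma rap_aphi l phi : rap phi -> rap (aphi l phi).
Proof.
move=> rphi; elim: l => [//|[[] i] l IH] //=.
have -> : (fun om : V => s * (om ord0 i - k ord0 i) * aphi l phi om) =
      (fun om => s * (om ord0 i * aphi l phi om) + (- (s * k ord0 i)) * aphi l phi om).
  by apply/funext => om; ring.
apply: rapidD => K N.
  apply: (@wfZ _ _ _ _ N _ (fun=> s)); first by exists `|s|.
  exact: (rapid_coord i _ IH).
by apply: (@wfZ _ _ _ _ N _ (fun=> - (s * k ord0 i))); [exists (`|- (s * k ord0 i)|)|exact: IH].
Qed.

(** Atoms are closed under differentiation: an x-derivative alters the amplitude and advances the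
    phase, a frequency derivative brings out [r] and differentiates [eta]. *)
Lemma atom_iterD l phi eta c : rap phi -> bdd eta ->
  iterD dir2 l (atom s r tau k phi eta c) =
  (fun z => r ^+ count (fun b => ~~ b.1) l *
     atom s r tau k (aphi l phi) (aeta l eta) (c + (count (fun b => b.1) l)%:R * (pi / 2)) z).
Proof.
move=> rphi beta; elim: l => [|[b i] l IH].
  by apply/funext => z /=; rewrite expr0 mul1r mul0r addr0.
rewrite /= IH; apply/funext => z.
have rl := rap_aphi l rphi; have bl := bdd_aeta l beta.
case: b => /=.
  rewrite add0n add1n.
  have D1 := @atom_derive1 (aphi l phi) (aeta l eta) (c + (count (fun b => b.1) l)%:R * (pi / 2)) z i rl bl.
  have -> : derive (fun z => r ^+ count (fun b => ~~ b.1) l * atom s r tau k (aphi l phi) (aeta l eta) (c + (count (fun b => b.1) l)%:R * (pi / 2)) z) z (dir2 (true, i)) =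
     r ^+ count (fun b => ~~ b.1) l * atom s r tau k (fun om => s * (om ord0 i - k ord0 i) * aphi l phi om) (aeta l eta) (c + (count (fun b => b.1) l)%:R * (pi / 2) + pi / 2) z.
    have [d1 d2] := D1; rewrite -d2.
    exact: (@deriveZ _ _ _ (atom s r tau k (aphi l phi) (aeta l eta) _) _ _ _ d1).
  congr (_ * atom _ _ _ _ _ _ _ _); rewrite -natr1; ring.
rewrite add1n add0n.
have D2 := @atom_derive2 (aphi l phi) (aeta l eta) (c + (count (fun b => b.1) l)%:R * (pi / 2)) z i rl bl.
have -> : derive (fun z => r ^+ count (fun b => ~~ b.1) l * atom s r tau k (aphi l phi) (aeta l eta) (c + (count (fun b => b.1) l)%:R * (pi / 2)) z) z (dir2 (false, i)) =
     r ^+ count (fun b => ~~ b.1) l * (r * atom s r tau k (aphi l phi) (fun a => derive (aeta l eta) a (evec i)) (c + (count (fun b => b.1) l)%:R * (pi / 2)) z).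
  have [d1 d2] := D2; rewrite -d2.
  exact: (@deriveZ _ _ _ (atom s r tau k (aphi l phi) (aeta l eta) _) _ _ _ d1).
by rewrite exprSr mulrA.
Qed.

Lemma smooth_atom phi eta c : rap phi -> bdd eta -> smooth dir2 (atom s r tau k phi eta c).
Proof.
move=> rphi beta l; rewrite atom_iterD//.
have rl := rap_aphi l rphi; have bl := bdd_aeta l beta.
split=> [|[b i] a]; first by apply: contM; [exact: contC|exact: continuous_atom].
apply: (@derivableZ _ _ _ (atom s r tau k (aphi l phi) (aeta l eta) _)).
case: b.
  by have [] := @atom_derive1 (aphi l phi) (aeta l eta) (c + (count (fun b => b.1) l)%:R * (pi / 2)) a i rl bl.
by have [] := @atom_derive2 (aphi l phi) (aeta l eta) (c + (count (fun b => b.1) l)%:R * (pi / 2)) a i rl bl.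
Qed.

Lemma enorm_ge0 (x : V) : 0 <= enorm x. Proof. exact: sqrtr_ge0. Qed.

Lemma continuous_enorm : continuous (@enorm R n).
Proof. by apply: cont_comp; [exact: sqrt_continuous|exact: continuous_dotRR]. Qed.

(** The complement of a closed annulus is open, so all derivatives vanish there with the
    function. *)
Lemma aeta_supp l eta (a b : R) : (forall y, ~~ (a <= enorm y <= b) -> eta y = 0) ->
  forall y, ~~ (a <= enorm y <= b) -> aeta l eta y = 0.
Proof.
move=> e0 y hy; pose U : set V := [set y | ~~ (a <= enorm y <= b)].
have oU : open U.
  have -> : U = (@enorm R n @^-1` [set t | t < a]) `|` (@enorm R n @^-1` [set t | b < t]).
    apply/seteqP; split=> [x|x] /=; first by rewrite /U /= negb_and -!ltNge => /orP.
    by move=> h; apply/negP => /andP[]; case: h; [rewrite ltNge => /negP|rewrite (ltNge b) => /negP].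
  by apply: openU; (apply: open_comp; [move=> ? _; exact: continuous_enorm|]);
    [exact: open_lt|exact: open_gt].
by rewrite /aeta (@iterD_open _ _ _ _ U eta (fun=> 0))// iterD0.
Qed.

Lemma aphi_supp l phi om : phi om = 0 -> aphi l phi om = 0.
Proof. by move=> p0; elim: l => [//|[[] i] l IH] //=; rewrite IH mulr0. Qed.

Lemma atom_iterD_eq0 l phi eta c (a b : R) z : rap phi -> bdd eta ->
  (forall y, ~~ (a <= enorm y <= b) -> eta y = 0) ->
  (forall om, phi om != 0 -> ~~ (a <= enorm (r *: (z.2 - (tau * s) *: (om - k))) <= b)) ->
  iterD dir2 l (atom s r tau k phi eta c) z = 0.
Proof.
move=> rphi beta e0 p0; rewrite atom_iterD// /atom.
rewrite -(intRn0 (R := R) (n := n)) (_ : intRn _ = 0) ?mulr0 ?intRn0//.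
rewrite -[RHS](intRn0 (R := R) (n := n)); apply: eq_intRn => om.
have [/aphi_supp ->|/p0 h] := eqVneq (phi om) 0; first by rewrite mul0r mulr0.
by rewrite (aeta_supp l e0 h) !mulr0.
Qed.

End Atoms.

Section AtomBounds.
Context {R : realType} {n : nat}.
Notation V := 'rV[R]_n.

(** Range of parameters over which atoms are estimated uniformly. Divided by s^2, the factor s (om_i
    - k_i) of an x-derivative is om_i / s - k_i / s, whose coefficients are bounded since s >= 1 and
    |k_i| <= s; [a_rt] keeps the affine map inside [eta] from expanding. *)
Record apar := APar { a_s : R; a_r : R; a_t : R; a_k : V;
  a_s1 : 1 <= a_s; a_rt : `|a_r * (a_t * a_s)| <= 1; a_kb : forall i, `|a_k ord0 i| <= a_s }.

Lemma a_s0 p : 0 < a_s p. Proof. exact: lt_le_trans (a_s1 p). Qed.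

Lemma aphi_rapid l (phi : V -> R) : rap phi ->
  rapid (fun (p : apar) om => a_s p ^- (2 * count (fun b => b.1) l) * aphi (a_s p) (a_k p) l phi om) (fun=> 1).
Proof.
move=> rphi; elim: l => [|[[] i] l IH].
- move=> K N; have := wf_reindex (fun _ : apar => tt) (rphi K N).
  by congr wf; apply/funext => p; apply/funext => om; rewrite muln0 expr0 invr1 mul1r.
- have -> : (fun (p : apar) om => a_s p ^- (2 * count (fun b => b.1) ((true, i) :: l)) * aphi (a_s p) (a_k p) ((true, i) :: l) phi om) =
     (fun (p : apar) om => (a_s p)^-1 * (om ord0 i * (a_s p ^- (2 * count (fun b => b.1) l) * aphi (a_s p) (a_k p) l phi om))
        + (- (a_k p ord0 i / a_s p)) * (a_s p ^- (2 * count (fun b => b.1) l) * aphi (a_s p) (a_k p) l phi om)).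
    apply/funext => p; apply/funext => om /=.
    have s0 : a_s p != 0 by rewrite gt_eqF// a_s0.
    rewrite add1n mulnS exprD; field.
    by rewrite s0 expf_neq0.
  apply: rapidD => K N; apply: wfZ.
  + exists 1 => p; rewrite ger0_norm ?invr_ge0 ?invf_le1 ?a_s0 ?a_s1//.
    exact: ltW (a_s0 p).
  + by apply: (rapid_coord i _ IH) => p.
  + exists 1 => p; rewrite normrN normrM normfV (gtr0_norm (a_s0 p)).
    by rewrite ler_pdivrMr ?a_s0// mul1r a_kb.
  + exact: IH.
- exact: IH.
Qed.

(** After division by its powers of s and r, the differentiated atom is the Fourier integral of a
    uniformly rapid family, taken at s x - k. Its decay there is the factor [w], which makes the sum
    over k bounded uniformly in x. *)
Lemma atom_bound l (phi eta : V -> R) : rap phi -> bdd eta ->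
  exists C : R, 0 <= C /\ forall p c z,
    `|iterD dir2 l (atom (a_s p) (a_r p) (a_t p) (a_k p) phi eta c) z| <=
    C * (a_s p ^+ (2 * count (fun b => b.1) l) * `|a_r p| ^+ count (fun b => ~~ b.1) l *
         w (a_s p *: z.1 - a_k p)).
Proof.
move=> rphi beta.
pose al (q : apar * V) := - (a_r q.1 * (a_t q.1 * a_s q.1)).
pose be (q : apar * V) := a_r q.1 *: (q.2 + (a_t q.1 * a_s q.1) *: a_k q.1).
pose psi (q : apar * V) om := (a_s q.1 ^- (2 * count (fun b => b.1) l) * aphi (a_s q.1) (a_k q.1) l phi om) *
    aeta l eta (al q *: om + be q).
have rpsi : rapid psi (fun=> 1).
  apply: rapidM => [K N|N]; first exact: (wf_reindex (fst : apar * V -> apar) (aphi_rapid l rphi K N)).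
  have h := @wf_affine _ _ N _ _ _ al be _ (wf_reindex (fun _ : apar * V => tt) (bdd_aeta l beta N)).
  by apply: h; exists 1 => q; rewrite normrN a_rt.
have [C hC] := FT_decay 1 (rapid1 rpsi).
exists `|C|; split=> // p c z.
rewrite atom_iterD//.
have E : atom (a_s p) (a_r p) (a_t p) (a_k p) (aphi (a_s p) (a_k p) l phi) (aeta l eta) (c + (count (fun b => b.1) l)%:R * (pi / 2)) z =
   a_s p ^+ (2 * count (fun b => b.1) l) * FT (psi (p, z.2)) (a_s p *: z.1 - a_k p)
     (c + (count (fun b => b.1) l)%:R * (pi / 2) - dotR (a_s p *: z.1 - a_k p) (a_k p)).
  have [D hD] := rapid_dom rpsi.
  rewrite /FT -(intRnZ (C := D * 1)); last 2 first.
  - by apply: contM; [exact: continuous_phase|exact: (rapid_cont rpsi (p, z.2))].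
  - exact: dom_phase (hD (p, z.2)).
  apply: eq_intRn => om; rewrite /psi /al /be /=.
  have s0 : a_s p ^+ (2 * count (fun b => b.1) l) != 0 by rewrite expf_neq0// gt_eqF// a_s0.
  rewrite dotRBr addrAC -!addrA.
  have -> : a_r p *: (z.2 - (a_t p * a_s p) *: (om - a_k p)) =
     - (a_r p * (a_t p * a_s p)) *: om + a_r p *: (z.2 + (a_t p * a_s p) *: a_k p).
    by apply/rowP => i; rewrite !mxE; ring.
  by field.
rewrite E normrM normrX normrM (ger0_norm (exprn_ge0 _ (ltW (a_s0 p)))).
rewrite [leRHS](_ : _ = `|a_r p| ^+ count (fun b => ~~ b.1) l * (a_s p ^+ (2 * count (fun b => b.1) l) * (`|C| * w (a_s p *: z.1 - a_k p)))); last by ring.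
rewrite ler_wpM2l ?exprn_ge0// ler_wpM2l ?exprn_ge0 ?(ltW (a_s0 p))//.
have := hC (p, z.2) (a_s p *: z.1 - a_k p) (c + (count (fun b => b.1) l)%:R * (pi / 2) - dotR (a_s p *: z.1 - a_k p) (a_k p)).
rewrite mulr1 expr1 => h; rewrite (le_trans h)// ler_wpM2r ?w_ge0// ler_norm//.
Qed.

End AtomBounds.

Section Euclid.
Context {R : realType} {n : nat}.
Notation V := 'rV[R]_n.
Implicit Types x y : V.

Lemma dotR_eq0 x : dotR x x = 0 -> x = 0.
Proof.
move=> h; apply/rowP => i; rewrite mxE; apply/eqP.
have : dotR x x == 0 by apply/eqP.
rewrite psumr_eq0 => [/allP /(_ i)|j _]; last by rewrite -expr2 sqr_ge0.
by rewrite mem_index_enum mulf_eq0 orbb; apply.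
Qed.

Lemma cauchy_schwarz x y : dotR x y <= enorm x * enorm y.
Proof.
have [y0|y0] := eqVneq (dotR y y) 0.
  rewrite (dotR_eq0 y0) -(scale0r (0 : V)) dotRZr mul0r mulr_ge0 ?sqrtr_ge0//.
have yp : 0 < dotR y y by rewrite lt_def y0 dotRR_ge0.
have := dotRR_ge0 (x - (dotR x y / dotR y y) *: y).
rewrite dotRBl !dotRBr !dotRZl !dotRZr (dotRC y x) => h.
have {}h : dotR x y ^+ 2 <= dotR x x * dotR y y.
  rewrite -ler_pdivrMr//; rewrite expr2.
  have e : dotR x y / dotR y y * (dotR x y / dotR y y * dotR y y) = dotR x y / dotR y y * dotR x y.
    by congr (_ * _); rewrite divfK.
  by move: h; rewrite e; lra.
rewrite -sqrtrM ?dotRR_ge0// (le_trans (ler_norm _))// -sqrtr_sqr ler_sqrt//.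
by rewrite mulr_ge0 ?dotRR_ge0.
Qed.

Lemma enorm_sqr x : enorm x ^+ 2 = dotR x x.
Proof. by rewrite sqr_sqrtr ?dotRR_ge0. Qed.

Lemma enormD x y : enorm (x + y) <= enorm x + enorm y.
Proof.
rewrite -(ler_pXn2r (n := 2)) ?nnegrE ?addr_ge0 ?enorm_ge0//.
rewrite enorm_sqr dotRDl !dotRDr (dotRC y x) sqrrD !enorm_sqr.
have := cauchy_schwarz x y; lra.
Qed.

Lemma enormZ a x : enorm (a *: x) = `|a| * enorm x.
Proof. by rewrite /enorm dotRZl dotRZr mulrA -expr2 sqrtrM ?sqr_ge0// sqrtr_sqr. Qed.

Lemma enormN x : enorm (- x) = enorm x.
Proof. by rewrite -scaleN1r enormZ normrN1 mul1r. Qed.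

Lemma enormB x y : enorm (x - y) <= enorm x + enorm y.
Proof. by rewrite -(enormN y) enormD. Qed.

Lemma enorm_coord x i : `|x ord0 i| <= enorm x.
Proof.
rewrite -sqrtr_sqr ler_sqrt ?dotRR_ge0// /dotR (bigD1 i)//= expr2 lerDl.
by apply: sumr_ge0 => j _; rewrite -expr2 sqr_ge0.
Qed.

Lemma enorm_le_sum x : enorm x <= n1 x.
Proof.
have s0 := n1_ge0 x.
rewrite -(ler_pXn2r (n := 2)) ?nnegrE ?enorm_ge0// enorm_sqr /dotR expr2 /n1 mulr_suml.
apply: ler_sum => i _; rewrite -expr2 -(real_normK (num_real _)) expr2 ler_wpM2l//.
by rewrite (bigD1 i)//= lerDl sumr_ge0.
Qed.

End Euclid.

(** * Scales, and the consequences of the choice of [j0] *)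

Section Symbol.
Context {R : realType} {n : nat}.
Notation V := 'rV[R]_n.

(** The standing hypotheses in the form in which they are used. Radiality of [phi] is recorded as
    evenness, which makes the integral of [Phi] squared positive. *)
Record adm (delta : R) (phi eta : V -> R) (j0 : nat) : Prop := Adm {
  adm_n : (0 < n)%N;
  adm_d : 0 < delta < 1;
  adm_phi : rap phi;
  adm_eta : rap eta;
  adm_even : forall xi, phi (- xi) = phi xi;
  adm_int : intRn phi = 1;
  adm_phi0 : forall xi, phi xi != 0 -> enorm xi <= 8^-1;
  adm_eta0 : forall xi, eta xi != 0 -> 2 `^ (- 2^-1) <= enorm xi <= 2 `^ (2^-1);
  adm_eta1 : forall xi, 2 `^ (- 4^-1) <= enorm xi <= 2 `^ (4^-1) -> eta xi = 1;
  adm_hi : 1 + 2 `^ (j0%:R * (delta - 1) + 1) <= 2 `^ (4^-1);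
  adm_lo : 1 - 2 `^ (j0%:R * (delta - 1) + 1) >= 2 `^ (- 4^-1);
  adm_s : 2 `^ (- (j0%:R * delta / 2)) * Num.sqrt n%:R <= 2 `^ (-3) }.

Definition sj (delta : R) (j : nat) : R := 2 `^ (j%:R * delta / 2).
Definition rj (j : nat) : R := 2 `^ (- j%:R).
(** Bound, valid for all j >= j0, on the displacements 2 s^2 met inside a block relative to its
    frequency 2^j. *)
Definition kap (delta : R) (j0 : nat) : R := 2 `^ (j0%:R * (delta - 1) + 1).

Lemma sj_gt0 delta j : 0 < sj delta j. Proof. exact: powR_gt0. Qed.
Lemma rj_gt0 j : 0 < rj j. Proof. exact: powR_gt0. Qed.
Lemma rjE j : rj j = 2 ^- j.
Proof. by rewrite /rj powRN powR_mulrn. Qed.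

Lemma sj_sqr delta j : sj delta j ^+ 2 = 2 `^ (j%:R * delta).
Proof. by rewrite -powR_mulrn ?powR_ge0// -powRrM; congr powR; field. Qed.

(** Here a = 2^(-1/4). The annulus of [eta], enlarged by the displacement k, stays within
    [8/15, 5/3]; as 8/15 > 1/2 and 5/3 < 2, neighbouring blocks vanish near frequencies of modulus
    2^j. The proof uses a^2 >= 7/10 and a >= 5/6, hence k <= 1/6. *)
Lemma fourth_root_num (a k : R) : 0 < a -> a ^+ 4 = 2^-1 -> a <= 1 - k -> 1 + k <= a^-1 ->
  [/\ k <= 4^-1, 8 / 15 <= a ^+ 2 - k & a ^- 2 + k <= 5 / 3].
Proof.
move=> a0 a4 h1 h2.
have a2 : 0 < a ^+ 2 by rewrite exprn_gt0.
have ha : a ^+ 2 * a ^+ 2 = 2^-1 by rewrite -exprD.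
have l2 : 7 / 10 <= a ^+ 2.
  rewrite leNgt; apply/negP => h; have : a ^+ 2 * a ^+ 2 < 7 / 10 * (7 / 10).
    by rewrite ltr_pM// ltW.
  by rewrite ha; lra.
have l1 : 5 / 6 <= a.
  rewrite leNgt; apply/negP => h; have : a * a < 5 / 6 * (5 / 6) by rewrite ltr_pM// ltW.
  by rewrite -expr2; lra.
have h5 : a ^- 2 <= 10 / 7 by rewrite -[a ^- 2]mul1r ler_pdivrMr//; lra.
have h6 : a^-1 <= 6 / 5 by rewrite -[a^-1]mul1r ler_pdivrMr//; lra.
clear ha a4 a0 a2; move: (a^-1) (a ^- 2) (a ^+ 2) h1 h2 l2 h5 h6 => b d c h1 h2 l2 h5 h6.
by split; lra.
Qed.

Section Adm.
Context (delta : R) (phi eta : V -> R) (j0 : nat) (A : adm delta phi eta j0).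
Notation s := (sj delta).
Notation r := rj.
Notation kp := (kap delta j0).

Lemma adm_d0 : 0 < delta. Proof. by case/andP: (adm_d A). Qed.
Lemma adm_d1 : delta < 1. Proof. by case/andP: (adm_d A). Qed.

Lemma sj_mono i j : (i <= j)%N -> s i <= s j.
Proof.
move=> ij; rewrite ler_powR// ?ler1n// ler_pM2r ?invr_gt0// ler_pM2r ?adm_d0//.
by rewrite ler_nat.
Qed.

Lemma sj_ge8n j : (j0 <= j)%N -> 8 * Num.sqrt n%:R <= s j.
Proof.
move=> jj; apply: le_trans (sj_mono jj).
have := adm_s A; rewrite powRN -/(sj delta j0) powRN -[3%R in X in _ <= X]/(3%:R) powR_mulrn//.
rewrite mulrC ler_pdivrMr ?sj_gt0// mulrC ler_pdivlMr ?exprn_gt0//.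
by rewrite mulrC; lra.
Qed.

Lemma sj_ge8 j : (j0 <= j)%N -> 8 <= s j.
Proof.
move=> jj; apply: le_trans (sj_ge8n jj); rewrite ler_peMr//.
by rewrite -[X in X <= _]sqrtr1 ler_sqrt ?ler0n// ler1n (adm_n A).
Qed.

Lemma rs_kap j : (j0 <= j)%N -> 2 * (r j * s j ^+ 2) <= kp.
Proof.
move=> jj; rewrite sj_sqr /rj.
have -> : 2 * (2 `^ (- j%:R) * 2 `^ (j%:R * delta)) = 2 `^ (j%:R * (delta - 1) + 1) :> R.
  rewrite -[X in X * _](@powRr1 R 2)// -!powRD//; try (by rewrite pnatr_eq0 /= ?implybT).
  by congr powR; ring.
rewrite ler_powR ?ler1n// lerD2r ler_wnM2r ?ler_nat//.
by rewrite subr_le0 ltW// adm_d1.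
Qed.

Lemma pow24 : exists2 a : R, 0 < a /\ a ^+ 4 = 2^-1 &
  [/\ 2 `^ (- 4^-1) = a, 2 `^ (4^-1) = a^-1, 2 `^ (- 2^-1) = a ^+ 2 & 2 `^ (2^-1) = a ^- 2].
Proof.
exists (2 `^ (- 4^-1)).
  split; first exact: powR_gt0.
  by rewrite -powR_mulrn ?powR_ge0// -powRrM mulNr mulVf// powR_inv1.
rewrite -powR_mulrn ?powR_ge0// -powRrM.
have -> : - 4^-1 * 2 = - 2^-1 :> R by field.
by rewrite -!powRN !opprK.
Qed.

Lemma kap_num : [/\ kp <= 4^-1, 8 / 15 <= 2 `^ (- 2^-1) - kp & 2 `^ (2^-1) + kp <= 5 / 3].
Proof.
have [a [a0 a4] [e1 e2 e3 e4]] := pow24.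
have := adm_hi A; have := adm_lo A; rewrite -/kp e1 e2 e3 e4.
exact: fourth_root_num.
Qed.

(** The two-sided condition on [j0] says that [1 - kap, 1 + kap] lies in the region where [eta] is
    1; after rescaling, a ball of radius 2 s^2 around a frequency of modulus 2^j is mapped into
    it. *)
Lemma eta_one_kap (xi xi0 : V) j : (j0 <= j)%N -> enorm xi0 = 2 ^+ j ->
  enorm (xi - xi0) <= 2 * s j ^+ 2 -> eta (r j *: xi) = 1.
Proof.
move=> jj e0 h; apply: (adm_eta1 A).
have r0 : 0 < r j := rj_gt0 j.
have hr : enorm (r j *: xi0) = 1 by rewrite enormZ e0 gtr0_norm// rjE mulVf// expf_neq0.
have hd : enorm (r j *: (xi - xi0)) <= kp.
  rewrite enormZ gtr0_norm//; apply: le_trans (rs_kap jj).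
  by rewrite mulrCA ler_pM2l.
have := adm_hi A; have := adm_lo A; rewrite -/kp.
have e1 : r j *: xi = r j *: xi0 + r j *: (xi - xi0) by rewrite -scalerDr addrC subrK.
have e2 : r j *: xi0 = r j *: xi - r j *: (xi - xi0) by rewrite -scalerBr opprB addrC subrK.
have := enormD (r j *: xi0) (r j *: (xi - xi0)); rewrite -e1 hr.
have := enormB (r j *: xi) (r j *: (xi - xi0)); rewrite -e2 hr.
by move=> *; apply/andP; split; lra.
Qed.

Lemma eta_range y : ~~ (2 `^ (- 2^-1) <= enorm y <= 2 `^ (2^-1)) -> eta y = 0.
Proof. by move=> h; apply/eqP; apply: contraNT h => /(adm_eta0 A). Qed.

End Adm.
End Symbol.

(** * Dyadic blocks and symbol classes *)

Section Symbol2.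
Context {R : realType} {n : nat}.
Notation V := 'rV[R]_n.
Notation tp := (@twopin R n).

Definition kbound (s : R) : nat := Num.truncn s.

Lemma kset_coord (s : R) (k : 'rV[int]_n) i : kset s k -> `|(intV k : V) ord0 i| <= s.
Proof. by move=> /andP[_ h]; exact: le_trans (enorm_coord _ _) h. Qed.

Lemma le_kbound (s : R) (k : 'rV[int]_n) i : `|(intV k : V) ord0 i| <= s -> (`|k ord0 i| <= kbound s)%N.
Proof.
rewrite mxE -intr_norm => h.
have : (`|k ord0 i|%N)%:R <= s by apply: le_trans h; rewrite -natr_absz lexx.
move=> h'; rewrite /kbound -ltnS -(ltr_nat R) (le_lt_trans h')//.
by have /andP[] := truncn_itv (le_trans (ler0n R _) h').
Qed.

Lemma kset_box (s : R) (k : 'rV[int]_n) i : kset s k -> (`|k ord0 i| <= kbound s)%N.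
Proof. by move=> /(@kset_coord s k i); exact: le_kbound. Qed.

Lemma finite_kset (s : R) : finite_set (@kset R n s).
Proof.
pose M := kbound s.
pose g (f : {ffun 'I_n -> 'I_M.*2.+1}) : 'rV[int]_n := \row_i ((f i)%:Z - M%:Z)%R.
apply: (@sub_finite_set _ _ (range g)); last exact/finite_image/finite_finset.
move=> k kk /=; exists [ffun i => inord `|(k ord0 i + M%:Z)%R|%N] => //.
apply/rowP => i; rewrite mxE ffunE.
have := kset_box i kk; rewrite -/M => h.
rewrite inordK; last by lia.
have hg : ((`|(k ord0 i + M%:Z)%R|%N)%:Z = k ord0 i + M%:Z)%R by lia.
by rewrite hg addrK.
Qed.

Definition kseq (s : R) : seq 'rV[int]_n := finmap.enum_fset (fset_set (kset s)).

Lemma kseqP (s : R) k : (k \in kseq s) = (0 < enorm (intV k : V) <= s).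
Proof. by apply: etrans (in_fset_set (finite_kset s) k) _; apply/idP/idP => [/set_mem//|h]; apply/mem_set. Qed.

Lemma kseq_uniq (s : R) : uniq (kseq s). Proof. exact: finmap.fset_uniq. Qed.

Lemma kseq_box (s : R) k i : k \in kseq s -> (`|k ord0 i| <= kbound s)%N.
Proof. by rewrite kseqP; exact: kset_box. Qed.

Lemma kseq_coord (s : R) k i : k \in kseq s -> `|(intV k : V) ord0 i| <= s.
Proof. by rewrite kseqP; exact: kset_coord. Qed.

Lemma sum_w_kseq (s : R) (u : V) : \sum_(k <- kseq s) w (u - intV k) <= (3 * pi) ^+ n.
Proof. by apply: (sum_w_lattice (M := kbound s)); [exact: kseq_uniq|move=> k kk i; exact: kseq_box]. Qed.

Section Adm.
Context (delta : R) (phi eta : V -> R) (j0 : nat) (A : adm delta phi eta j0).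
Notation s := (sj delta).
Notation r := rj.

Definition blk (m tau c : R) (j : nat) (z : V * V) : R :=
  2 `^ (j%:R * m) * tp *
  \sum_(k <- kseq (s j)) atom (s j) (r j) tau (intV k) phi eta c z.

Lemma smooth_blk m tau c j : smooth dir2 (blk m tau c j).
Proof.
apply: smooth_scale; apply: smooth_sum => k; apply: smooth_atom; first exact: adm_phi A.
exact: rap_bdd (adm_eta A).
Qed.

Lemma iterD_blk l m tau c j z : iterD dir2 l (blk m tau c j) z = 2 `^ (j%:R * m) * tp *
  \sum_(k <- kseq (s j)) iterD dir2 l (atom (s j) (r j) tau (intV k) phi eta c) z.
Proof.
have sa k : smooth dir2 (atom (s j) (r j) tau (intV k) phi eta c).
  by apply: smooth_atom; [exact: adm_phi A|exact: rap_bdd (adm_eta A)].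
by rewrite iterD_scale ?iterD_sum//; exact: smooth_sum.
Qed.

(** In the adjoint the argument of [eta] is displaced by s (om - k), of length at most s (1/8 + s)
    <= 2 s^2. *)
Lemma phase_shift_small (tau : R) j k om : (j0 <= j)%N -> 0 <= tau <= 1 -> k \in kseq (s j) ->
  phi om != 0 -> enorm (r j *: ((tau * s j) *: (om - intV k))) <= kap delta j0.
Proof.
move=> jj /andP[t0 t1] kk /(adm_phi0 A) ho; apply: le_trans (rs_kap A jj).
rewrite !enormZ (gtr0_norm (rj_gt0 _)) ger0_norm ?mulr_ge0 ?(ltW (sj_gt0 _ _))//.
rewrite [X in _ <= X]mulrCA ler_pM2l ?rj_gt0//.
have s8 := sj_ge8 A jj.
have h : enorm (om - intV k) <= 2 * s j.
  apply: le_trans (enormB _ _) _; move: kk; rewrite kseqP => /andP[_ h]; lra.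
have -> : 2 * s j ^+ 2 = 1 * s j * (2 * s j) by ring.
by rewrite ler_pM ?enorm_ge0 ?mulr_ge0 ?(ltW (sj_gt0 _ _))// ler_wpM2r// ltW// sj_gt0.
Qed.

Lemma blk_supp l m tau c j z : (j0 <= j)%N -> 0 <= tau <= 1 ->
  ~~ (8 / 15 <= enorm (r j *: z.2) <= 5 / 3) -> iterD dir2 l (blk m tau c j) z = 0.
Proof.
move=> jj tt hz; rewrite iterD_blk big_seq big1 ?mulr0// => k kk.
apply: atom_iterD_eq0 (eta_range A) _; [exact: adm_phi A|exact: rap_bdd (adm_eta A)|].
move=> om p0; apply: contra hz => /andP[h1 h2].
have hd := phase_shift_small jj tt kk p0.
have [_ h3 h4] := kap_num A.
rewrite scalerBr in h1 h2.
set a := r j *: z.2 in h1 h2 *; set b := r j *: _ in hd h1 h2.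
have h5 := enormB a b; have h6 := enormD (a - b) b; rewrite subrK in h6.
by apply/andP; split; lra.
Qed.

Lemma blk_slot l m tau c j z : (j0 <= j)%N -> 0 <= tau <= 1 ->
  ~~ (1 / 2 <= enorm (r j *: z.2) <= 2) -> iterD dir2 l (blk m tau c j) z = 0.
Proof.
move=> jj tt h; apply: blk_supp => //; apply: contra h => /andP[h1 h2].
by apply/andP; split; lra.
Qed.

(** The atoms of a block are summed through the lattice bound for w(s x - k), which costs only a
    constant; the remaining powers of s and r combine to the stated power of 2^j. *)
Lemma blk_bound l m tau c : 0 <= tau <= 1 -> exists C : R, 0 <= C /\ forall j z, (j0 <= j)%N ->
  `|iterD dir2 l (blk m tau c j) z| <=
  C * 2 `^ (j%:R * (m - (count (fun b => ~~ b.1) l)%:R + delta * (count (fun b => b.1) l)%:R)).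
Proof.
move=> tt; have [C [C0 hC]] := atom_bound l (adm_phi A) (rap_bdd (adm_eta A)).
exists (`|tp| * C * (3 * pi) ^+ n); split.
  by rewrite !mulr_ge0// exprn_ge0// mulr_ge0// pi_ge0.
move=> j z jj; rewrite iterD_blk.
rewrite !normrM (gtr0_norm (powR_gt0 _ _))//.
set a := count _ _; set b := count _ _.
have -> : 2 `^ (j%:R * (m - a%:R + delta * b%:R)) = 2 `^ (j%:R * m) * ((s j) ^+ (2 * b) * (r j) ^+ a).
  rewrite exprM sj_sqr rjE -!powR_mulrn ?powR_ge0 ?exprn_ge0 ?invr_ge0//.
  rewrite -powRN -!powRrM.
  by rewrite -!powRD ?pnatr_eq0 ?implybT//; congr powR; ring.
rewrite [leRHS](_ : _ = 2 `^ (j%:R * m) * `|tp| * (C * (s j ^+ (2 * b) * r j ^+ a * (3 * pi) ^+ n))); last by ring.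
rewrite ler_wpM2l ?mulr_ge0 ?powR_ge0//.
apply: (le_trans (ler_norm_sum _ _ _)).
apply: (le_trans _ (_ : \sum_(k <- kseq (s j)) C * (s j ^+ (2 * b) * r j ^+ a * w (s j *: z.1 - intV k)) <= _)); last first.
  rewrite -!mulr_sumr ler_wpM2l// ler_wpM2l ?sum_w_kseq//.
  by rewrite mulr_ge0 ?exprn_ge0 ?powR_ge0.
rewrite big_seq [leRHS]big_seq; apply: ler_sum => k kk.
have s1 : 1 <= s j by have := sj_ge8 A jj; lra.
have rt : `|r j * (tau * s j)| <= 1.
  case/andP: tt => t0 t1.
  rewrite ger0_norm ?mulr_ge0 ?powR_ge0//.
  have [h _ _] := kap_num A; have := rs_kap A jj.
  have : r j * (tau * s j) <= r j * s j ^+ 2.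
    rewrite ler_pM2l ?rj_gt0// expr2 ler_wpM2r ?(le_trans t1)// ltW//; exact: sj_gt0.
  lra.
have kb i : `|(intV k : V) ord0 i| <= s j by exact: kseq_coord.
have := hC (APar s1 rt kb) c z.
by rewrite /= (gtr0_norm (rj_gt0 j)).
Qed.

Definition slot (t : R) (j : nat) : bool := 1 / 2 <= r j * t <= 2.

(** The function u / (1 + u) takes values in [0, 1] and drops by at least 1/8 between 2^(-j) t and
    2^(-j-1) t whenever j is in the slot of t; the telescoping sum then allows at most 8 such j. *)
Lemma sum_slot (t : R) N : 0 <= t -> \sum_(j0 <= j < N) (slot t j)%:R <= 8 :> R.
Proof.
move=> t0; pose h (u : R) := u / (1 + u).
have u0 j : 0 <= r j * t by rewrite mulr_ge0 ?powR_ge0.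
have rS j : r j = 2 * r j.+1 :> R by rewrite !rjE exprS invfM mulVKf.
have step j : (slot t j)%:R <= 8 * (h (r j * t) - h (r j.+1 * t)).
  have := u0 j; rewrite /slot rS; have := u0 j.+1.
  rewrite -mulrA; move: (r j.+1 * t) => u hu _; rewrite /h.
  have p1 : 0 < 1 + u by lra.
  have p2 : 0 < 1 + 2 * u by lra.
  have -> : 2 * u / (1 + 2 * u) - u / (1 + u) = u / ((1 + 2 * u) * (1 + u)).
    by field; rewrite !gt_eqF.
  rewrite mulrA ler_pdivlMr ?mulr_gt0//.
  case: (boolP (_ && _)) => [/andP[a b]|_]; last by rewrite mul0r; lra.
  by rewrite mul1r; nra.
case: (leqP j0 N) => jN; last by rewrite big_geq// ltnW.
apply: (@le_trans _ _ (8 * (h (r j0 * t) - h (r N * t)))).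
  rewrite -opprB -(telescope_sumr (fun j => h (r j * t)) jN) -sumrN mulr_sumr.
  by apply: ler_sum => j _; rewrite opprB.
have : h (r j0 * t) <= 1 by rewrite /h ler_pdivrMr; have := u0 j0; lra.
have : 0 <= h (r N * t) by rewrite /h divr_ge0// ?u0//; have := u0 N; lra.
lra.
Qed.

Lemma slotE (t : R) j : slot t j -> 2 ^+ j <= 2 * t /\ t <= 2 * 2 ^+ j.
Proof.
have p0 : 0 < 2 ^+ j :> R by rewrite exprn_gt0.
rewrite /slot rjE => /andP[h1 h2]; have e : t = 2 ^+ j * (2 ^- j * t) by rewrite mulVKf// gt_eqF.
rewrite e; set u := 2 ^- j * t in h1 h2 *; nra.
Qed.

(** In the slot, 2^j and 1 + t agree up to a factor 4 in both directions, so the sign of [e] does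
    not matter. *)
Lemma pow_slot (e t : R) j : 0 <= t -> slot t j ->
  2 `^ (j%:R * e) <= 4 `^ `|e| * (1 + t) `^ e.
Proof.
move=> t0 /slotE[h1 h2]; rewrite powRrM powR_mulrn//.
have p1 : 1 <= 2 ^+ j :> R by rewrite exprn_ege1// ler1n.
have p0 : 0 < 2 ^+ j :> R by rewrite exprn_gt0.
have [e0|e0] := leP 0 e.
  rewrite ger0_norm// -powRM//; last by lra.
  by rewrite ge0_ler_powR// ?nnegrE; lra.
rewrite ltr0_norm// -[X in _ `^ X <= _]opprK -[X in (1 + t) `^ X]opprK.
rewrite !(powRN _ (- e)) ler_pdivlMr ?powR_gt0//; last by lra.
rewrite [X in X <= _]mulrC ler_pdivrMr ?powR_gt0// -powRM//.
by rewrite ge0_ler_powR// ?nnegrE; lra.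
Qed.

Definition syms (m tau c : R) (z : V * V) : R :=
  lim (\sum_(j0 <= j < N) blk m tau c j z @[N --> \oo]).

(** Makes the series locally finite in the frequency variable, locally uniformly in x. *)
Lemma blk_high l m tau c j N z : (j0 <= j)%N -> (N <= j)%N -> 0 <= tau <= 1 ->
  enorm z.2 < 2 ^+ N / 2 -> iterD dir2 l (blk m tau c j) z = 0.
Proof.
move=> jj Nj tt hz; apply: blk_slot => //; rewrite negb_and -!ltNge; apply/orP; left.
rewrite enormZ gtr0_norm ?rj_gt0// rjE mulrC ltr_pdivrMr ?exprn_gt0//.
by apply: lt_le_trans hz _; rewrite mul1r mulrC ler_pM2l ?invr_gt0// ler_weXn2l// ler1n.
Qed.

Lemma syms_loc m tau c N z : (j0 <= N)%N -> 0 <= tau <= 1 -> enorm z.2 < 2 ^+ N / 2 ->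
  syms m tau c z = \sum_(j0 <= j < N) blk m tau c j z.
Proof.
move=> jN tt hz; apply: lim_near_cst => //; exists N => // M /= NM.
rewrite (@big_cat_nat _ _ _ N)//= [X in _ + X]big_nat [X in _ + X]big1 ?addr0// => j /andP[Nj _].
exact: (@blk_high [::] m tau c j N z (leq_trans jN Nj) Nj tt hz).
Qed.

Lemma exists_scale (t : R) : exists N, (j0 <= N)%N /\ t < 2 ^+ N / 2.
Proof.
exists (j0 + (Num.truncn (2 * `|t|)).+1)%N; split; first exact: leq_addr.
have t0 : 0 <= 2 * `|t| by rewrite mulr_ge0.
rewrite ltr_pdivlMr// mulrC (le_lt_trans (_ : _ <= 2 * `|t|))//.
  by rewrite ler_wpM2l// ler_norm.
have /andP[_ h] := truncn_itv t0; apply: lt_trans h _.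
apply: (@lt_le_trans _ _ (2 ^ (j0 + (Num.truncn (2 * `|t|)).+1)%N)%:R); last by rewrite natrX.
rewrite ltr_nat; apply: (leq_trans (ltn_expl _ (ltnSn 1))).
by rewrite leq_exp2l// leq_addl.
Qed.

Lemma open_low (t : R) : open [set z : V * V | enorm z.2 < t].
Proof.
apply: (@open_comp _ _ (fun z : V * V => enorm z.2) [set u | u < t]); last exact: open_lt.
move=> z _; apply: (@continuous_comp _ _ _ snd (@enorm R n)); first exact: cvg_snd.
exact: continuous_enorm.
Qed.

Lemma smooth_syms m tau c : 0 <= tau <= 1 -> smooth dir2 (syms m tau c).
Proof.
move=> tt; apply: smooth_open => z; have [N [jN hN]] := exists_scale (enorm z.2).
exists [set z : V * V | enorm z.2 < 2 ^+ N / 2], (fun z => \sum_(j0 <= j < N) blk m tau c j z).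
split=> //; first exact: open_low.
  by apply: smooth_sum => j; exact: smooth_blk.
by move=> b hb; exact: syms_loc.
Qed.

(** Absolute values inside the sum and uniformity in [N] make this serve twice: as the symbol
    estimate, and as a majorant for dominated convergence in the construction of the adjoint. *)
Lemma blk_sum_bound l m tau c : 0 <= tau <= 1 -> exists C : R, 0 <= C /\ forall N z,
  \sum_(j0 <= j < N) `|iterD dir2 l (blk m tau c j) z| <= C * (1 + enorm z.2) `^
     (m - (count (fun b => ~~ b.1) l)%:R + delta * (count (fun b => b.1) l)%:R).
Proof.
move=> tt; have [C [C0 hC]] := blk_bound l m c tt.
set e := m - _ + _ in hC *.
exists (8 * (C * 4 `^ `|e|)); split; first by rewrite !mulr_ge0 ?powR_ge0.
move=> N z.
apply: (@le_trans _ _ (\sum_(j0 <= j < N) (slot (enorm z.2) j)%:R * (C * 4 `^ `|e| * (1 + enorm z.2) `^ e))).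
  rewrite big_nat [leRHS]big_nat; apply: ler_sum => j /andP[jj _].
  have := @blk_slot l m tau c j z jj tt.
  rewrite enormZ (gtr0_norm (rj_gt0 j)) -/(slot (enorm z.2) j).
  case: (boolP (slot _ _)) => [hs _|_ ->//]; last by rewrite normr0 mul0r.
  rewrite mul1r; apply: le_trans (hC j z jj) _; rewrite -mulrA ler_wpM2l//.
  by apply: pow_slot => //; exact: enorm_ge0.
rewrite -mulr_suml -[leRHS]mulrA ler_wpM2r ?mulr_ge0 ?powR_ge0//.
exact: sum_slot (enorm_ge0 _).
Qed.

Lemma syms_bound l m tau c : 0 <= tau <= 1 -> exists C : R, forall z,
  `|iterD dir2 l (syms m tau c) z| <= C * (1 + enorm z.2) `^
     (m - (count (fun b => ~~ b.1) l)%:R + delta * (count (fun b => b.1) l)%:R).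
Proof.
move=> tt; have [C [C0 hC]] := blk_sum_bound l m c tt.
exists C => z; have [N [jN hN]] := exists_scale (enorm z.2).
rewrite (@iterD_open _ _ _ _ [set z : V * V | enorm z.2 < 2 ^+ N / 2] _ (fun z => \sum_(j0 <= j < N) blk m tau c j z))//; last 2 first.
- exact: open_low.
- by move=> a ha; exact: syms_loc.
rewrite iterD_sum; last by move=> j; exact: smooth_blk.
by apply: (le_trans (ler_norm_sum _ _ _)); exact: hC.
Qed.

Lemma cabs_le (a b : R) : cabs (Complex a b) <= `|a| + `|b|.
Proof.
rewrite /cabs /reC /imC /= -[leRHS]ger0_norm ?addr_ge0// -sqrtr_sqr ler_wsqrtr//.
rewrite sqrrD !real_normK ?num_real//.
have : 0 <= `|a| * `|b| by rewrite mulr_ge0.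
by rewrite mulr2n; lra.
Qed.

Lemma symbol_class_syms m tau c c' (sigma : V -> V -> R[i]) : 0 <= tau <= 1 ->
  (forall x xi, sigma x xi = Complex (syms m tau c (x, xi)) (syms m tau c' (x, xi))) ->
  symbol_class 1 delta m sigma.
Proof.
move=> tt hs.
have e1 : (fun z : V * V => reC (sigma z.1 z.2)) = syms m tau c by apply/funext => -[x xi]; rewrite hs.
have e2 : (fun z : V * V => imC (sigma z.1 z.2)) = syms m tau c' by apply/funext => -[x xi]; rewrite hs.
rewrite /symbol_class /csmooth e1 e2; split; first by split; exact: smooth_syms.
move=> l; have [C hC] := syms_bound l m c tt; have [C' hC'] := syms_bound l m c' tt.
exists (C + C') => x xi; rewrite /citerD e1 e2.
apply: le_trans (cabs_le _ _) _; rewrite mulrDl mul1r.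
by apply: lerD; [exact: (hC (x, xi))|exact: (hC' (x, xi))].
Qed.

End Adm.
End Symbol2.

(** * Complex numbers encoded by a phase *)

Section ComplexParts.
Context {R : realType} {n : nat}.
Notation V := 'rV[R]_n.
Notation tp := (@twopin R n).
Implicit Types a b : R[i].

Lemma complex_ext a b : reC a = reC b -> imC a = imC b -> a = b.
Proof. by case: a b => [? ?] [? ?] /= -> ->. Qed.

Lemma reCM a b : reC (a * b) = reC a * reC b - imC a * imC b.
Proof. by case: a b => [? ?] [? ?]. Qed.

Lemma imCM a b : imC (a * b) = reC a * imC b + imC a * reC b.
Proof. by case: a b => [? ?] [? ?]. Qed.

Lemma reCD a b : reC (a + b) = reC a + reC b.
Proof. by case: a b => [? ?] [? ?]. Qed.

Lemma imCD a b : imC (a + b) = imC a + imC b.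
Proof. by case: a b => [? ?] [? ?]. Qed.

Lemma reC_conj a : reC (conjc a) = reC a. Proof. by case: a. Qed.
Lemma imC_conj a : imC (conjc a) = - imC a. Proof. by case: a. Qed.

Lemma reC_sum I (s : seq I) P (f : I -> R[i]) :
  reC (\sum_(i <- s | P i) f i) = \sum_(i <- s | P i) reC (f i).
Proof. by apply: (big_morph (@reC R)) => // a b; exact: reCD. Qed.

Lemma imC_sum I (s : seq I) P (f : I -> R[i]) :
  imC (\sum_(i <- s | P i) f i) = \sum_(i <- s | P i) imC (f i).
Proof. by apply: (big_morph (@imC R)) => // a b; exact: imCD. Qed.

(* A real quantity [F c] depending on a phase [c] as [Re (e^(ic) z)] encodes the complex number [z]. *)
Definition phased (F : R -> R) := forall c, F c = cos c * F 0 - sin c * F (- (pi / 2)).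
Definition phc (F : R -> R) : R[i] := Complex (F 0) (F (- (pi / 2))).

Lemma cosBpihalf (t : R) : cos (t - pi / 2) = sin t.
Proof. by rewrite cosB cos_pihalf sin_pihalf mulr0 add0r mulr1. Qed.

Lemma sinBpihalf (t : R) : sin (t - pi / 2) = - cos t.
Proof. by rewrite sinB cos_pihalf sin_pihalf mulr0 sub0r mulr1. Qed.

Lemma phased_cos (t : R) : phased (fun c => cos (t + c)).
Proof. by move=> c; rewrite addr0 cosBpihalf cosD mulrC (mulrC (sin t)). Qed.

(** If F c = Re (e^(ic) z), multiplying z by e^(it) translates the phase by t. *)
Lemma expi_phc t F : phased F -> expi t * phc F = phc (fun c => F (c + t)).
Proof.
move=> hF; rewrite /expi /phc; apply: complex_ext; rewrite /= ?reCM ?imCM /reC /imC /=.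
  by rewrite add0r [RHS]hF.
by rewrite [RHS]hF (addrC (- (pi / 2)) t) cosBpihalf sinBpihalf mulNr opprK [LHS]addrC.
Qed.

Lemma phasedZ r F : phased F -> phased (fun c => r * F c).
Proof. by move=> hF c; rewrite hF mulrBr !(mulrCA r). Qed.

Lemma phased_sum I (s : seq I) (F : I -> R -> R) : (forall i, phased (F i)) ->
  phased (fun c => \sum_(i <- s) F i c).
Proof.
move=> hF c; rewrite !mulr_sumr -sumrB; apply: eq_bigr => i _; exact: hF.
Qed.

Lemma phased_shift F t : phased F -> phased (fun c => F (c + t)).
Proof.
move=> hF c; rewrite (hF (c + t)) (hF (0 + t)) (hF (- (pi / 2) + t)) add0r.
rewrite (addrC (- (pi / 2)) t) cosBpihalf sinBpihalf cosD sinD; ring.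
Qed.

Lemma phased_intRn C (a f : V -> R) : continuous a -> continuous f -> dom C f ->
  phased (fun c => intRn (fun x => cos (a x + c) * f x)).
Proof.
move=> ca cf df c.
have cc d : continuous (fun x => cos (a x + d) * f x).
  apply: contM => //; apply: cont_comp; first exact: continuous_cos.
  by apply: contD => //; exact: contC.
have dd d : dom C (fun x => cos (a x + d) * f x).
  by move=> x; rewrite normrM (le_trans (ler_wpM2r _ (cos_abs_le1 _))) ?mul1r ?df.
rewrite -(intRnZ _ (cc 0) (dd 0)) -(intRnZ _ (cc (- (pi / 2))) (dd (- (pi / 2)))).
rewrite -(intRnB (C := `|cos c| * C) (D := `|sin c| * C)); last 4 first.
- by apply: contM; [exact: contC|exact: cc].
- exact: domZ.
- by apply: contM; [exact: contC|exact: cc].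
- exact: domZ.
by apply: eq_intRn => x; rewrite phased_cos mulrBl !mulrA.
Qed.

Lemma reC_real (r : R) a : reC (r%:C%C * a) = r * reC a.
Proof. by rewrite reCM /= mul0r subr0. Qed.

Lemma imC_real (r : R) a : imC (r%:C%C * a) = r * imC a.
Proof. by rewrite imCM /= mul0r addr0. Qed.

Lemma phcZ (r : R) F : r%:C%C * phc F = phc (fun c => r * F c).
Proof. by apply: complex_ext; rewrite ?reC_real ?imC_real. Qed.

Lemma phc_sum I (s : seq I) (F : I -> R -> R) :
  \sum_(i <- s) phc (F i) = phc (fun c => \sum_(i <- s) F i c).
Proof. by apply: complex_ext; rewrite ?reC_sum ?imC_sum. Qed.

Lemma cint_phc (F : R -> V -> R) :
  cint (fun x => phc (F^~ x)) = phc (fun c => intRn (F c)).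
Proof. by []. Qed.

Lemma phc_expi t (r : R) : expi t * r%:C%C = phc (fun c => cos (t + c) * r).
Proof.
apply: complex_ext; rewrite /= ?reCM ?imCM /reC /imC /= ?mulr0 ?subr0 ?addr0//.
by rewrite cosBpihalf add0r.
Qed.

Lemma ifourier_phc (f : V -> R) u : ifourier (fun z => (f z)%:C%C) u = phc (fun c => tp * FT f u c).
Proof.
rewrite /ifourier -phcZ -cint_phc; congr (_ * cint _); apply/funext => x.
exact: phc_expi.
Qed.

Lemma atom0E (s r : R) (k : V) phi eta c z : rap phi ->
  atom s r 0 k phi eta c z = FT phi (s *: z.1 - k) (c - dotR k (s *: z.1 - k)) * eta (r *: z.2).
Proof.
move=> rphi; have [C hC] := rap_dom rphi.
rewrite /FT mulrC -(intRnZ (C := C)); last 2 first.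
- by apply: contM; [exact: continuous_phase|exact: rap_cont].
- exact: dom_phase.
apply: eq_intRn => om; rewrite mul0r scale0r subr0 mulrA mulrC; congr (_ * (cos _ * _)).
by rewrite dotRBr (dotRC _ k) addrAC addrA.
Qed.

Lemma sigma_term_phc delta m (phi eta : V -> R) j x xi : rap phi ->
  sigma_term delta m phi eta j x xi = phc (fun c => blk delta phi eta m 0 c j (x, xi)).
Proof.
move=> rphi; have [C hC] := rap_dom rphi.
rewrite /sigma_term fsbig_finite; last exact: finite_kset.
have hF u : phased (fun c => tp * FT phi u c).
  by apply: phasedZ; apply: phased_intRn hC; [exact: continuous_dotR|exact: rap_cont].
under eq_bigr do rewrite ifourier_phc expi_phc//.
rewrite phc_sum phcZ mulrC phcZ; congr phc; apply/funext => c.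
rewrite /blk /= !mulr_sumr; apply: eq_bigr => k _; rewrite atom0E//= -/(sj delta j) -/(rj j).
by ring.
Qed.

Lemma sigma_delta_phc delta m (phi eta : V -> R) j0 x xi : rap phi ->
  sigma_delta delta m phi eta j0 x xi = phc (fun c => syms delta phi eta j0 m 0 c (x, xi)).
Proof.
move=> rphi; rewrite /sigma_delta /phc /syms.
by congr (Complex (limn _) (limn _)); apply/funext => N;
  rewrite ?reC_sum ?imC_sum; apply: eq_bigr => j _; rewrite sigma_term_phc.
Qed.

End ComplexParts.

(** * The adjoint symbol *)

Section AdjointAtoms.
Context {R : realType} {n : nat}.
Notation V := 'rV[R]_n.
Notation tp := (@twopin R n).
Implicit Types (phi eta : V -> R) (x xi zeta om k : V).

Definition wave (s : R) k x c om : R := cos (dotR (s *: x - k) (om - k) + c).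

Lemma wave_le1 s k x c om : `|wave s k x c om| <= 1. Proof. exact: cos_abs_le1. Qed.

Lemma continuous_wave s k x c : continuous (wave s k x c).
Proof.
rewrite /wave; under eq_fun do rewrite dotRBr -addrA.
exact: continuous_phase.
Qed.

(** The integral over y in the regularised adjoint, for a single atom of the symbol itself. *)
Definition atomJ (s r : R) k phi eta (eps : R) x xi c zeta : R :=
  intRn (fun y => gau (eps *: y) * atom s r 0 k phi eta (dotR y zeta + c) (x + y, xi + zeta)).

Lemma cont_gauZ (a : R) (b : V) : continuous (fun y : V => gau (a *: y + b)).
Proof. by apply: cont_shift; exact: continuous_gau. Qed.

Lemma cont_gauZ0 (a : R) : continuous (fun y : V => gau (a *: y)).
Proof. by have := cont_gauZ (a := a) (b := 0); under eq_fun do rewrite addr0. Qed.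

Lemma dom_gauZ (K : nat) (a : R) : 0 < a -> exists C : R, forall y : V, gau (a *: y) <= C * w y ^+ K.
Proof.
move=> a0; have [C hC] := @dom_gau R n K; have [D D0 hD] := w_affine (0 : V) a0.
have C0 : 0 <= C.
  have := le_trans (gau_ge0 0) (hC 0); by rewrite pmulr_lge0// exprn_gt0// w_gt0.
exists (C * D ^+ K) => y; apply: le_trans (hC _) _; rewrite -mulrA ler_wpM2l//.
rewrite -exprMn lerXn2r ?nnegrE ?mulr_ge0 ?w_ge0//.
by have := hD y; rewrite addr0.
Qed.

Lemma dom_gauZ1 (a : R) : 0 < a -> exists C : R, dom C (fun y : V => gau (a *: y)).
Proof.
move=> a0; have [C hC] := dom_gauZ 1 a0; exists C => y.
by rewrite ger0_norm ?gau_ge0//; have := hC y; rewrite expr1.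
Qed.

Lemma cont_gau_center (a s : R) (b k : V) : continuous (fun om : V => gau (a *: (b + s *: (om - k)))).
Proof.
have -> : (fun om : V => gau (a *: (b + s *: (om - k)))) = (fun om => gau ((a * s) *: om + a *: (b - s *: k))).
  by apply/funext => om; congr gau; apply/rowP => i; rewrite !mxE; ring.
exact: cont_gauZ.
Qed.

Lemma dom_gau1 : exists G : R, dom G (@gau R n).
Proof.
have [G hG] := @dom_gau R n 1; exists G => y.
by rewrite ger0_norm ?gau_ge0//; have := hG y; rewrite expr1.
Qed.

Section Explicit.
Context (s r : R) (k : V) (phi eta : V -> R) (rphi : rap phi) (reta : rap eta).
Context (eps : R) (eps0 : 0 < eps) (x xi : V) (c : R).

(** After exchanging the integrals over y and om, the one over y is the transform of a Gaussian; it
    confines [zeta] to distance of order [eps] from - s (om - k). *)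
Lemma atomJE zeta : atomJ s r k phi eta eps x xi c zeta =
  (Num.sqrt pi / eps) ^+ n * eta (r *: (xi + zeta)) *
  intRn (fun om => wave s k x c om * phi om * gau ((2 * eps)^-1 *: (zeta + s *: (om - k)))).
Proof.
have [C hC] := rap_dom rphi; have [D hD] := bdd_bound (rap_bdd reta).
have [E hE] := dom_gauZ1 eps0.
have cphi := rap_cont rphi.
set e := eta (r *: (xi + zeta)).
pose f (y om : V) := gau (eps *: y) * (cos (dotR (s *: (x + y) - k) (om - k) + (dotR y zeta + c)) * (phi om * e)).
have ff y om : f y om = (phi om * e) * (cos (dotR (s *: (om - k) + zeta) y + (dotR (s *: x - k) (om - k) + c)) * gau (eps *: y)).
  rewrite /f mulrC mulrAC mulrC; congr (_ * (cos _ * _)).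
  rewrite scalerDr addrAC !dotRDl !dotRZl (dotRC _ y) (dotRC zeta); ring.
have cf1 y : continuous (f y).
  apply: contM; first exact: contC; apply: contM; last by apply: contM => //; exact: contC.
  exact: continuous_wave.
have cf2 om : continuous (f^~ om).
  under eq_fun do rewrite ff; apply: contM; first exact: contC.
  by apply: contM; [exact: continuous_phase|exact: cont_gauZ0].
have df y om : `|f y om| <= E * C * `|e| * w y * w om.
  rewrite ff !normrM (_ : E * C * _ * _ * _ = (C * w om * `|e|) * (E * w y)); last by ring.
  rewrite ler_pM ?mulr_ge0// ?ler_wpM2r// (le_trans (ler_wpM2r _ (cos_abs_le1 _)))// mul1r.
  exact: hE.
transitivity (intRn (fun y => intRn (fun om => f y om))).
  apply: eq_intRn => y; rewrite /f /atom.
  rewrite (intRnZ (C := C * D)); last 2 first.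
  - apply: contM; first exact: continuous_wave.
    by apply: contM => //; exact: contC.
  - move=> om; rewrite normrM (le_trans (ler_wpM2r _ (cos_abs_le1 _)))// mul1r.
    by rewrite normrM mulrAC; rewrite ler_pM//; exact: hD.
  by congr (_ * _); apply: eq_intRn => om /=; rewrite mul0r scale0r subr0.
rewrite (intRn_swap cf1 cf2 df) -(intRnZ (C := C)); last 2 first.
- by apply: contM; [apply: contM => //; exact: continuous_wave|exact: cont_gau_center].
- move=> om; rewrite normrM mulrC (ger0_norm (gau_ge0 _)).
  apply: (le_trans (ler_wpM2r _ (gau_le1 _))) => //; rewrite mul1r normrM.
  by apply: (le_trans (ler_wpM2r _ (wave_le1 _ _ _ _ _))); rewrite ?mul1r.
apply: eq_intRn => om; under eq_intRn do rewrite ff.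
rewrite (intRnZ (C := E)); last 2 first.
- by apply: contM; [exact: continuous_phase|exact: cont_gauZ0].
- exact: dom_phase.
rewrite gauss_kernel// /wave (addrC zeta); ring.
Qed.

Definition Hcut (zeta : V) : R := gau (eps *: zeta) * eta (r *: (xi + zeta)).

Lemma continuous_Hcut : continuous Hcut.
Proof.
apply: contM; first exact: cont_gauZ0.
under eq_fun do rewrite scalerDr addrC.
by apply: cont_shift; exact: rap_cont reta.
Qed.

Lemma Hcut_bound D zeta : (forall x, `|eta x| <= D) -> `|Hcut zeta| <= D * gau (eps *: zeta).
Proof. by move=> hD; rewrite normrM ger0_norm ?gau_ge0// mulrC ler_wpM2r ?gau_ge0. Qed.

(** Gaussian average of [Hcut] around [z] at scale [2 * eps], not normalised: a constant is
    multiplied by [Num.sqrt pi ^+ n]. *)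
Definition Hcut_mean (z : V) : R := intRn (fun y => Hcut (2 * eps *: y + z) * gau y).

Lemma Hcut_dom D G z : (forall x, `|eta x| <= D) -> dom G (@gau R n) ->
  dom (D * G) (fun y => Hcut (2 * eps *: y + z) * gau y).
Proof.
move=> hD hG; have D0 : 0 <= D := le_trans (normr_ge0 _) (hD 0).
move=> y; rewrite normrM -mulrA ler_pM//.
by apply: le_trans (Hcut_bound _ hD) _; rewrite ler_piMr ?gau_le1.
Qed.

Lemma cont_Hcut_gau (z : V) : continuous (fun y : V => Hcut (2 * eps *: y + z) * gau y).
Proof. by apply: contM; [apply: cont_shift; exact: continuous_Hcut|exact: continuous_gau]. Qed.

Lemma Hcut_mean_bound D G z : (forall x, `|eta x| <= D) -> dom G (@gau R n) ->
  `|Hcut_mean z| <= D * G * pi ^+ n.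
Proof. by move=> hD hG; exact: intRn_bound (@cont_Hcut_gau z) (Hcut_dom z hD hG). Qed.

Lemma continuous_Hcut_mean : continuous (fun om => Hcut_mean (- (s *: (om - k)))).
Proof.
have [D hD] := bdd_bound (rap_bdd reta); have [G hG] := dom_gau1.
have c1 : continuous Hcut_mean.
  move=> a; apply: (continuous_intRn (C := D * G)).
  - exact: cont_Hcut_gau.
  - move=> y; apply: contM; last exact: contC.
    have := cont_shift (f := Hcut) (al := 1) (b := 2 * eps *: y) continuous_Hcut.
    by under eq_fun do rewrite scale1r addrC.
  - by move=> u; exact: Hcut_dom.
have -> : (fun om => Hcut_mean (- (s *: (om - k)))) = (fun om => Hcut_mean ((- s) *: om + s *: k)).
  by apply/funext => om; congr Hcut_mean; apply/rowP => i; rewrite !mxE; ring.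
exact: cont_shift.
Qed.

Lemma Hcut_le D zeta : (forall x, `|eta x| <= D) -> `|Hcut zeta| <= D.
Proof.
move=> hD; have D0 : 0 <= D := le_trans (normr_ge0 _) (hD 0).
by apply: le_trans (Hcut_bound zeta hD) _; rewrite ler_piMr ?gau_le1.
Qed.

(** The integral over zeta is recentred at - s (om - k), leaving an average of the frequency factor
    there. As [eps] tends to 0 the average becomes [eta] at r (xi - s (om - k)), which is the atom
    with [tau = 1]. *)
Lemma atomI : intRn (fun zeta => gau (eps *: zeta) * atomJ s r k phi eta eps x xi c zeta) =
  (2 * Num.sqrt pi) ^+ n * intRn (fun om => wave s k x c om * phi om *
     Hcut_mean (- (s *: (om - k)))).
Proof.
have [C hC] := rap_dom rphi; have [D hD] := bdd_bound (rap_bdd reta).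
have [E hE] := dom_gauZ1 eps0; have [G hG] := dom_gau1.
have cphi := rap_cont rphi.
have D0 : 0 <= D := le_trans (normr_ge0 _) (hD 0).
have C0 := dom_ge0 hC; have E0 := dom_ge0 hE.
have bH z : `|Hcut z| <= D.
  by apply: le_trans (Hcut_bound z hD) _; rewrite ler_piMr ?gau_le1.
pose g (om zeta : V) := wave s k x c om * phi om * (Hcut zeta * gau ((2 * eps)^-1 *: (zeta + s *: (om - k)))).
have cg1 om : continuous (g om).
  apply: contM; first exact: contC; apply: contM; first exact: continuous_Hcut.
  under eq_fun do rewrite scalerDr; exact: cont_gauZ.
have cg2 z : continuous (g^~ z).
  apply: contM; first by apply: contM => //; exact: continuous_wave.
  by apply: contM; [exact: contC|exact: cont_gau_center].
have dw om : `|wave s k x c om * phi om| <= C * w om.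
  by rewrite normrM; apply: (le_trans (ler_wpM2r _ (wave_le1 _ _ _ _ _))); rewrite ?mul1r.
have dg om z : `|g om z| <= C * (D * E) * w om * w z.
  rewrite normrM (_ : C * _ * _ * _ = C * w om * (D * (E * w z))); last by ring.
  rewrite ler_pM// normrM (ger0_norm (gau_ge0 _)).
  apply: (le_trans (ler_wpM2l _ (gau_le1 _))) => //; rewrite mulr1.
  apply: (le_trans (Hcut_bound z hD)); rewrite ler_wpM2l//.
  by apply: le_trans (hE z); rewrite ler_norm.
transitivity (intRn (fun z => (Num.sqrt pi / eps) ^+ n * intRn (g^~ z))).
  apply: eq_intRn => z; rewrite atomJE.
  have -> : intRn (g^~ z) = Hcut z * intRn (fun om => wave s k x c om * phi om * gau ((2 * eps)^-1 *: (z + s *: (om - k)))).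
    rewrite -(intRnZ (C := C)); last 2 first.
    - by apply: contM; [apply: contM => //; exact: continuous_wave|exact: cont_gau_center].
    - move=> om; rewrite normrM (ger0_norm (gau_ge0 _)).
      by apply: (le_trans (ler_wpM2l _ (gau_le1 _))); rewrite ?mulr1.
    by apply: eq_intRn => om; rewrite /g; ring.
  rewrite /Hcut; ring.
have hge om z := dg om z.
rewrite (intRnZ (C := C * (D * E) * pi ^+ n)); last 2 first.
- have dg' z : dom (C * (D * E)) (g^~ z).
    move=> om; apply: le_trans (dg om z) _; rewrite ler_piMr ?w_le1//.
    by rewrite !mulr_ge0 ?w_ge0.
  by move=> z; apply: continuous_intRn dg' => // om; exact: cg1.
- move=> z; have h : dom (C * (D * E) * w z) (g^~ z) by move=> om; rewrite mulrAC.
  by rewrite mulrAC; exact: intRn_bound h.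
rewrite -(intRn_swap cg1 cg2 dg).
have -> : (2 * Num.sqrt pi) ^+ n = (Num.sqrt pi / eps) ^+ n * (2 * eps) ^+ n :> R.
  by rewrite -exprMn; congr (_ ^+ n); field; rewrite gt_eqF.
rewrite -mulrA; congr (_ * _).
rewrite -(intRnZ (C := C * (D * G * pi ^+ n))); last 2 first.
- apply: contM; first by apply: contM => //; exact: continuous_wave.
  exact: continuous_Hcut_mean.
- move=> om; rewrite normrM mulrAC ler_pM//; exact: Hcut_mean_bound.
apply: eq_intRn => om; rewrite /g.
rewrite (intRnZ (C := D * E)); last 2 first.
- apply: contM; first exact: continuous_Hcut.
  under eq_fun do rewrite scalerDr; exact: cont_gauZ.
- move=> z; rewrite normrM (ger0_norm (gau_ge0 _)).
  apply: (le_trans (ler_wpM2l _ (gau_le1 _))) => //; rewrite mulr1.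
  apply: (le_trans (Hcut_bound z hD)); rewrite -mulrA ler_wpM2l//.
  by apply: le_trans (hE z); rewrite ler_norm.
rewrite mulrCA; congr (_ * _).
have hr := gauss_recenter (- (s *: (om - k))) eps0 continuous_Hcut bH.
rewrite /Hcut_mean -hr; by apply: eq_intRn => z; rewrite opprK.
Qed.

Lemma tp_sqrtpi : tp * (2 * Num.sqrt pi) ^+ n = Num.sqrt pi ^- n :> R.
Proof.
have p0 : 0 < Num.sqrt pi :> R by rewrite sqrtr_gt0 pi_gt0.
have e : 2 * pi = 2 * Num.sqrt pi * Num.sqrt pi :> R by rewrite -mulrA -expr2 sqr_sqrtr ?pi_ge0.
rewrite /twopin e (exprMn n (2 * Num.sqrt pi)) invfM mulrAC mulVf ?mul1r// expf_neq0//.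
by rewrite gt_eqF// mulr_gt0.
Qed.

End Explicit.

Section Limits.
Context (phi eta : V -> R) (rphi : rap phi) (reta : rap eta).

Lemma rap_n1 : exists C : R, 0 <= C /\ forall om, `|phi om| * (1 + n1 om) <= C * w om.
Proof.
have [C0 hC0] := wf_bound (rphi 2%N 0%N).
have C0' : 0 <= C0.
  have := le_trans (normr_ge0 _) (hC0 tt 0); rewrite mul1r pmulr_lge0// exprn_gt0// w_gt0//.
exists (C0 * (1 + n%:R)); split; first by rewrite mulr_ge0// addr_ge0.
move=> om; have := hC0 tt om; rewrite mul1r => h.
have p : 0 <= 1 + n1 om by rewrite addr_ge0 ?n1_ge0.
apply: (le_trans (ler_wpM2r p h)).
rewrite (_ : C0 * w om ^+ 2 * _ = C0 * w om * ((1 + n1 om) * w om)); last by ring.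
rewrite [leRHS](_ : _ = C0 * w om * (1 + n%:R)); last by ring.
rewrite ler_wpM2l ?mulr_ge0 ?w_ge0// mulrDl mul1r lerD ?w_le1//; exact: n1_w.
Qed.

Lemma rap_lip (f : V -> R) : rap f -> exists2 L : R, 0 <= L &
  forall x y : V, `|f (x + y) - f x| <= L * n1 y.
Proof.
move=> rf; have [|L hL] := @wfam_lip _ _ unit (fun=> f) (fun _ x => 1 * w x) (rapid1 rf).
  by move=> _ x; rewrite mul1r w_ge0 w_le1.
exists `|L| => // x y; apply: le_trans (hL tt x y) _.
by rewrite ler_wpM2r ?n1_ge0 ?ler_norm.
Qed.

Lemma n1D (x y : V) : n1 (x + y) <= n1 x + n1 y.
Proof. by rewrite /n1 -big_split /=; apply: ler_sum => i _; rewrite mxE ler_normD. Qed.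

(** Two errors occur, replacing the average by the value at its centre and replacing the Gaussian
    factor there by 1. Both are of order eps (1 + |om|), and the growth in om is absorbed by
    [phi]. *)
Lemma adj_atom_lim (s r : R) k x xi c : exists C : R, forall eps, 0 < eps -> eps <= 1 ->
  `|tp * intRn (fun zeta => gau (eps *: zeta) * atomJ s r k phi eta eps x xi c zeta)
    - atom s r 1 k phi eta c (x, xi)| <= eps * C.
Proof.
have [C1 [C10 hC1]] := rap_n1.
have [L1 L10 hL1] := rap_lip rapid_gau; have [L2 L20 hL2] := rap_lip reta.
have [D hD] := bdd_bound (rap_bdd reta); have [G hG] := @dom_gau1; have [C hC] := rap_dom rphi.
have D0 : 0 <= D := le_trans (normr_ge0 _) (hD 0).
have cphi := rap_cont rphi; have ceta := rap_cont reta.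
set M1 := intRn (fun y : V => n1 y * gau y).
set q := Num.sqrt pi ^+ n : R.
have q0 : 0 < q by rewrite exprn_gt0// sqrtr_gt0 pi_gt0.
pose L := L1 * D + L2 * `|r|.
(* The first summand comes from averaging at scale eps, the second from the Gaussian factor at z = -
   s (om - k). *)
pose B := `|2 * L * M1| + q * (D * L1 * (`|s| * (1 + n1 k))).
have B0 : 0 <= q * (D * L1 * (`|s| * (1 + n1 k))).
  have k0 := n1_ge0 k.
  by apply: mulr_ge0; [exact: ltW|rewrite !mulr_ge0// addr_ge0].
exists (q^-1 * (C1 * B * pi ^+ n)) => eps e0 e1.
rewrite atomI// mulrA tp_sqrtpi -/q.
pose e om := eta (r *: (xi - s *: (om - k))).
have ce : continuous e.
  have -> : e = (fun om => eta ((- (r * s)) *: om + r *: (xi + s *: k))).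
    by apply/funext => om; congr eta; apply/rowP => i; rewrite !mxE; ring.
  exact: cont_shift.
have ea : atom s r 1 k phi eta c (x, xi) = intRn (fun om => wave s k x c om * phi om * e om).
  by apply: eq_intRn => om; rewrite mul1r mulrA.
have cw : continuous (fun om => wave s k x c om * phi om).
  by apply: contM => //; exact: continuous_wave.
have dw om : `|wave s k x c om * phi om| <= `|phi om|.
  by rewrite normrM; apply: (le_trans (ler_wpM2r _ (wave_le1 _ _ _ _ _))); rewrite ?mul1r.
have d1 : dom (C * D) (fun om => wave s k x c om * phi om * e om).
  move=> om; rewrite normrM mulrAC ler_pM//; last exact: hD.
  exact: le_trans (dw om) (hC om).
have c1 : continuous (fun om => wave s k x c om * phi om * e om) by exact: contM.
pose Hm om := Hcut_mean r eta eps xi (- (s *: (om - k))).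
have c2 : continuous (fun om => wave s k x c om * phi om * Hm om).
  by apply: contM => //; exact: continuous_Hcut_mean.
have d2 : dom (C * (D * G * pi ^+ n)) (fun om => wave s k x c om * phi om * Hm om).
  move=> om; rewrite normrM mulrAC ler_pM//; last exact: Hcut_mean_bound.
  exact: le_trans (dw om) (hC om).
have c3 : continuous (fun om => q * (wave s k x c om * phi om * e om)).
  by apply: contM => //; exact: contC.
have -> : q^-1 * intRn (fun om => wave s k x c om * phi om * Hm om) - atom s r 1 k phi eta c (x, xi) =
   q^-1 * intRn (fun om => wave s k x c om * phi om * Hm om - q * (wave s k x c om * phi om * e om)).
  rewrite (intRnB c2 d2 c3 (domZ q d1)) (intRnZ _ c1 d1) ea mulrBr mulKf//.
  by rewrite gt_eqF.
rewrite normrM (ger0_norm (ltW _)) ?invr_gt0// mulrCA ler_pM2l ?invr_gt0//.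
rewrite !mulrA; apply: intRn_bound.
  by apply: contB => //; apply: contM => //; exact: contC.
move=> om; rewrite (_ : _ - _ = wave s k x c om * phi om * (Hm om - q * e om)); last by ring.
rewrite normrM.
have lipH z y : `|Hcut r eta eps xi (z + y) - Hcut r eta eps xi z| <= L * n1 y.
  rewrite /Hcut (_ : _ - _ = (gau (eps *: (z + y)) - gau (eps *: z)) * eta (r *: (xi + (z + y)))
     + gau (eps *: z) * (eta (r *: (xi + (z + y))) - eta (r *: (xi + z)))); last by ring.
  rewrite (le_trans (ler_normD _ _))// !normrM /L mulrDl; apply: lerD.
    rewrite [leRHS]mulrAC ler_pM// scalerDr; apply: le_trans (hL1 _ _) _.
    by rewrite ler_wpM2l// n1Z gtr0_norm// ler_piMl// n1_ge0.
  rewrite (ger0_norm (gau_ge0 _)); apply: (le_trans (ler_wpM2r (normr_ge0 _) (gau_le1 _))).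
  rewrite mul1r addrA scalerDr; apply: le_trans (hL2 _ _) _.
  by rewrite n1Z mulrA.
have bH z : `|Hcut r eta eps xi z| <= D.
  by exact: Hcut_le.
have h1 z : `|Hcut_mean r eta eps xi z - q * eta (r *: (xi + z))| <=
   eps * (`|2 * L * M1| + q * (D * L1) * n1 z).
  have a1 := gauss_approx e0 (continuous_Hcut (r := r) reta (eps := eps) (xi := xi)) bH (lipH z).
  have a2 : `|Hcut r eta eps xi z - eta (r *: (xi + z))| <= eps * (D * L1 * n1 z).
    rewrite /Hcut -[X in _ - X]mul1r -mulrBl normrM.
    have g0 : gau (0 : V) = 1 by rewrite /gau -(scale0r (0 : V)) dotRZr mul0r oppr0 expR0.
    have := hL1 0 (eps *: z); rewrite add0r g0 n1Z (gtr0_norm e0) => h.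
    apply: le_trans (ler_pM (normr_ge0 _) (normr_ge0 _) h (hD _)) _.
    by rewrite le_eqVlt; apply/orP; left; apply/eqP; ring.
  rewrite (_ : _ - _ = (Hcut_mean r eta eps xi z - Hcut r eta eps xi z * q) +
     q * (Hcut r eta eps xi z - eta (r *: (xi + z)))); last by ring.
  rewrite (le_trans (ler_normD _ _))// [leRHS]mulrDr; apply: lerD.
    apply: le_trans a1 _; rewrite -/M1 (_ : 2 * eps * L * M1 = eps * (2 * L * M1)); last by ring.
    by rewrite ler_pM2l// ler_norm.
  rewrite normrM (gtr0_norm q0) (_ : eps * _ = q * (eps * (D * L1 * n1 z))); last by ring.
  by rewrite ler_pM2l.
have h2 : `|Hm om - q * e om| <= eps * B * (1 + n1 om).
  apply: le_trans (h1 _) _; rewrite -(mulrA eps) ler_pM2l// /B [leRHS]mulrDl.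
  have n0 := n1_ge0 om; have k0 := n1_ge0 k.
  apply: lerD; first by rewrite ler_peMr// lerDl.
  rewrite -mulrA -(mulrA q) ler_pM2l// -(mulrA (D * L1)) ler_wpM2l ?mulr_ge0//.
  rewrite -scaleNr n1Z normrN -mulrA ler_wpM2l//.
  apply: le_trans (n1D _ _) _; rewrite -scaleN1r n1Z normrN1 mul1r; nra.
apply: le_trans (ler_pM (normr_ge0 _) (normr_ge0 _) (dw om) h2) _.
rewrite [leLHS](_ : _ = eps * B * (`|phi om| * (1 + n1 om))); last by ring.
rewrite [leRHS](_ : _ = eps * B * (C1 * w om)); last by ring.
by rewrite ler_wpM2l// mulr_ge0// ?addr_ge0// ltW.
Qed.

(** If the support of [eta] is at distance [rho] from the point around which the average is taken,
    only the Gaussian tail beyond rho / (2 eps) contributes. The constant does not depend on the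
    scale, the lattice point or (x, xi), which allows summation over high blocks. *)
Lemma adj_atom_tail (K : nat) : exists C : R, 0 <= C /\ forall s r k x xi c eps rho,
  0 < eps -> 0 < rho ->
  (forall om y, phi om != 0 -> eta (r *: (xi + y - s *: (om - k))) != 0 -> rho <= enorm y) ->
  `|intRn (fun zeta => gau (eps *: zeta) * atomJ s r k phi eta eps x xi c zeta)| <= C * (eps / rho) ^+ K.
Proof.
have [D hD] := bdd_bound (rap_bdd reta); have [C hC] := rap_dom rphi.
have D0 : 0 <= D := le_trans (normr_ge0 _) (hD 0); have C0 := dom_ge0 hC.
have cphi := rap_cont rphi.
have [G hG] := @dom_gau R n K.+1; have [G1 hG1] := @dom_gau1.
have G0 : 0 <= G.
  by have := le_trans (gau_ge0 0) (hG 0); rewrite pmulr_lge0// exprn_gt0// w_gt0.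
have pi0 : 0 <= pi ^+ n :> R by rewrite exprn_ge0// pi_ge0.
pose E := D * ((2 * n%:R) ^+ K * G).
have E0 : 0 <= E by rewrite !mulr_ge0// exprn_ge0// mulr_ge0.
exists (`|(2 * Num.sqrt pi) ^+ n| * (C * (E * pi ^+ n)) * pi ^+ n); split.
  by rewrite !mulr_ge0.
move=> s r k x xi c eps rho e0 r0 hsupp.
rewrite atomI// normrM -!mulrA ler_wpM2l//.
set t := (eps / rho) ^+ K; have t0 : 0 <= t by rewrite exprn_ge0// divr_ge0// ltW.
rewrite [leRHS](_ : _ = C * (E * t * pi ^+ n) * pi ^+ n); last by rewrite /E; ring.
apply: intRn_bound.
  apply: contM; first by apply: contM => //; exact: continuous_wave.
  exact: continuous_Hcut_mean.
move=> om; rewrite normrM [leRHS]mulrAC normrM.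
have [p0|p0] := eqVneq (phi om) 0.
  by rewrite p0 normr0 mulr0 mul0r !mulr_ge0 ?w_ge0.
have h : `|Hcut_mean r eta eps xi (- (s *: (om - k)))| <= E * t * pi ^+ n.
  apply: intRn_bound; first exact: cont_Hcut_gau.
  move=> y; rewrite normrM (ger0_norm (gau_ge0 _)).
  have [h0|h0] := eqVneq (Hcut r eta eps xi (2 * eps *: y + - (s *: (om - k)))) 0.
    by rewrite h0 normr0 mul0r !mulr_ge0 ?w_ge0.
  have er : eta (r *: (xi + (2 * eps) *: y - s *: (om - k))) != 0.
    by move: h0; rewrite /Hcut addrA; apply: contra => /eqP ->; rewrite mulr0.
  have hy := hsupp _ _ p0 er.
  have hn : rho <= 2 * eps * n1 y.
    apply: le_trans hy (le_trans (enorm_le_sum _) _).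
    by rewrite n1Z gtr0_norm// mulr_gt0.
  (* Where the integrand is nonzero this factor is at least 1; it is inserted, and its growth in y
     is absorbed by the Gaussian. *)
  have h1 : 1 <= (2 * eps / rho * n1 y) ^+ K.
    by rewrite exprn_ege1// mulrAC ler_pdivlMr// mul1r.
  have bH : `|Hcut r eta eps xi (2 * eps *: y + - (s *: (om - k)))| <= D.
    by exact: Hcut_le.
  apply: le_trans (ler_wpM2r (gau_ge0 _) bH) _.
  rewrite /E -!mulrA ler_wpM2l//.
  apply: (@le_trans _ _ ((2 * eps / rho * n1 y) ^+ K * gau y)); first by rewrite ler_peMl ?gau_ge0.
  have u0 : 0 <= (2 * eps / rho) ^+ K by rewrite exprn_ge0// divr_ge0 ?mulr_ge0// ltW.
  have nw : 0 <= n1 y * w y by rewrite mulr_ge0 ?n1_ge0 ?w_ge0.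
  apply: (@le_trans _ _ ((2 * eps / rho) ^+ K * (G * w y * (n1 y * w y) ^+ K))).
    rewrite [leLHS](_ : _ = (2 * eps / rho) ^+ K * (n1 y ^+ K * gau y)); last by rewrite exprMn mulrA.
    rewrite ler_wpM2l//.
    rewrite [leRHS](_ : _ = n1 y ^+ K * (G * w y ^+ K.+1)); last by rewrite exprMn exprS; ring.
    by rewrite ler_wpM2l ?exprn_ge0 ?n1_ge0.
  rewrite [leRHS](_ : _ = (2 * eps / rho) ^+ K * (G * w y * n%:R ^+ K)); last first.
    rewrite /t -[2 * eps / rho]mulrA !exprMn; ring.
  rewrite ler_wpM2l// ler_wpM2l ?mulr_ge0 ?w_ge0//.
  by rewrite lerXn2r ?nnegrE// n1_w.
apply: ler_pM => //.
by apply: (le_trans (ler_wpM2r _ (wave_le1 _ _ _ _ _))); rewrite ?mul1r.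
Qed.

End Limits.
End AdjointAtoms.

(** * Summation over the blocks and removal of the cut-off *)

Section Adjoint.
Context {R : realType} {n : nat}.
Notation V := 'rV[R]_n.
Notation tp := (@twopin R n).

Lemma atom_phased (s r tau : R) (k : V) phi eta z : rap phi -> bdd eta ->
  phased (fun c => atom s r tau k phi eta c z).
Proof.
move=> rphi beta; have [C hC] := rap_dom rphi; have [D hD] := bdd_bound beta.
apply: (@phased_intRn _ _ (C * D) (fun om => dotR (s *: z.1 - k) (om - k))
   (fun om => phi om * eta (r *: (z.2 - (tau * s) *: (om - k))))).
- under eq_fun do rewrite dotRBr.
  by apply: contB; [exact: continuous_dotR|exact: contC].
- apply: contM; first exact: rap_cont.
  have -> : (fun om => eta (r *: (z.2 - (tau * s) *: (om - k)))) =
     (fun om => eta ((- (r * (tau * s))) *: om + r *: (z.2 + (tau * s) *: k))).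
    by apply/funext => om; congr eta; apply/rowP => i; rewrite !mxE; ring.
  by apply: cont_shift; exact: bdd_cont.
- move=> om; rewrite normrM mulrAC ler_pM//; exact: hD.
Qed.

Lemma cvg_linear_right (f : R -> R) (l C : R) :
  (forall e, 0 < e -> e <= 1 -> `|f e - l| <= e * C) -> f e @[e --> 0^'+] --> l.
Proof.
move=> h; apply/cvgrPdist_le => e e0.
have C0 : 0 <= C by have := h 1 ltr01 (lexx _); rewrite mul1r; apply: le_trans.
near=> t.
have t0 : 0 < t by near: t; exact: nbhs_right_gt.
have t1 : t <= 1 by near: t; exact: nbhs_right_le.
rewrite distrC; apply: le_trans (h t t0 t1) _.
have te : t <= e / (C + 1) by near: t; apply: nbhs_right_le; rewrite divr_gt0// ltr_wpDl.
apply: (le_trans (ler_wpM2r C0 te)).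
by rewrite -mulrA ler_piMr ?(ltW e0)// mulrC ler_pdivrMr ?ltr_wpDl// mul1r lerDl.
Unshelve. all: by end_near. Qed.

(** Polynomial growth in xi + zeta is absorbed by the decay in zeta at a cost depending only on
    xi. *)
Lemma lower_bound_pow (K : nat) (xi : V) : exists C : R, 0 <= C /\ forall zeta,
  (1 + enorm (xi + zeta)) ^+ K * w zeta ^+ K <= C.
Proof.
exists (((1 + enorm xi) * (1 + n%:R)) ^+ K).
have x0 := enorm_ge0 xi; split; first by rewrite exprn_ge0// mulr_ge0// addr_ge0.
move=> zeta; rewrite -exprMn.
have h1 := enormD xi zeta; have h2 := enorm_le_sum zeta; have h3 := enorm_ge0 (xi + zeta).
have h4 := n1_w zeta; have h5 := w_le1 zeta; have h6 := w_ge0 zeta; have h7 := n1_ge0 zeta.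
have h8 := enorm_ge0 zeta.
rewrite lerXn2r ?nnegrE ?mulr_ge0// ?addr_ge0//.
apply: (@le_trans _ _ ((1 + enorm xi) * (1 + n1 zeta) * w zeta)).
  rewrite ler_wpM2r//; nra.
rewrite -mulrA ler_wpM2l ?addr_ge0// mulrDl mul1r; lra.
Qed.

Section Adm.
Context (delta : R) (phi eta : V -> R) (j0 : nat) (A : adm delta phi eta j0) (m : R).
Notation s := (sj delta).
Notation r := rj.
Let rphi := adm_phi A.
Let reta := adm_eta A.
Let beta := rap_bdd (adm_eta A).
Notation B := (blk delta phi eta m).
Notation Sy := (syms delta phi eta j0 m).
Let t00 : 0 <= (0 : R) <= 1. Proof. by rewrite lexx ler01. Qed.
Let t11 : 0 <= (1 : R) <= 1. Proof. by rewrite lexx ler01. Qed.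

Lemma blk_phased tau j z : phased (fun c => B tau c j z).
Proof. by apply: phasedZ; apply: phased_sum => k; exact: atom_phased. Qed.

Lemma syms_phased z : phased (fun c => Sy 0 c z).
Proof.
have [N [jN hN]] := exists_scale j0 (enorm z.2).
move=> c; rewrite !(syms_loc A m _ jN t00 hN).
by apply: (@phased_sum _ _ (index_iota j0 N) (fun j c => B 0 c j z)) => j; exact: blk_phased.
Qed.

Context (x xi : V).

Definition adjJ (eps c : R) (zeta : V) : R :=
  intRn (fun y => chi0 (eps *: y) (eps *: zeta) * Sy 0 (dotR y zeta + c) (x + y, xi + zeta)).

(** The integrand is the conjugate of e^(i y . zeta) sigma: the phase gains y . zeta, and
    conjugation moves the phase of the imaginary part from - pi / 2 to pi / 2. *)
Lemma adj_epsE eps : adj_eps (sigma_delta delta m phi eta j0) x xi eps =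
  Complex (tp * intRn (adjJ eps 0)) (tp * intRn (adjJ eps (pi / 2))).
Proof.
have hs : sigma_delta delta m phi eta j0 = (fun y eta' => phc (fun c => Sy 0 c (y, eta'))).
  by apply/funext => y; apply/funext => e; rewrite sigma_delta_phc.
rewrite hs; apply: complex_ext; rewrite /adj_eps ?reC_real ?imC_real; congr (_ * _);
  rewrite /cint /=; apply: eq_intRn => zeta /=; apply: eq_intRn => y.
  have hF := @syms_phased (x + y, xi + zeta).
  rewrite [in RHS]addr0 [in RHS]hF cosN sinN; ring.
have hF := @syms_phased (x + y, xi + zeta).
rewrite [in RHS]hF cosDpihalf' sinDpihalf cosN sinN; ring.
Qed.

Definition adjc (j : nat) : R := 2 `^ (j%:R * m) * tp.

Definition adjB (eps c : R) (j : nat) (zeta : V) : R :=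
  adjc j * \sum_(k <- kseq (s j))
     gau (eps *: zeta) * atomJ (s j) (r j) (intV k) phi eta eps x xi c zeta.

Lemma chi0E (y zeta : V) : chi0 y zeta = gau zeta * gau y.
Proof. by rewrite /chi0 /gau opprD expRD mulrC. Qed.

Lemma cont_atom_y (S r' : R) k zeta c : continuous (fun y : V =>
  atom S r' 0 k phi eta (dotR y zeta + c) (x + y, xi + zeta)).
Proof.
have cp : continuous (fun y : V => (x + y, xi + zeta)).
  move=> y; apply: (cvg_pair (F := nbhs y) (G := nbhs (x + y)) (H := nbhs (xi + zeta))); last exact: cvg_cst.
  by apply: cvgD; [exact: cvg_cst|exact: cvg_id].
have ct : continuous (fun y : V => dotR y zeta + c).
  under eq_fun do rewrite dotRC.
  by apply: contD; [exact: continuous_dotR|exact: contC].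
have ca d : continuous (fun y : V => atom S r' 0 k phi eta d (x + y, xi + zeta)).
  exact: (cont_comp (h := atom S r' 0 k phi eta d) (@continuous_atom _ _ S r' 0 k phi eta d rphi beta) cp).
under eq_fun do rewrite (atom_phased _ _ _ _ _ rphi beta).
apply: contB; apply: contM => //; first exact: cont_comp (@continuous_cos R) ct.
exact: cont_comp (@continuous_sin R) ct.
Qed.

Lemma atom_le : exists C : R, forall (S r' tau : R) k c z, `|atom S r' tau k phi eta c z| <= C.
Proof.
have [C hC] := rap_dom rphi; have [D hD] := bdd_bound beta.
exists (C * D * pi ^+ n) => S r' tau k c z.
apply: intRn_bound; last exact: atom_dom.
by apply: atom_cont_om; [exact: rap_cont|exact: bdd_cont].
Qed.

Lemma adjB_intRn eps c j zeta : 0 < eps -> adjB eps c j zeta =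
  intRn (fun y => chi0 (eps *: y) (eps *: zeta) * B 0 (dotR y zeta + c) j (x + y, xi + zeta)).
Proof.
move=> e0; have [C hC] := atom_le; have [E hE] := dom_gauZ1 (n := n) e0.
set f := fun (k : 'rV[int]_n) (y : V) => gau (eps *: y) * atom (s j) (r j) 0 (intV k) phi eta (dotR y zeta + c) (x + y, xi + zeta).
have cf k : continuous (f k) by apply: contM; [exact: cont_gauZ0|exact: cont_atom_y].
have df k : dom (E * C) (f k) by move=> y; rewrite normrM mulrAC ler_pM.
have -> : (fun y => chi0 (eps *: y) (eps *: zeta) * B 0 (dotR y zeta + c) j (x + y, xi + zeta)) =
   (fun y => adjc j * (\sum_(k <- kseq (s j)) gau (eps *: zeta) * f k y)).
  by apply/funext => y; rewrite chi0E /blk !mulr_sumr; apply: eq_bigr => k _; rewrite /f /adjc; ring.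
have cg k : continuous (fun y => gau (eps *: zeta) * f k y) by apply: contM => //; exact: contC.
have dg k : dom (`|gau (eps *: zeta)| * (E * C)) (fun y => gau (eps *: zeta) * f k y) by exact: domZ.
rewrite (@intRnZ _ _ (\sum_(k <- @kseq R n (s j)) `|gau (eps *: zeta)| * (E * C))); last 2 first.
- exact: cont_sum.
- move=> y; rewrite mulr_suml; apply: le_trans (ler_norm_sum _ _ _) _.
  by apply: ler_sum => k _; exact: dg.
rewrite (@intRn_sum _ _ _ (kseq (s j)) xpredT (fun=> `|gau (eps *: zeta)| * (E * C)) (fun k y => gau (eps *: zeta) * f k y) cg dg).
by congr (_ * _); apply: eq_bigr => k _; rewrite (intRnZ _ (cf k) (df k)).
Qed.

Lemma cont_blk_y j zeta c : continuous (fun y : V => B 0 (dotR y zeta + c) j (x + y, xi + zeta)).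
Proof.
apply: contM; first exact: contC.
by apply: cont_sum => k; exact: cont_atom_y.
Qed.

Lemma blk_le j : exists C : R, forall tau c z, `|B tau c j z| <= C.
Proof.
have [C hC] := atom_le; exists (`|2 `^ (j%:R * m) * tp| * \sum_(k <- @kseq R n (s j)) C) => tau c z.
rewrite normrM ler_wpM2l//; apply: le_trans (ler_norm_sum _ _ _) _.
by apply: ler_sum => k _.
Qed.

Lemma dom_chi_blk (eps : R) (zeta : V) c j : 0 < eps -> exists C : R, dom C (fun y : V =>
  chi0 (eps *: y) (eps *: zeta) * B 0 (dotR y zeta + c) j (x + y, xi + zeta)).
Proof.
move=> e0; have [C hC] := blk_le j; have [E hE] := dom_gauZ1 (n := n) e0.
exists (`|gau (eps *: zeta)| * (E * C)) => y; rewrite chi0E normrM (normrM (gau _)) -!mulrA ler_wpM2l//.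
by rewrite (mulrC C) mulrA ler_pM//; exact: hE.
Qed.

Lemma cont_chi_blk (eps : R) (zeta : V) c j : continuous (fun y : V =>
  chi0 (eps *: y) (eps *: zeta) * B 0 (dotR y zeta + c) j (x + y, xi + zeta)).
Proof.
apply: contM; last exact: cont_blk_y.
under eq_fun do rewrite chi0E; apply: contM; first exact: contC.
exact: cont_gauZ0.
Qed.

Lemma adjJ_loc eps c N zeta : 0 < eps -> (j0 <= N)%N -> enorm (xi + zeta) < 2 ^+ N / 2 ->
  adjJ eps c zeta = \sum_(j0 <= j < N) adjB eps c j zeta.
Proof.
move=> e0 jN hN; under eq_bigr do rewrite adjB_intRn//.
have [C hC] := choice (fun j => dom_chi_blk zeta c j e0).
rewrite -(@intRn_sum _ _ _ (index_iota j0 N) xpredT C _ (fun j => @cont_chi_blk eps zeta c j) hC).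
by apply: eq_intRn => y; rewrite (syms_loc A m _ jN t00)//= mulr_sumr.
Qed.

(** For fixed [eps] the cut-off in zeta beats the polynomial growth of the symbol, so the partial
    sums have a common majorant. *)
Lemma adjB_sum_dom eps c : 0 < eps -> exists C : R, forall N,
  dom C (fun zeta => \sum_(j0 <= j < N) adjB eps c j zeta).
Proof.
move=> e0.
(* An integer exponent above [m], so that the growth is measured by natural powers. *)
pose K := (Num.truncn `|m|).+1.
have mK : m <= K%:R.
  by apply: le_trans (ler_norm _) (ltW _); have /andP[] := truncn_itv (normr_ge0 m).
have hB c' : exists C : R, 0 <= C /\ forall N z,
    \sum_(j0 <= j < N) `|B 0 c' j z| <= C * (1 + enorm z.2) ^+ K.
  have [C [C0 hC]] := blk_sum_bound A [::] m c' t00; exists C; split=> // N z.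
  apply: le_trans (hC N z) _; rewrite /= subr0 mulr0 addr0 ler_wpM2l//.
  have e1 : 1 <= 1 + enorm z.2 by rewrite lerDl enorm_ge0.
  by rewrite -powR_mulrn ?(le_trans _ e1)// ler_powR.
have [C1 [C10 hC1]] := hB 0; have [C2 [C20 hC2]] := hB (- (pi / 2)).
have [G hG] := dom_gauZ (n := n) K.+1 e0; have [E hE] := dom_gauZ1 (n := n) e0.
have G0 : 0 <= G.
  by have := le_trans (gau_ge0 _) (hG 0); rewrite pmulr_lge0// exprn_gt0// w_gt0.
have E0 := dom_ge0 hE.
have [P [P0 hP]] := lower_bound_pow K xi.
exists ((G * P) * (E * (C1 + C2) * pi ^+ n)) => N zeta.
have [C hC] := choice (fun j => dom_chi_blk zeta c j e0).
have -> : \sum_(j0 <= j < N) adjB eps c j zeta = intRn (fun y =>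
    \sum_(j0 <= j < N) chi0 (eps *: y) (eps *: zeta) * B 0 (dotR y zeta + c) j (x + y, xi + zeta)).
  rewrite (@intRn_sum _ _ _ (index_iota j0 N) xpredT C _ (fun j => @cont_chi_blk eps zeta c j) hC).
  by apply: eq_bigr => j _; rewrite adjB_intRn.
set q := (1 + enorm (xi + zeta)) ^+ K.
have q0 : 0 <= q by rewrite exprn_ge0// addr_ge0// enorm_ge0.
have hq : gau (eps *: zeta) * q <= G * P * w zeta.
  apply: (le_trans (ler_wpM2r q0 (hG zeta))).
  rewrite [leLHS](_ : _ = G * w zeta * (q * w zeta ^+ K)); last by rewrite exprS; ring.
  by rewrite [leRHS]mulrAC ler_wpM2l ?mulr_ge0 ?w_ge0//; exact: hP.
have D0 : 0 <= E * (C1 + C2) * pi ^+ n by rewrite !mulr_ge0 ?addr_ge0 ?exprn_ge0 ?pi_ge0.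
apply: (@le_trans _ _ (gau (eps *: zeta) * q * (E * (C1 + C2) * pi ^+ n))); last first.
  by rewrite [leRHS]mulrAC ler_wpM2r.
rewrite [leRHS](_ : _ = (gau (eps *: zeta) * q * (E * (C1 + C2))) * pi ^+ n); last by ring.
apply: intRn_bound; first by apply: cont_sum => j; exact: cont_chi_blk.
move=> y; apply: le_trans (ler_norm_sum _ _ _) _.
under eq_bigr do rewrite chi0E normrM (normrM (gau _)) -mulrA.
rewrite -mulr_sumr ger0_norm ?gau_ge0// -!mulrA ler_wpM2l ?gau_ge0// -mulr_sumr.
rewrite [leRHS](_ : _ = (E * w y) * (q * (C1 + C2))); last by ring.
apply: ler_pM => //; first by rewrite sumr_ge0.
(* The phase in the blocks moves with y; the values at the two fixed phases 0 and - pi / 2 control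
   all others. *)
apply: (@le_trans _ _ (\sum_(j0 <= j < N) (`|B 0 0 j (x + y, xi + zeta)| + `|B 0 (- (pi / 2)) j (x + y, xi + zeta)|))).
  apply: ler_sum => j _; rewrite blk_phased; apply: le_trans (ler_normB _ _) _.
  rewrite !normrM; apply: lerD; rewrite ler_piMl//; first exact: cos_abs_le1.
  by rewrite ler_norml sin_geN1 sin_le1.
rewrite big_split mulrDr ![q * _]mulrC; apply: lerD; [exact: (hC1 N (_, _))|exact: (hC2 N (_, _))].
Qed.

Lemma cont_atomJ (S r' : R) (k : V) (eps : R) c : 0 < eps -> continuous (atomJ S r' k phi eta eps x xi c).
Proof.
move=> e0; have [C hC] := rap_dom rphi.
have -> : atomJ S r' k phi eta eps x xi c = (fun zeta => (Num.sqrt pi / eps) ^+ n * eta (r' *: (xi + zeta)) *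
  intRn (fun om => wave S k x c om * phi om * gau ((2 * eps)^-1 *: (zeta + S *: (om - k))))).
  by apply/funext => z; rewrite atomJE.
apply: contM.
  apply: contM; first exact: contC.
  under eq_fun do rewrite scalerDr addrC.
  by apply: cont_shift; exact: rap_cont reta.
move=> a; apply: (continuous_intRn (C := C)).
- by move=> u; apply: contM; [apply: contM; [exact: continuous_wave|exact: rap_cont]|exact: cont_gau_center].
- move=> om; apply: contM; first exact: contC.
  under eq_fun do rewrite scalerDr; exact: cont_gauZ.
- move=> u om; rewrite normrM (ger0_norm (gau_ge0 _)).
  apply: (le_trans (ler_wpM2l _ (gau_le1 _))) => //; rewrite mulr1 normrM.
  by apply: (le_trans (ler_wpM2r _ (wave_le1 _ _ _ _ _))); rewrite ?mul1r.
Qed.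

Lemma cont_adjB eps c j : 0 < eps -> continuous (adjB eps c j).
Proof.
move=> e0; apply: contM; first exact: contC.
by apply: cont_sum => k; apply: contM; [exact: cont_gauZ0|exact: cont_atomJ].
Qed.

(** Near a given zeta a fixed finite number of blocks gives the whole integral. *)
Lemma cont_adjJ eps c : 0 < eps -> continuous (adjJ eps c).
Proof.
move=> e0 a; have [N [jN hN]] := exists_scale j0 (enorm (xi + a)).
have near_eq : \forall z \near a, \sum_(j0 <= j < N) adjB eps c j z = adjJ eps c z.
  have oU : open [set z : V | enorm (xi + z) < 2 ^+ N / 2].
    apply: (@open_comp _ _ (fun z : V => enorm (xi + z)) [set u | u < 2 ^+ N / 2]); last exact: open_lt.
    move=> z _; have := cont_shift (f := @enorm R n) (al := 1) (b := xi) (@continuous_enorm R n).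
    by under eq_fun do rewrite scale1r addrC; apply.
  near=> z; rewrite (@adjJ_loc eps c N)//.
  by near: z; apply: (open_nbhs_nbhs (conj oU _)).
rewrite /continuous_at -(nbhs_singleton near_eq).
have h := @cont_sum _ _ _ (index_iota j0 N) xpredT _ (fun j => @cont_adjB eps c j e0) a.
by apply: cvg_trans h; exact: near_eq_cvg near_eq.
Unshelve. all: by end_near. Qed.

Lemma adjB_dom eps c j : 0 < eps -> exists C : R, dom C (adjB eps c j).
Proof.
move=> e0; have [C hC] := blk_le j; have [E hE] := dom_gauZ1 (n := n) e0.
exists (E * (E * C * pi ^+ n)) => zeta; rewrite adjB_intRn//.
rewrite [leRHS](_ : _ = (E * w zeta * (E * C)) * pi ^+ n); last by ring.
apply: intRn_bound; first exact: cont_chi_blk.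
move=> y; rewrite chi0E normrM (normrM (gau _)).
by rewrite [leRHS](_ : _ = E * w zeta * (E * w y) * C) ?ler_pM ?mulr_ge0//; ring.
Qed.

(** At each zeta the partial sums are eventually constant, and the common majorant lets the sum over
    blocks be taken outside the integral. *)
Lemma adjJ_cvg eps c : 0 < eps ->
  \sum_(j0 <= j < N) intRn (adjB eps c j) @[N --> \oo] --> intRn (adjJ eps c).
Proof.
move=> e0; have [C hC] := adjB_sum_dom c e0; have [C' hC'] := choice (fun j => adjB_dom c j e0).
have cB N : continuous (fun zeta => \sum_(j0 <= j < N) adjB eps c j zeta).
  by apply: cont_sum => j; exact: cont_adjB.
have -> : (fun N => \sum_(j0 <= j < N) intRn (adjB eps c j)) =
   (fun N => intRn (fun zeta => \sum_(j0 <= j < N) adjB eps c j zeta)).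
  by apply/funext => N; rewrite (@intRn_sum _ _ _ (index_iota j0 N) xpredT C' _ (fun j => @cont_adjB eps c j e0) hC').
have E N zeta : enorm (xi + zeta) < 2 ^+ N / 2 -> (j0 <= N)%N -> forall M, (N <= M)%N ->
    \sum_(j0 <= j < M) adjB eps c j zeta = adjJ eps c zeta.
  move=> hN jN M NM; rewrite (@adjJ_loc eps c M)//; first exact: leq_trans NM.
  by apply: lt_le_trans hN _; rewrite ler_pM2r ?invr_gt0// ler_weXn2l// ler1n.
apply: (intRn_dct (C := C)) => //.
- exact: cont_adjJ.
- move=> zeta; have [N [jN hN]] := exists_scale j0 (enorm (xi + zeta)).
  rewrite -(E N zeta hN jN N (leqnn N)); exact: hC.
- move=> zeta; have [N [jN hN]] := exists_scale j0 (enorm (xi + zeta)).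
  apply: cvg_near_cst; exists N => // M /= NM.
  by rewrite (E N zeta hN jN M NM).
Qed.

Lemma intRn_adjB eps c j : 0 < eps -> intRn (adjB eps c j) = adjc j * \sum_(k <- kseq (s j))
   intRn (fun zeta => gau (eps *: zeta) * atomJ (s j) (r j) (intV k) phi eta eps x xi c zeta).
Proof.
move=> e0; have [C hC] := atom_le; have [E hE] := dom_gauZ1 (n := n) e0.
set f := fun (k : 'rV[int]_n) zeta => gau (eps *: zeta) * atomJ (s j) (r j) (intV k) phi eta eps x xi c zeta.
have cf k : continuous (f k) by apply: contM; [exact: cont_gauZ0|exact: cont_atomJ].
have df k : dom (E * (E * C * pi ^+ n)) (f k).
  move=> zeta; rewrite normrM mulrAC ler_pM//.
  apply: intRn_bound; first by apply: contM; [exact: cont_gauZ0|exact: cont_atom_y].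
  by move=> y; rewrite normrM mulrAC ler_pM.
rewrite (@intRnZ _ _ (\sum_(k <- @kseq R n (s j)) E * (E * C * pi ^+ n))); last 2 first.
- exact: cont_sum.
- move=> y; rewrite mulr_suml; apply: le_trans (ler_norm_sum _ _ _) _.
  by apply: ler_sum => k _; exact: df.
by rewrite (@intRn_sum _ _ _ (kseq (s j)) xpredT (fun=> E * (E * C * pi ^+ n)) f cf df).
Qed.

(** For 4 |xi| <= 2^j the scaled frequency contributes at most 1/4 of the at least 8/15 needed to
    reach the support of [eta] after the displacement; y has to supply the rest, which exceeds
    1/4. *)
Lemma adj_supp j (k : 'rV[int]_n) om y : (j0 <= j)%N -> 4 * enorm xi <= 2 ^+ j -> k \in kseq (s j) ->
  phi om != 0 -> eta (r j *: (xi + y - s j *: (om - intV k))) != 0 -> 2 ^+ j / 4 <= enorm y.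
Proof.
move=> jj hx kk p0 /(adm_eta0 A)/andP[h1 _].
have h2 := phase_shift_small A jj t11 kk p0; rewrite mul1r in h2.
have [_ h3 _] := kap_num A.
have p2 : 0 < 2 ^+ j :> R by rewrite exprn_gt0.
have h4 : enorm (r j *: (xi + y - s j *: (om - intV k))) <=
    r j * enorm xi + r j * enorm y + enorm (r j *: (s j *: (om - intV k))).
  rewrite scalerBr scalerDr; apply: le_trans (enormB _ _) _; rewrite lerD2r.
  by apply: le_trans (enormD _ _) _; rewrite !enormZ !(gtr0_norm (rj_gt0 j)).
have h5 : r j * enorm xi <= 1 / 4.
  by rewrite rjE mulrC ler_pdivrMr//; lra.
have h6 : 1 / 4 <= r j * enorm y by lra.
by move: h6; rewrite rjE [X in _ <= X]mulrC ler_pdivlMr//; lra.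
Qed.

Lemma size_kseq j : (size (@kseq R n (s j)))%:R <= (3 * 2 ^+ j) ^+ n :> R.
Proof.
have h := @size_lattice R n (kbound (s j)) _ (kseq_uniq (s j)) (fun k kk i => @kseq_box R n _ k i kk).
apply: (@le_trans _ _ (((kbound (s j)).*2.+1)%:R ^+ n)).
  by rewrite -natrX ler_nat.
have s0 := sj_gt0 delta j.
have p1 : 1 <= 2 ^+ j :> R by rewrite exprn_ege1// ler1n.
have sp : s j <= 2 ^+ j.
  rewrite -powR_mulrn// ler_powR ?ler1n//.
  have := adm_d0 A; have := adm_d1 A; have := ler0n R j; nra.
have hM : (kbound (s j))%:R <= s j by have /andP[] := truncn_itv (ltW s0).
rewrite lerXn2r ?nnegrE ?mulr_ge0 ?exprn_ge0//.
by rewrite -natr1 -muln2 natrM; lra.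
Qed.

(** Blocks far above xi vanish in the limit, and do so at a rate summable in j: xi is at distance of
    order 2^j from the displaced support of [eta]. *)
Lemma adjB_tail c : exists C : R, 0 <= C /\ forall j eps, 0 < eps -> eps <= 1 -> (j0 <= j)%N ->
  4 * enorm xi <= 2 ^+ j -> `|tp * intRn (adjB eps c j)| <= eps * C * 2 ^- j.
Proof.
(* Of the exponent [K], the part [Km] pays for 2^(j m), [n] for the number of lattice points, and 1
   leaves the factor 2^(-j). *)
pose Km := (Num.truncn `|m|).+1; pose K := (Km + n + 1)%N.
have mK : m <= Km%:R.
  by apply: le_trans (ler_norm _) (ltW _); have /andP[] := truncn_itv (normr_ge0 m).
have [C [C0 hC]] := adj_atom_tail rphi reta K.
have [Ce hCe] := dom_gauZ1 (n := n) (ltr01 : 0 < (1 : R)).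
exists (`|tp| * (`|tp| * (3 ^+ n * (C * 4 ^+ K)))); split; first by rewrite !mulr_ge0 ?exprn_ge0.
move=> j eps e0 e1 jj hx; set p : R := 2 ^+ j.
have p0 : 0 < p by rewrite exprn_gt0.
have p1 : 1 <= p by rewrite exprn_ege1// ler1n.
have hk k : k \in kseq (s j) -> `|intRn (fun zeta => gau (eps *: zeta) * atomJ (s j) (r j) (intV k) phi eta eps x xi c zeta)| <= C * (eps / (p / 4)) ^+ K.
  by move=> kk; apply: hC => //; [rewrite divr_gt0|move=> om y; exact: adj_supp].
have E : intRn (adjB eps c j) = adjc j * \sum_(k <- kseq (s j))
   intRn (fun zeta => gau (eps *: zeta) * atomJ (s j) (r j) (intV k) phi eta eps x xi c zeta).
  exact: intRn_adjB.
rewrite E normrM [leRHS](_ : _ = `|tp| * (eps * (`|tp| * (3 ^+ n * (C * 4 ^+ K))) / p)); last by ring.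
rewrite ler_wpM2l// normrM /adjc normrM (gtr0_norm (powR_gt0 _ _))//.
have h1 : `|\sum_(k <- kseq (s j)) intRn (fun zeta => gau (eps *: zeta) * atomJ (s j) (r j) (intV k) phi eta eps x xi c zeta)|
   <= (3 * p) ^+ n * (C * (eps / (p / 4)) ^+ K).
  apply: le_trans (ler_norm_sum _ _ _) _.
  apply: (@le_trans _ _ (\sum_(k <- @kseq R n (s j)) C * (eps / (p / 4)) ^+ K)).
    by rewrite big_seq [leRHS]big_seq; apply: ler_sum.
  rewrite big_const_seq count_predT iter_addr_0 -[X in X <= _]mulr_natl.
  by rewrite ler_wpM2r ?size_kseq// mulr_ge0// exprn_ge0// divr_ge0 ?ltW// divr_gt0.
have h2 : 2 `^ (j%:R * m) <= p ^+ Km.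
  by rewrite powRrM powR_mulrn// -[p ^+ Km]powR_mulrn ?(ltW p0)// ler_powR.
have hq : (eps / (p / 4)) ^+ K <= eps * (4 ^+ K * p ^- K).
  have -> : eps / (p / 4) = eps * (4 / p) by field; rewrite gt_eqF.
  have pK : 0 <= p ^- K by rewrite invr_ge0 exprn_ge0// ltW.
  rewrite exprMn expr_div_n ler_wpM2r ?mulr_ge0 ?exprn_ge0//.
  by rewrite /K addn1 exprS ler_piMr ?(ltW e0)// exprn_ile1// ltW.
apply: (@le_trans _ _ (p ^+ Km * (`|tp| * ((3 * p) ^+ n * (C * (eps * (4 ^+ K * p ^- K))))))).
  rewrite -[leLHS]mulrA; apply: ler_pM; [exact: powR_ge0|exact: mulr_ge0|exact: h2|].
  rewrite ler_wpM2l//; apply: le_trans h1 _.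
  by rewrite ler_wpM2l ?exprn_ge0 ?mulr_ge0 ?(ltW p0)// ler_wpM2l.
rewrite le_eqVlt; apply/orP; left; apply/eqP.
rewrite /K !exprD expr1 exprMn; field.
by rewrite !expf_neq0 ?gt_eqF.
Qed.

Lemma adjB_lim c j : exists C : R, forall eps, 0 < eps -> eps <= 1 ->
  `|tp * intRn (adjB eps c j) - B 1 c j (x, xi)| <= eps * C.
Proof.
have [C hC] := choice (fun k : 'rV[int]_n => adj_atom_lim rphi reta (s j) (r j) (intV k) x xi c).
exists (`|adjc j| * \sum_(k <- kseq (s j)) C k) => eps e0 e1.
rewrite intRn_adjB// mulrCA mulr_sumr /blk -/(adjc j) -mulrBr normrM mulrCA ler_wpM2l//.
rewrite -sumrB mulr_sumr; apply: le_trans (ler_norm_sum _ _ _) _.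
by apply: ler_sum => k _; exact: hC.
Qed.

(** A fixed finite number of low blocks converges at rate [eps]; the remaining ones are of total
    size [eps] times a geometric series, and the bound passes to the infinite sum. *)
Lemma adj_limit c : exists C : R, forall eps, 0 < eps -> eps <= 1 ->
  `|tp * intRn (adjJ eps c) - Sy 1 c (x, xi)| <= eps * C.
Proof.
(* The factor 2 provides 4 |xi| < 2^N, as the tail estimate requires. *)
have [N [jN hN]] := exists_scale j0 (2 * enorm xi).
have [C1 hC1] := choice (adjB_lim c); have [C2 [C20 hC2]] := adjB_tail c.
have x0 := enorm_ge0 xi.
exists (\sum_(j0 <= j < N) C1 j + C2 * 2) => eps e0 e1.
have sy : Sy 1 c (x, xi) = \sum_(j0 <= j < N) B 1 c j (x, xi).
  by apply: (syms_loc A) => //=; lra.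
have bnd M : (N <= M)%N -> `|tp * (\sum_(j0 <= j < M) intRn (adjB eps c j)) - Sy 1 c (x, xi)| <=
   eps * (\sum_(j0 <= j < N) C1 j + C2 * 2).
  move=> NM; rewrite sy (@big_cat_nat _ _ _ N)//= mulrDr addrAC !mulr_sumr -sumrB.
  apply: le_trans (ler_normD _ _) _; rewrite mulrDr; apply: lerD.
    rewrite mulr_sumr; apply: le_trans (ler_norm_sum _ _ _) _.
    by apply: ler_sum => j _; exact: hC1.
  apply: le_trans (ler_norm_sum _ _ _) _.
  apply: (@le_trans _ _ (\sum_(N <= j < M) eps * C2 * 2 ^- j)).
    rewrite big_nat [leRHS]big_nat; apply: ler_sum => j /andP[Nj _].
    apply: hC2 => //; first exact: leq_trans Nj.
    apply: (@le_trans _ _ (2 ^+ N)); first by lra.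
    by rewrite ler_weXn2l// ler1n.
  rewrite -mulr_sumr mulrA ler_wpM2l ?mulr_ge0 ?(ltW e0)//.
  have -> : \sum_(N <= j < M) 2 ^- j = 2 * (2 ^- N - 2 ^- M) :> R.
    rewrite -opprB -(telescope_sumr (fun j => 2 ^- j : R) NM) -sumrN mulr_sumr.
    apply: eq_bigr => j _; rewrite opprB exprS; field.
    by rewrite expf_neq0.
  have a1 : 2 ^- N <= 1 :> R by rewrite invf_le1 ?exprn_gt0// exprn_ege1// ler1n.
  have a2 : 0 <= 2 ^- M :> R by rewrite invr_ge0 exprn_ge0.
  lra.
have cv : `|tp * (\sum_(j0 <= j < M) intRn (adjB eps c j)) - Sy 1 c (x, xi)| @[M --> \oo] -->
    `|tp * intRn (adjJ eps c) - Sy 1 c (x, xi)|.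
  apply: cvg_norm; apply: cvgB; last exact: cvg_cst.
  by apply: cvgM; [exact: cvg_cst|exact: adjJ_cvg].
rewrite -(cvg_lim _ cv)//; apply: limr_le; first by apply/cvg_ex; eexists; exact: cv.
by exists N => // M /= NM; exact: bnd.
Qed.

Lemma adjoint_syms : adjoint_symbol (sigma_delta delta m phi eta j0) x xi =
  Complex (Sy 1 0 (x, xi)) (Sy 1 (pi / 2) (x, xi)).
Proof.
rewrite /adjoint_symbol; under eq_fun do rewrite adj_epsE.
congr Complex; last first.
  apply: cvg_lim => //; under eq_fun do rewrite adj_epsE.
  have [C hC] := adj_limit (pi / 2); exact: cvg_linear_right hC.
by apply: cvg_lim => //; have [C hC] := adj_limit 0; exact: cvg_linear_right hC.
Qed.

End Adm.
End Adjoint.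

(** * Complex-valued integrals *)

Section ComplexAbs.
Context {R : realType}.
Implicit Types (a b : R[i]) (t : R).

Lemma cabsE a : cabs a = Normc.normc a. Proof. by case: a. Qed.
Lemma cabs_ge0 a : 0 <= cabs a. Proof. exact: sqrtr_ge0. Qed.
Lemma cabsM a b : cabs (a * b) = cabs a * cabs b.
Proof. by rewrite !cabsE Normc.normcM. Qed.
Lemma cabsD a b : cabs (a + b) <= cabs a + cabs b.
Proof. by rewrite !cabsE le_normcD. Qed.
Lemma cabsN a : cabs (- a) = cabs a. Proof. by rewrite !cabsE normcN. Qed.
Lemma cabsB a b : cabs (a - b) <= cabs a + cabs b.
Proof. by rewrite -(cabsN b) cabsD. Qed.
Lemma cabs0 : cabs (0 : R[i]) = 0. Proof. by rewrite cabsE Normc.normc0. Qed.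
Lemma cabs1 : cabs (1 : R[i]) = 1. Proof. by rewrite cabsE Normc.normc1. Qed.
Lemma cabs_conj a : cabs (conjc a) = cabs a.
Proof. by case: a => x y; rewrite /cabs /= sqrrN. Qed.
Lemma cabs_real t : cabs t%:C%C = `|t|.
Proof. by rewrite /cabs /= expr0n addr0 sqrtr_sqr. Qed.
Lemma cabs_expi t : cabs (expi t) = 1.
Proof. by rewrite /cabs /= cos2Dsin2 sqrtr1. Qed.
Lemma re_le_cabs a : `|reC a| <= cabs a.
Proof. by rewrite -sqrtr_sqr ler_wsqrtr// lerDl sqr_ge0. Qed.
Lemma im_le_cabs a : `|imC a| <= cabs a.
Proof. by rewrite -sqrtr_sqr ler_wsqrtr// lerDr sqr_ge0. Qed.
Lemma cabs_le_parts a : cabs a <= `|reC a| + `|imC a|.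
Proof. by case: a => x y; exact: cabs_le. Qed.

Lemma reCB a b : reC (a - b) = reC a - reC b. Proof. by case: a b => [? ?] [? ?]. Qed.
Lemma imCB a b : imC (a - b) = imC a - imC b. Proof. by case: a b => [? ?] [? ?]. Qed.

Lemma cabs_sum I (s : seq I) (P : pred I) (f : I -> R[i]) :
  cabs (\sum_(i <- s | P i) f i) <= \sum_(i <- s | P i) cabs (f i).
Proof.
apply: (big_rec2 (fun a (t : R) => cabs a <= t)); first by rewrite cabs0.
by move=> i t a _ h; apply: le_trans (cabsD _ _) _; rewrite lerD2l.
Qed.

Lemma cabs_eq0 a : cabs a = 0 -> a = 0.
Proof. by rewrite cabsE => /Normc.eq0_normc. Qed.

Lemma cabs_gt0 a : a != 0 -> 0 < cabs a.
Proof. by move=> a0; rewrite lt_def cabs_ge0 andbT; apply: contra a0 => /eqP /cabs_eq0 ->. Qed.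

Lemma expiD (t u : R) : expi (t + u) = expi t * expi u.
Proof.
apply: complex_ext; rewrite ?reCM ?imCM /= ?cosD ?sinD//.
by rewrite addrC mulrC (mulrC (sin t)).
Qed.

Lemma expi0 : expi (0 : R) = 1.
Proof. by apply: complex_ext => /=; rewrite ?cos0 ?sin0. Qed.

Lemma conj_expi (t : R) : conjc (expi t) = expi (- t).
Proof. by apply: complex_ext => /=; rewrite ?cosN ?sinN. Qed.

Lemma conjM a b : conjc (a * b) = conjc a * conjc b. Proof. exact: rmorphM. Qed.

Lemma conj_sum I (s : seq I) (P : pred I) (f : I -> R[i]) :
  conjc (\sum_(i <- s | P i) f i) = \sum_(i <- s | P i) conjc (f i).
Proof. exact: rmorph_sum. Qed.

Lemma conj_real (t : R) : conjc t%:C%C = t%:C%C.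
Proof. exact: conjc_real. Qed.

Lemma lip_expi (t : R) : cabs (expi t - 1) <= 2 * `|t|.
Proof.
have h (f f' : R -> R) : (forall x : R, is_derive x (1 : R) f (f' x)) -> (forall x, `|f' x| <= 1) ->
    `|f t - f 0| <= `|t|.
  move=> df bf; have := @mvt_dir R R f 0 1 (fun u => f' (0 + u *: 1)) 1 t (fun u => df _) (fun u _ => bf _).
  by rewrite add0r /GRing.scale /= mulr1 mul1r.
apply: le_trans (cabs_le_parts _) _; rewrite reCD imCD /= subr0 mulr_natl mulr2n.
apply: lerD.
  by rewrite -[in 1](@cos0 R); apply: (h cos (fun x => - sin x)) => x; rewrite normrN ler_norml sin_geN1 sin_le1.
by rewrite -[sin t]subr0 -[in X in _ - X](@sin0 R); apply: (h sin cos) => x; exact: cos_abs_le1.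
Qed.

End ComplexAbs.

Section ComplexContinuity.
Context {R : realType} {T : topologicalType}.
Implicit Types f g : T -> R[i].

Definition ccont f := continuous (fun x => reC (f x)) /\ continuous (fun x => imC (f x)).

Lemma ccontM f g : ccont f -> ccont g -> ccont (fun x => f x * g x).
Proof.
move=> [f1 f2] [g1 g2]; split.
  by under eq_fun do rewrite reCM; apply: contB; apply: contM.
by under eq_fun do rewrite imCM; apply: contD; apply: contM.
Qed.

Lemma ccontD f g : ccont f -> ccont g -> ccont (fun x => f x + g x).
Proof.
move=> [f1 f2] [g1 g2]; split.
  by under eq_fun do rewrite reCD; apply: contD.
by under eq_fun do rewrite imCD; apply: contD.
Qed.

Lemma ccontC (z : R[i]) : ccont (fun _ => z).
Proof. by split; exact: contC. Qed.

Lemma ccont_conj f : ccont f -> ccont (fun x => conjc (f x)).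
Proof.
move=> [f1 f2]; split; first by under eq_fun do rewrite reC_conj.
by under eq_fun do rewrite imC_conj; exact: contN.
Qed.

Lemma ccont_sum I (s : seq I) (F : I -> T -> R[i]) : (forall i, ccont (F i)) ->
  ccont (fun x => \sum_(i <- s) F i x).
Proof.
move=> hF; split.
  by under eq_fun do rewrite reC_sum; apply: cont_sum => i; have [] := hF i.
by under eq_fun do rewrite imC_sum; apply: cont_sum => i; have [] := hF i.
Qed.

Lemma ccont_real (f : T -> R) : continuous f -> ccont (fun x => (f x)%:C%C).
Proof. by move=> cf; split => //; exact: contC. Qed.

Lemma ccont_expi (f : T -> R) : continuous f -> ccont (fun x => expi (f x)).
Proof.
move=> cf; split.
  exact: cont_comp (@continuous_cos R) cf.
exact: cont_comp (@continuous_sin R) cf.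
Qed.

End ComplexContinuity.

Section ComplexIntegral.
Context {R : realType} {n : nat}.
Notation V := 'rV[R]_n.
Notation tp := (@twopin R n).
Implicit Types f g : V -> R[i].

Definition cdom (C : R) f := forall x, cabs (f x) <= C * w x.

Lemma cdom_re C f : cdom C f -> dom C (fun x => reC (f x)).
Proof. by move=> h x; apply: le_trans (re_le_cabs _) (h x). Qed.

Lemma cdom_im C f : cdom C f -> dom C (fun x => imC (f x)).
Proof. by move=> h x; apply: le_trans (im_le_cabs _) (h x). Qed.

Lemma cdom_ge0 C f : cdom C f -> 0 <= C.
Proof. by move=> /cdom_re /dom_ge0. Qed.

Lemma eq_cint f g : (forall x, f x = g x) -> cint f = cint g.
Proof. by move=> /funext ->. Qed.

Lemma cint_bound C f : ccont f -> cdom C f -> cabs (cint f) <= 2 * (C * pi ^+ n).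
Proof.
move=> [c1 c2] h; apply: le_trans (cabs_le_parts _) _.
by rewrite mulr_natl mulr2n; apply: lerD; apply: intRn_bound => //;
  [exact: cdom_re|exact: cdom_im].
Qed.

Lemma cintZ C (z : R[i]) f : ccont f -> cdom C f -> cint (fun x => z * f x) = z * cint f.
Proof.
move=> [c1 c2] h; have d1 := cdom_re h; have d2 := cdom_im h.
have e (r : R) (g : V -> R) : continuous g -> dom C g ->
    [/\ continuous (fun x => r * g x), dom (`|r| * C) (fun x => r * g x) & intRn (fun x => r * g x) = r * intRn g].
  move=> cg dg; split; [by apply: contM => //; exact: contC|exact: domZ|exact: intRnZ dg].
have [a1 b1 e1] := e (reC z) _ c1 d1; have [a2 b2 e2] := e (imC z) _ c2 d2.
have [a3 b3 e3] := e (reC z) _ c2 d2; have [a4 b4 e4] := e (imC z) _ c1 d1.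
apply: complex_ext; rewrite ?reCM ?imCM /=.
  by under eq_intRn do rewrite reCM; rewrite (intRnB a1 b1 a2 b2) e1 e2.
by under eq_intRn do rewrite imCM; rewrite (intRnD a3 b3 a4 b4) e3 e4.
Qed.

Lemma cint_sum I (s : seq I) (C : I -> R) (F : I -> V -> R[i]) :
  (forall i, ccont (F i)) -> (forall i, cdom (C i) (F i)) ->
  cint (fun x => \sum_(i <- s) F i x) = \sum_(i <- s) cint (F i).
Proof.
move=> cF dF; apply: complex_ext; rewrite ?reC_sum ?imC_sum /=.
  under eq_intRn do rewrite reC_sum.
  rewrite (@intRn_sum _ _ _ s xpredT C (fun i x => reC (F i x)))// => i; first by have [] := cF i.
  exact: cdom_re.
under eq_intRn do rewrite imC_sum.
rewrite (@intRn_sum _ _ _ s xpredT C (fun i x => imC (F i x)))// => i; first by have [] := cF i.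
exact: cdom_im.
Qed.

Lemma cintB C D f g : ccont f -> cdom C f -> ccont g -> cdom D g ->
  cint (fun x => f x - g x) = cint f - cint g.
Proof.
move=> [c1 c2] df [d1 d2] dg; apply: complex_ext => /=.
  under eq_intRn do rewrite reCB.
  by rewrite (intRnB c1 (cdom_re df) d1 (cdom_re dg)).
under eq_intRn do rewrite imCB.
by rewrite (intRnB c2 (cdom_im df) d2 (cdom_im dg)).
Qed.

Lemma cint_conj f : (exists C, cdom C f) -> ccont f -> cint (fun x => conjc (f x)) = conjc (cint f).
Proof.
move=> [C dC] [c1 c2]; apply: complex_ext; rewrite ?reC_conj ?imC_conj /=.
  by apply: eq_intRn => x; rewrite reC_conj.
by under eq_intRn do rewrite imC_conj; rewrite (intRnN c2 (cdom_im dC)).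
Qed.

Lemma cint_swap C (f : V -> V -> R[i]) :
  (forall x, ccont (f x)) -> (forall y, ccont (f^~ y)) ->
  (forall x y, cabs (f x y) <= C * w x * w y) ->
  cint (fun x => cint (fun y => f x y)) = cint (fun y => cint (fun x => f x y)).
Proof.
move=> c1 c2 df; apply: complex_ext => /=.
  apply: (intRn_swap (C := C) (f := fun x y => reC (f x y))) => x; first by have [] := c1 x.
    by have [] := c2 x.
  by move=> y; apply: le_trans (re_le_cabs _) (df x y).
apply: (intRn_swap (C := C) (f := fun x y => imC (f x y))) => x; first by have [] := c1 x.
  by have [] := c2 x.
by move=> y; apply: le_trans (im_le_cabs _) (df x y).
Qed.

Lemma cint_affine C f (al : R) (b : V) : 0 < al -> ccont f -> cdom C f ->
  cint (fun x => f (al *: x + b)) = (al ^- n)%:C%C * cint f.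
Proof.
move=> al0 [c1 c2] df; apply: complex_ext; rewrite ?reC_real ?imC_real /=.
  exact: (intRn_affine _ al0 c1 (cdom_re df)).
exact: (intRn_affine _ al0 c2 (cdom_im df)).
Qed.

Lemma ccont_cint C (W : normedModType R) (f : W -> V -> R[i]) :
  (forall u, ccont (f u)) -> (forall x, ccont (f^~ x)) -> (forall u, cdom C (f u)) ->
  ccont (fun u => cint (f u)).
Proof.
move=> c1 c2 df; split=> a.
  apply: (continuous_intRn (C := C) (f := fun u x => reC (f u x))) => [u|x|u]; first by have [] := c1 u.
    by have [h _] := c2 x; exact: h.
  exact: cdom_re.
apply: (continuous_intRn (C := C) (f := fun u x => imC (f u x))) => [u|x|u]; first by have [] := c1 u.
  by have [_ h] := c2 x; exact: h.
exact: cdom_im.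
Qed.

Lemma ccont_shift f (al : R) (b : V) : ccont f -> ccont (fun x : V => f (al *: x + b)).
Proof.
move=> [c1 c2]; split.
  exact: (cont_shift (f := fun x => reC (f x))).
exact: (cont_shift (f := fun x => imC (f x))).
Qed.

Lemma cdom_mul (C D : R) f g : cdom C f -> (forall x, cabs (g x) <= D) ->
  cdom (C * D) (fun x => g x * f x).
Proof. by move=> df dg x; rewrite cabsM mulrAC mulrC ler_pM ?cabs_ge0. Qed.

Definition crap f := rap (fun x => reC (f x)) /\ rap (fun x => imC (f x)).

Lemma crap_cont f : crap f -> ccont f.
Proof. by move=> [r1 r2]; split; exact: rap_cont. Qed.

Lemma crap_wbound f (K : nat) : crap f -> exists C : R, 0 <= C /\ forall x, cabs (f x) <= C * w x ^+ K.
Proof.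
move=> [r1 r2]; have [C1 h1] := wf_bound (r1 K 0%N); have [C2 h2] := wf_bound (r2 K 0%N).
exists (`|C1| + `|C2|); split; first by rewrite addr_ge0.
move=> x; apply: le_trans (cabs_le_parts _) _; rewrite mulrDl.
have p : 0 <= w x ^+ K by rewrite exprn_ge0// w_ge0.
apply: lerD; [apply: le_trans (h1 tt x) _|apply: le_trans (h2 tt x) _];
  by rewrite mul1r ler_wpM2r// ler_norm.
Qed.

Lemma crap_dom f : crap f -> exists C : R, cdom C f.
Proof. by move=> /(crap_wbound 1) [C [_ h]]; exists C => x; have := h x; rewrite expr1. Qed.

Lemma crap_real (f : V -> R) : rap f -> crap (fun x => (f x)%:C%C).
Proof.
move=> rf; split => //= K N.
have -> : (fun (p : unit) (x : V) => 0 : R) = (fun p x => 0 * f x).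
  by apply/funext => p; apply/funext => x; rewrite mul0r.
by apply: (@wfZ _ _ _ _ N _ (fun=> 0)); [exists 0 => _; rewrite normr0|exact: rf].
Qed.

Lemma rap_schwartz f : crap f -> schwartz f.
Proof. by move=> [r1 r2]; split; exact: rapid_schwartzR. Qed.

Lemma schwartz_crap f : schwartz f -> crap f.
Proof. by move=> [r1 r2]; split; exact: schwartzR_rapid. Qed.

Lemma crap_lip f : crap f -> exists2 L : R, 0 <= L & forall x y, cabs (f (x + y) - f x) <= L * n1 y.
Proof.
move=> [r1 r2]; have [L1 a1 h1] := rap_lip r1; have [L2 a2 h2] := rap_lip r2.
exists (L1 + L2); first exact: addr_ge0.
move=> x y; apply: le_trans (cabs_le_parts _) _; rewrite mulrDl.
by rewrite reCB imCB; apply: lerD.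
Qed.

Lemma rapZ (r : R) (f : V -> R) : rap f -> rap (fun x => r * f x).
Proof. by move=> rf K N; apply: (@wfZ _ _ _ _ N _ (fun=> r)); [exists (`|r|)|exact: rf]. Qed.

Lemma rapD (f g : V -> R) : rap f -> rap g -> rap (fun x => f x + g x).
Proof. exact: rapidD. Qed.

Lemma rap_FT (f : V -> R) c : rap f -> rap (fun u => FT f u c).
Proof. by move=> rf; apply: (@rapid_FT _ _ unit (fun=> f) (fun=> 1) (fun=> c)). Qed.

(** The factor i in front of the imaginary part of [f] is a quarter turn of the phase. *)
Lemma ifourier_parts C f x : ccont f -> cdom C f -> ifourier f x =
  phc (fun c => tp * (FT (fun y => reC (f y)) x c + FT (fun y => imC (f y)) x (c + pi / 2))).
Proof.
move=> [c1 c2] df; have h1 := cdom_re df; have h2 := cdom_im df.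
have E c : FT (fun y => reC (f y)) x c + FT (fun y => imC (f y)) x (c + pi / 2) =
    intRn (fun y => cos (dotR x y + c) * reC (f y) - sin (dotR x y + c) * imC (f y)).
  rewrite /FT -(intRnD (C := C) (D := C)).
  - by apply: eq_intRn => y; rewrite addrA cosDpihalf' mulNr.
  - by apply: contM; [exact: continuous_phase|exact: c1].
  - exact: dom_phase.
  - by apply: contM; [exact: continuous_phase|exact: c2].
  - exact: dom_phase.
rewrite /ifourier -phcZ; congr (_ * _); rewrite /phc !E; apply: complex_ext => /=; apply: eq_intRn => y.
  by rewrite reCM /= addr0.
by rewrite imCM /= cosBpihalf sinBpihalf mulNr opprK addrC.
Qed.

Lemma crap_ifourier f : crap f -> crap (ifourier f).
Proof.
move=> cf; have [r1 r2] := cf.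
have E c : rap (fun x => tp * (FT (fun y => reC (f y)) x c + FT (fun y => imC (f y)) x (c + pi / 2))).
  by apply: rapZ; apply: rapD; exact: rap_FT.
have -> : ifourier f = fun x => phc (fun c => tp * (FT (fun y => reC (f y)) x c + FT (fun y => imC (f y)) x (c + pi / 2))).
  by apply/funext => x; have [C hC] := crap_dom cf; exact: ifourier_parts (crap_cont cf) hC.
by split; exact: E.
Qed.

Lemma two_pi_tp : tp * (2 * pi) ^+ n = 1 :> R.
Proof. by rewrite mulVf// expf_neq0// mulf_neq0// gt_eqF// pi_gt0. Qed.

Lemma fourier_ifourier f xi : crap f -> fourier (ifourier f) xi = f xi.
Proof.
move=> cf; have [r1 r2] := cf.
have cF (g : V -> R) c : rap g -> continuous (fun x => FT g x (c - dotR x xi)).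
  move=> rg; have [C hC] := rap_dom rg.
  apply: (cont_FT (rap_cont rg) hC) => [x|].
    by under eq_fun do rewrite dotRC; exact: continuous_dotR.
  by apply: contB; [exact: contC|under eq_fun do rewrite dotRC; exact: continuous_dotR].
have dF (g : V -> R) c : rap g -> exists C, dom C (fun x => FT g x (c - dotR x xi)).
  move=> rg; have [C hC] := FT_decay 1 (rapid1 rg).
  by exists C => x; have := hC tt x (c - dotR x xi); rewrite mulr1 expr1.
have E c : intRn (fun x => tp * (FT (fun y => reC (f y)) x (c - dotR x xi) +
     FT (fun y => imC (f y)) x (c - dotR x xi + pi / 2))) = cos c * reC (f xi) + cos (c + pi / 2) * imC (f xi).
  have cc := cF _ c r1; have [C dC] := dF _ c r1.
  have [cd [D dD]] := (cF _ (c + pi / 2) r2, dF _ (c + pi / 2) r2).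
  have e x : FT (fun y => imC (f y)) x (c - dotR x xi + pi / 2) = FT (fun y => imC (f y)) x (c + pi / 2 - dotR x xi).
    by rewrite addrAC.
  under eq_intRn do rewrite e.
  rewrite (intRnZ (C := C + D)); last 2 first.
  - exact: contD.
  - exact: domD.
  rewrite (intRnD cc dC cd dD) !FT_inversion// mulrDr !mulrA two_pi_tp !mul1r//.
rewrite /fourier.
have -> : (fun x => expi (- dotR xi x) * ifourier f x) = (fun x => phc (fun c =>
    tp * (FT (fun y => reC (f y)) x (c - dotR x xi) + FT (fun y => imC (f y)) x (c - dotR x xi + pi / 2)))).
  apply/funext => x; have [C0 hC0] := crap_dom cf; rewrite (ifourier_parts x (crap_cont cf) hC0) expi_phc.
    by rewrite (dotRC xi).
  move=> c; have [C hC] := rap_dom r1; have [D hD] := rap_dom r2.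
  have p1 := phased_intRn (@continuous_dotR R n x) (rap_cont r1) hC.
  have p2 := phased_shift (pi / 2) (phased_intRn (@continuous_dotR R n x) (rap_cont r2) hD).
  by rewrite /FT (p1 c) (p2 c) /=; ring.
rewrite (cint_phc (fun c x => tp * _)) /phc !E; apply: complex_ext => /=.
  by rewrite cos0 add0r cos_pihalf mul0r addr0 mul1r.
by rewrite cosN cos_pihalf mul0r add0r addNr cos0 mul1r.
Qed.

End ComplexIntegral.

(** * Short-time Fourier transform of wave packets *)

Section WavePackets.
Context {R : realType} {n : nat}.
Notation V := 'rV[R]_n.
Notation tp := (@twopin R n).
Implicit Types (f gamma : V -> R[i]) (b v x xi t : V).

Context (phi : V -> R) (rphi : rap phi).

Definition Phi : V -> R[i] := ifourier (fun z => (phi z)%:C%C).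

(** The spectrum is b + e supp [phi]. The scale [e] carries a sign, so that conjugate packets, with
    scale - s, have the same shape. *)
Definition wpk b (e d : R) v t : R[i] := expi (dotR b t + d) * Phi (e *: t + v).

Lemma crap_Phi : crap Phi.
Proof. by apply: crap_ifourier; exact: crap_real. Qed.

Lemma PhiE y : Phi y = tp%:C%C * cint (fun om => expi (dotR y om) * (phi om)%:C%C).
Proof. by []. Qed.

Lemma ccont_wpk b e d v : ccont (wpk b e d v).
Proof.
apply: ccontM; last by apply: ccont_shift; exact: crap_cont crap_Phi.
by apply: ccont_expi; apply: contD; [exact: continuous_dotR|exact: contC].
Qed.

Lemma Phi_le : exists C : R, 0 <= C /\ forall y, cabs (Phi y) <= C.
Proof.
have [C [C0 hC]] := crap_wbound 0 crap_Phi; exists C; split=> // y.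
by have := hC y; rewrite expr0 mulr1.
Qed.

Lemma wpk_le C b e d v : (forall y, cabs (Phi y) <= C) -> forall t, cabs (wpk b e d v t) <= C.
Proof. by move=> hC t; rewrite cabsM cabs_expi mul1r. Qed.

Section Stft.
Context (gamma : V -> R[i]) (cgam : crap gamma).

Definition win x xi t : R[i] := conjc (expi (dotR xi t) * gamma (t - x)).

Lemma stftE f x xi : stft gamma f x xi = cint (fun t => f t * win x xi t).
Proof. by []. Qed.

Lemma ccont_gshift x : ccont (fun t => gamma (t - x)).
Proof.
have := ccont_shift (f := gamma) 1 (- x) (crap_cont cgam).
by rewrite (_ : (fun y : V => gamma (1 *: y - x)) = (fun t => gamma (t - x)))//; apply/funext => y; rewrite scale1r.
Qed.

Lemma ccont_win x xi : ccont (win x xi).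
Proof.
apply: ccont_conj; apply: ccontM; last exact: ccont_gshift.
by apply: ccont_expi; exact: continuous_dotR.
Qed.

Lemma cabs_win x xi t : cabs (win x xi t) = cabs (gamma (t - x)).
Proof. by rewrite cabs_conj cabsM cabs_expi mul1r. Qed.

Lemma cdom_gshift x : exists2 C : R, 0 <= C & forall t, cabs (gamma (t - x)) <= C * w t.
Proof.
have [C [C0 hC]] := crap_wbound 1 cgam.
have [D D0 hD] := w_affine (- x) (ltr01 : 0 < (1 : R)).
exists (C * D); first exact: mulr_ge0.
move=> t; apply: le_trans (hC _) _; rewrite expr1 -mulrA ler_wpM2l//.
by have := hD t; rewrite scale1r.
Qed.

Lemma win_dom x : exists2 C : R, 0 <= C & forall xi, cdom C (win x xi).
Proof. by have [C C0 hC] := cdom_gshift x; exists C => // xi t; rewrite cabs_win. Qed.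

Lemma stft_int f (B : R) x xi : ccont f -> (forall t, cabs (f t) <= B) ->
  exists C, ccont (fun t => f t * win x xi t) /\ cdom C (fun t => f t * win x xi t).
Proof.
move=> cf bf; have [C C0 hC] := win_dom x; exists (C * B); split.
  by apply: ccontM => //; exact: ccont_win.
exact: cdom_mul.
Qed.

Lemma ccont_stft f (B : R) x (h : V -> V) : ccont f -> (forall t, cabs (f t) <= B) ->
  (forall t, continuous (fun om => dotR (h om) t)) -> ccont (fun om => stft gamma f x (h om)).
Proof.
move=> cf bf ch; have [C C0 hC] := win_dom x.
apply: (ccont_cint (C := C * B) (f := fun om t => f t * win x (h om) t)).
- by move=> om; apply: ccontM => //; exact: ccont_win.
- move=> t; apply: ccontM; first exact: ccontC.
  by apply: ccont_conj; apply: ccontM; [apply: ccont_expi; exact: ch|exact: ccontC].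
- by move=> om; exact: cdom_mul.
Qed.

(** Expanding [Phi] as a Fourier integral writes the packet as a superposition of pure waves of
    frequency b + e om; each wave only translates the transform of [f] in frequency. *)
Lemma stft_wpk f (B : R) b e d v x xi : ccont f -> (forall t, cabs (f t) <= B) ->
  stft gamma (fun t => wpk b e d v t * f t) x xi =
  tp%:C%C * cint (fun om => expi (d + dotR v om) * (phi om)%:C%C * stft gamma f x (xi - b - e *: om)).
Proof.
move=> cf bf; have [Cg Cg0 hCg] := win_dom x.
have B0 : 0 <= B := le_trans (cabs_ge0 _) (bf 0).
have [Cp [Cp0 hCp]] := crap_wbound 1 (crap_real rphi).
have hCp' om : cabs (phi om)%:C%C <= Cp * w om by have := hCp om; rewrite expr1.
have cphi : ccont (fun om => (phi om)%:C%C) by apply: ccont_real; exact: rap_cont.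
pose q t om := expi (d + dotR v om) * (phi om)%:C%C * (f t * win x (xi - b - e *: om) t).
have qE t om : q t om = (expi (dotR b t + d) * f t * win x xi t) * (expi (dotR (e *: t + v) om) * (phi om)%:C%C).
  rewrite /q /win !conjM !conj_expi.
  have -> : - dotR (xi - b - e *: om) t = - dotR xi t + dotR b t + dotR (e *: t) om.
    rewrite !dotRBl !dotRZl (dotRC om); ring.
  rewrite dotRDl !expiD; ring.
have c1 t : ccont (q t).
  have -> : q t = (fun om => (expi (dotR b t + d) * f t * win x xi t) * (expi (dotR (e *: t + v) om) * (phi om)%:C%C)).
    by apply/funext => om; rewrite qE.
  apply: ccontM; first exact: ccontC.
  by apply: ccontM => //; apply: ccont_expi; exact: continuous_dotR.
have c2 om : ccont (q^~ om).
  apply: ccontM; first exact: ccontC.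
  by apply: ccontM => //; exact: ccont_win.
have dq t om : cabs (q t om) <= B * Cg * Cp * w t * w om.
  rewrite !cabsM cabs_expi mul1r.
  rewrite [leRHS](_ : _ = (Cp * w om) * (B * (Cg * w t))); last by ring.
  apply: ler_pM; [exact: cabs_ge0|by rewrite mulr_ge0 ?cabs_ge0|exact: hCp'|].
  by apply: ler_pM; rewrite ?cabs_ge0//; exact: hCg.
have -> : stft gamma (fun t => wpk b e d v t * f t) x xi = cint (fun t => tp%:C%C * cint (q t)).
  apply: eq_cint => t.
  have -> : q t = (fun om => (expi (dotR b t + d) * f t * win x xi t) * (expi (dotR (e *: t + v) om) * (phi om)%:C%C)).
    by apply/funext => om; rewrite qE.
  rewrite (cintZ (C := Cp)); last 2 first.
  - by apply: ccontM => //; apply: ccont_expi; exact: continuous_dotR.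
  - by move=> om; rewrite cabsM cabs_expi mul1r; have := hCp om; rewrite expr1.
  rewrite /wpk PhiE -/(win x xi t); ring.
rewrite (cintZ (C := 2 * (B * Cg * Cp * pi ^+ n))); last 2 first.
- apply: (ccont_cint (C := B * Cg * Cp)) => // t om.
  by apply: le_trans (dq t om) _; rewrite ler_wpM2r ?w_ge0// ler_piMr ?w_le1// !mulr_ge0.
- move=> t; have h : cdom (B * Cg * Cp * w t) (q t) by exact: dq.
  have := cint_bound (c1 t) h; rewrite [leRHS](_ : _ = 2 * (B * Cg * Cp * pi ^+ n) * w t)//; ring.
rewrite (cint_swap c1 c2 dq); congr (_ * cint _); apply/funext => om.
have [C [cs ds]] := stft_int x (xi - b - e *: om) cf bf.
by rewrite /q (cintZ _ cs ds).
Qed.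

(** Starting point for products of packets, regarded as packets acting on the constant function 1;
    the transform of 1 decays in frequency like that of the window. *)
Lemma stft_one x xi : stft gamma (fun=> 1) x xi = expi (- dotR xi x) * (tp^-1%:C%C * conjc (ifourier gamma xi)).
Proof.
have [C hC] := crap_dom cgam.
have tp0 : tp != 0 :> R by rewrite invr_eq0 expf_neq0// mulf_neq0// gt_eqF// pi_gt0.
pose f t := expi (dotR xi t) * gamma t.
have cf : ccont f.
  by apply: ccontM; [apply: ccont_expi; exact: continuous_dotR|exact: crap_cont].
have df : cdom C f by move=> t; rewrite cabsM cabs_expi mul1r.
have -> : tp^-1%:C%C * conjc (ifourier gamma xi) = cint (fun t => conjc (f t)).
  rewrite cint_conj//; last by exists C.
  by rewrite /ifourier conjM conj_real mulrA -rmorphM mulVf// rmorph1 mul1r.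
have ccf : ccont (fun t => conjc (f t)) by exact: ccont_conj.
have dcf : cdom C (fun t => conjc (f t)) by move=> t; rewrite cabs_conj.
have := cint_affine (- x) (ltr01 : 0 < (1 : R)) ccf dcf.
rewrite expr1n invr1 mul1r => <-.
have [C' [c' d']] : exists C', ccont (fun t => conjc (f (1 *: t - x))) /\ cdom C' (fun t => conjc (f (1 *: t - x))).
  have [D D0 hD] := w_affine (- x) (ltr01 : 0 < (1 : R)).
  exists (C * D); split; first exact: ccont_shift ccf.
  move=> t; apply: le_trans (dcf _) _; rewrite -mulrA ler_wpM2l ?hD//; exact: cdom_ge0 df.
rewrite -(cintZ _ c' d'); apply: eq_cint => t.
rewrite mul1r scale1r /f !conjM !conj_expi mulrA -expiD; congr (expi _ * _).
by rewrite dotRBr; ring.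
Qed.

Lemma stft_one_le (K : nat) : exists C : R, 0 <= C /\ forall x xi, cabs (stft gamma (fun=> 1) x xi) <= C * w xi ^+ K.
Proof.
have [C [C0 hC]] := crap_wbound K (crap_ifourier cgam).
exists (`|tp^-1| * C); split; first by rewrite mulr_ge0.
by move=> x xi; rewrite stft_one !cabsM cabs_expi mul1r cabs_conj cabs_real -mulrA ler_wpM2l.
Qed.

(* The Fourier transforms of the factors live where [phi] does, so only the values of [w] at the
   possible frequencies matter. *)
Lemma stft_wpk_le : exists C : R, 0 <= C /\ forall f (B : R) b e d v x xi D,
  ccont f -> (forall t, cabs (f t) <= B) ->
  (forall om, phi om != 0 -> cabs (stft gamma f x (xi - b - e *: om)) <= D) -> 0 <= D ->
  cabs (stft gamma (fun t => wpk b e d v t * f t) x xi) <= C * D.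
Proof.
have [Cp [Cp0 hCp]] := crap_wbound 1 (crap_real rphi).
exists (`|tp| * (2 * (Cp * pi ^+ n))); split.
  by rewrite !mulr_ge0// exprn_ge0// pi_ge0.
move=> f B b e d v x xi D cf bf hD D0.
rewrite (stft_wpk _ _ _ _ _ _ cf bf) cabsM cabs_real -mulrA ler_wpM2l//.
rewrite [leRHS](_ : _ = 2 * (Cp * D * pi ^+ n)); last by ring.
apply: cint_bound.
  apply: ccontM.
    apply: ccontM; last by apply: ccont_real; exact: rap_cont.
    by apply: ccont_expi; apply: contD; [exact: contC|exact: continuous_dotR].
  apply: (ccont_stft _ cf bf) => t.
  have -> : (fun om => dotR (xi - b - e *: om) t) = (fun om => dotR (xi - b) t - e * dotR t om).
    by apply/funext => om; rewrite [LHS]dotRBl dotRZl (dotRC om).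
  apply: contB; first exact: contC.
  by apply: contM; [exact: contC|exact: continuous_dotR].
move=> om; rewrite !cabsM cabs_expi mul1r.
have h : cabs (phi om)%:C%C <= Cp * w om by have := hCp om; rewrite expr1.
have [p0|p0] := eqVneq (phi om) 0.
  by rewrite p0 cabs0 mul0r !mulr_ge0 ?w_ge0.
rewrite [leRHS]mulrAC; apply: ler_pM; rewrite ?cabs_ge0//; exact: hD.
Qed.

(** Both packets are peeled off in turn, leaving the decay of the transform of 1 at the distance
    from xi to the sum of the two spectra. *)
Lemma stft_wpk2_le (K : nat) : exists C : R, 0 <= C /\ forall b e d v b' e' d' v' x xi D,
  (forall om om', phi om != 0 -> phi om' != 0 -> w (xi - b - e *: om - b' - e' *: om') ^+ K <= D) -> 0 <= D ->
  cabs (stft gamma (fun t => wpk b e d v t * wpk b' e' d' v' t) x xi) <= C * D.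
Proof.
have [C1 [C10 h1]] := stft_wpk_le; have [C2 [C20 h2]] := stft_one_le K.
have [CP [CP0 hP]] := Phi_le.
exists (C1 * (C1 * C2)); split; first by rewrite !mulr_ge0.
move=> b e d v b' e' d' v' x xi D hD D0.
have c1 : ccont (fun _ : V => 1 : R[i]) by exact: ccontC.
have b1 (t : V) : cabs (1 : R[i]) <= 1 by rewrite cabs1.
have e1 : (fun t => wpk b' e' d' v' t) = (fun t => wpk b' e' d' v' t * 1) by apply/funext => t; rewrite mulr1.
rewrite -!mulrA; apply: (h1 _ CP); [exact: ccont_wpk|by move=> t; exact: wpk_le| |by rewrite !mulr_ge0].
move=> om p0; rewrite [X in stft _ X](_ : _ = (fun t => wpk b' e' d' v' t * 1)); last exact: e1.
apply: (h1 _ 1) => //; last by rewrite mulr_ge0.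
move=> om' p0'; apply: le_trans (h2 _ _) _; rewrite ler_wpM2l//; exact: hD.
Qed.

End Stft.
End WavePackets.

(** * Test functions: sums of packets over a lattice set *)

Section Packets.
Context {R : realType} {n : nat}.
Notation V := 'rV[R]_n.
Notation tp := (@twopin R n).
Implicit Types (x xi t y : V).

(** The bound of the lattice points by the scale is the one under which the spectrum stays in a box
    of side of order s^2 around [p_x]. *)
Record ppar := PPar { p_s : R; p_A : seq 'rV[int]_n; p_x : V; p_s1 : 1 <= p_s; p_u : uniq p_A;
  p_b : forall k, k \in p_A -> forall i, `|(intV k : V) ord0 i| <= p_s }.

Lemma p_s0 p : 0 < p_s p. Proof. exact: lt_le_trans (p_s1 p). Qed.

Context (phi : V -> R) (rphi : rap phi).

(** One definition covers both test functions: the lattice box at scale s, and the single point 0 at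
    scale 1. *)
Definition pk (p : ppar) (t : V) : R[i] :=
  \sum_(l <- p_A p) wpk phi (p_x p + p_s p *: intV l) (p_s p) (- dotR (intV l) (intV l)) (- intV l) t.

(** The Fourier transform of [pk p]. The constant phase - l . l of the packet cancels the one
    produced by centring its spectrum at [p_x] + s l. *)
Definition pkF (p : ppar) (zeta : V) : R[i] :=
  \sum_(l <- p_A p) ((p_s p) ^- n)%:C%C *
    (expi (- dotR (intV l) ((p_s p)^-1 *: (zeta - p_x p))) * (phi ((p_s p)^-1 *: (zeta - p_x p) - intV l))%:C%C).

Lemma rap_mod (u : V) (c al : R) (b : V) : 0 < al -> rap (fun y => cos (dotR u y + c) * phi (al *: y + b)).
Proof.
move=> al0; have r1 : rap (fun y => phi (al *: y + b)).
  have [D D0 hD] := w_affine b al0.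
  have h1 : exists C : R, forall _ : unit, `|al| <= C by exists (`|al|).
  move=> K N; have := @wf_affine _ _ N unit _ _ (fun=> al) (fun=> b) h1 (rphi K N); apply: wf_le.
  exists (D ^+ K) => _ x; rewrite !mul1r exprn_ge0 ?w_ge0//=.
  by rewrite -exprMn lerXn2r ?nnegrE ?mulr_ge0 ?w_ge0.
have -> : (fun y => cos (dotR u y + c) * phi (al *: y + b)) = (fun y => phi (al *: y + b) * cos (dotR u y + c)).
  by apply/funext => y; rewrite mulrC.
apply: (rapidM r1) => N; apply: (@wf_cos _ _ N unit (fun=> u) (fun=> c)).
by exists (n1 u) => _ i; rewrite /n1 (bigD1 i)//= lerDl sumr_ge0.
Qed.

Lemma reC_expiM (t r : R) : reC (expi t * r%:C%C) = cos t * r.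
Proof. by rewrite reCM /= mulr0 subr0. Qed.

Lemma imC_expiM (t r : R) : imC (expi t * r%:C%C) = cos (t - pi / 2) * r.
Proof. by rewrite imCM /= mulr0 add0r cosBpihalf. Qed.

Lemma rap_sum (I : Type) (s : seq I) (f : I -> V -> R) : (forall i, rap (f i)) ->
  rap (fun x => \sum_(i <- s) f i x).
Proof.
move=> rf; elim: s => [|i s IH].
  under eq_fun do rewrite big_nil.
  have -> : (fun _ : V => 0 : R) = (fun x => 0 * phi x) by apply/funext => x; rewrite mul0r.
  exact: rapZ.
under eq_fun do rewrite big_cons; exact: rapD.
Qed.

Lemma crap_pkF p : crap (pkF p).
Proof.
have s0 := p_s0 p.
have E (l : 'rV[int]_n) c : rap (fun zeta => (p_s p) ^- n * (cos (- dotR (intV l) ((p_s p)^-1 *: (zeta - p_x p)) + c) * phi ((p_s p)^-1 *: (zeta - p_x p) - intV l))).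
  apply: rapZ; have := rap_mod (- ((p_s p)^-1 *: intV l)) (dotR (intV l) ((p_s p)^-1 *: p_x p) + c) (- ((p_s p)^-1 *: p_x p) - intV l) (_ : 0 < (p_s p)^-1).
  rewrite invr_gt0 => /(_ s0); congr rap; apply/funext => y; congr (cos _ * phi _).
    rewrite scalerBr dotRBr dotRNl dotRZl !dotRZr; ring.
  by rewrite scalerBr addrA.
split.
  have -> : (fun x => reC (pkF p x)) = (fun zeta => \sum_(l <- p_A p) (p_s p) ^- n * (cos (- dotR (intV l) ((p_s p)^-1 *: (zeta - p_x p)) + 0) * phi ((p_s p)^-1 *: (zeta - p_x p) - intV l))).
    by apply/funext => z; rewrite reC_sum; apply: eq_bigr => l _; rewrite reC_real reC_expiM addr0.
  by apply: rap_sum => l; exact: E.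
have -> : (fun x => imC (pkF p x)) = (fun zeta => \sum_(l <- p_A p) (p_s p) ^- n * (cos (- dotR (intV l) ((p_s p)^-1 *: (zeta - p_x p)) + - (pi / 2)) * phi ((p_s p)^-1 *: (zeta - p_x p) - intV l))).
  by apply/funext => z; rewrite imC_sum; apply: eq_bigr => l _; rewrite imC_real imC_expiM.
by apply: rap_sum => l; exact: E.
Qed.

Lemma pkF_supp p zeta : pkF p zeta != 0 -> exists2 l, l \in p_A p &
  phi ((p_s p)^-1 *: (zeta - p_x p) - intV l) != 0.
Proof.
move=> h; have /hasP[l lA hl] : has (fun l => phi ((p_s p)^-1 *: (zeta - p_x p) - intV l) != 0) (p_A p).
  apply/negPn/negP => /hasPn h0; move/eqP: h; apply.
  rewrite /pkF big_seq big1// => l lA; have := h0 l lA; rewrite negbK => /eqP ->.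
  by rewrite !mulr0.
by exists l.
Qed.

Lemma phi_wave_dom : exists C : R, forall (th : V -> R), cdom C (fun om => expi (th om) * (phi om)%:C%C).
Proof.
have [C [C0 hC]] := crap_wbound 1 (crap_real rphi).
by exists C => th om; rewrite cabsM cabs_expi mul1r; have := hC om; rewrite expr1.
Qed.

Lemma ccont_phi : ccont (fun om => (phi om)%:C%C).
Proof. by apply: ccont_real; exact: rap_cont. Qed.

(** In each term zeta = [p_x] + s (om + l) is substituted. Starting from the spectrum, both
    membership in the Schwartz class and the Fourier transform of [pk] follow by inversion. *)
Lemma ifourier_pkF p t : ifourier (pkF p) t = pk p t.
Proof.
have s0 := p_s0 p; have [C hC] := phi_wave_dom; have C0 := cdom_ge0 (hC (fun=> 0)).
set s := p_s p in s0 *.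
pose f (l : 'rV[int]_n) om := expi (dotR t (p_x p + s *: (om + intV l)) - dotR (intV l) (om + intV l)) * (phi om)%:C%C.
have cf l : ccont (f l).
  apply: ccontM; last exact: ccont_phi.
  apply: ccont_expi; rewrite (_ : (fun om => _) = (fun om => (dotR t (p_x p + s *: intV l) - dotR (intV l) (intV l)) + dotR (s *: t - intV l) om)).
    by apply: contD; [exact: contC|exact: continuous_dotR].
  apply/funext => om; rewrite scalerDr dotRBl !dotRDr dotRZl !dotRZr; ring.
have df l : cdom C (f l) by exact: hC.
pose b (l : 'rV[int]_n) := - (s^-1 *: p_x p) - intV l.
have si : 0 < s^-1 by rewrite invr_gt0.
have fb l zeta : f l (s^-1 *: zeta + b l) = expi (dotR t zeta) *
   (expi (- dotR (intV l) (s^-1 *: (zeta - p_x p))) * (phi (s^-1 *: (zeta - p_x p) - intV l))%:C%C).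
  have e1 : s^-1 *: zeta + b l = s^-1 *: (zeta - p_x p) - intV l.
    by rewrite /b scalerBr addrA.
  rewrite /f e1 subrK scalerA divff ?gt_eqF// scale1r (addrC (p_x p)) subrK mulrA -expiD//.
have cfb l : ccont (fun zeta : V => (s ^- n)%:C%C * f l (s^-1 *: zeta + b l)).
  by apply: ccontM; [exact: ccontC|exact: ccont_shift].
have [D D0 hD] := w_affine (n := n) 0 si.
have dfb0 l : exists C', cdom C' (fun zeta => f l (s^-1 *: zeta + b l)).
  have [D' D0' hD'] := w_affine (b l) si.
  by exists (C * D') => z; apply: le_trans (df l _) _; rewrite -mulrA ler_wpM2l.
have [C' hC'] := choice dfb0.
have dfb l : cdom (`|s ^- n| * C' l) (fun zeta => (s ^- n)%:C%C * f l (s^-1 *: zeta + b l)).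
  by move=> z; rewrite cabsM cabs_real -mulrA ler_wpM2l//; exact: hC'.
have -> : ifourier (pkF p) t = tp%:C%C * \sum_(l <- p_A p) cint (fun zeta => (s ^- n)%:C%C * f l (s^-1 *: zeta + b l)).
  rewrite -(cint_sum (p_A p) cfb dfb); congr (_ * cint _); apply/funext => z.
  by rewrite /pkF mulr_sumr; apply: eq_bigr => l _; rewrite fb mulrCA.
rewrite /pk mulr_sumr; apply: eq_bigr => l _.
rewrite (cintZ _ (ccont_shift s^-1 (b l) (cf l)) (hC' l)) (cint_affine (b l) si (cf l) (df l)).
have sn : s ^- n * s^-1 ^- n = 1 by rewrite exprVn invrK mulVf// expf_neq0// gt_eqF.
rewrite [X in _ * X]mulrA -rmorphM sn rmorph1 mul1r.
have cg : ccont (fun om => expi (dotR (s *: t - intV l) om) * (phi om)%:C%C).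
  by apply: ccontM; [apply: ccont_expi; exact: continuous_dotR|exact: ccont_phi].
have -> : f l = (fun om => expi (dotR (p_x p + s *: intV l) t - dotR (intV l) (intV l)) *
   (expi (dotR (s *: t - intV l) om) * (phi om)%:C%C)).
  apply/funext => om; rewrite mulrA -expiD; congr (expi _ * _).
  rewrite scalerDr dotRBl !dotRDr !dotRDl !dotRZl !dotRZr (dotRC t (p_x p)) (dotRC t (intV l)); ring.
rewrite (cintZ _ cg (hC _)) /wpk PhiE; ring.
Qed.

Lemma pkE p : pk p = ifourier (pkF p).
Proof. by apply/funext => t; rewrite ifourier_pkF. Qed.

Lemma schwartz_pk p : schwartz (pk p).
Proof. by rewrite pkE; apply: rap_schwartz; apply: crap_ifourier; exact: crap_pkF. Qed.

Lemma fourier_pk p zeta : fourier (pk p) zeta = pkF p zeta.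
Proof. by rewrite pkE fourier_ifourier//; exact: crap_pkF. Qed.

(** With u = (y + z) / s - l one has z / (2 s^2) = u / (2 s) + l / (2 s) - y / (2 s^2), and the
    middle term is at most 1/2. This is where the frequency scale 2 s^2 of the packets comes
    from. *)
Lemma w1_peetre (s y z l : R) : 1 <= s -> `|l| <= s ->
  w1 (s^-1 * (y + z) - l) * w1 y <= 2 * w1 ((2 * s ^+ 2)^-1 * z).
Proof.
move=> s1 hl; have s0 : 0 < s by lra.
set u := s^-1 * (y + z) - l.
have -> : (2 * s ^+ 2)^-1 * z = s^-1 * u / 2 + s^-1 * l / 2 - s^-1 ^+ 2 * y / 2.
  by rewrite /u; field; rewrite gt_eqF.
have i0 : 0 <= s^-1 by rewrite invr_ge0 ltW.
have i1 : s^-1 <= 1 by rewrite invf_le1.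
set p := s^-1 * u; set q := s^-1 * l; set r := s^-1 ^+ 2 * y.
have hp : p ^+ 2 <= u ^+ 2 by rewrite exprMn ler_piMl ?sqr_ge0// exprn_ile1.
have hr : r ^+ 2 <= y ^+ 2 by rewrite exprMn ler_piMl ?sqr_ge0// !exprn_ile1// ?exprn_ge0.
have hq : q ^+ 2 <= 1.
  rewrite -(real_normK (num_real q)) exprn_ile1// normrM ger0_norm// mulrC ler_pdivrMr// mul1r//.
have A1 : 0 < 1 + u ^+ 2 by rewrite ltr_pwDl// sqr_ge0.
have A2 : 0 < 1 + y ^+ 2 by rewrite ltr_pwDl// sqr_ge0.
have A3 : 0 < 1 + (p / 2 + q / 2 - r / 2) ^+ 2 by rewrite ltr_pwDl// sqr_ge0.
rewrite /w1 -invfM -[X in X <= _]mul1r ler_pdivrMr ?mulr_gt0// mulrAC ler_pdivlMr// mul1r.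
have B1 := sqr_ge0 (p - q); have B2 := sqr_ge0 (p + r); have B3 := sqr_ge0 (q + r).
have B4 := sqr_ge0 u; have B5 := sqr_ge0 y.
have B6 : 0 <= u ^+ 2 * y ^+ 2 by rewrite mulr_ge0.
move: (u ^+ 2) (y ^+ 2) hp hr B4 B5 B6 => U Y hp hr B4 B5 B6; nra.
Qed.

Lemma w_peetre (s : R) (y z l : V) : 1 <= s -> (forall i, `|l ord0 i| <= s) ->
  w (s^-1 *: (y + z) - l) * w y <= 2 ^+ n * w ((2 * s ^+ 2)^-1 *: z).
Proof.
move=> s1 hl; rewrite /w -big_split /= -[X in 2 ^+ X]card_ord -prodr_const -big_split /=.
apply: ler_prod => i _; rewrite mulr_ge0 ?w1_ge0//= !mxE; exact: w1_peetre.
Qed.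

Section Upper.
Context (gamma : V -> R[i]) (cgam : crap gamma).

(** The complex conjugate of the Fourier transform of [gamma] at y. *)
Definition gdual y : R[i] := tp^-1%:C%C * conjc (ifourier gamma (- y)).

Lemma crap_gdual : crap gdual.
Proof.
have [r1 r2] := crap_ifourier cgam.
have rN (f : V -> R) : rap f -> rap (fun y => f (- y)).
  have h1 : exists C : R, forall _ : unit, `|-1 : R| <= C by exists (`|-1|).
  move=> rf K N; have := @wf_affine _ _ N unit _ _ (fun=> -1) (fun=> 0) h1 (rf K N).
  have e : (fun (p : unit) (x : V) => f (- x)) = (fun p x => f (-1 *: x + 0)).
    by apply/funext => p; apply/funext => x; rewrite scaleN1r addr0.
  rewrite -e; apply: wf_le; exists 1 => _ x.
  by rewrite scaleN1r addr0 wN !mul1r exprn_ge0 ?w_ge0/=.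
split.
  have -> : (fun x => reC (gdual x)) = (fun y => tp^-1 * reC (ifourier gamma (- y))).
    by apply/funext => y; rewrite reC_real reC_conj.
  by apply: rapZ; exact: (rN _ r1).
have -> : (fun x => imC (gdual x)) = (fun y => (- tp^-1) * imC (ifourier gamma (- y))).
  by apply/funext => y; rewrite imC_real imC_conj mulrN mulNr.
by apply: rapZ; exact: (rN _ r2).
Qed.

(** Uniform bounds on a family quantify over all lattice points, whereas |l_i| <= s is known only in
    the set of the packet; the default 0 makes it hold always. *)
Definition clamp (s : R) (l : 'rV[int]_n) : V :=
  if [forall i, `|(intV l : V) ord0 i| <= s] then intV l else 0.

Lemma clampE p l : l \in p_A p -> clamp (p_s p) l = intV l.
Proof. by move=> lA; rewrite /clamp; case: ifP => // /forallP[] i; exact: p_b. Qed.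

(** With its phases 0 and - pi / 2, this is s^n times the spectrum of the packet at xi + y, where
    [q] is the pair of the packet and xi. *)
Definition pfam (c : R) (q : ppar * V) (y : V) : R :=
  \sum_(l <- p_A q.1) cos (dotR (- ((p_s q.1)^-1 *: clamp (p_s q.1) l)) y +
      (- dotR (intV l) ((p_s q.1)^-1 *: (q.2 - p_x q.1)) + c)) *
    phi ((p_s q.1)^-1 *: y + ((p_s q.1)^-1 *: (q.2 - p_x q.1) - intV l)).

Definition pweight (q : ppar * V) : R := w ((2 * p_s q.1 ^+ 2)^-1 *: (q.2 - p_x q.1)).

(** Estimates the sum over l inside the family, before any Fourier integral is taken; the gain is
    the weight in xi. *)
Lemma pfam_wf c (g : V -> R) : rap g ->
  wfam evec (fun q y => pfam c q y * g y) (fun q y => pweight q * w y).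
Proof.
move=> rg N.
have w1' : wf evec N (pfam c) (fun q y => \sum_(l <- p_A q.1) 1 *
    (1 * w ((p_s q.1)^-1 *: y + ((p_s q.1)^-1 *: (q.2 - p_x q.1) - intV l)) ^+ 2)).
  apply: (@wf_sum _ _ _ evec N _ _ (fun q => p_A q.1)
    (fun ql y => cos (dotR (- ((p_s ql.1.1)^-1 *: clamp (p_s ql.1.1) ql.2)) y +
      (- dotR (intV ql.2) ((p_s ql.1.1)^-1 *: (ql.1.2 - p_x ql.1.1)) + c)) *
    phi ((p_s ql.1.1)^-1 *: y + ((p_s ql.1.1)^-1 *: (ql.1.2 - p_x ql.1.1) - intV ql.2)))
    (fun ql y => 1 * (1 * w ((p_s ql.1.1)^-1 *: y + ((p_s ql.1.1)^-1 *: (ql.1.2 - p_x ql.1.1) - intV ql.2)) ^+ 2))).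
  apply: wfM.
    apply: (@wf_cos _ _ N _ (fun ql : ppar * V * 'rV[int]_n => - ((p_s ql.1.1)^-1 *: clamp (p_s ql.1.1) ql.2))
      (fun ql => - dotR (intV ql.2) ((p_s ql.1.1)^-1 *: (ql.1.2 - p_x ql.1.1)) + c)).
    exists 1 => -[[p z] l] i /=; rewrite mxE normrN mxE normrM normfV (gtr0_norm (p_s0 p)) mulrC ler_pdivrMr ?p_s0// mul1r.
    rewrite /clamp; case: ifP => [/forallP h|_]; first exact: h.
    by rewrite mxE normr0 ltW// p_s0.
  apply: (@wf_affine _ _ N _ (fun _ => phi) (fun _ x => 1 * w x ^+ 2) (fun ql : ppar * V * 'rV[int]_n => (p_s ql.1.1)^-1)
    (fun ql => (p_s ql.1.1)^-1 *: (ql.1.2 - p_x ql.1.1) - intV ql.2)).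
    exists 1 => -[[p z] l] /=; rewrite ger0_norm ?invr_ge0 ?(ltW (p_s0 p))//.
    by rewrite invf_le1 ?p_s0 ?p_s1.
  exact: (wf_reindex (fun _ => tt) (rphi 2%N N)).
have w2 : wf evec N (fun (_ : ppar * V) y => g y) (fun _ y => 1 * w y ^+ 3).
  exact: (wf_reindex (fun _ => tt) (rg 3%N N)).
apply: wf_le (wfM w1' w2); exists ((3 * pi) ^+ n * 2 ^+ n) => -[p z] y /=.
have s0 := p_s0 p; rewrite /pweight /=; set s := p_s p in s0 *.
apply/andP; split.
  by rewrite !mulr_ge0 ?exprn_ge0 ?w_ge0// sumr_ge0// => l _; rewrite !mul1r exprn_ge0 ?w_ge0.
rewrite mul1r mulr_suml.
apply: (@le_trans _ _ (\sum_(l <- p_A p) w (s^-1 *: (y + (z - p_x p)) - intV l) * (2 ^+ n * w ((2 * s ^+ 2)^-1 *: (z - p_x p)) * w y))).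
  rewrite big_seq [leRHS]big_seq; apply: ler_sum => l lA.
  have -> : s^-1 *: y + (s^-1 *: (z - p_x p) - intV l) = s^-1 *: (y + (z - p_x p)) - intV l.
    by rewrite [in RHS]scalerDr addrA.
  have h := w_peetre y (z - p_x p) (p_s1 p) (p_b lA); rewrite -/s in h.
  set a := w (_ - intV l) in h *.
  have a0 : 0 <= a := w_ge0 _.
  have y0 := w_ge0 y; have y1 := w_le1 y.
  (* One factor [a] is kept for the lattice sum, [a * w y] gives the weight in xi by the Peetre-type
     inequality, and the last two factors leave integrability in y. *)
  rewrite [leLHS](_ : _ = a * ((a * w y) * (w y * w y))); last by rewrite !exprS expr0; ring.
  rewrite ler_wpM2l//; apply: ler_pM; rewrite ?mulr_ge0//.
  by rewrite ler_piMr.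
rewrite -mulr_suml [leRHS](_ : _ = (3 * pi) ^+ n * (2 ^+ n * w ((2 * s ^+ 2)^-1 *: (z - p_x p)) * w y)); last by ring.
rewrite ler_wpM2r ?mulr_ge0 ?exprn_ge0 ?w_ge0//.
apply: (sum_w_lattice (M := kbound s)); first exact: p_u.
by move=> k kA i; apply: (@le_kbound R); exact: p_b.
Qed.

(** Substituting y = [p_x] + s (om + l) - xi in the term l brings all terms to the same variable,
    and the short-time transform becomes an inverse Fourier transform in y. *)
Lemma stft_pk p x xi : stft gamma (pk p) x xi = ((p_s p) ^- n)%:C%C *
  ifourier (fun y => phc (fun c => pfam c (p, xi) y) * gdual y) x.
Proof.
have s0 := p_s0 p; have [C hC] := phi_wave_dom; have C0 := cdom_ge0 (hC (fun=> 0)).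
set s := p_s p in s0 *.
have si : 0 < s^-1 by rewrite invr_gt0.
have [CP [CP0 hP]] := Phi_le rphi.
pose W (l : 'rV[int]_n) := wpk phi (p_x p + s *: intV l) s (- dotR (intV l) (intV l)) (- intV l).
have hW l := stft_int cgam x xi (ccont_wpk rphi (p_x p + s *: intV l) s (- dotR (intV l) (intV l)) (- intV l))
  (wpk_le (p_x p + s *: intV l) s (- dotR (intV l) (intV l)) (- intV l) hP).
have [CW hCW] := choice hW.
have -> : stft gamma (pk p) x xi = \sum_(l <- p_A p) stft gamma (W l) x xi.
  rewrite -(@cint_sum _ _ _ (p_A p) CW (fun l t => W l t * win gamma x xi t)) => [|l|l]; last 2 first.
  - by have [] := hCW l.
  - by have [] := hCW l.
  by apply: eq_cint => t; rewrite /pk mulr_suml.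
have cG := crap_cont crap_gdual; have [CG [CG0 hG]] := crap_wbound 0 crap_gdual.
have {}hG y : cabs (gdual y) <= CG by have := hG y; rewrite expr0 mulr1.
have stG eta : stft gamma (fun=> 1) x eta = expi (- dotR eta x) * gdual (- eta).
  by rewrite stft_one// /gdual opprK.
pose f (l : 'rV[int]_n) om := expi (- dotR (intV l) (intV l) + dotR (- intV l) om) * (phi om)%:C%C *
   (expi (- dotR (xi - (p_x p + s *: intV l) - s *: om) x) * gdual (- (xi - (p_x p + s *: intV l) - s *: om))).
have cf l : ccont (f l).
  apply: ccontM.
    apply: ccontM; last exact: ccont_phi.
    by apply: ccont_expi; apply: contD; [exact: contC|exact: continuous_dotR].
  apply: ccontM.
    apply: ccont_expi.
    have -> : (fun om => - dotR (xi - (p_x p + s *: intV l) - s *: om) x) = (fun om => s * dotR x om - dotR (xi - (p_x p + s *: intV l)) x).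
      by apply/funext => om; rewrite [in LHS]dotRBl dotRZl (dotRC om) opprB.
    by apply: contB; [apply: contM; [exact: contC|exact: continuous_dotR]|exact: contC].
  have -> : (fun om => gdual (- (xi - (p_x p + s *: intV l) - s *: om))) = (fun om => gdual (s *: om + - (xi - (p_x p + s *: intV l)))).
    by apply/funext => om; rewrite opprB.
  exact: ccont_shift.
have df l : cdom (C * CG) (f l).
  move=> om; rewrite /f (cabsM (_ * _)) cabsM (cabsM (expi _) (gdual _)) !cabs_expi !mul1r mulrAC ler_pM ?cabs_ge0//.
  by have := hC (fun=> 0) om; rewrite cabsM cabs_expi mul1r.
pose b (l : 'rV[int]_n) := s^-1 *: (xi - p_x p) - intV l.
have fb l y : f l (s^-1 *: y + b l) = expi (dotR x y) *
   (phc (fun c => cos (dotR (- (s^-1 *: intV l)) y + (- dotR (intV l) (s^-1 *: (xi - p_x p)) + c)) * phi (s^-1 *: y + b l)) * gdual y).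
  have -> : phc (fun c => cos (dotR (- (s^-1 *: intV l)) y + (- dotR (intV l) (s^-1 *: (xi - p_x p)) + c)) * phi (s^-1 *: y + b l)) =
     expi (dotR (- (s^-1 *: intV l)) y - dotR (intV l) (s^-1 *: (xi - p_x p))) * (phi (s^-1 *: y + b l))%:C%C.
    by rewrite phc_expi; congr phc; apply/funext => c; rewrite addrA.
  have eE : xi - (p_x p + s *: intV l) - s *: (s^-1 *: y + b l) = - y.
    by rewrite /b; apply/rowP => i; rewrite !mxE; field; rewrite gt_eqF.
  rewrite /f eE (dotRNl x y) !opprK (dotRC x y).
  have -> : - dotR (intV l) (intV l) + dotR (- intV l) (s^-1 *: y + b l) = dotR (- (s^-1 *: intV l)) y - dotR (intV l) (s^-1 *: (xi - p_x p)).
    by rewrite /b !dotRNl !dotRDr dotRNr dotRZl dotRZr; ring.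
  by ring.
have cfb l : ccont (fun y => f l (s^-1 *: y + b l)) by exact: ccont_shift.
have dfb0 l : exists C', cdom C' (fun y => f l (s^-1 *: y + b l)).
  have [D' D0' hD'] := w_affine (b l) si.
  exists (C * CG * D') => z; apply: le_trans (df l _) _; rewrite -[leRHS]mulrA ler_wpM2l//.
  by rewrite mulr_ge0.
have [C' hC'] := choice dfb0.
have -> : ifourier (fun y => phc (fun c => pfam c (p, xi) y) * gdual y) x =
    tp%:C%C * \sum_(l <- p_A p) cint (fun y => f l (s^-1 *: y + b l)).
  rewrite -(cint_sum (p_A p) cfb hC'); congr (_ * cint _); apply/funext => y.
  have -> : phc (fun c => pfam c (p, xi) y) = \sum_(l <- p_A p) phc (fun c => cos (dotR (- (s^-1 *: intV l)) y + (- dotR (intV l) (s^-1 *: (xi - p_x p)) + c)) * phi (s^-1 *: y + b l)).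
    rewrite phc_sum; congr phc; apply/funext => c; rewrite /pfam /= -/s.
    by rewrite big_seq [RHS]big_seq; apply: eq_bigr => l lA; rewrite (clampE lA).
  rewrite mulr_suml mulr_sumr; apply: eq_bigr => l _; rewrite fb//.
rewrite mulrCA !mulr_sumr; apply: eq_bigr => l _; rewrite (cint_affine (b l) si (cf l) (df l)).
have sn : s ^- n * s^-1 ^- n = 1 by rewrite exprVn invrK mulVf// expf_neq0// gt_eqF.
rewrite [X in _ = _ * X]mulrA -rmorphM sn rmorph1 mul1r.
have c1 : ccont (fun _ : V => 1 : R[i]) by exact: ccontC.
have b1 (t : V) : cabs (1 : R[i]) <= 1 by rewrite cabs1.
have -> : stft gamma (W l) x xi = stft gamma (fun t => W l t * 1) x xi.
  by congr (stft _ _ _ _); apply/funext => t; rewrite mulr1.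
rewrite (stft_wpk rphi cgam _ _ _ _ _ _ c1 b1); congr (_ * cint _); apply/funext => om.
by rewrite stG.
Qed.

(** Decay in x comes from smoothness in y, decay in xi from the weight of the family; the constant
    is uniform over all packets. *)
Lemma stft_pk_le : exists C : R, 0 <= C /\ forall p x xi,
  cabs (stft gamma (pk p) x xi) <= C * (p_s p) ^- n * w x * w ((2 * p_s p ^+ 2)^-1 *: (xi - p_x p)).
Proof.
have [g1 g2] := crap_gdual.
pose fr c c' q y := pfam c q y * reC (gdual y) - pfam c' q y * imC (gdual y).
pose fi c c' q y := pfam c q y * imC (gdual y) + pfam c' q y * reC (gdual y).
have wr : wfam evec (fr 0 (- (pi / 2))) (fun q y => pweight q * w y).
  by move=> N; apply: wfD; [exact: pfam_wf|apply: wfN; exact: pfam_wf].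
have wi : wfam evec (fi 0 (- (pi / 2))) (fun q y => pweight q * w y).
  by move=> N; apply: wfD; exact: pfam_wf.
have [C1 h1] := FT_decay 1 wr; have [C2 h2] := FT_decay 1 wi.
exists (`|tp| * (2 * (`|C1| + `|C2|))); split; first by rewrite !mulr_ge0 ?addr_ge0.
move=> p x xi; rewrite stft_pk cabsM cabs_real gtr0_norm ?invr_gt0 ?exprn_gt0 ?p_s0//.
set W := w (_ *: (xi - _)).
rewrite [leRHS](_ : _ = (p_s p) ^- n * (`|tp| * (2 * (`|C1| + `|C2|)) * (W * w x))); last by ring.
rewrite ler_wpM2l ?invr_ge0 ?exprn_ge0 ?(ltW (p_s0 p))//.
have e1 : (fun y => reC (phc (fun c => pfam c (p, xi) y) * gdual y)) = fr 0 (- (pi / 2)) (p, xi).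
  by apply/funext => y; rewrite reCM.
have e2 : (fun y => imC (phc (fun c => pfam c (p, xi) y) * gdual y)) = fi 0 (- (pi / 2)) (p, xi).
  by apply/funext => y; rewrite imCM.
have cc : ccont (fun y => phc (fun c => pfam c (p, xi) y) * gdual y).
  by split; [rewrite e1; exact: (wf_cont (wr 0%N) (p := (p, xi)))|rewrite e2; exact: (wf_cont (wi 0%N) (p := (p, xi)))].
have [D1 d1] := wf_bound (wr 0%N); have [D2 d2] := wf_bound (wi 0%N).
have dd : cdom (`|D1| + `|D2|) (fun y => phc (fun c => pfam c (p, xi) y) * gdual y).
  move=> y; apply: le_trans (cabs_le_parts _) _.
  have -> : reC (phc (fun c => pfam c (p, xi) y) * gdual y) = fr 0 (- (pi / 2)) (p, xi) y by rewrite -e1.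
  have -> : imC (phc (fun c => pfam c (p, xi) y) * gdual y) = fi 0 (- (pi / 2)) (p, xi) y by rewrite -e2.
  have pw : pweight (p, xi) * w y <= w y by rewrite ler_piMl ?w_ge0 ?w_le1.
  have p0 : 0 <= pweight (p, xi) * w y by rewrite mulr_ge0 ?w_ge0.
  rewrite [leRHS]mulrDl; apply: lerD.
    by apply: le_trans (d1 _ _) _; apply: (le_trans (ler_wpM2r p0 (ler_norm _))); rewrite ler_wpM2l.
  by apply: le_trans (d2 _ _) _; apply: (le_trans (ler_wpM2r p0 (ler_norm _))); rewrite ler_wpM2l.
rewrite (ifourier_parts x cc dd) e1 e2 -phcZ cabsM cabs_real -mulrA ler_wpM2l//.
have k1 c : `|FT (fr 0 (- (pi / 2)) (p, xi)) x c| <= `|C1| * (W * w x).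
  have := h1 (p, xi) x c; rewrite expr1 -mulrA => /le_trans; apply.
  by rewrite ler_wpM2r ?ler_norm// mulr_ge0 ?w_ge0.
have k2 c : `|FT (fi 0 (- (pi / 2)) (p, xi)) x c| <= `|C2| * (W * w x).
  have := h2 (p, xi) x c; rewrite expr1 -mulrA => /le_trans; apply.
  by rewrite ler_wpM2r ?ler_norm// mulr_ge0 ?w_ge0.
have k3 c : `|FT (fr 0 (- (pi / 2)) (p, xi)) x c + FT (fi 0 (- (pi / 2)) (p, xi)) x (c + pi / 2)| <= (`|C1| + `|C2|) * (W * w x).
  by apply: le_trans (ler_normD _ _) _; rewrite [leRHS]mulrDl; apply: lerD.
apply: le_trans (cabs_le_parts _) _; rewrite /= -mulrA mulr_natl mulr2n.
by apply: lerD; exact: k3.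
Qed.

End Upper.
End Packets.

(** * Resonance *)

Section Concentration.
Context {R : realType} {n : nat}.
Notation V := 'rV[R]_n.
Notation tp := (@twopin R n).
Implicit Types (x xi t y : V).

Lemma tp_gt0 : 0 < tp :> R.
Proof. by rewrite invr_gt0 exprn_gt0// mulr_gt0// pi_gt0. Qed.

(** Psi(s t - l) has mass s^(-n) near l / s, so [G] may be frozen at its reference value. The errors
    n / s, n th and r stem from the width of the bump, from the position of its centre and from the
    slack in the bound on [G]. *)
Lemma concentrate (Psi G : V -> R[i]) (G0 : R[i]) (C K r th s Bg : R) (l : V) :
  ccont Psi -> (forall y, cabs (Psi y) <= C * w y ^+ 2) ->
  ccont G -> (forall t, cabs (G t) <= Bg) ->
  (forall t, cabs (G t - G0) <= K * (n1 t + r)) -> 0 <= K -> 0 <= r -> 0 <= th ->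
  1 <= s -> (forall i, `|l ord0 i| <= th * s) ->
  cabs (cint (fun t => Psi (s *: t - l) * G t) - (s ^- n)%:C%C * (cint Psi * G0)) <=
  s ^- n * (2 * (C * K * (n%:R / s + n%:R * th + r) * pi ^+ n)).
Proof.
move=> cP dP cG bG lG K0 r0 th0 s1 hl.
have s0 : 0 < s by lra.
have C0 : 0 <= C by have := le_trans (cabs_ge0 _) (dP 0); rewrite pmulr_lge0// exprn_gt0// w_gt0.
have Bg0 : 0 <= Bg := le_trans (cabs_ge0 _) (bG 0).
have dP1 : cdom C Psi.
  move=> y; apply: le_trans (dP y) _; rewrite ler_wpM2l// expr2 ler_piMr ?w_ge0//; exact: w_le1.
pose f y := Psi y * G (s^-1 *: y + s^-1 *: l).
have cf : ccont f by apply: ccontM => //; exact: ccont_shift.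
have df : cdom (C * Bg) f.
  by move=> y; rewrite cabsM mulrAC ler_pM ?cabs_ge0.
have -> : cint (fun t => Psi (s *: t - l) * G t) = (s ^- n)%:C%C * cint f.
  rewrite -(cint_affine (- l) s0 cf df); apply: eq_cint => t.
  by rewrite /f -scalerDr subrK scalerA mulVf ?gt_eqF// scale1r.
have cPG : ccont (fun y => G0 * Psi y) by apply: ccontM => //; exact: ccontC.
have dPG : cdom (cabs G0 * C) (fun y => G0 * Psi y).
  by move=> y; rewrite cabsM -mulrA ler_wpM2l ?cabs_ge0.
rewrite -mulrBr cabsM cabs_real gtr0_norm ?invr_gt0 ?exprn_gt0// ler_pM2l ?invr_gt0 ?exprn_gt0//.
rewrite [cint Psi * _]mulrC -(cintZ _ cP dP1) -(cintB cf df cPG dPG).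
apply: cint_bound.
  have -> : (fun y => f y - G0 * Psi y) = (fun y => Psi y * (G (s^-1 *: y + s^-1 *: l) + - G0)).
    by apply/funext => y; rewrite /f mulrDr mulrN (mulrC G0).
  by apply: ccontM => //; apply: ccontD; [exact: ccont_shift|exact: ccontC].
move=> y; rewrite /f (mulrC G0) -mulrBr cabsM.
have nl : n1 l <= n%:R * (th * s).
  rewrite /n1; apply: (@le_trans _ _ (\sum_(i < n) th * s)); first exact: ler_sum.
  by rewrite sumr_const card_ord mulr_natl.
have h1 : cabs (G (s^-1 *: y + s^-1 *: l) - G0) <= K * (s^-1 * n1 y + n%:R * th + r).
  apply: le_trans (lG _) _; rewrite ler_wpM2l// lerD2r.
  apply: le_trans (n1D _ _) _; rewrite !n1Z gtr0_norm ?invr_gt0// lerD2l.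
  by rewrite mulrC ler_pdivrMr// -mulrA.
apply: le_trans (ler_pM (cabs_ge0 _) (cabs_ge0 _) (dP y) h1) _.
have nw := n1_w y; have w0 := w_ge0 y; have w1' := w_le1 y; have n0 := n1_ge0 y.
have si : 0 < s^-1 by rewrite invr_gt0.
have thn : 0 <= n%:R * th by rewrite mulr_ge0.
rewrite [leLHS](_ : _ = C * K * (w y * (s^-1 * (n1 y * w y) + (n%:R * th + r) * w y))); last by ring.
rewrite [leRHS](_ : _ = C * K * (w y * (s^-1 * n%:R + (n%:R * th + r)))); last by ring.
rewrite ler_wpM2l ?mulr_ge0// ler_wpM2l//; apply: lerD; first by rewrite ler_pM2l.
by rewrite ler_piMr// addr_ge0.
Qed.

Context (phi : V -> R) (rphi : rap phi).

(** By Fourier inversion the integral of Phi^2 is (2 pi)^(-n) times that of phi(om) phi(- om);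
    evenness turns the integrand into a square. *)
Lemma cint_Phi_sq : (forall y, phi (- y) = phi y) ->
  cint (fun y => Phi phi y * Phi phi y) = (tp * intRn (fun om => phi om ^+ 2))%:C%C.
Proof.
move=> even; have cPh := crap_Phi rphi; have ccP := crap_cont cPh.
have [CP [CP0 hP]] := crap_wbound 1 cPh; have [CB [CB0 hB]] := Phi_le rphi.
have {}hP y : cabs (Phi phi y) <= CP * w y by have := hP y; rewrite expr1.
have [C hC] := phi_wave_dom rphi; have C0 := cdom_ge0 (hC (fun=> 0)).
have cphi := ccont_phi rphi.
pose q (y om : V) := (expi (dotR y om) * (phi om)%:C%C) * Phi phi y.
have c1 y : ccont (q y).
  apply: ccontM; last exact: ccontC.
  by apply: ccontM => //; apply: ccont_expi; exact: continuous_dotR.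
have c2 om : ccont (q^~ om).
  apply: ccontM => //; apply: ccontM; last exact: ccontC.
  by apply: ccont_expi; under eq_fun do rewrite dotRC; exact: continuous_dotR.
have dq y om : cabs (q y om) <= C * CP * w y * w om.
  rewrite /q cabsM [leRHS](_ : _ = (C * w om) * (CP * w y)); last by ring.
  by apply: ler_pM; rewrite ?cabs_ge0//; exact: (hC (fun om => dotR y om)).
have E : (fun y => Phi phi y * Phi phi y) = (fun y => tp%:C%C * cint (q y)).
  apply/funext => y; rewrite {1}PhiE -mulrA; congr (_ * _).
  have -> : q y = (fun om => Phi phi y * (expi (dotR y om) * (phi om)%:C%C)).
    by apply/funext => om; rewrite /q mulrC.
  have cc : ccont (fun om => expi (dotR y om) * (phi om)%:C%C).
    by apply: ccontM => //; apply: ccont_expi; exact: continuous_dotR.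
  by rewrite (cintZ _ cc (hC _)) mulrC.
rewrite E (cintZ (C := 2 * (C * CP * pi ^+ n))); last 2 first.
- apply: (ccont_cint (C := C * CP)) => // y om; apply: le_trans (dq y om) _.
  by rewrite ler_wpM2r ?w_ge0// ler_piMr ?w_le1// mulr_ge0.
- move=> y; have h : cdom (C * CP * w y) (q y) by exact: dq.
  by have := cint_bound (c1 y) h; rewrite [leRHS](_ : _ = 2 * (C * CP * pi ^+ n) * w y)//; ring.
rewrite (cint_swap c1 c2 dq) rmorphM; congr (_ * _).
have -> : (fun om => cint (q^~ om)) = (fun om => (phi om ^+ 2)%:C%C).
  apply/funext => om.
  have -> : q^~ om = (fun y => (phi om)%:C%C * (expi (- dotR (- om) y) * Phi phi y)).
    by apply/funext => y; rewrite /q dotRNl opprK (dotRC y) mulrAC mulrC.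
  rewrite (cintZ (C := CP)); last 2 first.
  - by apply: ccontM => //; apply: ccont_expi; apply: contN; exact: continuous_dotR.
  - by move=> y; rewrite cabsM cabs_expi mul1r.
  rewrite -/(fourier (Phi phi) (- om)) fourier_ifourier ?even ?expr2 ?rmorphM//.
  exact: crap_real.
by apply: complex_ext => //=; exact: intRn0.
Qed.

Lemma cint_conj_Phi (u : V) : cint (fun y => expi (dotR u y) * conjc (Phi phi y)) = (phi u)%:C%C.
Proof.
have cPh := crap_Phi rphi; have ccP := crap_cont cPh; have [CP hP] := crap_dom cPh.
have -> : (fun y => expi (dotR u y) * conjc (Phi phi y)) = (fun y => conjc (expi (- dotR u y) * Phi phi y)).
  by apply/funext => y; rewrite conjM conj_expi opprK.
rewrite cint_conj; last 2 first.
- by exists CP => y; rewrite cabsM cabs_expi mul1r.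
- by apply: ccontM => //; apply: ccont_expi; apply: contN; exact: continuous_dotR.
rewrite -/(fourier (Phi phi) u) fourier_ifourier ?conj_real//; exact: crap_real.
Qed.

Lemma conj_Phi (y : V) : conjc (Phi phi y) = Phi phi (- y).
Proof.
have [C hC] := phi_wave_dom rphi; have cphi := ccont_phi rphi.
rewrite !PhiE conjM conj_real -cint_conj; last 2 first.
- by exists C; exact: (hC (fun om => dotR y om)).
- by apply: ccontM => //; apply: ccont_expi; exact: continuous_dotR.
congr (_ * cint _); apply/funext => om.
by rewrite conjM conj_expi conj_real dotRNl.
Qed.

Lemma Phi0 : intRn phi = 1 -> Phi phi 0 = tp%:C%C.
Proof.
move=> i1; rewrite PhiE.
have -> : (fun om : V => expi (dotR 0 om) * (phi om)%:C%C) = (fun om => (phi om)%:C%C).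
  by apply/funext => om; rewrite -(scale0r (0 : V)) dotRZl mul0r expi0 mul1r.
have -> : cint (fun om => (phi om)%:C%C) = 1%:C%C.
  by apply: complex_ext => //=; exact: intRn0.
by rewrite rmorph1 mulr1.
Qed.

(** On the support of phi, phi <= t phi^2 + 1 / (4 t), and 1 <= 2^n w there. With t = 2^n pi^n the
    second term integrates to at most 1/4, so t times the integral of phi^2 is at least 3/4. *)
Lemma intRn_sq_gt0 : (forall xi, phi xi != 0 -> enorm xi <= 8^-1) -> intRn phi = 1 ->
  0 < intRn (fun om => phi om ^+ 2).
Proof.
move=> supp i1; have [C hC] := rap_dom rphi; have cphi := rap_cont rphi.
have [D hD] := bdd_bound (rap_bdd rphi).
have c2 : continuous (fun om => phi om ^+ 2) by under eq_fun do rewrite expr2; exact: contM.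
have d2 : dom (D * C) (fun om => phi om ^+ 2).
  by move=> om; rewrite expr2 normrM -mulrA ler_pM//; exact: hC.
set I := intRn _; pose t : R := 2 ^+ n * pi ^+ n.
have t0 : 0 < t by rewrite mulr_gt0 ?exprn_gt0 ?pi_gt0.
have wl om : phi om != 0 -> 1 <= 2 ^+ n * w om.
  move=> /supp h; rewrite /w -[X in 2 ^+ X]card_ord -prodr_const -big_split /=.
  apply: (@le_trans _ _ (\prod_(i < n) (1 : R))); first by rewrite big1.
  apply: ler_prod => i _; rewrite ler01/= /w1.
  have := le_trans (enorm_coord om i) h => hi.
  have h2 : om ord0 i ^+ 2 <= 1 by rewrite -(real_normK (num_real _)) exprn_ile1//; lra.
  by rewrite ler_pdivlMr ?ltr_pwDl ?sqr_ge0//; lra.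
have pw om : phi om <= t * phi om ^+ 2 + (4 * t)^-1 * (2 ^+ n * w om).
  have [->|p0] := eqVneq (phi om) 0.
    by rewrite expr0n mulr0 add0r !mulr_ge0 ?w_ge0 ?exprn_ge0// invr_ge0 mulr_ge0// ltW.
  have h := wl _ p0.
  apply: (@le_trans _ _ (t * phi om ^+ 2 + (4 * t)^-1 * 1)).
    have := sqr_ge0 (2 * t * phi om - 1) => h2.
    rewrite mulr1 -subr_ge0.
    have -> : t * phi om ^+ 2 + (4 * t)^-1 - phi om = (4 * t)^-1 * (2 * t * phi om - 1) ^+ 2.
      by field; rewrite gt_eqF.
    by rewrite mulr_ge0// invr_ge0 mulr_ge0// ltW.
  by rewrite lerD2l ler_wpM2l// invr_ge0 mulr_ge0// ltW.
have cw : continuous (fun om : V => (4 * t)^-1 * (2 ^+ n * w om)).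
  by do 2 (apply: contM; first exact: contC); exact: continuous_w.
have dw : dom ((4 * t)^-1 * 2 ^+ n) (fun om : V => (4 * t)^-1 * (2 ^+ n * w om)).
  move=> om; rewrite ger0_norm ?mulrA// !mulr_ge0 ?invr_ge0 ?exprn_ge0 ?w_ge0//.
  by rewrite !mulr_ge0 ?exprn_ge0 ?pi_ge0.
have c3 : continuous (fun om => t * phi om ^+ 2) by apply: contM => //; exact: contC.
have d3 := domZ t d2.
have := le_intRn cphi hC (contD c3 cw) (domD d3 dw) pw.
rewrite i1 (intRnD c3 d3 cw dw) (intRnZ _ c2 d2) -/I.
have := intRn_bound cw dw => /(le_trans (ler_norm _)).
have -> : (4 * t)^-1 * 2 ^+ n * pi ^+ n = 4^-1 :> R.
  by rewrite -mulrA -/t; field; rewrite gt_eqF.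
move=> h1 h2; rewrite -(pmulr_rgt0 _ t0); lra.
Qed.

(** The box {1, ..., L}^n; starting at 1 keeps it off the origin, which the symbol leaves out. *)
Definition lat (L : nat) : seq 'rV[int]_n :=
  [seq (\row_i ((f i).+1)%:Z)%R | f : {ffun 'I_n -> 'I_L} <- enum {: {ffun 'I_n -> 'I_L}}].

Lemma size_lat L : size (lat L) = (L ^ n)%N.
Proof. by rewrite size_map -cardE card_ffun !card_ord. Qed.

Lemma lat_uniq L : uniq (lat L).
Proof.
rewrite map_inj_uniq ?enum_uniq// => f g /rowP h; apply/ffunP => i.
by have := h i; rewrite !mxE => -[] /ord_inj.
Qed.

Lemma latP L k : k \in lat L -> forall i, exists2 m : nat, (0 < m <= L)%N & (intV k : V) ord0 i = m%:R.
Proof.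
by move=> /mapP[f _ ->] i; exists (f i).+1; [exact: ltn_ord|rewrite !mxE pmulrn].
Qed.

Lemma lat_kseq L (s : R) k : (0 < n)%N -> n%:R * L%:R <= s -> k \in lat L -> k \in @kseq R n s.
Proof.
move=> n0 hs kl; have hk := latP kl; rewrite kseqP; apply/andP; split.
  have [m /andP[m0 _] e] := hk (Ordinal n0).
  by apply: lt_le_trans (enorm_coord _ (Ordinal n0)); rewrite e normr_gt0 pnatr_eq0 -lt0n.
apply: le_trans (enorm_le_sum _) (le_trans _ hs).
rewrite /n1; apply: (@le_trans _ _ (\sum_(i < n) L%:R)).
  by apply: ler_sum => i _; have [m /andP[_ mL] ->] := hk i; rewrite ger0_norm ?ler0n// ler_nat.
by rewrite sumr_const card_ord mulr_natl.
Qed.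

Lemma w_le_coord (x : V) i : w x <= w1 (x ord0 i).
Proof.
rewrite /w (bigD1 i)//= ler_piMr ?w1_ge0//; apply: prodr_ile1 => j.
by rewrite w1_ge0 w1_le1.
Qed.

Lemma w1_small (z a : R) : 0 < a -> a <= `|z| -> w1 z <= a ^- 2.
Proof.
move=> a0 az; rewrite /w1 lef_pV2 ?posrE ?exprn_gt0 ?ltr_pwDl ?sqr_ge0//.
rewrite -(real_normK (num_real z)) (@le_trans _ _ (`|z| ^+ 2))//; last by rewrite lerDr.
by rewrite lerXn2r ?nnegrE// ltW.
Qed.

(** Distinct lattice points differ by at least 1 in some coordinate, so after dilation and a
    perturbation of at most s / 2 that coordinate is still at least s / 2. *)
Lemma w_gap (s : R) (a b : 'rV[int]_n) (e : V) (K : nat) : 0 < s -> a != b ->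
  (forall i, `|e ord0 i| <= s / 2) ->
  w (s *: (intV a - intV b) + e) ^+ K <= (4 / s ^+ 2) ^+ K.
Proof.
move=> s0 ab he.
have [i hi] : exists i, a ord0 i != b ord0 i.
  apply/existsP; apply: contra_neqT ab; rewrite negb_exists => /forallP h.
  by apply/rowP => i; apply/eqP; have := h i; rewrite negbK.
rewrite lerXn2r ?nnegrE ?w_ge0 ?divr_ge0 ?exprn_ge0 ?(ltW s0)//.
apply: le_trans (w_le_coord _ i) _.
have -> : 4 / s ^+ 2 = (s / 2) ^- 2 by field; rewrite gt_eqF.
apply: w1_small; first by rewrite divr_gt0.
rewrite !mxE.
have h1 : 1 <= `|(a ord0 i)%:~R - (b ord0 i)%:~R| :> R.
  by rewrite -intrB -intr_norm ler1z; have := hi; lia.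
have h2 : s <= `|s * ((a ord0 i)%:~R - (b ord0 i)%:~R)|.
  by rewrite normrM gtr0_norm// ler_peMr// ltW.
have := he i; have := ler_normD (s * ((a ord0 i)%:~R - (b ord0 i)%:~R) + e ord0 i) (- e ord0 i).
by rewrite addrK normrN; lra.
Qed.

Lemma size_kseq_s (s : R) : 1 <= s -> (size (@kseq R n s))%:R <= (3 * s) ^+ n :> R.
Proof.
move=> s1.
have h := @size_lattice R n (kbound s) _ (kseq_uniq s) (fun k kk i => @kseq_box R n _ k i kk).
apply: (@le_trans _ _ (((kbound s).*2.+1)%:R ^+ n)).
  by rewrite -natrX ler_nat.
have s0 : 0 <= s by lra.
have hM : (kbound s)%:R <= s by have /andP[] := truncn_itv s0.
rewrite lerXn2r ?nnegrE ?mulr_ge0//.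
by rewrite -natr1 -muln2 natrM; lra.
Qed.

Lemma cabs_lower (a b : R[i]) : cabs b <= cabs a + cabs (a - b).
Proof.
have -> : cabs b = cabs (a - (a - b)) by congr cabs; rewrite opprB addrC subrK.
exact: cabsB.
Qed.

(** * Lower bounds for the short-time Fourier transform of the output *)

Section Lower.
Context (supp : forall xi, phi xi != 0 -> enorm xi <= 8^-1).
Context (gamma : V -> R[i]) (cgam : crap gamma) (t0 : V) (gt0 : gamma t0 != 0).

Lemma supp_coord om i : phi om != 0 -> `|om ord0 i| <= 8^-1.
Proof. by move=> /supp; apply: le_trans; exact: enorm_coord. Qed.

Lemma stft_sum (I : Type) (r : seq I) (f : I -> V -> R[i]) (B : I -> R) x xi :
  (forall i, ccont (f i)) -> (forall i t, cabs (f i t) <= B i) ->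
  stft gamma (fun t => \sum_(i <- r) f i t) x xi = \sum_(i <- r) stft gamma (f i) x xi.
Proof.
move=> cf bf; have h i := stft_int cgam x xi (cf i) (bf i); have [C hC] := choice h.
rewrite -(@cint_sum _ _ _ r C (fun i t => f i t * win gamma x xi t)) => [|i|i]; last 2 first.
- by have [] := hC i.
- by have [] := hC i.
by apply: eq_cint => t; rewrite mulr_suml.
Qed.

(** The term P_k(s t) of the amplitude, with its phase expanded. *)
Definition wv (s : R) (k : 'rV[int]_n) : V -> R[i] := wpk phi (- (s *: intV k)) s (dotR (intV k) (intV k)) (- intV k).
Definition amp (s : R) (t : V) : R[i] := \sum_(k <- kseq s) wv s k t.
Definition pw (p : ppar) (l : 'rV[int]_n) : V -> R[i] :=
  wpk phi (p_x p + p_s p *: intV l) (p_s p) (- dotR (intV l) (intV l)) (- intV l).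

(** The products to be tested concentrate near t = 0, so the window has to be centred at x close to
    - t0 for its value there to be close to gamma(t0), which is nonzero. *)
Lemma win_near : exists K : R, [/\ 0 <= K, exists B, forall y, cabs (gamma y) <= B &
  forall x t r, n1 (x + t0) <= r -> cabs (conjc (gamma (t - x)) - conjc (gamma t0)) <= K * (n1 t + r)].
Proof.
have [L L0 hL] := crap_lip cgam; have [B [B0 hB]] := crap_wbound 0 cgam.
exists L; split=> //; first by exists B => y; have := hB y; rewrite expr0 mulr1.
move=> x t r hr.
have -> : conjc (gamma (t - x)) - conjc (gamma t0) = conjc (gamma (t - x) - gamma t0).
  by rewrite rmorphB.
rewrite cabs_conj.
have -> : t - x = t0 + (t - (x + t0)) by apply/rowP => i; rewrite !mxE; ring.
apply: le_trans (hL _ _) _; rewrite ler_wpM2l//; apply: le_trans (n1D _ _) _.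
by rewrite lerD2l -scaleN1r n1Z normrN1 mul1r.
Qed.

Lemma le_n1 (y : V) (rho : R) : (forall i, `|y ord0 i| <= rho) -> n1 y <= n%:R * rho.
Proof.
move=> h; rewrite /n1; apply: (@le_trans _ _ (\sum_(i < n) rho)); first exact: ler_sum.
by rewrite sumr_const card_ord mulr_natl.
Qed.

Lemma dotR_le_n1 (y t : V) (a : R) : (forall i, `|y ord0 i| <= a) -> `|dotR y t| <= a * n1 t.
Proof.
move=> h; apply: le_trans (ler_norm_sum _ _ _) _; rewrite mulr_sumr.
by apply: ler_sum => i _; rewrite normrM ler_wpM2r.
Qed.

(** There are at most (3 s)^n lattice points; the exponent n + 1 of s^(-2) beats their number and
    still leaves the size s^(-n) of a diagonal term times 1 / s. *)
Lemma offdiag_sum : exists C : R, 0 <= C /\ forall (s : R) (l : 'rV[int]_n) (T : 'rV[int]_n -> R[i]) (D : R),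
  1 <= s -> 0 <= D -> (forall k, k != l -> cabs (T k) <= D * (4 / s ^+ 2) ^+ n.+1) ->
  \sum_(k <- kseq s | k != l) cabs (T k) <= C * D * (s ^- n / s).
Proof.
exists (3 ^+ n * 4 ^+ n.+1); split; first by rewrite mulr_ge0 ?exprn_ge0.
move=> s l T D s1 D0 hT; have s0 : 0 < s by lra.
apply: (@le_trans _ _ (\sum_(k <- @kseq R n s) D * (4 / s ^+ 2) ^+ n.+1)).
  rewrite [leLHS]big_mkcond /=; apply: ler_sum => k _; case: ifP => [/hT//|_].
  by rewrite mulr_ge0// exprn_ge0// divr_ge0// exprn_ge0// ltW.
rewrite big_const_seq count_predT iter_addr_0 -[X in X <= _]mulr_natl.
apply: (le_trans (ler_wpM2r _ (size_kseq_s s1))).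
  by rewrite mulr_ge0// exprn_ge0// divr_ge0// exprn_ge0// ltW.
have -> : (3 * s) ^+ n * (D * (4 / s ^+ 2) ^+ n.+1) = 3 ^+ n * 4 ^+ n.+1 * D * (s ^- n / s * s^-1).
  have -> : (4 / s ^+ 2) ^+ n.+1 = 4 ^+ n.+1 / (s ^+ n.+1 * s ^+ n.+1).
    by rewrite expr_div_n -exprM -exprD; congr (_ / _ ^+ _); lia.
  rewrite exprMn [s ^+ n.+1]exprS; field.
  by rewrite expf_neq0 gt_eqF.
rewrite ler_wpM2l ?mulr_ge0 ?exprn_ge0// ler_piMr ?invf_le1//.
by rewrite mulr_ge0 ?invr_ge0 ?exprn_ge0 ?(ltW s0).
Qed.

(** For k = l the two spectra cancel except for the centre of the packet, and Psi = Phi^2 is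
    concentrated with the same value for every l; about (theta s)^n terms of size s^(-n) add up
    without cancellation. *)
Lemma resonant_sq : (0 < n)%N -> (forall y, phi (- y) = phi y) -> intRn phi = 1 ->
  exists c rho th s1 : R, [/\ 0 < c, 0 < rho, 0 < th, n%:R * th <= 1 &
   forall p : ppar, s1 <= p_s p -> p_A p = lat (Num.truncn (th * p_s p)) ->
   forall x xi, (forall i, `|(x + t0) ord0 i| <= rho) -> (forall i, `|(xi - p_x p) ord0 i| <= rho) ->
   c <= cabs (stft gamma (fun t => amp (p_s p) t * pk phi p t) x xi)].
Proof.
move=> n0 even i1.
set M0 := tp * intRn (fun om => phi om ^+ 2).
have M00 : 0 < M0 by rewrite mulr_gt0 ?tp_gt0 ?intRn_sq_gt0.
set g0 := cabs (gamma t0); have g00 : 0 < g0 := cabs_gt0 gt0.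
have [Kg [Kg0 [B hB] hKg]] := win_near.
have B0 : 0 <= B := le_trans (cabs_ge0 _) (hB 0).
have cPh := crap_Phi rphi; have ccP := crap_cont cPh.
have [CP [CP0 hP]] := crap_wbound 1 cPh; have {}hP y : cabs (Phi phi y) <= CP * w y by have := hP y; rewrite expr1.
have [CB [CB0 hCB]] := Phi_le rphi.
pose Psi y := Phi phi y * Phi phi y.
have cPsi : ccont Psi by exact: ccontM.
have dPsi y : cabs (Psi y) <= CP ^+ 2 * w y ^+ 2.
  by rewrite cabsM -exprMn expr2 ler_pM ?cabs_ge0.
(* Lipschitz constant of the modulated window: 2 B from the wave, [Kg] from the window. *)
pose K := 2 * B + Kg; have K0 : 0 <= K by rewrite addr_ge0// mulr_ge0.
pose D1 := 2 * (CP ^+ 2 * K * pi ^+ n).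
have D10 : 0 <= D1 by rewrite !mulr_ge0 ?exprn_ge0 ?pi_ge0.
(* Each of the three errors in [concentrate] will be at most [ka]; this choice keeps them below half
   of the main term. *)
pose ka := Num.min 1 (M0 * g0 / (8 * (D1 + 1))).
have D11 : 0 < D1 + 1 by rewrite ltr_wpDl.
have ka0 : 0 < ka by rewrite lt_min ltr01/=; apply: divr_gt0; apply: mulr_gt0.
have ka1 : ka <= 1 by rewrite ge_min lexx.
have kaD : D1 * (3 * ka) <= M0 * g0 / 2.
  have : ka <= M0 * g0 / (8 * (D1 + 1)) by rewrite ge_min lexx orbT.
  rewrite ler_pdivlMr ?mulr_gt0// => h.
  have := mulr_ge0 D10 (ltW ka0); clear -h ka0 rphi supp cgam gt0; lra.
have nR : 0 < n%:R :> R by rewrite ltr0n.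
pose th := ka / n%:R; have th0 : 0 < th by rewrite divr_gt0.
have nth' : n%:R * th = ka by rewrite mulrCA divff ?gt_eqF// mulr1.
have [C3 [C30 hC3]] := stft_wpk2_le rphi cgam n.+1.
have [C4 [C40 hC4]] := offdiag_sum.
pose c := (th / 2) ^+ n * (M0 * g0) / 4.
have c0 : 0 < c by rewrite divr_gt0// mulr_gt0 ?exprn_gt0 ?divr_gt0// mulr_gt0.
(* The summands give, in order, the frequency gap s / 2 between distinct terms, n / s <= ka, a box
   side of at least theta s / 2, and off-diagonal terms of total size at most [c]. *)
pose s1 := 8 + n%:R / ka + 2 / th + C4 * C3 / c.
(* The radius of the boxes is th = ka / n, so that their points have coordinate sum of absolute
   values at most [ka]. *)
exists c, th, th, s1; split=> //; first by rewrite nth'.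
move=> p; set s := p_s p; move=> hs pA x xi hx hxi.
have a1 : 0 <= n%:R / ka by rewrite divr_ge0// ltW.
have a2 : 0 <= 2 / th by rewrite divr_ge0// ltW.
have a3 : 0 <= C4 * C3 / c by apply: divr_ge0; [exact: mulr_ge0|exact: ltW].
have s8 : 8 <= s by clear -hs a1 a2 a3 rphi supp cgam gt0; rewrite /s1 in hs; lra.
have s0 : 0 < s by clear -s8 rphi supp cgam gt0; lra.
have s1' : 1 <= s by clear -s8 rphi supp cgam gt0; lra.
have hs1 : n%:R / s <= ka.
  rewrite ler_pdivrMr// mulrC -ler_pdivrMr//; clear -hs a1 a2 a3 rphi supp cgam gt0; rewrite /s1 in hs; lra.
have hs2 : 2 <= th * s.
  rewrite mulrC -ler_pdivrMr//; clear -hs a1 a2 a3 rphi supp cgam gt0; rewrite /s1 in hs; lra.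
have hs3 : C4 * C3 / s <= c.
  rewrite ler_pdivrMr// [X in _ <= X]mulrC -ler_pdivrMr//; rewrite /s1 in hs; lra.
set L := Num.truncn (th * s).
have ths0 : 0 <= th * s by rewrite mulr_ge0 ?(ltW th0) ?(ltW s0).
have /andP[L1 L2] := truncn_itv ths0.
rewrite -/L -natr1 in L1 L2.
have hL : th / 2 * s <= L%:R by clear -hs2 L2 rphi supp cgam gt0; lra.
have nL : n%:R * L%:R <= s.
  apply: (@le_trans _ _ (n%:R * (th * s))); first by rewrite ler_pM2l.
  by rewrite mulrA nth' ler_piMl// ltW.
have Ls : L%:R <= s.
  apply: le_trans nL; rewrite ler_peMl// ler1n//.
have lk l : l \in lat L -> l \in kseq s by exact: lat_kseq.
have lth l : l \in lat L -> forall i, `|(intV l : V) ord0 i| <= th * s.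
  move=> /latP h i; have [m /andP[_ mL] ->] := h i.
  by rewrite ger0_norm ?ler0n//; apply: le_trans L1; rewrite ler_nat.
pose T k l := stft gamma (fun t => wv s k t * pw p l t) x xi.
have cW b e d v : ccont (wpk phi b e d v) by exact: ccont_wpk.
have bW b e d v t : cabs (wpk phi b e d v t) <= CB by exact: wpk_le.
have -> : stft gamma (fun t => amp s t * pk phi p t) x xi = \sum_(l <- lat L) \sum_(k <- kseq s) T k l.
  have -> : (fun t => amp s t * pk phi p t) = (fun t => \sum_(l <- lat L) \sum_(k <- kseq s) wv s k t * pw p l t).
    by apply/funext => t; rewrite /pk pA mulr_sumr; apply: eq_bigr => l _; rewrite mulr_suml.
  have b2 k l t : cabs (wv s k t * pw p l t) <= CB * CB.
    by rewrite cabsM ler_pM ?cabs_ge0// ?bW.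
  rewrite (@stft_sum _ (lat L) (fun l t => \sum_(k <- kseq s) wv s k t * pw p l t) (fun=> \sum_(k <- @kseq R n s) CB * CB)).
  - apply: eq_bigr => l _; rewrite (@stft_sum _ (kseq s) (fun k t => wv s k t * pw p l t) (fun=> CB * CB))//.
    by move=> k; apply: ccontM; exact: cW.
  - by move=> l; apply: ccont_sum => k; apply: ccontM; exact: cW.
  - by move=> l t; apply: le_trans (cabs_sum _ _ _) _; apply: ler_sum.
have off l k : k != l -> cabs (T k l) <= C3 * (4 / s ^+ 2) ^+ n.+1.
  move=> kl; apply: hC3; last by rewrite exprn_ge0// divr_ge0// exprn_ge0// ltW.
  move=> om om' p1 p2.
  have -> : xi - - (s *: intV k) - s *: om - (p_x p + p_s p *: intV l) - p_s p *: om' =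
     s *: (intV k - intV l) + ((xi - p_x p) - s *: (om + om')).
    by rewrite -/s; apply/rowP => i; rewrite !mxE; ring.
  apply: w_gap => // i; have h1 := supp_coord i p1; have h2 := supp_coord i p2; have h3 := hxi i.
  have t1 : th <= 1.
    by apply: le_trans ka1; rewrite -nth' ler_peMl ?ler1n// ltW.
  have -> : (xi - p_x p - s *: (om + om')) ord0 i = (xi - p_x p) ord0 i - s * (om ord0 i + om' ord0 i).
    by rewrite !mxE.
  apply: le_trans (ler_normB _ _) _; rewrite normrM (gtr0_norm s0).
  have h4 := ler_normD (om ord0 i) (om' ord0 i).
  have h5 : s * `|om ord0 i + om' ord0 i| <= s * (1 / 4) by rewrite ler_pM2l//; clear -h1 h2 h4 rphi supp cgam gt0; lra.
  clear -h3 h5 t1 s8 rphi supp cgam gt0; lra.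
have diag l : l \in lat L -> cabs (T l l - (s ^- n)%:C%C * (M0%:C%C * conjc (gamma t0))) <= s ^- n * (M0 * g0 / 2).
  move=> lA.
  pose G t := expi (dotR (p_x p - xi) t) * conjc (gamma (t - x)).
  have cG : ccont G.
    by apply: ccontM; [apply: ccont_expi; exact: continuous_dotR|apply: ccont_conj; exact: ccont_gshift].
  have bG t : cabs (G t) <= B by rewrite cabsM cabs_expi mul1r cabs_conj.
  have lG t : cabs (G t - conjc (gamma t0)) <= K * (n1 t + ka).
    have -> : G t - conjc (gamma t0) = (expi (dotR (p_x p - xi) t) - 1) * conjc (gamma (t - x)) + (conjc (gamma (t - x)) - conjc (gamma t0)).
      by rewrite /G mulrBl mul1r addrA subrK.
    apply: le_trans (cabsD _ _) _; rewrite /K [leRHS]mulrDl; apply: lerD; last first.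
      by apply: hKg; rewrite -nth'; exact: le_n1.
    rewrite cabsM cabs_conj mulrAC; apply: ler_pM; rewrite ?cabs_ge0//.
    apply: le_trans (lip_expi _) _; rewrite ler_pM2l//.
    have := @dotR_le_n1 (p_x p - xi) t 1; rewrite mul1r => h.
    apply: (le_trans (h _)); last by rewrite lerDl ltW.
    move=> i; have := hxi i.
    have -> : (p_x p - xi) ord0 i = - (xi - p_x p) ord0 i by rewrite !mxE opprB.
    rewrite normrN.
    have t1 : th <= 1 by apply: le_trans ka1; rewrite -nth' ler_peMl ?ler1n// ltW.
    by move=> h'; apply: le_trans h' t1.
  have := concentrate cPsi dPsi cG bG lG K0 (ltW ka0) (ltW th0) s1' (lth _ lA).
  have -> : cint (fun t => Psi (s *: t - intV l) * G t) = T l l.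
    apply: eq_cint => t; rewrite /Psi /G /wv /pw /wpk /win -/s conjM conj_expi.
    have -> : expi (dotR (p_x p - xi) t) = expi (dotR (- (s *: intV l)) t + dotR (intV l) (intV l)) *
        expi (dotR (p_x p + s *: intV l) t + - dotR (intV l) (intV l)) * expi (- dotR xi t).
      by rewrite -!expiD; congr expi; rewrite dotRBl dotRNl dotRDl; ring.
    ring.
  rewrite /Psi cint_Phi_sq// -/M0 => /le_trans; apply.
  rewrite ler_pM2l ?invr_gt0 ?exprn_gt0//.
  have -> : 2 * (CP ^+ 2 * K * (n%:R / s + n%:R * th + ka) * pi ^+ n) = D1 * (n%:R / s + n%:R * th + ka).
    by rewrite /D1; ring.
  by apply: le_trans kaD; rewrite ler_wpM2l// nth'; clear -hs1 rphi supp cgam gt0; lra.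
pose LL := (size (lat L))%:R : R.
have LLE : LL = L%:R ^+ n by rewrite /LL size_lat natrX.
pose Z := \sum_(l <- lat L) ((s ^- n)%:C%C * (M0%:C%C * conjc (gamma t0))).
have cZ : cabs Z = LL * (s ^- n * (M0 * g0)).
  rewrite /Z big_const_seq count_predT iter_addr_0 -mulr_natl !cabsM cabs_conj !cabs_real -/g0.
  rewrite (gtr0_norm M00) gtr0_norm ?invr_gt0 ?exprn_gt0//; congr (_ * _).
  have -> : (size (lat L))%:R = (LL)%:C%C by rewrite /LL rmorph_nat.
  by rewrite cabs_real ger0_norm// ler0n.
have dZ : cabs (\sum_(l <- lat L) \sum_(k <- kseq s) T k l - Z) <=
    LL * (s ^- n * (M0 * g0 / 2)) + LL * (C4 * C3 * (s ^- n / s)).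
  rewrite /Z -sumrB; apply: le_trans (cabs_sum _ _ _) _.
  rewrite -mulrDr mulr_natl -[leRHS]iter_addr_0 -(count_predT (lat L)) -big_const_seq.
  rewrite big_seq [leRHS]big_seq; apply: ler_sum => l lA.
  rewrite (bigD1_seq l) ?kseq_uniq ?lk//= addrAC.
  apply: le_trans (cabsD _ _) _; apply: lerD; first exact: diag.
  apply: le_trans (cabs_sum _ _ _) _; apply: hC4 => //; exact: off.
have sn0 : 0 < s ^- n by rewrite invr_gt0 exprn_gt0.
have LL0 : 0 <= LL by rewrite ler0n.
have h1 : (th / 2) ^+ n <= LL * s ^- n.
  have q0 : 0 <= th / 2 * s by apply: mulr_ge0; [apply: divr_ge0 => //; exact: ltW|exact: ltW].
  by rewrite ler_pdivlMr ?exprn_gt0// LLE -exprMn lerXn2r ?nnegrE ?ler0n.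
have h2 : LL * s ^- n <= 1.
  by rewrite ler_pdivrMr ?exprn_gt0// mul1r LLE lerXn2r ?nnegrE// ltW.
have h3 : LL * (C4 * C3 * (s ^- n / s)) <= c.
  rewrite [leLHS](_ : _ = (LL * s ^- n) * (C4 * C3 / s)); last by ring.
  apply: le_trans hs3; rewrite ler_piMl//; apply: divr_ge0; [exact: mulr_ge0|exact: ltW].
have := cabs_lower (\sum_(l <- lat L) \sum_(k <- kseq s) T k l) Z; rewrite cZ.
have h4 : 4 * c <= LL * s ^- n * (M0 * g0).
  rewrite /c [4 * _]mulrC divfK//; apply: ler_wpM2r => //; apply: mulr_ge0; exact: ltW.
have e1 : LL * (s ^- n * (M0 * g0)) = LL * s ^- n * (M0 * g0) by ring.
have e2 : LL * (s ^- n * (M0 * g0 / 2)) = LL * s ^- n * (M0 * g0) / 2 by ring.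
rewrite e1; rewrite e2 in dZ; clear -dZ h3 h4 rphi supp cgam gt0; lra.
Qed.

Lemma intV0 : intV 0 = 0 :> V.
Proof. by apply/rowP => i; rewrite !mxE. Qed.

Lemma conj_wv (s : R) (k : 'rV[int]_n) t :
  conjc (wv s k t) = wpk phi (s *: intV k) (- s) (- dotR (intV k) (intV k)) (intV k) t.
Proof.
have e1 : - (dotR (- (s *: intV k)) t + dotR (intV k) (intV k)) = dotR (s *: intV k) t + - dotR (intV k) (intV k).
  by rewrite opprD dotRNl opprK.
have e2 : - (s *: t + - intV k) = - s *: t + intV k by rewrite opprB scaleNr addrC.
by rewrite /wv /wpk conjM conj_expi conj_Phi// e1 e2.
Qed.

(** The k-th term of the conjugate amplitude moves the packet to frequencies near [p_x] + s (k - u)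
    with u in the support of [phi]. At such a frequency for k0 the other terms are at distance at
    least s / 2, and the k0-th has size s^(-n) |phi(u)| |Phi(0) gamma(t0)|. *)
Lemma resonant_conj : (0 < n)%N -> intRn phi = 1 ->
  exists (c rho th s1 : R) (om0 : V), [/\ 0 < c, 0 < rho, 0 < th, n%:R * th <= 1 &
   forall (p : ppar) (s : R), p_s p = 1 -> p_A p = [:: 0] -> s1 <= s ->
   forall k0, k0 \in lat (Num.truncn (th * s)) -> forall x u,
   (forall i, `|(x + t0) ord0 i| <= rho) -> (forall i, `|(u - om0) ord0 i| <= rho) ->
   c * s ^- n <= cabs (stft gamma (fun t => conjc (amp s t) * pk phi p t) x (p_x p + s *: (intV k0 - u)))].
Proof.
move=> n0 i1.
(* The integral of [phi] being 1, it is nonzero somewhere; u is kept near such a point. *)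
have [om0 p00] : exists om0, phi om0 != 0.
  apply: contrapT => /forallNP h; have e : phi = (fun=> 0).
    by apply/funext => om; have := h om; move/negP; rewrite negbK => /eqP.
  by move: i1; rewrite e intRn0 => /eqP; rewrite eq_sym oner_eq0.
set f0 := `|phi om0|; have f00 : 0 < f0 by rewrite normr_gt0.
set g0 := cabs (gamma t0); have g00 : 0 < g0 := cabs_gt0 gt0.
have tp0 := tp_gt0.
have [Kg [Kg0 [B hB] hKg]] := win_near.
have B0 : 0 <= B := le_trans (cabs_ge0 _) (hB 0).
have cPh := crap_Phi rphi; have ccP := crap_cont cPh.
have [CP [CP0 hP]] := crap_wbound 2 cPh.
have [CB [CB0 hCB]] := Phi_le rphi.
have [LP LP0 hLP] := crap_lip cPh.
have [Lf Lf0 hLf] := rap_lip rphi.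
pose K := LP * B + CB * Kg; have K0 : 0 <= K by rewrite addr_ge0// mulr_ge0.
pose D1 := 2 * (CP * K * pi ^+ n).
have D10 : 0 <= D1 by rewrite !mulr_ge0 ?exprn_ge0 ?pi_ge0.
pose m0 := f0 / 2 * (tp * g0).
have m00 : 0 < m0 by apply: mulr_gt0; [exact: divr_gt0|exact: mulr_gt0].
have D11 : 0 < D1 + 1 by rewrite ltr_wpDl.
have Lf1 : 0 < Lf + 1 by rewrite ltr_wpDl.
(* The second bound keeps the concentration error below half of the main term, the third keeps
   |phi(u)| above half of |phi(om0)|. *)
pose ka := Num.min 1 (Num.min (m0 / (6 * (D1 + 1))) (f0 / (2 * (Lf + 1)))).
have ka0 : 0 < ka.
  by rewrite !lt_min ltr01/=; apply/andP; split; apply: divr_gt0 => //; apply: mulr_gt0.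
have ka1 : ka <= 1 by rewrite ge_min lexx.
have kaD : D1 * (3 * ka) <= m0 / 2.
  have : ka <= m0 / (6 * (D1 + 1)) by rewrite !ge_min lexx orbT.
  rewrite ler_pdivlMr ?mulr_gt0// => h.
  have := mulr_ge0 D10 (ltW ka0); clear -h ka0 rphi supp cgam gt0; lra.
have kaL : Lf * ka <= f0 / 2.
  have : ka <= f0 / (2 * (Lf + 1)) by rewrite !ge_min lexx !orbT.
  rewrite ler_pdivlMr ?mulr_gt0// => h.
  have := mulr_ge0 Lf0 (ltW ka0); clear -h ka0 rphi supp cgam gt0; lra.
have nR : 0 < n%:R :> R by rewrite ltr0n.
pose th := ka / n%:R; have th0 : 0 < th by rewrite divr_gt0.
have nth' : n%:R * th = ka by rewrite mulrCA divff ?gt_eqF// mulr1.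
have [C3 [C30 hC3]] := stft_wpk2_le rphi cgam n.+1.
have [C4 [C40 hC4]] := offdiag_sum.
pose c := m0 / 4.
have c0 : 0 < c by rewrite divr_gt0.
pose s1 := 8 + n%:R / ka + C4 * C3 / c.
exists c, th, th, s1, om0; split=> //; first by rewrite nth'.
move=> p s ps1 pA hs k0 kl x u hx hu.
have a1 : 0 <= n%:R / ka by rewrite divr_ge0// ltW.
have a3 : 0 <= C4 * C3 / c by apply: divr_ge0; [exact: mulr_ge0|exact: ltW].
have s8 : 8 <= s by clear -hs a1 a3 rphi supp cgam gt0; rewrite /s1 in hs; lra.
have s0 : 0 < s by clear -s8 rphi supp cgam gt0; lra.
have s1' : 1 <= s by clear -s8 rphi supp cgam gt0; lra.
have hs1 : n%:R / s <= ka.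
  rewrite ler_pdivrMr// [X in _ <= X]mulrC -ler_pdivrMr//; clear -hs a1 a3 rphi supp cgam gt0; rewrite /s1 in hs; lra.
have hs3 : C4 * C3 / s <= c.
  rewrite ler_pdivrMr// [X in _ <= X]mulrC -ler_pdivrMr//; clear -hs a1 a3 rphi supp cgam gt0; rewrite /s1 in hs; lra.
set L := Num.truncn (th * s) in kl.
have ths0 : 0 <= th * s by rewrite mulr_ge0 ?(ltW th0) ?(ltW s0).
have /andP[L1 L2] := truncn_itv ths0; rewrite -/L in L1 L2.
have nL : n%:R * L%:R <= s.
  apply: (@le_trans _ _ (n%:R * (th * s))); first by rewrite ler_pM2l.
  by rewrite mulrA nth' ler_piMl// ltW.
have lk : k0 \in kseq s by exact: lat_kseq kl.
have lth i : `|(intV k0 : V) ord0 i| <= th * s.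
  have [m /andP[_ mL] ->] := latP kl i.
  by rewrite ger0_norm ?ler0n//; apply: le_trans L1; rewrite ler_nat.
have phu : f0 / 2 <= `|phi u|.
  have h1 : `|phi u - phi om0| <= f0 / 2.
    have -> : u = om0 + (u - om0) by rewrite addrC subrK.
    apply: le_trans (hLf _ _) _; apply: le_trans kaL; rewrite ler_wpM2l//.
    by rewrite -nth'; exact: le_n1.
  have h2 := ler_normB (phi u) (phi u - phi om0).
  rewrite (_ : phi u - (phi u - phi om0) = phi om0) in h2; last by rewrite opprB addrC subrK.
  by rewrite -/f0 in h2; clear -h1 h2 rphi supp cgam gt0; lra.
have phu0 : phi u != 0 by rewrite -normr_gt0; clear -phu f00 rphi supp cgam gt0; lra.
set xi := p_x p + _.
pose W (k : 'rV[int]_n) := wpk phi (s *: intV k) (- s) (- dotR (intV k) (intV k)) (intV k).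
pose T k := stft gamma (fun t => W k t * pw p 0 t) x xi.
have cW b e d v : ccont (wpk phi b e d v) by exact: ccont_wpk.
have bW b e d v t : cabs (wpk phi b e d v t) <= CB by exact: wpk_le.
have -> : stft gamma (fun t => conjc (amp s t) * pk phi p t) x xi = \sum_(k <- kseq s) T k.
  have -> : (fun t => conjc (amp s t) * pk phi p t) = (fun t => \sum_(k <- kseq s) W k t * pw p 0 t).
    apply/funext => t; rewrite /pk pA big_seq1 conj_sum mulr_suml; apply: eq_bigr => k _.
    by rewrite conj_wv.
  rewrite (@stft_sum _ (kseq s) (fun k t => W k t * pw p 0 t) (fun=> CB * CB))//.
    by move=> k; apply: ccontM; exact: cW.
  by move=> k t; rewrite cabsM ler_pM ?cabs_ge0// ?bW.
have off k : k != k0 -> cabs (T k) <= C3 * (4 / s ^+ 2) ^+ n.+1.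
  move=> kl'; apply: hC3; last by rewrite exprn_ge0// divr_ge0// exprn_ge0// ltW.
  move=> om om' p1 p2.
  have -> : xi - s *: intV k - (- s) *: om - (p_x p + p_s p *: intV 0) - p_s p *: om' =
     s *: (intV k0 - intV k) + (s *: (om - u) - om').
    by rewrite /xi ps1 intV0; apply/rowP => i; rewrite !mxE; ring.
  apply: w_gap => //; first by rewrite eq_sym.
  move=> i; have h1 := supp_coord i p1; have h2 := supp_coord i p2; have h3 := supp_coord i phu0.
  have -> : (s *: (om - u) - om') ord0 i = s * (om ord0 i - u ord0 i) - om' ord0 i by rewrite !mxE.
  apply: le_trans (ler_normB _ _) _; rewrite normrM (gtr0_norm s0).
  have h4 := ler_normB (om ord0 i) (u ord0 i).
  have h5 : s * `|om ord0 i - u ord0 i| <= s * (1 / 4) by rewrite ler_pM2l//; clear -h1 h3 h4 rphi supp cgam gt0; lra.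
  clear -h2 h5 s8 rphi supp cgam gt0; lra.
pose Psi y := expi (dotR u y) * conjc (Phi phi y).
have cPsi : ccont Psi.
  by apply: ccontM; [apply: ccont_expi; exact: continuous_dotR|exact: ccont_conj].
have dPsi y : cabs (Psi y) <= CP * w y ^+ 2 by rewrite cabsM cabs_expi mul1r cabs_conj.
pose G t := Phi phi t * conjc (gamma (t - x)).
have cG : ccont G by apply: ccontM => //; apply: ccont_conj; exact: ccont_gshift.
have bG t : cabs (G t) <= CB * B by rewrite cabsM cabs_conj ler_pM ?cabs_ge0.
have hxk : n1 (x + t0) <= ka by rewrite -nth'; exact: le_n1.
have lG t : cabs (G t - Phi phi 0 * conjc (gamma t0)) <= K * (n1 t + ka).
  have -> : G t - Phi phi 0 * conjc (gamma t0) = (Phi phi t - Phi phi 0) * conjc (gamma (t - x)) +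
      Phi phi 0 * (conjc (gamma (t - x)) - conjc (gamma t0)).
    by rewrite /G; ring.
  apply: le_trans (cabsD _ _) _; rewrite /K [leRHS]mulrDl; apply: lerD.
    rewrite cabsM cabs_conj [leRHS]mulrAC; apply: ler_pM; rewrite ?cabs_ge0//.
    have := hLP 0 t; rewrite add0r => /le_trans; apply; rewrite ler_wpM2l// lerDl ltW//.
  rewrite cabsM -[leRHS]mulrA; apply: ler_pM; rewrite ?cabs_ge0//; exact: hKg.
have dg := concentrate cPsi dPsi cG bG lG K0 (ltW ka0) (ltW th0) s1' lth.
rewrite cint_conj_Phi// Phi0// in dg.
set I0 := cint _ in dg.
(* Up to a unimodular constant the resonant term has the form treated by [concentrate], since all
   phases linear in t combine to u . (s t - k0). *)
have T0 : T k0 = expi (dotR u (intV k0) - dotR (intV k0) (intV k0)) * I0.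
  have [CI [cI dI]] : exists C, ccont (fun t => Psi (s *: t - intV k0) * G t) /\ cdom C (fun t => Psi (s *: t - intV k0) * G t).
    have [Cx Cx0 hCx] := cdom_gshift cgam x.
    exists (CP * (CB * Cx)); split.
      apply: ccontM => //; exact: (ccont_shift s (- intV k0) cPsi).
    move=> t; rewrite cabsM -[leRHS]mulrA; apply: ler_pM; rewrite ?cabs_ge0//.
      by apply: le_trans (dPsi _) _; rewrite ler_piMr// exprn_ile1// ?w_ge0 ?w_le1.
    by rewrite /G (cabsM (Phi phi t)) cabs_conj -[leRHS]mulrA; apply: ler_pM; rewrite ?cabs_ge0.
  rewrite /I0 -(cintZ _ cI dI); apply: eq_cint => t.
  rewrite /Psi /G /W /pw /wpk /win ps1 intV0 conjM conj_expi conj_Phi//.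
  have -> : - (s *: t - intV k0) = - s *: t + intV k0 by rewrite opprB scaleNr addrC.
  have -> : 1 *: t + - 0 = t :> V by rewrite oppr0 addr0 scale1r.
  have -> : dotR (0 : V) 0 = 0 by rewrite -{2}(scale0r (0 : V)) dotRZr mul0r.
  have -> : expi (dotR (s *: intV k0) t + - dotR (intV k0) (intV k0)) * Phi phi (- s *: t + intV k0) *
     (expi (dotR (p_x p + 1 *: 0) t + - 0) * Phi phi t) * (expi (- dotR xi t) * conjc (gamma (t - x))) =
     (expi (dotR (s *: intV k0) t + - dotR (intV k0) (intV k0)) * expi (dotR (p_x p + 1 *: 0) t + - 0) * expi (- dotR xi t)) *
     (Phi phi (- s *: t + intV k0) * (Phi phi t * conjc (gamma (t - x)))) by ring.
  have -> : expi (dotR u (intV k0) - dotR (intV k0) (intV k0)) *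
     (expi (dotR u (s *: t - intV k0)) * Phi phi (- s *: t + intV k0) * (Phi phi t * conjc (gamma (t - x)))) =
     (expi (dotR u (intV k0) - dotR (intV k0) (intV k0)) * expi (dotR u (s *: t - intV k0))) *
     (Phi phi (- s *: t + intV k0) * (Phi phi t * conjc (gamma (t - x)))) by ring.
  rewrite -!expiD; congr (expi _ * _).
  rewrite /xi scaler0 addr0 dotRBr !dotRDl !dotRZl dotRBl dotRZr; ring.
have TI : cabs (T k0) = cabs I0 by rewrite T0 cabsM cabs_expi mul1r.
have sn0 : 0 < s ^- n by rewrite invr_gt0 exprn_gt0.
have h1 : s ^- n * m0 <= cabs I0 + s ^- n * (m0 / 2).
  have := cabs_lower I0 ((s ^- n)%:C%C * ((phi u)%:C%C * (tp%:C%C * conjc (gamma t0)))).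
  rewrite !cabsM !cabs_real cabs_conj -/g0 (gtr0_norm sn0) (gtr0_norm tp0) => h.
  apply: (@le_trans _ _ (s ^- n * (`|phi u| * (tp * g0)))).
    rewrite ler_pM2l// ler_wpM2r//; apply: mulr_ge0; exact: ltW.
  apply: le_trans h _; rewrite lerD2l; apply: le_trans dg _; rewrite ler_pM2l//.
  have -> : 2 * (CP * K * (n%:R / s + n%:R * th + ka) * pi ^+ n) = D1 * (n%:R / s + n%:R * th + ka).
    by rewrite /D1; ring.
  by apply: le_trans kaD; rewrite ler_wpM2l// nth'; clear -hs1 rphi supp cgam gt0; lra.
have h2 : cabs (\sum_(k <- kseq s) T k - T k0) <= C4 * C3 * (s ^- n / s).
  rewrite (bigD1_seq k0) ?kseq_uniq//= addrAC subrr add0r.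
  by apply: le_trans (cabs_sum _ _ _) _; apply: hC4 => //; exact: off.
have h3 : C4 * C3 * (s ^- n / s) <= s ^- n * c.
  by rewrite [leLHS](_ : _ = s ^- n * (C4 * C3 / s)) ?ler_pM2l//; ring.
have := cabs_lower (\sum_(k <- kseq s) T k) (T k0); rewrite TI.
rewrite mulrC /c in h3 *; have e : s ^- n * (m0 / 2) = s ^- n * m0 / 2 by rewrite mulrA.
have e' : s ^- n * (m0 / 4) = s ^- n * m0 / 4 by rewrite mulrA.
rewrite e' in h3 *; rewrite e in h1; clear -h1 h2 h3 rphi supp cgam gt0; lra.
Qed.

End Lower.
End Concentration.

(** * Modulation norms *)

Section ExtendedIntegrals.
Context {R : realType}.
Notation mu := (@lebesgue_measure R).
Implicit Types (F G : (nat -> R) -> \bar R) (a b : nat -> R).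

(* No measurability is needed: the integral is a supremum over simple functions. *)
Lemma le_integralT (f g : R -> \bar R) : (forall t, 0 <= f t)%E -> (forall t, f t <= g t)%E ->
  (\int[mu]_t f t <= \int[mu]_t g t)%E.
Proof.
move=> f0 fg; have g0 t : (0 <= g t)%E by apply: le_trans (fg t).
rewrite !ge0_integralTE//; apply: ereal_sup_le => _ [h hf <-].
by exists h => // t; apply: le_trans (hf t) (fg t).
Qed.

Lemma iintE_ge0 k F a : (forall b, 0 <= F b)%E -> (0 <= iintE k F a)%E.
Proof.
elim: k F a => [//|k IH] F a F0 /=; apply: integral_ge0 => t _; exact: IH.
Qed.

Lemma le_iintE k F G a : (forall b, 0 <= F b)%E -> (forall b, F b <= G b)%E ->
  (iintE k F a <= iintE k G a)%E.
Proof.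
elim: k F G a => [//|k IH] F G a F0 FG /=; apply: le_integralT => t; first exact: iintE_ge0.
exact: IH.
Qed.

Lemma iintE_eq k F G a : (forall b, F b = G b) -> iintE k F a = iintE k G a.
Proof. by move=> FG; congr iintE; apply/funext. Qed.

(** The factor [c] may depend on coordinates that are not yet integrated: for the inner integrals
    g_k(b_k) is such a constant, and the induction moves it into [c]. *)
Lemma iintE_prod k (c : (nat -> R) -> R) (g : nat -> R -> R) (I : nat -> R) a :
  (forall b, 0 <= c b) -> (forall b i t, (i < k)%N -> c (upd b i t) = c b) ->
  (forall i, measurable_fun [set: measurableTypeR R] (g i)) -> (forall i t, 0 <= g i t) ->
  (forall i, (\int[mu]_t (g i t)%:E = (I i)%:E)%E) ->
  iintE k (fun b => (c b * \prod_(i < k) g i (b i))%:E) a = (c a * \prod_(i < k) I i)%:E.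
Proof.
elim: k c a => [|k IH] c a c0 cu mg g0 hI; first by rewrite /= !big_ord0.
have I0 i : 0 <= I i by rewrite -lee_fin -hI; apply: integral_ge0 => t _; rewrite lee_fin.
pose d b := c b * g k (b k).
have E b : iintE k (fun b => (c b * \prod_(i < k.+1) g i (b i))%:E) b =
   (d b * \prod_(i < k) I i)%:E.
  rewrite -IH//.
  - by apply: iintE_eq => b'; rewrite big_ord_recr/= /d -mulrA (mulrC (g k _)).
  - by move=> b'; apply: mulr_ge0.
  - by move=> b' i t ik; rewrite /d cu ?updE 1?gtn_eqF// ltnW.
rewrite /=; under eq_integral do rewrite E.
have cP : 0 <= c a * \prod_(i < k) I i by apply: mulr_ge0 => //; apply: prodr_ge0.
transitivity (\int[mu]_t ((c a * \prod_(i < k) I i)%:E * (g k t)%:E))%E.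
  by apply: eq_integral => t _; rewrite /d cu// updE eqxx -EFinM; congr EFin; ring.
rewrite ge0_integralZl_EFin//; first by rewrite hI -EFinM big_ord_recr/= mulrA.
  by move=> t _; rewrite lee_fin.
by apply/measurable_EFinP; exact: mg.
Qed.

End ExtendedIntegrals.

Lemma integral_indicT {R : realType} (A : set (measurableTypeR R)) : measurable A ->
  (\int[@lebesgue_measure R]_t (\1_A t : R)%:E = @lebesgue_measure R A)%E.
Proof. by move=> mA; rewrite integral_indic// setIT. Qed.

(** * Upper and lower bounds for modulation norms *)

Section ModulationNorm.
Context {R : realType} {n : nat}.
Notation mu := (@lebesgue_measure R).
Notation V := 'rV[R]_n.
Context (p q : R) (gamma : V -> R[i]).
Context (p1 : 1 < p) (q1 : 1 < q).
Let p0 : 0 < p. Proof. exact: lt_trans p1. Qed.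
Let q0 : 0 < q. Proof. exact: lt_trans q1. Qed.

Lemma intRnE_ge0 (f : V -> \bar R) : (forall x, 0 <= f x)%E -> (0 <= intRnE f)%E.
Proof. by move=> f0; apply: iintE_ge0. Qed.

Lemma le_intRnE (f g : V -> \bar R) : (forall x, 0 <= f x)%E -> (forall x, f x <= g x)%E ->
  (intRnE f <= intRnE g)%E.
Proof. by move=> f0 fg; apply: le_iintE. Qed.

Lemma intRnE_prod (c J : R) (g : nat -> R -> R) : 0 <= c ->
  (forall i, measurable_fun [set: measurableTypeR R] (g i)) -> (forall i t, 0 <= g i t) ->
  (forall i, (\int[mu]_t (g i t)%:E = J%:E)%E) ->
  intRnE (fun x : V => (c * \prod_(i < n) g i (x ord0 i))%:E) = (c * J ^+ n)%:E.
Proof.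
move=> c0 mg g0 hJ.
rewrite -[in RHS](card_ord n) -prodr_const.
rewrite -(@iintE_prod _ n (fun=> c) g (fun=> J) (fun=> 0))//.
by apply: iintE_eq => b; congr (c * _)%:E; apply: eq_bigr => i _; rewrite mxE.
Qed.

Lemma le_poweR (r : R) (x y : \bar R) : 0 <= r -> (0 <= x)%E -> (x <= y)%E -> (x `^ r <= y `^ r)%E.
Proof.
move=> r0 x0 xy; apply: gt0_ler_poweR => //; rewrite in_itv /= leey andbT//.
exact: le_trans xy.
Qed.

Lemma powR_w_le (r : R) (x : V) : 1 <= r -> w x `^ r <= w x.
Proof.
move=> r1; rewrite -[leRHS](powRr1 (w_ge0 x)); apply: ger_powR => //.
by rewrite w_gt0 w_le1.
Qed.

Lemma powRVK (x : R) : 0 <= x -> (x `^ q) `^ q^-1 = x.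
Proof. by move=> x0; rewrite -powRrM mulfV ?gt_eqF// powRr1. Qed.

Lemma powR_div (x : R) : (x `^ (q / p)) `^ q^-1 = x `^ p^-1.
Proof. by rewrite -powRrM mulrAC mulfV ?gt_eqF// mul1r. Qed.

(** As w <= 1, its powers with exponent at least 1 are at most w, so the p-th and q-th powers
    integrate to at most the masses pi^n and (pi / b)^n of the weights. *)
Lemma Mnorm_le (A b : R) (y : V) (f : V -> R[i]) : 0 <= A -> 0 < b ->
  (forall x xi, cabs (stft gamma f x xi) <= A * w x * w (b *: (xi - y))) ->
  (Mnorm p q gamma f <= (A * ((pi ^+ n) `^ p^-1 * ((pi / b) ^+ n) `^ q^-1))%:E)%E.
Proof.
move=> A0 b0 H.
have iw : intRnE (fun x : V => (w x)%:E) = (pi ^+ n)%:E.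
  rewrite -[RHS](congr1 EFin (mul1r _)) -(@intRnE_prod 1 pi (fun=> @w1 R))//.
  - by congr intRnE; apply/funext => x; rewrite mul1r.
  - by move=> _; apply: continuous_measurable_fun; exact: continuous_w1.
  - by move=> _ t; exact: w1_ge0.
  - by move=> _; exact: integral_w1.
have iwb c : 0 <= c -> intRnE (fun xi : V => (c * w (b *: (xi - y)))%:E) = (c * (pi / b) ^+ n)%:E.
  move=> c0; pose g (i : nat) (t : R) : R := w1 (b * t - b * oapp (fun j => y ord0 j) 0 (insub i)).
  rewrite -(@intRnE_prod c (pi / b) g)//.
  - congr intRnE; apply/funext => x; congr (c * _)%:E; apply: eq_bigr => i _.
    by rewrite /g valK /= !mxE mulrBr.
  - by move=> i; apply: continuous_measurable_fun; apply: continuous_affine; exact: continuous_w1.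
  - by move=> i t; exact: w1_ge0.
  - move=> i; have := ge0_integral_affine (- (b * oapp (fun j => y ord0 j) 0 (insub i))) b0 (@continuous_w1 R) (@w1_ge0 R).
    rewrite integral_w1 => h.
    transitivity (\int[mu]_t (b^-1%:E * (b * g i t)%:E))%E.
      by apply: eq_integral => t _; rewrite -EFinM mulrA mulVf ?gt_eqF// mul1r.
    rewrite ge0_integralZl_EFin//.
    + by rewrite -h -EFinM mulrC.
    + by move=> t _; rewrite lee_fin; apply: mulr_ge0; [exact: ltW|exact: w1_ge0].
    + apply/measurable_EFinP; apply: measurable_funM => //.
      by apply: continuous_measurable_fun; apply: continuous_affine; exact: continuous_w1.
    + by rewrite invr_ge0 ltW.
have pn0 : 0 <= (pi : R) ^+ n by rewrite exprn_ge0// pi_ge0.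
have pbn0 : 0 <= ((pi : R) / b) ^+ n by rewrite exprn_ge0// divr_ge0 ?pi_ge0// ltW.
have inner xi : (intRnE (fun x => (cabs (stft gamma f x xi) `^ p)%:E) <=
    ((A * w (b *: (xi - y))) `^ p * pi ^+ n)%:E)%E.
  set e := (A * _) `^ p; have e0 : 0 <= e by exact: powR_ge0.
  apply: (@le_trans _ _ (intRnE (fun x : V => (e * \prod_(i < n) w1 (x ord0 i))%:E))).
    apply: le_intRnE => x; rewrite lee_fin ?powR_ge0//.
    apply: (@le_trans _ _ ((A * w (b *: (xi - y)) * w x) `^ p)).
      apply: ge0_ler_powR; rewrite ?nnegrE ?cabs_ge0 ?(ltW p0)//.
        by rewrite !mulr_ge0 ?w_ge0.
      by rewrite [leRHS]mulrAC.
    rewrite powRM ?w_ge0//; last by rewrite mulr_ge0// w_ge0.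
    by rewrite ler_wpM2l// powR_w_le// ltW.
  rewrite (@intRnE_prod e pi (fun=> @w1 R))//.
  - by move=> _; apply: continuous_measurable_fun; exact: continuous_w1.
  - by move=> _ t; exact: w1_ge0.
  - by move=> _; exact: integral_w1.
have mid xi : (intRnE (fun x => (cabs (stft gamma f x xi) `^ p)%:E) `^ (q / p) <=
    (A `^ q * (pi ^+ n) `^ (q / p) * w (b *: (xi - y)))%:E)%E.
  apply: le_trans (le_poweR _ _ (inner xi)) _.
  - by rewrite divr_ge0// ltW.
  - by apply: intRnE_ge0 => x; rewrite lee_fin powR_ge0.
  rewrite poweR_EFin lee_fin powRM ?powR_ge0//.
  rewrite -powRrM [p * _]mulrC divfK ?gt_eqF// powRM ?w_ge0//.
  rewrite [leLHS]mulrAC; apply: ler_wpM2l; first by rewrite mulr_ge0// powR_ge0.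
  by rewrite powR_w_le// ltW.
rewrite /Mnorm; apply: (@le_trans _ _ ((A `^ q * (pi ^+ n) `^ (q / p) * (pi / b) ^+ n)%:E `^ q^-1)%E).
  apply: le_poweR.
  - by rewrite invr_ge0 ltW.
  - by apply: intRnE_ge0 => xi; rewrite poweR_ge0.
  - rewrite -iwb; last by rewrite mulr_ge0// powR_ge0.
    by apply: le_intRnE => xi; rewrite ?poweR_ge0.
rewrite poweR_EFin lee_fin !powRM ?mulr_ge0 ?powR_ge0//.
by rewrite powRVK// powR_div mulrA.
Qed.

(** The norm is restricted to a box in x and to a product of sets of measure [J] in xi. General sets
    are allowed because the frequencies reached by the adjoint form many separated intervals. *)
Lemma Mnorm_ge (c rho J : R) (y : V) (S : nat -> set R) (f : V -> R[i]) :
  0 <= c -> 0 < rho ->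
  (forall i, measurable (S i : set (measurableTypeR R))) -> (forall i, mu (S i) = J%:E) ->
  (forall x xi : V, (forall i, `|(x - y) ord0 i| <= rho) -> (forall i : 'I_n, S i (xi ord0 i)) ->
     c <= cabs (stft gamma f x xi)) ->
  ((c * (((2 * rho) ^+ n) `^ p^-1 * (J ^+ n) `^ q^-1))%:E <= Mnorm p q gamma f)%E.
Proof.
move=> c0 r0 mS hS H.
have J0 : 0 <= J by rewrite -lee_fin -(hS 0%N) measure_ge0.
pose z (i : nat) := oapp (fun j => y ord0 j) 0 (insub i).
have zE (i : 'I_n) : z i = y ord0 i by rewrite /z valK.
pose B (i : nat) : set R := `[z i - rho, z i + rho]%classic.
pose X (xi : V) : R := \prod_(i < n) \1_(S i) (xi ord0 i).
have iS i : (\int[mu]_t (\1_(S i) t)%:E = J%:E)%E by rewrite -(hS i); exact: integral_indicT.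
have iB i : (\int[mu]_t (\1_(B i) t)%:E = (2 * rho)%:E)%E.
  rewrite integral_indicT; last exact: measurable_itv.
  rewrite lebesgue_measure_itv /= lte_fin.
  rewrite ifT; last by lra.
  by rewrite -EFinD; congr EFin; ring.
have mI (A : set (measurableTypeR R)) : measurable A ->
    measurable_fun [set: measurableTypeR R] (\1_A : R -> R).
  by move=> mA; exact: measurable_indic.
have X01 xi : X xi = 0 \/ (X xi = 1 /\ forall i : 'I_n, S i (xi ord0 i)).
  have [/existsP[i hi]|/existsPn h] := boolP [exists i : 'I_n, xi ord0 i \notin S i].
    by left; rewrite /X (bigD1 i)//= indicE (negbTE hi) mul0r.
  right; split; last by move=> i; have := h i; rewrite negbK inE.
  by apply: big1 => i _; rewrite indicE; have := h i; rewrite negbK => ->.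
have c2 : 0 <= (2 * rho) ^+ n by rewrite exprn_ge0// mulr_ge0// ltW.
have Jn : 0 <= J ^+ n by rewrite exprn_ge0.
have mid xi : ((c `^ q * ((2 * rho) ^+ n) `^ (q / p) * X xi)%:E <=
    intRnE (fun x => (cabs (stft gamma f x xi) `^ p)%:E) `^ (q / p))%E.
  have [->|[-> Sxi]] := X01 xi; first by rewrite mulr0 poweR_ge0.
  rewrite mulr1; have -> : c `^ q = (c `^ p) `^ (q / p).
    by rewrite -powRrM [p * _]mulrC divfK// gt_eqF.
  rewrite -powRM ?powR_ge0// -poweR_EFin; apply: le_poweR.
  - by rewrite divr_ge0// ltW.
  - by rewrite lee_fin mulr_ge0 ?powR_ge0.
  rewrite -(@intRnE_prod (c `^ p) (2 * rho) (fun i => \1_(B i)))//; first last.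
  - by move=> i; apply: mI; exact: measurable_itv.
  - exact: powR_ge0.
  apply: le_intRnE => x.
    by rewrite lee_fin mulr_ge0 ?powR_ge0// prodr_ge0.
  rewrite lee_fin.
  have [/existsP[i hi]|/existsPn h] := boolP [exists i : 'I_n, x ord0 i \notin B i].
    by rewrite (bigD1 i)//= indicE (negbTE hi) mul0r mulr0 powR_ge0.
  rewrite big1 => [|i _]; last by rewrite indicE; have := h i; rewrite negbK => ->.
  rewrite mulr1; apply: ge0_ler_powR; rewrite ?nnegrE ?cabs_ge0 ?(ltW p0)//.
  apply: H => // i; have := h i; rewrite negbK inE /B /= in_itv /= zE !mxE ler_norml => /andP[h1 h2].
  by apply/andP; split; lra.
rewrite /Mnorm.
have -> : (c * (((2 * rho) ^+ n) `^ p^-1 * (J ^+ n) `^ q^-1))%:E =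
   ((c `^ q * ((2 * rho) ^+ n) `^ (q / p) * J ^+ n)%:E `^ q^-1)%E.
  rewrite poweR_EFin !powRM ?mulr_ge0 ?powR_ge0//.
  by rewrite powRVK// powR_div mulrA.
apply: le_poweR; first by rewrite invr_ge0 ltW.
  by rewrite lee_fin !mulr_ge0 ?powR_ge0.
rewrite -(@intRnE_prod _ J (fun i => \1_(S i)))//; last first.
  by rewrite mulr_ge0 ?powR_ge0.
apply: le_intRnE => xi; last exact: mid.
by rewrite lee_fin !mulr_ge0 ?powR_ge0// prodr_ge0.
Qed.

End ModulationNorm.

(** * Combs of equally spaced intervals *)

Section Comb.
Context {R : realType}.
Notation mu := (@lebesgue_measure R).

(** The successor places the teeth at y + d, ..., y + L d, matching the lattice box, which starts at
    1. *)
Definition tooth (y d rho : R) (m : nat) : set R :=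
  `[y + d * m.+1%:R - d * rho, y + d * m.+1%:R + d * rho]%classic.
Definition comb (L : nat) (y d rho : R) : set R := \big[setU/set0]_(m < L) tooth y d rho m.

Lemma toothP y d rho m t : tooth y d rho m t -> `|t - (y + d * m.+1%:R)| <= d * rho.
Proof. by rewrite /tooth /= in_itv /= ler_norml => /andP[h1 h2]; apply/andP; split; lra. Qed.

Lemma measurable_comb L (y d rho : R) : measurable (comb L y d rho : set (measurableTypeR R)).
Proof. by apply: bigsetU_measurable => m _; exact: measurable_itv. Qed.

Lemma combP L y d rho t : comb L y d rho t ->
  exists2 m : nat, (1 <= m <= L)%N & `|t - (y + d * m%:R)| <= d * rho.
Proof. by rewrite /comb -bigcup_mkord => -[m /= mL /toothP h]; exists m.+1. Qed.

Lemma tooth_disjoint (y d rho : R) (i j : nat) (t : R) : 0 < d -> 0 < rho -> rho < 2^-1 -> i != j ->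
  tooth y d rho i t -> tooth y d rho j t -> False.
Proof.
move=> d0 r0 r1 ij /toothP h1 /toothP h2.
have h : d * `|i.+1%:R - j.+1%:R| <= 2 * (d * rho).
  rewrite -{1}(gtr0_norm d0) -normrM.
  rewrite (_ : d * (i.+1%:R - j.+1%:R) = (t - (y + d * j.+1%:R)) - (t - (y + d * i.+1%:R))); last by ring.
  apply: le_trans (ler_normB _ _) _; lra.
have ij1 : 1 <= `|i.+1%:R - j.+1%:R| :> R.
  have [lt|lt|e] := ltngtP i j; last by rewrite e eqxx in ij.
    rewrite distrC ger0_norm -natrB ?ler1n ?subn_gt0 ?ltnS ?(ltnW lt)//; exact: ler0n.
  rewrite ger0_norm -natrB ?ler1n ?subn_gt0 ?ltnS ?(ltnW lt)//; exact: ler0n.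
have : d * 1 <= 2 * (d * rho) by apply: le_trans h; rewrite ler_pM2l.
rewrite mulr1 mulrCA -[leLHS]mulr1 ler_pM2l//; lra.
Qed.

Lemma measure_tooth (y d rho : R) m : 0 < d * rho ->
  mu (tooth y d rho m) = (2 * (d * rho))%:E.
Proof.
move=> dr; rewrite /tooth lebesgue_measure_itv /= lte_fin ifT; last by lra.
by rewrite -EFinD; congr EFin; ring.
Qed.

Lemma measure_comb L (y d rho : R) : 0 < d -> 0 < rho < 2^-1 ->
  mu (comb L y d rho) = (L%:R * (2 * (d * rho)))%:E.
Proof.
move=> d0 /andP[r0 r1]; have dr0 : 0 < d * rho by exact: mulr_gt0.
rewrite /comb measure_bigsetU; first last.
- apply/trivIsetP => i j _ _ ij; apply/seteqP; split => // t [h1 h2].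
  exact: (tooth_disjoint d0 r0 r1 ij h1 h2).
- by move=> i; exact: measurable_itv.
transitivity (\sum_(i < L) (2 * (d * rho))%:E :> \bar R)%E.
  by apply: eq_bigr => i _; exact: measure_tooth.
rewrite sumEFin; congr EFin; rewrite sumr_const card_ord [RHS]mulr_natl; congr (_ *+ _).
Qed.

End Comb.

(** * Unboundedness *)

Section Exponential.
Context {R : realType}.

(** Bernoulli's inequality for the powers of 2^e = 1 + h. *)
Lemma powR2_unbounded (e K : R) : 0 < e -> exists J : nat, forall j, (J <= j)%N -> K < 2 `^ (j%:R * e).
Proof.
move=> e0; set h := 2 `^ e - 1.
have h0 : 0 < h by rewrite subr_gt0 /powR pnatr_eq0 /= expR_gt1 mulr_gt0// ln_gt0// ltr1n.
have bern j : 1 + j%:R * h <= 2 `^ (j%:R * e).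
  elim: j => [|j IH]; first by rewrite !mul0r addr0 powRr0.
  rewrite -natr1 [in leRHS]mulrDl powRD ?pnatr_eq0 ?implybT// mul1r.
  have -> : 2 `^ e = 1 + h by rewrite /h addrC subrK.
  apply: le_trans (_ : (1 + j%:R * h) * (1 + h) <= _); last by rewrite ler_wpM2r// addr_ge0// ltW.
  have : 0 <= j%:R * h * h by rewrite !mulr_ge0 ?ler0n// ltW.
  lra.
exists (Num.truncn (`|K| / h)).+1 => j jJ; apply: lt_le_trans (bern j).
apply: le_lt_trans (ler_norm K) _.
have : `|K| / h < j%:R.
  have /andP[_ h1] := truncn_itv (divr_ge0 (normr_ge0 K) (ltW h0)).
  by apply: lt_le_trans h1 _; rewrite ler_nat.
rewrite ltr_pdivrMr//; lra.
Qed.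

End Exponential.

(** * Action of the operators on packets *)

Section Operators.
Context {R : realType} {n : nat}.
Notation V := 'rV[R]_n.
Notation tp := (@twopin R n).

Lemma psido_mult (sigma : V -> V -> R[i]) (phi : V -> R) (p : ppar) (x : V) (a : R[i]) : rap phi ->
  (forall xi, pkF phi p xi != 0 -> sigma x xi = a) ->
  psido sigma (pk phi p) x = a * pk phi p x.
Proof.
move=> rphi h; rewrite /psido (_ : fourier (pk phi p) = pkF phi p); last first.
  by apply/funext => xi; exact: fourier_pk.
rewrite pkE// /ifourier mulrCA; congr (_ * _).
have [C hC] := crap_dom (crap_pkF rphi p).
have cf : ccont (fun xi => expi (dotR x xi) * pkF phi p xi).
  apply: ccontM; last exact: crap_cont (crap_pkF rphi p).
  by apply: ccont_expi; exact: continuous_dotR.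
have df : cdom C (fun xi => expi (dotR x xi) * pkF phi p xi).
  by move=> xi; rewrite cabsM cabs_expi mul1r.
rewrite -(cintZ a cf df); apply: eq_cint => xi.
have [->|e] := eqVneq (pkF phi p xi) 0; first by rewrite !mulr0.
by rewrite h// mulrAC mulrC mulrA.
Qed.

Context (delta : R) (phi eta : V -> R) (j0 : nat) (A : adm delta phi eta j0).
Notation s := (sj delta).
Notation r := rj.
Notation B := (blk delta phi eta).

(** Blocks vanish unless the scaled frequency is in [8/15, 5/3]. Within 2^j / 20 of modulus 2^j,
    block j + 1 sees at most 21/40 < 8/15 and blocks below j see at least 19/10 > 5/3. *)
Lemma syms_single m tau c j xi0 z : (j0 <= j)%N -> 0 <= tau <= 1 -> enorm xi0 = 2 ^+ j ->
  enorm (z.2 - xi0) <= 2 ^+ j / 20 -> syms delta phi eta j0 m tau c z = B m tau c j z.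
Proof.
move=> jj tt e0 hz.
have p0 : 0 < 2 ^+ j :> R by rewrite exprn_gt0.
have u1 : enorm z.2 <= 21 / 20 * 2 ^+ j.
  have := enormD xi0 (z.2 - xi0); rewrite addrC subrK e0; lra.
have u2 : 19 / 20 * 2 ^+ j <= enorm z.2.
  have := enormB z.2 (z.2 - xi0); rewrite opprB addrC subrK e0; lra.
(* Blocks from j + 2 on vanish, as the frequency is below 2^(j+2) / 2; the sum up to j + 1
   remains. *)
rewrite (@syms_loc _ _ _ _ _ _ A _ _ _ j.+2)//; first last.
- rewrite !exprS; lra.
- by rewrite (leq_trans jj)// -addn2 leq_addr.
rewrite big_nat_recr ?(leq_trans jj)//= big_nat_recr//= [X in _ + X](_ : _ = 0); last first.
  apply: (@blk_supp _ _ _ _ _ _ A [::]) => //; first by rewrite (leq_trans jj).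
  rewrite negb_and -!ltNge; apply/orP; left.
  rewrite enormZ gtr0_norm ?rj_gt0// rjE exprS mulrC ltr_pdivrMr ?mulr_gt0//; lra.
rewrite addr0 big_nat big1 ?add0r// => i /andP[i0 ij].
apply: (@blk_supp _ _ _ _ _ _ A [::]) => //; rewrite negb_and -!ltNge; apply/orP; right.
rewrite enormZ gtr0_norm ?rj_gt0// rjE [ltRHS]mulrC ltr_pdivlMr ?exprn_gt0//.
have h : 2 * 2 ^+ i <= 2 ^+ j :> R by rewrite -exprS ler_weXn2l// ler1n.
lra.
Qed.

Lemma atom_eta1 (t u tau : R) (k : V) c (z : V * V) :
  (forall om, phi om != 0 -> eta (u *: (z.2 - (tau * t) *: (om - k))) = 1) ->
  atom t u tau k phi eta c z = FT phi (t *: z.1 - k) (c - dotR k (t *: z.1 - k)).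
Proof.
move=> h; apply: eq_intRn => om.
have -> : phi om * eta (u *: (z.2 - (tau * t) *: (om - k))) = phi om.
  by have [->|/h ->] := eqVneq (phi om) 0; rewrite ?mul0r// mulr1.
by congr (cos _ * _); rewrite dotRBr (dotRC _ k) addrAC addrA.
Qed.

(** A block in the region where [eta] is 1: it no longer depends on the frequency, and it is the
    same for the symbol and its adjoint, which differ there only in the phase used for the imaginary
    part. *)
Definition sblk m j c (x : V) : R := 2 `^ (j%:R * m) * tp *
  \sum_(k <- kseq (s j)) FT phi (s j *: x - intV k) (c - dotR (intV k) (s j *: x - intV k)).

Lemma sblk_phased m j x : phased (fun c => sblk m j c x).
Proof.
have [C hC] := rap_dom (adm_phi A).
apply: phasedZ; apply: phased_sum => k; apply: phased_shift.
by apply: phased_intRn hC; [exact: continuous_dotR|exact: rap_cont (adm_phi A)].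
Qed.

Lemma sblk_amp m j x : phc (fun c => sblk m j c x) = (2 `^ (j%:R * m))%:C%C * amp phi (s j) x.
Proof.
have rphi := adm_phi A; have [C hC] := rap_dom rphi.
have hF u : phased (fun c => tp * FT phi u c).
  by apply: phasedZ; apply: phased_intRn hC; [exact: continuous_dotR|exact: rap_cont].
rewrite /amp /wv /wpk /Phi.
transitivity ((2 `^ (j%:R * m))%:C%C * \sum_(k <- kseq (s j))
   phc (fun c => tp * FT phi (s j *: x - intV k) (c - dotR (intV k) (s j *: x - intV k)))).
  rewrite phc_sum phcZ; congr phc; apply/funext => c.
  by rewrite /sblk -mulrA mulr_sumr.
congr (_ * _); apply: eq_bigr => k _.
rewrite ifourier_phc expi_phc//; congr phc; apply/funext => c.
by congr (_ * FT _ _ (_ + _)); rewrite dotRBr dotRNl dotRZl dotRZr; ring.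
Qed.

(** The hypothesis bounds the total displacement of the argument of [eta] from xi0: the distance of
    xi to xi0, plus, for the adjoint, s |om - k| <= s (s + 1/8). *)
Lemma blk_sblk m tau c j xi0 (x xi : V) : (j0 <= j)%N -> 0 <= tau <= 1 -> enorm xi0 = 2 ^+ j ->
  enorm (xi - xi0) + tau * (s j ^+ 2 + s j / 8) <= 2 * s j ^+ 2 ->
  B m tau c j (x, xi) = sblk m j c x.
Proof.
move=> jj /andP[t0 t1] e0 h; rewrite /blk /sblk; congr (_ * _).
have s0 := sj_gt0 delta j.
apply: eq_big_seq => k kk; apply: atom_eta1 => om hom.
apply: (eta_one_kap A jj e0); apply: le_trans h => /=.
rewrite addrAC; apply: le_trans (enormB _ _) _; rewrite lerD2l enormZ ger0_norm ?mulr_ge0 ?(ltW s0)//.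
rewrite -mulrA ler_wpM2l//.
have -> : s j ^+ 2 + s j / 8 = s j * (8^-1 + s j) by ring.
rewrite ler_pM2l//; apply: le_trans (enormB _ _) _; apply: lerD; first exact: (adm_phi0 A).
by move: kk; rewrite kseqP => /andP[].
Qed.

Lemma sigma_block m j xi0 x xi : (j0 <= j)%N -> enorm xi0 = 2 ^+ j ->
  enorm (xi - xi0) <= 2 ^+ j / 20 -> enorm (xi - xi0) <= 2 * s j ^+ 2 ->
  sigma_delta delta m phi eta j0 x xi = (2 `^ (j%:R * m))%:C%C * amp phi (s j) x.
Proof.
move=> jj e0 h1 h2; rewrite (sigma_delta_phc _ _ _ _ _ _ (adm_phi A)).
rewrite -sblk_amp; congr phc; apply/funext => c.
rewrite (@syms_single _ _ _ j xi0)// ?lexx ?ler01//.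
by apply: (@blk_sblk _ _ _ _ xi0); rewrite // ?lexx ?ler01// mul0r addr0.
Qed.

Lemma sigma_star_block m j xi0 x xi : (j0 <= j)%N -> enorm xi0 = 2 ^+ j ->
  enorm (xi - xi0) <= 2 ^+ j / 20 -> enorm (xi - xi0) <= 8^-1 ->
  adjoint_symbol (sigma_delta delta m phi eta j0) x xi = (2 `^ (j%:R * m))%:C%C * conjc (amp phi (s j) x).
Proof.
move=> jj e0 h1 h2; have s8 := sj_ge8 A jj.
have hs : s j / 8 + 8^-1 <= s j ^+ 2.
  have : 8 * s j <= s j ^+ 2 by rewrite expr2 ler_wpM2r//; lra.
  lra.
have E c : syms delta phi eta j0 m 1 c (x, xi) = sblk m j c x.
  rewrite (@syms_single _ _ _ j xi0)// ?lexx ?ler01//.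
  by apply: (@blk_sblk _ _ _ _ xi0); rewrite // ?lexx ?ler01// mul1r; lra.
rewrite adjoint_syms// !E -[(_)%:C%C]conj_real -conjM -sblk_amp.
apply: complex_ext => //=.
by rewrite (sblk_phased m j x (pi / 2)) cos_pihalf sin_pihalf mul0r mul1r sub0r.
Qed.

End Operators.

Section Growth.
Context {R : realType} {n : nat}.
Notation V := 'rV[R]_n.

Lemma growth (e K1 K2 : R) : 0 < e -> 0 < K1 ->
  exists J : nat, forall j, (J <= j)%N -> K2 < K1 * 2 `^ (j%:R * e).
Proof.
move=> e0 k0; have [J hJ] := powR2_unbounded (K2 / K1) e0.
by exists J => j /hJ; rewrite ltr_pdivrMr// mulrC.
Qed.

Lemma powR_sqrX (q X s : R) : 0 < q -> 0 <= X -> 0 < s ->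
  ((X * s ^+ 2) ^+ n) `^ q^-1 = (X ^+ n) `^ q^-1 * s `^ (2 * n%:R / q).
Proof.
move=> q0 X0 s0; have s2 : 0 <= s ^+ 2 by exact: sqr_ge0.
rewrite (exprMn n X).
rewrite (powRM _ (exprn_ge0 _ X0) (exprn_ge0 _ s2)); congr (_ * _).
by rewrite -exprM -(powR_mulrn _ (ltW s0)) -powRrM natrM.
Qed.

Lemma sj_powR (delta a : R) j : sj delta j `^ a = 2 `^ (j%:R * (delta / 2 * a)).
Proof. by rewrite -powRrM; congr powR; rewrite -!mulrA. Qed.

Lemma sj_exprV (delta : R) j : sj delta j ^- n = sj delta j `^ (- n%:R).
Proof. by rewrite powRN powR_mulrn// ltW// sj_gt0. Qed.

Lemma mem_lat L (k : 'rV[int]_n) (m : 'I_n -> nat) :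
  (forall i, (1 <= m i <= L)%N) -> k = \row_i (m i)%:Z -> k \in lat L.
Proof.
move=> hm ->.
have h i : ((m i).-1 < L)%N by have /andP[m0 mL] := hm i; rewrite prednK.
apply/mapP; exists [ffun i => Ordinal (h i)]; first by rewrite mem_enum.
by apply/rowP => i; rewrite !mxE ffunE /= prednK//; have /andP[] := hm i.
Qed.

Lemma enorm_axis (i : 'I_n) j : enorm (2 ^+ j *: evec i : V) = 2 ^+ j.
Proof.
rewrite enormZ ger0_norm ?exprn_ge0// /enorm /dotR (bigD1 i)//= big1 => [|l li].
  by rewrite !mxE eqxx mulr1 addr0 sqrtr1 mulr1.
by rewrite !mxE eq_sym (negbTE li) mulr0.
Qed.

Lemma bounded_le (p q : R) (gamma : V -> R[i]) T : bounded_Mpq p q gamma T ->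
  exists2 C : R, 0 <= C & forall f l U, schwartz f -> (Mnorm p q gamma f <= U%:E)%E ->
    (l%:E <= Mnorm p q gamma (T f))%E -> l <= C * U.
Proof.
move=> [C hC]; exists `|C| => // f l U sf hU hl.
rewrite -lee_fin; apply: le_trans hl _; apply: le_trans (hC f sf) _.
have M0 : (0 <= Mnorm p q gamma f)%E by exact: poweR_ge0.
rewrite EFinM; apply: (@le_trans _ _ (`|C|%:E * Mnorm p q gamma f)%E).
  by apply: lee_wpmul2r => //; rewrite lee_fin ler_norm.
by apply: lee_wpmul2l => //; rewrite lee_fin.
Qed.

End Growth.

Section Unbounded.
Context {R : realType} {n : nat}.
Notation V := 'rV[R]_n.
Context (p q delta m : R) (phi eta : V -> R) (j0 : nat) (A : adm delta phi eta j0).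
Context (p1 : 1 < p) (q1 : 1 < q) (hm : - (`|q^-1 - 2^-1| * delta * n%:R) < m).
Context (gamma : V -> R[i]) (cgam : crap gamma) (t0 : V) (gt0 : gamma t0 != 0).
Notation s := (sj delta).
Let q0 : 0 < q. Proof. exact: lt_trans q1. Qed.
Let rphi : rap phi := adm_phi A.
Let i0 : 'I_n := Ordinal (adm_n A).

Lemma stft_scale (b : R) (f : V -> R[i]) (B : R) x xi : ccont f -> (forall t, cabs (f t) <= B) ->
  stft gamma (fun t => b%:C%C * f t) x xi = b%:C%C * stft gamma f x xi.
Proof.
move=> cf bf; have [C [ci di]] := stft_int cgam x xi cf bf.
by rewrite !stftE -(cintZ _ ci di); apply: eq_cint => t; rewrite mulrA.
Qed.

Lemma pk_bounded pp : exists B : R, forall t, cabs (pk phi pp t) <= B.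
Proof.
have [C [C0 hC]] := crap_wbound 0 (schwartz_crap (schwartz_pk rphi pp)); exists C => t.
by have := hC t; rewrite expr0 mulr1.
Qed.

Lemma amp_bounded u : exists B : R, forall t, cabs (amp phi u t) <= B.
Proof.
have [C [C0 hC]] := Phi_le rphi; exists (\sum_(k <- @kseq R n u) C) => t.
apply: le_trans (cabs_sum _ _ _) _; apply: ler_sum => k _; exact: wpk_le.
Qed.

Lemma ccont_amp u : ccont (amp phi u).
Proof. by apply: ccont_sum => k; exact: ccont_wpk. Qed.

Lemma ccont_pk pp : ccont (pk phi pp).
Proof. by apply: ccont_sum => k; exact: ccont_wpk. Qed.

(** A comb with one tooth, shifted back by its spacing, is a single interval; this lets one notion
    of comb serve both lower bounds. *)
Lemma comb_wide (y : R) (rho t : R) : comb 1 (y - 1) 1 rho t -> `|t - y| <= rho.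
Proof.
move=> /combP[l /andP[l0 l1]]; have -> : l = 1%N by apply/eqP; rewrite eqn_leq l1.
by rewrite !mul1r subrK.
Qed.

Definition cext (y : V) (i : nat) : R := oapp (fun j => y ord0 j) 0 (insub i).

Lemma cextE y (i : 'I_n) : cext y i = y ord0 i.
Proof. by rewrite /cext valK. Qed.

(** Since delta < 1, 2^(j (1 - delta)) exceeds 40 for large j, so the region where the block is
    constant in frequency, of size 2 s^2, lies inside the one where a single block is active. *)
Lemma block_scale (e : R) : 0 < e -> exists J : nat, forall j, (J <= j)%N ->
  [/\ (j0 <= j)%N, e <= s j & 2 * s j ^+ 2 <= 2 ^+ j / 20].
Proof.
move=> e0.
have d0 := adm_d0 A; have d1 := adm_d1 A.
have [J1 h1] := @powR2_unbounded R (delta / 2) e (divr_gt0 d0 (ltr0Sn _ 1)).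
have [J2 h2] := @powR2_unbounded R (1 - delta) 40 ltac:(lra).
exists (maxn j0 (maxn J1 J2)) => j; rewrite !geq_max => /and3P[a1 a2 a3]; split => //.
  by have := h1 j a2; rewrite mulrA => /ltW.
have := h2 j a3; rewrite mulrBr mulr1 powRD ?pnatr_eq0 ?implybT// powRN -sj_sqr powR_mulrn//.
have s2 : 0 < s j ^+ 2 by rewrite exprn_gt0// sj_gt0.
rewrite ltr_pdivlMr// => h; lra.
Qed.

Lemma unbounded_sigma : 2 <= q -> ~ bounded_Mpq p q gamma (psido (sigma_delta delta m phi eta j0)).
Proof.
move=> q2 /bounded_le[CB CB0 hCB].
have [c [rho' [th [s1 [c0 rho0' th0 nth H]]]]] :=
  resonant_sq rphi (adm_phi0 A) cgam gt0 (adm_n A) (adm_even A) (adm_int A).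
pose rho := Num.min rho' 4^-1.
have rho0 : 0 < rho by rewrite lt_min rho0' invr_gt0 ltr0n.
have rho1 : rho < 2^-1 by rewrite (@le_lt_trans _ _ 4^-1)// ?ge_min ?lexx ?orbT//; lra.
have [CU [CU0 hU]] := stft_pk_le rphi cgam.
pose K1 := c * (((2 * rho) ^+ n) `^ p^-1 * ((2 * rho) ^+ n) `^ q^-1).
have K10 : 0 < K1 by apply: mulr_gt0 => //; apply: mulr_gt0; rewrite powR_gt0// exprn_gt0// mulr_gt0.
pose K2 := CU * ((pi ^+ n) `^ p^-1 * ((pi * 2) ^+ n) `^ q^-1).
(* The growth exponent of the ratio of norms; for q >= 2 its positivity is the hypothesis on [m]. *)
pose e := m + delta * n%:R * (2^-1 - q^-1).
have e0 : 0 < e.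
  have qi : q^-1 <= 2^-1 by rewrite lef_pV2 ?posrE.
  have := hm; rewrite ler0_norm ?subr_le0// /e; lra.
have [J1 hJ1] := growth (CB * K2) e0 K10.
have [J2 hJ2] := @block_scale (Num.max s1 1) ltac:(by rewrite lt_max ltr01 orbT).
pose j := maxn J1 J2.
have /(_ (leq_maxl _ _)) gr := hJ1 j.
have [jj] := hJ2 j (leq_maxr _ _).
rewrite ge_max => /andP[ss1 s1'] sm.
have s0 := sj_gt0 delta j; have s8 := sj_ge8 A jj.
set L := Num.truncn (th * s j).
have pb k : k \in lat L -> forall i, `|(intV k : V) ord0 i| <= s j.
  move=> kl i; have [l /andP[_ lL] ->] := @latP R n _ _ kl i.
  have /andP[h1 _] := truncn_itv (mulr_ge0 (ltW th0) (ltW s0)).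
  rewrite ger0_norm ?ler0n//; apply: le_trans (_ : L%:R <= _); first by rewrite ler_nat.
  apply: le_trans h1 _; rewrite ler_piMl ?(ltW s0)//.
  apply: le_trans nth; rewrite ler_peMl ?(ltW th0)// ler1n; exact: adm_n A.
pose pp := @PPar R n (s j) (lat L) (2 ^+ j *: evec i0) s1' (lat_uniq L) pb.
pose b := 2 `^ (j%:R * m) : R.
have b0 : 0 < b by exact: powR_gt0.
(* The spectrum lies within s (1/8 + s) <= 2 s^2 of the centre, where the symbol is a multiplier
   independent of the frequency. *)
have Tf : psido (sigma_delta delta m phi eta j0) (pk phi pp) =
    (fun x => b%:C%C * (amp phi (s j) x * pk phi pp x)).
  apply/funext => x; rewrite mulrA; apply: psido_mult => // xi /pkF_supp[l /= lA /(adm_phi0 A)].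
  set u := _ - intV l => hu.
  have ex : xi - 2 ^+ j *: evec i0 = s j *: (u + intV l).
    by rewrite /u subrK scalerA mulfV ?gt_eqF// scale1r.
  have hx : enorm (xi - 2 ^+ j *: evec i0) <= 2 * s j ^+ 2.
    rewrite ex enormZ gtr0_norm//.
    have : enorm (u + intV l) <= 8^-1 + s j.
      apply: le_trans (enormD _ _) _; apply: lerD => //.
      have : l \in @kseq R n (s j).
        apply: lat_kseq lA; first exact: adm_n A.
        have /andP[h1 _] := truncn_itv (mulr_ge0 (ltW th0) (ltW s0)).
        apply: (@le_trans _ _ (n%:R * (th * s j))); first by rewrite ler_wpM2l.
        by rewrite mulrA ler_piMl// ltW.
      by rewrite kseqP => /andP[].
    rewrite -(ler_pM2l s0) => h; apply: le_trans h _.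
    have : s j * 8 <= s j * s j by rewrite ler_pM2l.
    clear -s8 A p1 q1 hm cgam gt0 q0 rphi i0; rewrite expr2 mulrDr; lra.
  apply: (@sigma_block _ _ _ _ _ _ A m j (2 ^+ j *: evec i0)) => //; first exact: enorm_axis.
  exact: le_trans hx sm.
have [B1 hB1] := amp_bounded (s j); have [B2 hB2] := pk_bounded pp.
have cf : ccont (fun t => amp phi (s j) t * pk phi pp t).
  by apply: ccontM; [exact: ccont_amp|exact: ccont_pk].
have bf t : cabs (amp phi (s j) t * pk phi pp t) <= B1 * B2.
  by rewrite cabsM; apply: ler_pM; rewrite ?cabs_ge0.
have lower : ((b * K1)%:E <= Mnorm p q gamma (psido (sigma_delta delta m phi eta j0) (pk phi pp)))%E.
  have -> : b * K1 = b * c * (((2 * rho) ^+ n) `^ p^-1 * ((1%:R * (2 * (1 * rho))) ^+ n) `^ q^-1).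
    by rewrite /K1 !mul1r mulrA.
  apply: (@Mnorm_ge _ _ _ _ _ p1 q1 _ _ _ (- t0) (fun i => comb 1 (cext (p_x pp) i - 1) 1 rho)) => //.
  - by rewrite mulr_ge0// ltW.
  - by move=> i; exact: measurable_comb.
  - by move=> i; rewrite measure_comb// rho0.
  move=> x xi hx hxi; rewrite Tf (stft_scale _ _ _ cf bf) cabsM cabs_real gtr0_norm// ler_pM2l//.
  apply: (H pp ss1 erefl x xi) => i.
    by have := hx i; rewrite opprK => /le_trans; apply; rewrite ge_min lexx.
  have := comb_wide (hxi i); rewrite cextE !mxE => /le_trans; apply; by rewrite ge_min lexx.
(* The amplitude contributes s^(-n), the frequency width 2 s^2 contributes its power n / q. *)
have upper : (Mnorm p q gamma (pk phi pp) <= (K2 * s j `^ (- n%:R + 2 * n%:R / q))%:E)%E.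
  have s20 : 0 < (2 * s j ^+ 2)^-1 by rewrite invr_gt0 mulr_gt0// exprn_gt0.
  have := @Mnorm_le _ _ _ _ _ p1 q1 _ _ (p_x pp) (pk phi pp) _ s20 (hU pp).
  move=> /(_ ltac:(by rewrite mulr_ge0// invr_ge0 exprn_ge0// ltW))/le_trans; apply.
  rewrite lee_fin -[p_s pp]/(s j) sj_exprV.
  rewrite (_ : pi / _ = pi * 2 * s j ^+ 2); last by rewrite invrK mulrA.
  rewrite powR_sqrX//; last by rewrite mulr_ge0// pi_ge0.
  rewrite powRD; last by rewrite (gt_eqF s0) implybT.
  by rewrite /K2 le_eqVlt; apply/orP; left; apply/eqP; ring.
have := hCB _ _ _ (schwartz_pk rphi pp) upper lower.
rewrite leNgt => /negP; apply.
rewrite sj_powR mulrA.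
have P0 : 0 < 2 `^ (j%:R * (delta / 2 * (- n%:R + 2 * n%:R / q))) :> R by exact: powR_gt0.
rewrite -ltr_pdivlMr//; apply: lt_le_trans gr _.
rewrite -powRN [leRHS]mulrAC [leRHS]mulrC ler_pM2l// /b -powRD ?pnatr_eq0 ?implybT//.
rewrite le_eqVlt; apply/orP; left; apply/eqP; congr powR; rewrite /e.
by field; rewrite gt_eqF.
Qed.

Lemma unbounded_sigma_star : q <= 2 ->
  ~ bounded_Mpq p q gamma (psido (adjoint_symbol (sigma_delta delta m phi eta j0))).
Proof.
move=> q2 /bounded_le[CB CB0 hCB].
have [c [rho' [th [s1 [om0 [c0 rho0' th0 nth H]]]]]] :=
  resonant_conj rphi (adm_phi0 A) cgam gt0 (adm_n A) (adm_int A).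
pose rho := Num.min rho' 4^-1.
have rho0 : 0 < rho by rewrite lt_min rho0' invr_gt0 ltr0n.
have rho1 : rho < 2^-1 by rewrite (@le_lt_trans _ _ 4^-1)// ?ge_min ?lexx ?orbT//; lra.
have [CU [CU0 hU]] := stft_pk_le rphi cgam.
pose K1 := c * (((2 * rho) ^+ n) `^ p^-1 * ((th * rho) ^+ n) `^ q^-1).
have K10 : 0 < K1.
  apply: mulr_gt0 => //; apply: mulr_gt0; rewrite powR_gt0// exprn_gt0// mulr_gt0//.
pose K2 := CU * ((pi ^+ n) `^ p^-1 * ((pi * 2) ^+ n) `^ q^-1).
pose e := m + delta * n%:R * (q^-1 - 2^-1).
have e0 : 0 < e.
  have qi : 2^-1 <= q^-1 by rewrite lef_pV2 ?posrE.
  have := hm; rewrite ger0_norm ?subr_ge0// /e; lra.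
have [J1 hJ1] := growth (CB * K2) e0 K10.
(* The bound 2 / th makes theta s at least 2, so truncation to an integer loses at most a factor
   2. *)
have [J2 hJ2] := @block_scale (Num.max s1 (2 / th)) ltac:(by rewrite lt_max divr_gt0 ?orbT).
(* With j >= 2 the spectrum of the packet, of radius 1/8, fits into 2^j / 20. *)
pose j := maxn J1 (maxn J2 2).
have /(_ (leq_maxl _ _)) gr := hJ1 j.
have [|jj] := hJ2 j; first by rewrite /j !leq_max leqnn ?orbT.
rewrite ge_max => /andP[ss1 sth] sm.
have s0 := sj_gt0 delta j; have s8 := sj_ge8 A jj.
set L := Num.truncn (th * s j).
have ths : 0 <= th * s j by rewrite mulr_ge0 ?(ltW th0) ?(ltW s0).
have L2 : th * s j <= 2 * L%:R.
  have /andP[_ h1] := truncn_itv ths; rewrite -/L -natr1 in h1.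
  move: sth; rewrite ler_pdivrMr// mulrC => h2; clear -h1 h2 A p1 q1 hm cgam gt0 q0 rphi i0; lra.
have pb k : k \in [:: (0 : 'rV[int]_n)] -> forall i, `|(intV k : V) ord0 i| <= 1.
  by rewrite inE => /eqP -> i; rewrite !mxE normr0.
pose pp := @PPar R n 1 [:: 0] (2 ^+ j *: evec i0) (lexx 1) isT pb.
pose b := 2 `^ (j%:R * m) : R.
have b0 : 0 < b by exact: powR_gt0.
set T := psido _ in hCB.
have Tf : T (pk phi pp) = (fun x => b%:C%C * (conjc (amp phi (s j) x) * pk phi pp x)).
  apply/funext => x; rewrite mulrA; apply: psido_mult => // xi /pkF_supp[l /=].
  rewrite inE => /eqP -> /(adm_phi0 A).
  rewrite invr1 scale1r intV0 subr0 => hx.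
  apply: (@sigma_star_block _ _ _ _ _ _ A m j (2 ^+ j *: evec i0)) => //; first exact: enorm_axis.
  apply: le_trans hx _.
  have : 2 ^+ 2 <= 2 ^+ j :> R by rewrite ler_weXn2l ?ler1n// /j !leq_max leqnn ?orbT.
  clear -s8 A p1 q1 hm cgam gt0 q0 rphi i0; rewrite expr2; lra.
have [B1 hB1] := amp_bounded (s j); have [B2 hB2] := pk_bounded pp.
have cf : ccont (fun t => conjc (amp phi (s j) t) * pk phi pp t).
  by apply: ccontM; [apply: ccont_conj; exact: ccont_amp|exact: ccont_pk].
have bf t : cabs (conjc (amp phi (s j) t) * pk phi pp t) <= B1 * B2.
  by rewrite cabsM cabs_conj; apply: ler_pM; rewrite ?cabs_ge0.
have sn0 : 0 < s j ^- n by rewrite invr_gt0 exprn_gt0.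
have lower : ((b * (c * s j ^- n) * (((2 * rho) ^+ n) `^ p^-1 * ((L%:R * (2 * (s j * rho))) ^+ n) `^ q^-1))%:E <=
    Mnorm p q gamma (T (pk phi pp)))%E.
  apply: (@Mnorm_ge _ _ _ _ _ p1 q1 _ _ _ (- t0)
    (fun i => comb L (cext (p_x pp) i - s j * cext om0 i) (s j) rho)) => //.
  - by rewrite !mulr_ge0// ltW.
  - by move=> i; exact: measurable_comb.
  - by move=> i; rewrite measure_comb// rho0.
  move=> x xi hx hxi; rewrite Tf (stft_scale _ _ _ cf bf) cabsM cabs_real gtr0_norm// ler_pM2l//.
  have /choice[mm hmm] : forall i : 'I_n, exists l : nat, (1 <= l <= L)%N /\
      `|xi ord0 i - (cext (p_x pp) i - s j * cext om0 i + s j * l%:R)| <= s j * rho.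
    by move=> i; have [l h1 h2] := combP (hxi i); exists l.
  pose k0 : 'rV[int]_n := \row_i (mm i)%:Z.
  have kl : k0 \in lat L by apply: (@mem_lat _ _ _ mm) => // i; have [] := hmm i.
  (* The solution of xi = [p_x] + s (k0 - u); lying in the tooth of k0 means that u is within [rho]
     of [om0] in each coordinate. *)
  pose u := intV k0 - (s j)^-1 *: (xi - p_x pp).
  have -> : xi = p_x pp + s j *: (intV k0 - u).
    by rewrite /u opprB addrCA subrr addr0 scalerA mulfV ?gt_eqF// scale1r addrCA subrr addr0.
  apply: (H pp (s j) erefl erefl ss1 k0 kl x u) => i.
    by have := hx i; rewrite opprK => /le_trans; apply; rewrite ge_min lexx.
  have [_] := hmm i; rewrite !cextE => h.
  have : s j * `|(u - om0) ord0 i| <= s j * rho.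
    rewrite -{1}(gtr0_norm s0) -normrM -normrN; apply: le_trans h.
    rewrite le_eqVlt; apply/orP; left; apply/eqP; congr (`|_|).
    by rewrite !mxE /= -pmulrn; field; rewrite gt_eqF.
  by rewrite ler_pM2l// => /le_trans; apply; rewrite ge_min lexx.
have upper : (Mnorm p q gamma (pk phi pp) <= K2%:E)%E.
  have s20 : 0 < (2 * 1 ^+ 2 : R)^-1 by rewrite expr1n mulr1 invr_gt0.
  have := @Mnorm_le _ _ _ _ _ p1 q1 _ _ (p_x pp) (pk phi pp) _ s20 (hU pp).
  move=> /(_ ltac:(by rewrite mulr_ge0// invr_ge0 exprn_ge0))/le_trans; apply.
  by rewrite lee_fin invrK /= !expr1n invr1 !mulr1.
have := hCB _ _ _ (schwartz_pk rphi pp) upper lower.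
rewrite leNgt => /negP; apply; apply: lt_le_trans gr _.
(* A comb has L teeth of length 2 s rho, and 2 L >= theta s: each coordinate provides a set of
   frequencies of measure of order s^2. *)
have hJ : ((th * rho * s j ^+ 2) ^+ n) `^ q^-1 <= ((L%:R * (2 * (s j * rho))) ^+ n) `^ q^-1.
  have h1 : 0 <= th * rho * s j ^+ 2 by rewrite !mulr_ge0 ?sqr_ge0// ltW.
  have h2 : th * rho * s j ^+ 2 <= L%:R * (2 * (s j * rho)).
    have : th * s j * (s j * rho) <= 2 * L%:R * (s j * rho) by rewrite ler_pM2r// mulr_gt0.
    clear -s8 A p1 q1 hm cgam gt0 q0 rphi i0; rewrite expr2; lra.
  apply: ge0_ler_powR; rewrite ?nnegrE ?exprn_ge0 ?invr_ge0 ?(ltW q0)//.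
    exact: le_trans h2.
  by rewrite lerXn2r ?nnegrE//; exact: le_trans h2.
apply: (@le_trans _ _ (b * (c * s j ^- n) * (((2 * rho) ^+ n) `^ p^-1 * ((th * rho * s j ^+ 2) ^+ n) `^ q^-1))); last first.
  rewrite ler_pM2l; last by apply: mulr_gt0 => //; exact: mulr_gt0.
  by rewrite ler_wpM2l ?powR_ge0.
rewrite powR_sqrX//; last by rewrite mulr_ge0// ltW.
rewrite sj_exprV.
rewrite [leRHS](_ : _ = K1 * (b * (s j `^ (- n%:R) * s j `^ (2 * n%:R / q)))); last by rewrite /K1; ring.
rewrite ler_pM2l// -powRD; last by rewrite (gt_eqF s0) implybT.
rewrite sj_powR /b -powRD ?pnatr_eq0 ?implybT//.
rewrite le_eqVlt; apply/orP; left; apply/eqP; congr powR; rewrite /e.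
by field; rewrite gt_eqF.
Qed.

End Unbounded.

Theorem theorem2p1 (R : realType) (n : nat) (p q delta m : R)
  (phi eta : 'rV[R]_n -> R) (j0 : nat) :
  (0 < n)%N ->
  1 < p -> 1 < q -> 0 < delta < 1 ->
  - (`|q^-1 - 2^-1| * delta * n%:R) < m ->
  (* phi *)
  schwartzR phi ->
  (forall x y : 'rV[R]_n, enorm x = enorm y -> phi x = phi y) ->
  (forall xi : 'rV[R]_n, phi xi != 0 -> enorm xi <= 8^-1) ->
  intRn phi = 1 ->
  (* eta *)
  schwartzR eta ->
  (forall xi : 'rV[R]_n, eta xi != 0 ->
     2 `^ (- 2^-1) <= enorm xi <= 2 `^ (2^-1)) ->
  (forall xi : 'rV[R]_n, 2 `^ (- 4^-1) <= enorm xi <= 2 `^ (4^-1) ->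
     eta xi = 1) ->
  (* j0 *)
  1 + 2 `^ (j0%:R * (delta - 1) + 1) <= 2 `^ (4^-1) ->
  1 - 2 `^ (j0%:R * (delta - 1) + 1) >= 2 `^ (- 4^-1) ->
  2 `^ (- (j0%:R * delta / 2)) * Num.sqrt n%:R <= 2 `^ (-3) ->
  let sigma := sigma_delta delta m phi eta j0 in
  let sigma_star := adjoint_symbol sigma in
  symbol_class 1 delta m sigma /\ symbol_class 1 delta m sigma_star /\
  (forall gamma : 'rV[R]_n -> R[i], schwartz gamma -> (exists x, gamma x != 0) ->
     (2 <= q -> ~ bounded_Mpq p q gamma (psido sigma)) /\
     (q <= 2 -> ~ bounded_Mpq p q gamma (psido sigma_star))).
Proof.
move=> n0 p1 q1 dd hm sphi rad phi0 int1 seta eta0 eta1 hi lo hs sigma sigma_star.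
have rphi : rap phi := schwartzR_rapid sphi.
have A : adm delta phi eta j0.
  split => //; first exact: schwartzR_rapid.
  by move=> xi; apply: rad; rewrite enormN.
split; [|split].
- apply: (symbol_class_syms A (tau := 0) (c := 0) (c' := - (pi / 2))) => [|x xi].
    by rewrite lexx ler01.
  exact: sigma_delta_phc.
(* Conjugation puts the phase of the imaginary part at pi / 2 instead of - pi / 2. *)
- apply: (symbol_class_syms A (tau := 1) (c := 0) (c' := pi / 2)) => [|x xi].
    by rewrite lexx ler01.
  exact: adjoint_syms.
move=> gamma sgam [t0 gt0]; have cgam := schwartz_crap sgam; split => q2.
  exact: (unbounded_sigma A p1 q1 hm cgam gt0 q2).
exact: (unbounded_sigma_star A p1 q1 hm cgam gt0 q2).
Qed.
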